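(* Let $n\ge 2$, $0<a\le \tfrac12$, and let $\phi$, $\hat v$, $\hat p$ be as in the context. Then: (i) (H\''older continuity) $\hat v\in C^{2b,b}(\overline{\mathbb{R}^n_+}\times[0,2])$ (parabolic H\''older space: H\''older exponent $2b$ in $x$ and $b$ in $t$), where $b=a$ if $0<a<\tfrac12$, and $b$ may be any number in $(0,\tfrac12)$ if $a=\tfrac12$. (ii) (Finite energy) If $n\ge 3$, then $$\operatorname*{ess\,sup}_{0<t<2}\int_{\mathbb{R}^n_+}|\hat v(x,t)|^2\,dx+\int_0^2\int_{\mathbb{R}^n_+}|\nabla \hat v(x,t)|^2\,dx\,dt<\infty .$$ (iii) (Pressure) There is $C>0$ such that for all $x\in\mathbb{R}^n_+$ and $t\in\mathbb{R}$, $$|\hat p(x,t)|\le C\frac{\chi_{[1/4,1]}(t)}{(1-t)^{1-a}}\Big(\mathbf 1_{n\ge3}\frac{1}{\langle x\rangle^{n-2}}+\mathbf 1_{n=2}\log(|x|+2)\Big)+C\frac{\chi_{(1,\infty)}(t)}{|t-1|^{1-a}\langle x\rangle^{n-1}}.$$ (iv) (Lower bound) Suppose $n\ge3$ and $g(\xi')=\prod_{j=1}^{n-1}\mathcal G(\xi_j)$, where $\mathcal G:\mathbb{R}\to\mathbb{R}$ is smooth, even, supported in $(-\tfrac{4}{5\sqrt{n-1}},\tfrac{4}{5\sqrt{n-1}})$, $\mathcal G(\zeta)=1$ for $|\zeta|<\tfrac{1}{2\sqrt{n-1}}$, and $\mathcal G'(\zeta)\le 0$ for $\zeta>0$. Then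 there are constants $C_1,C_2>0$ such that for all $x=(x_1,\dots,x_n)\in\mathbb{R}^n_+$ with $|x'|\ge 3$ and $x_n\le 1$, and every $i<n$ with $|x_i|=\max_{1\le j\le n-1}|x_j|$, $$|\partial_{x_n}\hat v_i(x,1)|\ge \begin{cases}\dfrac{C_1}{|x'|^{n-1}}\log\dfrac{2}{x_n}-\dfrac{C_2}{|x'|^{n-2}}, & a=\tfrac12,\\[2mm] \dfrac{C_1}{|x'|^{n-1}x_n^{1-2a}}-\dfrac{C_2}{|x'|^{n-2}}, & 0<a<\tfrac12.\end{cases}$$
   Context: Notation: $n\ge2$, $x=(x',x_n)\in\mathbb{R}^n$, $\mathbb{R}^n_+=\{x_n>0\}$, $\Sigma=\mathbb{R}^{n-1}\cong\partial\mathbb{R}^n_+$, $B_1'$ the open unit ball of $\mathbb{R}^{n-1}$, $e_n=(0,\dots,0,1)$, $\langle x\rangle=(1+|x|^2)^{1/2}$. Heat kernel $\Gamma(x,t)=(4\pi t)^{-n/2}e^{-|x|^2/(4t)}$ for $t>0$ and $\Gamma(x,t)=0$ for $t\le 0$. Fundamental solution of $-\Delta$: $E(x)=\frac{1}{n(n-2)|B_1|}|x|^{2-n}$ for $n\ge3$ ($|B_1|$ the volume of the unit ball of $\mathbb{R}^n$), $E(x)=-\frac1{2\pi}\log|x|$ for $n=2$. Define $C_i(x,0,t)=\int_0^{x_n}\int_{\Sigma}\partial_n\Gamma(x-z,t)\,\partial_iE(z)\,dz'\,dz_n$, $\widetilde K_{in}(x,t)=-2\delta_{in}\partial_n\Gamma(x,t)-4\partial_{x_n}\big[C_i(x,0,t)\big]$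 (this is the Golovkin (Poisson) kernel of the Stokes system in $\mathbb{R}^n_+$ for $t>0$), and $A(x,t)=\int_\Sigma\Gamma(z',0,t)E(x-z')\,dz'$. Boundary data: $0<a\le\frac12$, $\phi(\xi',s)=g(\xi')h(s)e_n$, where $g\in C^3_c(B_1')$, $h\ge0$, $h\in C_c(\mathbb{R})\cap C^1(0,1)$, $\operatorname{supp}h\subset[\frac14,1]$, and $h(s)=(1-s)^a$ for $s\in[\frac12,1]$. The Stokes solution with boundary data $\phi$, zero initial data and zero force is $$\hat v_i(x,t)=\int_0^t\!\!\int_\Sigma\widetilde K_{in}(x-\xi',t-s)\phi_n(\xi',s)\,d\xi'ds-2\int_\Sigma\partial_iE(x-\xi')\phi_n(\xi',t)\,d\xi',$$ $$\hat p(x,t)=2\partial_n^2\!\int_\Sigma E(x-\xi')\phi_n(\xi',t)d\xi'+2\!\int_\Sigma E(x-\xi')\partial_t\phi_n(\xi',t)d\xi'-4(\partial_t-\Delta_{x'})\!\int_{-\infty}^{\infty}\!\!\int_\Sigma\partial_nA(x-\xi',t-\tau)\phi_n(\xi',\tau)d\xi'd\tau,$$ where $\phi$ is taken to be $0$ for $s<0$. *)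

(* Defs.v *)
From HB Require Import structures.
From mathcomp Require Import all_boot all_order all_algebra.
From mathcomp Require Import all_classical all_reals all_analysis.
Set Implicit Arguments. Unset Strict Implicit. Unset Printing Implicit Defensive.
Import Order.TTheory GRing.Theory Num.Theory.
Import numFieldNormedType.Exports.
Local Open Scope classical_set_scope.
Local Open Scope ring_scope.

(* Dimension convention: n = m.+1, points of R^n are row vectors 'rV[R]_(m.+1);
   the last coordinate (index ord_max) is x_n; Sigma = R^(n-1) = 'rV[R]_m. *)

Section Defs.
Variable R : realType.

Definition enorm (k : nat) (x : 'rV[R]_k) : R := Num.sqrt (\sum_(i < k) x 0 i ^+ 2).
Definition jbr (k : nat) (x : 'rV[R]_k) : R := Num.sqrt (1 + enorm x ^+ 2).

Definition xlast (m : nat) (x : 'rV[R]_m.+1) : R := x 0 ord_max.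
Definition xprime (m : nat) (x : 'rV[R]_m.+1) : 'rV[R]_m :=
  \row_(j < m) x 0 (widen_ord (leqnSn m) j).
Definition emb (m : nat) (x' : 'rV[R]_m) (s : R) : 'rV[R]_m.+1 :=
  \row_(i < m.+1) match unlift ord_max i with Some j => x' 0 j | None => s end.

Definition unitv (k : nat) (i : 'I_k) : 'rV[R]_k := \row_(j < k) (i == j)%:R.
Definition partial (k : nat) (i : 'I_k) (f : 'rV[R]_k -> R) (x : 'rV[R]_k) : R :=
  derive1 (fun s : R => f (x + s *: unitv i)) 0.
Definition has_partial (k : nat) (i : 'I_k) (f : 'rV[R]_k -> R) (x : 'rV[R]_k) : Prop :=
  derivable (fun s : R => f (x + s *: unitv i)) 0 1.

Fixpoint Ck (k : nat) (l : nat) (f : 'rV[R]_l -> R) : Prop :=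
  match k with
  | 0 => continuous f
  | k'.+1 => continuous f /\
      forall i : 'I_l, (forall x, has_partial i f x) /\ Ck k' (partial i f)
  end.

Fixpoint iintE (k : nat) : ('rV[R]_k -> \bar R) -> \bar R :=
  match k with
  | 0 => fun f => f 0
  | k'.+1 => fun f =>
      (\int[@lebesgue_measure R]_(s in [set: R])
          iintE (fun y : 'rV[R]_k' => f (row_mx (const_mx s : 'rV[R]_1) y)))%E
  end.
Fixpoint iintR (k : nat) : ('rV[R]_k -> R) -> R :=
  match k with
  | 0 => fun f => f 0
  | k'.+1 => fun f =>
      Rintegral (@lebesgue_measure R) [set: R]
          (fun s => iintR (fun y : 'rV[R]_k' => f (row_mx (const_mx s : 'rV[R]_1) y)))
  end.
Definition oint (a b : R) (f : R -> R) : R :=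
  if a <= b then Rintegral (@lebesgue_measure R) `[a, b] f
  else - Rintegral (@lebesgue_measure R) `[b, a] f.

Variable m : nat.
Local Notation N := m.+1.
Local Notation pt := 'rV[R]_m.+1.

Definition Gam (x : pt) (t : R) : R :=
  if 0 < t then (4 * pi * t) `^ (- (N%:R / 2)) * expR (- (enorm x ^+ 2 / (4 * t)))
  else 0.
Definition volB1 : R := fine (iintE (fun x : pt => (if enorm x < 1 then 1 else 0)%:E)).
Definition Efund (x : pt) : R :=
  if (3 <= N)%N then (N%:R * (N%:R - 2) * volB1)^-1 * (enorm x) `^ (2 - N%:R)
  else - (2 * pi)^-1 * ln (enorm x).

Definition dnGam (x : pt) (t : R) : R := partial ord_max (fun y => Gam y t) x.
Definition dE (i : 'I_N) (x : pt) : R := partial i Efund x.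

Definition Cfun (i : 'I_N) (x : pt) (t : R) : R :=
  oint 0 (xlast x) (fun zn =>
    iintR (fun z' : 'rV[R]_m => dnGam (x - emb z' zn) t * dE i (emb z' zn))).
Definition Ktil (i : 'I_N) (x : pt) (t : R) : R :=
  - 2 * (i == ord_max)%:R * dnGam x t - 4 * partial ord_max (fun y => Cfun i y t) x.
Definition Afun (x : pt) (t : R) : R :=
  iintR (fun z' : 'rV[R]_m => Gam (emb z' 0) t * Efund (x - emb z' 0)).
Definition dnA (x : pt) (t : R) : R := partial ord_max (fun y => Afun y t) x.

Variables (g : 'rV[R]_m -> R) (h : R -> R).
Definition phin (xi : 'rV[R]_m) (s : R) : R := g xi * h s.

Definition vhat (i : 'I_N) (x : pt) (t : R) : R :=
  oint 0 t (fun s => iintR (fun xi : 'rV[R]_m => Ktil i (x - emb xi 0) (t - s) * phin xi s))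
  - 2 * iintR (fun xi : 'rV[R]_m => dE i (x - emb xi 0) * phin xi t).

Definition lapx' (f : pt -> R) (x : pt) : R :=
  \sum_(j < N | j != ord_max) partial j (partial j f) x.

Definition phat (x : pt) (t : R) : R :=
  2 * partial ord_max (partial ord_max
        (fun y => iintR (fun xi : 'rV[R]_m => Efund (y - emb xi 0) * phin xi t))) x
  + 2 * iintR (fun xi : 'rV[R]_m => Efund (x - emb xi 0) * (g xi * derive1 h t))
  - 4 * ( derive1 (fun s => Rintegral (@lebesgue_measure R) [set: R] (fun tau =>
              iintR (fun xi : 'rV[R]_m => dnA (x - emb xi 0) (s - tau) * phin xi tau))) t
        - lapx' (fun y => Rintegral (@lebesgue_measure R) [set: R] (fun tau =>
              iintR (fun xi : 'rV[R]_m => dnA (y - emb xi 0) (t - tau) * phin xi tau))) x).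

End Defs.

(* Main.v *)
(* Since d_i E = kappa x_i |x|^(-n), convolving the Golovkin kernel with g in the
   tangential variables turns it into one-dimensional integrals of the normal heat
   kernel against the harmonic potentials of the tangential heat flow of g. These
   potentials, and their normal derivatives as traded for tangential derivatives of
   g by harmonicity, are bounded by the weight (1 + |x|^2)^(-(n-1)/2). In the
   normal derivative of the velocity the only singular term is a function of x'
   times the time integral of h(t - s) against the second normal derivative of the
   heat kernel. That integral gives the Hoelder exponent and the energy bound, and
   at t = 1 an integration by parts shows its size to be log(2/x_n) or x_n^(2a-1),
   while the tangential factor is at least c |x'|^(1-n) because x_i - xi_i has
   constant sign on the support of g. In the pressure the operator d_t - Lap_x'
   annihilates the tangential heat flow, so it falls on (t - s)^(-1/2) or on h. *)

Require Import Defs.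
From HB Require Import structures.
From mathcomp Require Import all_boot all_order all_algebra.
From mathcomp Require Import all_classical all_reals all_analysis.
From mathcomp Require Import measurable_realfun.
From mathcomp Require Import ring lra.
Set Implicit Arguments. Unset Strict Implicit. Unset Printing Implicit Defensive.
Import Order.TTheory GRing.Theory Num.Theory.
Import numFieldNormedType.Exports.
Local Open Scope classical_set_scope.
Local Open Scope ring_scope.

Section RealIntegral.
Context {R : realType}.
Local Notation mu := (@lebesgue_measure R).
Local Notation Intg D f := (mu.-integrable (D : set R) (EFin \o (f : R -> R))).
Local Notation Rint := (@Rintegral _ _ R mu).

Lemma integrable_dom (D : set R) (f g : R -> R) : measurable D ->
  measurable_fun D f -> (forall x, D x -> `|f x| <= g x) -> Intg D g -> Intg D f.
Proof.
move=> mD mf fg ig; have := @le_integrable _ _ _ mu D mD (EFin \o f) (EFin \o g) _ _ ig; apply.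
  exact/measurable_EFinP.
move=> x Dx /=; rewrite lee_fin (le_trans (fg x Dx))// ler_norm //.
Qed.

Lemma integrable_measurable (D : set R) (f : R -> R) : Intg D f -> measurable_fun D f.
Proof. by move=> /integrableP[/measurable_EFinP]. Qed.

Lemma Rint_le (D : set R) (f g : R -> R) : measurable D -> Intg D f -> Intg D g ->
  (forall x, D x -> f x <= g x) -> Rint D f <= Rint D g.
Proof. move=> mD If Ig fg; exact: (@le_Rintegral _ _ R mu D f g mD If Ig fg). Qed.

Lemma le_norm_Rint (D : set R) (f g : R -> R) : measurable D -> Intg D f -> Intg D g ->
  (forall x, D x -> `|f x| <= g x) -> `|Rint D f| <= Rint D g.
Proof.
move=> mD If Ig fg; have h := @le_normr_Rintegral _ _ R mu D f mD If; apply: (le_trans h).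
by apply: Rint_le => //; exact: integrable_norm.
Qed.

Lemma RintD (D : set R) (f g : R -> R) : measurable D -> Intg D f -> Intg D g ->
  Rint D (fun x => f x + g x) = Rint D f + Rint D g.
Proof. move=> mD If Ig; exact: (@RintegralD _ _ R mu D f g mD If Ig). Qed.

Lemma RintB (D : set R) (f g : R -> R) : measurable D -> Intg D f -> Intg D g ->
  Rint D (fun x => f x - g x) = Rint D f - Rint D g.
Proof. move=> mD If Ig; exact: (@RintegralB _ _ R mu D f g mD If Ig). Qed.

Lemma RintZ (D : set R) (f : R -> R) (c : R) : measurable D -> Intg D f ->
  Rint D (fun x => c * f x) = c * Rint D f.
Proof. move=> mD If; exact: (@RintegralZl _ _ R mu D f c mD If). Qed.

Lemma integrable_add (D : set R) (f g : R -> R) : measurable D -> Intg D f -> Intg D g ->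
  Intg D (fun x => f x + g x).
Proof. move=> mD If Ig; exact: (@integrableD _ _ R mu D mD (EFin \o f) (EFin \o g) If Ig). Qed.

Lemma integrable_sub (D : set R) (f g : R -> R) : measurable D -> Intg D f -> Intg D g ->
  Intg D (fun x => f x - g x).
Proof. move=> mD If Ig; exact: (@integrableB _ _ R mu D mD (EFin \o f) (EFin \o g) If Ig). Qed.

Lemma integrable_scale (D : set R) (f : R -> R) (c : R) : measurable D -> Intg D f ->
  Intg D (fun x => c * f x).
Proof. move=> mD If; exact: (@integrableZl _ _ R mu D mD c (EFin \o f) If). Qed.

Lemma Rint_eq (D : set R) (f g : R -> R) : (forall x, D x -> f x = g x) ->
  Rint D f = Rint D g.
Proof. by move=> fg; apply: eq_Rintegral => x; rewrite inE => /fg. Qed.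

Lemma integrable_eq (D : set R) (f g : R -> R) : measurable D -> (forall x, D x -> f x = g x) ->
  Intg D f -> Intg D g.
Proof.
move=> mD fg If.
apply: (@integrable_dom D g (fun x => `|f x|)) => //; last exact: integrable_norm.
  have := integrable_measurable If; apply: eq_measurable_fun => x; rewrite inE => /fg //.
by move=> x Dx; rewrite fg.
Qed.

Lemma Rint_dct (D : set R) (f_ : nat -> R -> R) (f g : R -> R) : measurable D ->
  (forall n, measurable_fun D (f_ n)) -> (forall n x, D x -> `|f_ n x| <= g x) ->
  Intg D g -> (forall x, D x -> f_ ^~ x @ \oo --> f x) ->
  Intg D f /\ (fun n => Rint D (f_ n)) @ \oo --> Rint D f.
Proof.
move=> mD mf fg Ig cf.
have mlim : measurable_fun D f by have := measurable_fun_cvg mf cf; exact.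
have fg' x : D x -> `|f x| <= g x.
  move=> Dx; have c : (fun n => `|f_ n x|) @ \oo --> `|f x| by apply: cvg_norm; exact: cf.
  rewrite -(cvg_lim (@Rhausdorff R) c); apply: limr_le; first by apply/cvg_ex; exists `|f x|.
  by apply: nearW => n; exact: fg.
have If : Intg D f by exact: (integrable_dom mD mlim fg' Ig).
split=> //.
have h := @dominated_cvg _ _ _ mu D mD (fun n => EFin \o f_ n) (EFin \o f) (EFin \o g).
rewrite /Rintegral; apply: fine_cvg; rewrite fineK; last first.
  have h2 := @integrable_fin_num _ _ R mu D mD (EFin \o f) If; exact: h2.
apply: h => //.
- by move=> n; have := mf n; apply: measurableT_comp.
- by move=> x Dx; apply: cvg_EFin; [exact: nearW|exact: cf].
Qed.

Lemma Rint_is_derive (D : set R) (F dF : R -> R -> R) (G : R -> R) (a e : R) :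
  measurable D -> 0 < e ->
  (forall x, `|x - a| < e -> Intg D (F x)) ->
  (forall x y, `|x - a| < e -> D y -> is_derive x 1 (F ^~ y) (dF x y)) ->
  Intg D G -> (forall x y, `|x - a| < e -> D y -> `|dF x y| <= G y) ->
  Intg D (dF a) /\ is_derive a 1 (fun x => Rint D (F x)) (Rint D (dF a)).
Proof.
move=> mD e0 IF dFd IG FG.
have Iab x : `]a - e, a + e[%classic x -> `|x - a| < e.
  by rewrite /= in_itv /= ltr_distl.
have Ia : `]a - e, a + e[%classic a by rewrite /= in_itv /= ltrBlDr ltrDl e0.
have pE x y : `|x - a| < e -> D y -> partial1of2 F x y = dF x y.
  by move=> xa Dy; rewrite partial1of2E; have [] := dFd x y xa Dy.
have aa : `|a - a| < e by rewrite subrr normr0.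
pose G' (y : R) : R := `|G y|.
have IG' : Intg D G' by exact: integrable_norm.
have IF' x : `]a - e, a + e[%classic x -> Intg D (F x) by move=> /Iab; exact: IF.
have dv x y : `]a - e, a + e[%classic x -> D y -> derivable (F ^~ y) x 1.
  by move=> /Iab xa Dy; have [] := dFd x y xa Dy.
have Gub x y : `]a - e, a + e[%classic x -> D y -> `|partial1of2 F x y| <= G' y.
  by move=> /Iab xa Dy; rewrite pE// (le_trans (FG x y xa Dy))// ler_norm.
have G'0 y : 0 <= G' y by exact: normr_ge0.
have d1 := @derivable_under_integral _ _ _ mu F D mD a _ _ Ia IF' dv G' G'0 IG' Gub.
have d2 := @differentiation_under_integral _ _ _ mu F D mD a _ _ Ia IF' dv G' G'0 IG' Gub.
have Hm : measurable_fun D (dF a).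
  pose u (n : nat) : R := a + e / 2 * n.+1%:R^-1.
  have ua n : `|u n - a| < e.
    rewrite /u addrC addKr ger0_norm ?mulr_ge0 ?invr_ge0 ?ler0n ?(ltW e0)//.
    rewrite -[ltRHS]mulr1 -mulrA ltr_pM2l// (@le_lt_trans _ _ (2^-1 * 1))// ?mulr1 ?invf_lt1 ?ltr1n//.
    by rewrite ler_piMr// invf_le1 ?ler1n ?ltr0n.
  have := @measurable_fun_cvg _ _ R D (fun n y => (u n - a)^-1 * (F (u n) y - F a y)) (dF a).
  apply.
    move=> n; apply: measurable_funM; first exact: measurable_cst.
    by apply: measurable_funB; apply: integrable_measurable; apply: IF.
  move=> y Dy; have [dv1 dv2] := dFd a y aa Dy.
  have := dv1; rewrite /derivable => /cvg_ex[l hl].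
  have lE : l = dF a y by rewrite -dv2 /derive; apply/esym/cvg_lim => //; exact: hl.
  rewrite -lE; have := cvgr_dnbhsP (fun h => h^-1 *: ((F ^~ y \o shift a) (h *: 1) - F a y)) 0 l.
  move=> [h _]; have /h{h} := hl => /(_ (fun n => u n - a)).
  rewrite /= => h; have := h _; rewrite /GRing.scale /=.
  have -> : (fun n => (u n - a)^-1 * (F (u n) y - F a y)) =
      (fun n => (u n - a)^-1 * (F ((u n - a) * 1 + a) y - F a y)).
    by apply/funext => n; rewrite mulr1 subrK.
  apply; split.
    move=> n; rewrite /u addrC addKr mulf_neq0 ?invr_eq0 ?pnatr_eq0// mulf_neq0 ?invr_eq0 ?pnatr_eq0//.
    by rewrite gt_eqF.
  under eq_fun do rewrite /u addrC addKr.
  have h3 : (fun n => e / 2 * harmonic n) @ \oo --> e / 2 * 0.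
    by apply: cvgM; [exact: cvg_cst|exact: cvg_harmonic].
  by rewrite mulr0 in h3.
split.
  by apply: (integrable_dom mD Hm _ IG) => y Dy; exact: FG.
split.
  exact: d1.
rewrite -derive1E d2; apply: Rint_eq => y Dy; exact: pE.
Qed.

Let affine (c e x : R) : R := c * x + e.

Lemma measurable_affine (c e : R) : measurable_fun [set: R] (affine c e).
Proof.
apply: measurable_funD; last exact: measurable_cst.
by apply: measurable_funM; [exact: measurable_cst|exact: measurable_id].
Qed.

Lemma lebesgue_measure_affine (c e : R) (A : set R) : c != 0 -> measurable A ->
  (mu A = `|c|%:E * mu (affine c e @^-1` A))%E.
Proof.
move=> c0 mA.
pose k : {nonneg R} := NngNum (normr_ge0 c).
have mphi : @measurable_fun _ _ (measurableTypeR R) (measurableTypeR R) setT (affine c e)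
  by exact: measurable_affine.
pose nu0 : {measure set (measurableTypeR R) -> \bar R} :=
  measure_function_pushforward__canonical__measure_function_Measure mu mphi.
pose nu : {measure set (measurableTypeR R) -> \bar R} := mscale k nu0.
have -> : (`|c|%:E * mu (affine c e @^-1` A))%E = nu A by [].
apply: (@lebesgue_measure_unique R nu) => // X /ocitvP[->|[[a b] /= ab ->]].
  by rewrite !measure0.
rewrite /nu /mscale /= /pushforward lebesgue_measure_itv /= lte_fin ab.
have cp : 0 < `|c| by rewrite normr_gt0.
have [c_gt0|c_lt0|c00] := ltgtP 0 c; last by rewrite -c00 eqxx in c0.
- have -> : affine c e @^-1` `]a, b]%classic = `](a - e) / c, (b - e) / c]%classic.
    apply/seteqP; split => x /=; rewrite !in_itv /= /affine.
      by rewrite ltr_pdivrMr// ler_pdivlMr// ltrBlDr lerBrDr (mulrC x).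
    by rewrite ltr_pdivrMr// ler_pdivlMr// ltrBlDr lerBrDr (mulrC x).
  rewrite lebesgue_measure_itv /= lte_fin ltr_pM2r ?invr_gt0// ltrD2r ab -!EFinD -EFinM gtr0_norm//.
  by congr (_%:E); field.
- have -> : affine c e @^-1` `]a, b]%classic = `[(b - e) / c, (a - e) / c[%classic.
    apply/seteqP; split => x /=; rewrite !in_itv /= /affine.
      by rewrite ltr_ndivlMr// ler_ndivrMr// ltrBlDr lerBrDr (mulrC x) => /andP[-> ->].
    by rewrite ltr_ndivlMr// ler_ndivrMr// ltrBlDr lerBrDr (mulrC x) => /andP[-> ->].
  rewrite lebesgue_measure_itv /= lte_fin ltr_nM2r ?invr_lt0// ltrD2r ab -!EFinD -EFinM ltr0_norm//.
  by congr (_%:E); field.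
Qed.

Lemma ge0_integral_affine (c e : R) (f : R -> \bar R) : c != 0 ->
  measurable_fun [set: R] f -> (forall x, 0 <= f x)%E ->
  (\int[mu]_x f x = `|c|%:E * \int[mu]_x f (c * x + e)%R)%E.
Proof.
move=> c0 mf f0.
pose k : {nonneg R} := NngNum (normr_ge0 c).
have mphi : @measurable_fun _ _ (measurableTypeR R) (measurableTypeR R) setT (affine c e)
  by exact: measurable_affine.
pose nu0 : {measure set (measurableTypeR R) -> \bar R} :=
  measure_function_pushforward__canonical__measure_function_Measure mu mphi.
pose nu : {measure set (measurableTypeR R) -> \bar R} := mscale k nu0.
have -> : (\int[mu]_x f x = \int[nu]_x f x)%E.
  by apply: eq_measure_integral => A mA _; exact: lebesgue_measure_affine.
rewrite /nu ge0_integral_mscale//; congr (_ * _)%E.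
have h := @ge0_integral_pushforward _ _ _ _ R _ mphi mu [set: R] f measurableT mf.
by rewrite [LHS]h// => x _.
Qed.

Lemma ge0_Rint_affine (c e : R) (f : R -> R) : c != 0 -> Intg [set: R] f -> (forall x, 0 <= f x) ->
  Intg [set: R] (fun x => f (c * x + e)) /\
  Rint [set: R] (fun x => f (c * x + e)) = `|c|^-1 * Rint [set: R] f.
Proof.
move=> c0 If f0.
have mf := integrable_measurable If.
have mfa : measurable_fun [set: R] (fun x => f (c * x + e)).
  by apply: (measurableT_comp mf); exact: measurable_affine.
have h := @ge0_integral_affine c e (EFin \o f) c0 _ _.
have {}h : (\int[mu]_x (f x)%:E = `|c|%:E * \int[mu]_x (f (c * x + e)%R)%:E)%E.
  by apply: h => [|x]; [exact/measurable_EFinP|rewrite lee_fin].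
have h2 : (\int[mu]_x (f (c * x + e))%:E = `|c|^-1%:E * \int[mu]_x (f x)%:E)%E.
  by rewrite h muleA -EFinM mulVf ?normr_eq0// mul1e.
have fin : (\int[mu]_x (f x)%:E)%E \is a fin_num.
  have := @integrable_fin_num _ _ R mu [set: R] measurableT (EFin \o f) If; exact.
split.
  apply/integrableP; split; first exact/measurable_EFinP.
  rewrite (_ : (\int[mu]_x `|(EFin \o (fun x => f (c * x + e)%R)) x|)%E = (\int[mu]_x (f (c * x + e)%R)%:E)%E).
    rewrite h2 -(fineK fin) -EFinM ltry //.
  by apply: eq_integral => x _ /=; rewrite ger0_norm.
by rewrite /Rintegral h2 -(fineK fin) -EFinM.
Qed.

Lemma Rint_affine (c e : R) (f : R -> R) : c != 0 -> Intg [set: R] f ->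
  Intg [set: R] (fun x => f (c * x + e)) /\
  Rint [set: R] (fun x => f (c * x + e)) = `|c|^-1 * Rint [set: R] f.
Proof.
move=> c0 If.
have In : Intg [set: R] (fun x => `|f x|) by exact: integrable_norm.
have Is : Intg [set: R] (fun x => f x + `|f x|) by exact: integrable_add.
have [I1 E1] := ge0_Rint_affine e c0 In (fun x => normr_ge0 _).
have s0 x : 0 <= f x + `|f x| by have := ler_norm (- f x); rewrite normrN; lra.
have [I2 E2] := ge0_Rint_affine e c0 Is s0.
have fE x : f x = (f x + `|f x|) - `|f x| by rewrite addrK.
split.
  have h : Intg [set: R] (fun x => (f (c * x + e) + `|f (c * x + e)|) - `|f (c * x + e)|).
    exact: integrable_sub.
  by apply: integrable_eq h => // x _; rewrite addrK.
rewrite (@Rint_eq _ _ (fun x => (f (c * x + e) + `|f (c * x + e)|) - `|f (c * x + e)|)); last first.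
  by move=> x _; rewrite addrK.
rewrite RintB// E1 E2 RintD//; ring.
Qed.
End RealIntegral.

Section Caratheodory.
Context {R : realType}.
Local Notation mu := (@lebesgue_measure R).
Local Notation Intg D f := (mu.-integrable (D : set R) (EFin \o (f : R -> R))).
Local Notation Rint := (@Rintegral _ _ R mu).

Let grid (n : nat) (s : R) : R := (Num.floor (n.+1%:R * s))%:~R / n.+1%:R.

Let grid_cvg (s : R) : (fun n => grid n s) @ \oo --> s.
Proof.
apply: (@squeeze_cvgr _ _ _ _ (fun n => s - harmonic n) (fun=> s)).
- apply: nearW => n; rewrite /grid /harmonic /=.
  have n0 : (0 : R) < n.+1%:R by rewrite ltr0n.
  have /andP[h1 h2] := floor_itv (n.+1%:R * s).
  apply/andP; split.
    rewrite ler_pdivlMr// mulrBl mulVf ?gt_eqF//.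
    by rewrite intrD in h2; rewrite mulrC lerBlDr ltW.
  by rewrite ler_pdivrMr// [s * _]mulrC.
- have h : (fun n => s - harmonic n) @ \oo --> s - 0.
    by apply: cvgB; [exact: cvg_cst|exact: cvg_harmonic].
  by rewrite subr0 in h; exact: h.
- exact: cvg_cst.
Qed.

(* A Caratheodory integrand is the limit of its samples along a shrinking grid. *)
Lemma measurable_caratheodory d (T : measurableType d) (U : set R) (F : T -> R -> R) :
  open U -> (forall s, measurable_fun [set: T] (F ^~ s)) ->
  (forall t s, U s -> {for s, continuous (F t)}) ->
  measurable_fun [set: (T * R)%type] (fun p => \1_U p.2 * F p.1 p.2).
Proof.
move=> oU mF cF.
have mU : measurable U by exact: open_measurable.
apply: (@measurable_fun_cvg _ _ R setT (fun n p => \1_U p.2 * F p.1 (grid n p.2))).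
- move=> n; apply: measurable_funM.
    by have h := measurableT_comp (@measurable_indic _ _ R setT U mU) (@measurable_snd _ _ T R); exact: h.
  have n0 : (0 : R) < n.+1%:R by rewrite ltr0n.
  move=> _ Y mY; rewrite setTI.
  have -> : (fun p => F p.1 (grid n p.2)) @^-1` Y =
    \bigcup_(k in [set: int]) ([set t | Y (F t (k%:~R / n.+1%:R))] `*`
      `[k%:~R / n.+1%:R, (k + 1)%:~R / n.+1%:R[%classic).
    apply/seteqP; split=> [[t s] /= Ys|[t s] /= [k _ /= [Yt]]].
      exists (Num.floor (n.+1%:R * s)) => //=; split => //.
      have /andP[h1 h2] := floor_itv (n.+1%:R * s).
      by rewrite in_itv /= ler_pdivrMr// ltr_pdivlMr// [s * _]mulrC h1.
    rewrite in_itv /= ler_pdivrMr// ltr_pdivlMr// [s * _]mulrC => h.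
    by rewrite /grid (floor_def h).
  apply: countable_bigcupT_measurable => // k; apply: measurableX.
    by have := mF (k%:~R / n.+1%:R) measurableT Y mY; rewrite setTI.
  exact: measurable_itv.
- move=> [t s] _ /=; have [Us|nUs] := pselect (U s).
    rewrite indicE mem_set//; apply: cvgM; first exact: cvg_cst.
    by apply: continuous_cvg; [exact: cF|exact: grid_cvg].
  rewrite indicE memNset//; under eq_fun do rewrite mul0r; rewrite mul0r.
  exact: cvg_cst.
Qed.

Let cut d (T : measurableType d) (D : set T) (U : set R) (F : T -> R -> R) (t : T) (s : R) : R :=
  \1_D t * (\1_U s * F t s).

Let measurable_cut d (T : measurableType d) (D : set T) (U : set R) (F : T -> R -> R) :
  measurable D -> open U -> (forall s, U s -> measurable_fun D (F ^~ s)) ->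
  (forall t s, D t -> U s -> {for s, continuous (F t)}) ->
  measurable_fun [set: (T * R)%type] (fun p => cut D U F p.1 p.2).
Proof.
move=> mD oU mF cF.
pose F' t s := \1_D t * (\1_U s * F t s).
have -> : (fun p => cut D U F p.1 p.2) = (fun p => \1_U p.2 * F' p.1 p.2).
  apply/funext => -[t s]; rewrite /cut /F' /=.
  rewrite !indicE; case: (s \in U); rewrite /= ?mul1r ?mul0r ?mulr0//.
apply: measurable_caratheodory => //.
- move=> s; rewrite /F'; have [Us|nUs] := pselect (U s).
    have := mF s Us => /(measurable_restrictT _ mD).
    apply: eq_measurable_fun => t _; rewrite patchE /= !indicE (mem_set Us) mul1r.
    by case: ifP; rewrite ?mul1r ?mul0r.
  rewrite (_ : (fun _ => _) = (fun=> 0)); first exact: measurable_cst.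
  by apply/funext => t; rewrite !indicE (memNset nUs) mul0r mulr0.
- move=> t s Us; have [Dt|nDt] := pselect (D t); last first.
    have -> : F' t = cst 0 by apply/funext => r; rewrite /F' indicE memNset// mul0r.
    exact: cst_continuous.
  have h : \forall r \near s, F t r = F' t r.
    have := open_nbhs_nbhs (conj oU Us); apply: filterS => r Ur.
    by rewrite /F' !indicE !mem_set// !mul1r.
  have c : F t x @[x --> s] --> F t s by exact: (cF t s Dt Us).
  have e : F' t s = F t s by rewrite /F' !indicE !mem_set// !mul1r.
  suff : F' t x @[x --> s] --> F' t s by exact.
  by rewrite e; apply: cvg_trans c; exact: near_eq_cvg.
Qed.

Let Rint_cut d (T : measurableType d) (D : set T) (U : set R) (F : T -> R -> R) (t : T) :
  D t -> (fun s => cut D U F t s) = (F t) \_ U.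
Proof.
move=> Dt; apply/funext => s; rewrite /cut patchE !indicE (mem_set Dt) mul1r.
by case: ifP; rewrite ?mul1r ?mul0r.
Qed.

Lemma measurable_Rint d (T : measurableType d) (D : set T) (U : set R) (F : T -> R -> R) :
  measurable D -> open U -> (forall s, U s -> measurable_fun D (F ^~ s)) ->
  (forall t s, D t -> U s -> {for s, continuous (F t)}) ->
  measurable_fun D (fun t => Rint U (F t)).
Proof.
move=> mD oU mF cF.
have mG := measurable_cut mD oU mF cF.
have mGE : measurable_fun [set: (T * R)%type] (fun p => (cut D U F p.1 p.2)%:E).
  by apply: measurableT_comp mG.
have mp := measurable_funepos mGE.
have mn := measurable_funeneg mGE.
have m1 := @measurable_fun_fubini_tonelli_F _ _ T _ R mu _ mp (fun _ => funepos_ge0 _ _).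
have m2 := @measurable_fun_fubini_tonelli_F _ _ T _ R mu _ mn (fun _ => funeneg_ge0 _ _).
have mB := emeasurable_funB m1 m2.
have mf : measurable_fun [set: T] (fine \o (fubini_F mu (fun p => (cut D U F p.1 p.2)%:E)^\+ \-
   fubini_F mu (fun p => (cut D U F p.1 p.2)%:E)^\-)%E).
  by apply: measurableT_comp mB; exact: fine_measurable.
apply: (@eq_measurable_fun _ _ _ _ D _ _ _ (measurable_funS measurableT (@subsetT _ D) mf)).
move=> t; rewrite inE => Dt; rewrite Rintegral_mkcond -(Rint_cut U F Dt) /Rintegral /=.
congr fine; apply/esym; rewrite /fubini_F.
rewrite [LHS]integralE; congr (_ - _)%E; [apply: eq_integral => y _|apply: eq_integral => y _].
by rewrite ?funeposE ?funenegE.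
by rewrite ?funeposE ?funenegE.
Qed.

Lemma Rint_swap (D U : set R) (F : R -> R -> R) (a b : R -> R) : measurable D -> open U ->
  (forall s, U s -> measurable_fun D (F ^~ s)) ->
  (forall t s, D t -> U s -> {for s, continuous (F t)}) ->
  Intg D a -> Intg U b -> (forall t s, D t -> U s -> `|F t s| <= a t * b s) ->
  Rint D (fun t => Rint U (F t)) = Rint U (fun s => Rint D (F ^~ s)).
Proof.
move=> mD oU mF cF Ia Ib Fab.
have mU : measurable U by exact: open_measurable.
have mG := @measurable_cut _ (measurableTypeR R) _ _ _ mD oU mF cF.
pose G (p : measurableTypeR R * measurableTypeR R) : \bar R := (cut D U F p.1 p.2)%:E.
have mGE : measurable_fun setT G.
  by apply: measurableT_comp mG.
pose a' := (fun t => `|a t|) \_ D. pose b' := (fun t => `|b t|) \_ U.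
have Ia' : Intg [set: R] a'.
  have : Intg D (fun t => `|a t|) by exact: integrable_norm.
  by move/(@integrable_mkcond _ _ R mu D _ mD); rewrite restrict_EFin.
have Ib' : Intg [set: R] b'.
  have : Intg U (fun t => `|b t|) by exact: integrable_norm.
  by move/(@integrable_mkcond _ _ R mu U _ mU); rewrite restrict_EFin.
have cutle t s : `|cut D U F t s| <= a' t * b' s.
  rewrite /cut /a' /b' !patchE !indicE; case: ifPn => tD; case: ifPn => sU;
    rewrite ?mul1r ?mul0r ?mulr0 ?normr0//.
  move: tD sU; rewrite !inE => tD sU; rewrite (le_trans (Fab _ _ tD sU))//.
  by rewrite -normrM ler_norm.
have a0 t : 0 <= a' t by rewrite /a' patchE; case: ifP.
have b0 t : 0 <= b' t by rewrite /b' patchE; case: ifP.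
have IG : (mu \x mu)%E.-integrable setT G.
  apply/(integrable12ltyP mu mu mGE).
  apply: (@le_lt_trans _ _ (\int[mu]_t (a' t * Rint [set: R] b')%:E)%E).
    apply: ge0_le_integral => //.
    - by move=> x _; apply: integral_ge0 => y _; exact: abse_ge0.
    - have := @measurable_fun_fubini_tonelli_F _ _ _ _ R mu (fun p => `|G p|%E) _ (fun _ => abse_ge0 _).
      by apply; exact: measurableT_comp mGE.
    - apply/measurable_EFinP; apply: measurable_funM; last exact: measurable_cst.
      exact: (integrable_measurable Ia').
    - move=> t _; rewrite EFinM.
      have -> : ((Rint [set: R] b')%:E = \int[mu]_s (b' s)%:E)%E.
        by rewrite /Rintegral fineK//; exact: (@integrable_fin_num _ _ R mu _ measurableT (EFin \o b') Ib').
      rewrite -ge0_integralZl ?lee_fin//; first last.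
      + by move=> s _; rewrite lee_fin.
      + by apply/measurable_EFinP; exact: (integrable_measurable Ib').
      apply: ge0_le_integral => //.
      + have h := measurableT_comp mGE (measurable_pair1 t).
        by apply: measurableT_comp h.
      + apply/measurable_EFinP; apply: measurable_funM; first exact: measurable_cst.
        exact: (integrable_measurable Ib').
      + by move=> s _; rewrite /G /= lee_fin.
  have Ic : Intg [set: R] (fun t => a' t * Rint [set: R] b').
    have := integrable_scale (Rint [set: R] b') measurableT Ia'.
    by apply: integrable_eq => // x _; rewrite mulrC.
  have := @integrable_fin_num _ _ R mu _ measurableT _ Ic.
  by rewrite fin_numElt => /andP[_].
have Fub := Fubini IG.
have E1 (t : R) : (\int[mu]_s G (t, s) = ((fun t => Rint U (F t)) \_ D t)%:E)%E.
  rewrite patchE; case: ifPn => [|tD]; last first.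
    by under eq_integral do rewrite /G /cut indicE (negbTE tD) mul0r; rewrite integral0.
  rewrite inE => Dt; rewrite Rintegral_mkcond /Rintegral fineK; last first.
    apply: (@integrable_fin_num _ _ R mu _ measurableT).
    rewrite -(Rint_cut U F Dt).
    have h1 : measurable_fun [set: R] (fun s => cut D U F t s).
      exact: (measurableT_comp mG (measurable_pair1 t)).
    have h2 s : [set: R] s -> `|cut D U F t s| <= a' t * b' s by move=> _; exact: cutle.
    exact: (integrable_dom measurableT h1 h2 (integrable_scale (a' t) measurableT Ib')).
  by apply: eq_integral => s _; rewrite -(Rint_cut U F Dt).
have E2 (s : R) : (\int[mu]_t G (t, s) = ((fun s => Rint D (F ^~ s)) \_ U s)%:E)%E.
  rewrite patchE; case: ifPn => [|sU]; last first.
    by under eq_integral do rewrite /G /cut [in X in _ * (X * _)]indicE (negbTE sU) mul0r mulr0; rewrite integral0.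
  rewrite inE => Us.
  have cE : (fun t => cut D U F t s) = (F ^~ s) \_ D.
    apply/funext => t; rewrite /cut patchE !indicE (mem_set Us) mul1r.
    by case: ifP; rewrite ?mul1r ?mul0r.
  rewrite Rintegral_mkcond /Rintegral fineK; last first.
    apply: (@integrable_fin_num _ _ R mu _ measurableT).
    rewrite -cE.
    have h1 : measurable_fun [set: R] (fun t => cut D U F t s).
      exact: (measurableT_comp mG (measurable_pair2 s)).
    have h2 t : [set: R] t -> `|cut D U F t s| <= b' s * a' t.
      by move=> _; rewrite mulrC; exact: cutle.
    exact: (integrable_dom measurableT h1 h2 (integrable_scale (b' s) measurableT Ia')).
  by apply: eq_integral => t _; rewrite -cE.
rewrite [LHS]Rintegral_mkcond [RHS]Rintegral_mkcond /Rintegral; congr fine.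
transitivity (\int[mu]_t \int[mu]_s G (t, s))%E.
  by apply: eq_integral => t _; rewrite E1.
by rewrite Fub; apply: eq_integral => s _; rewrite E2.
Qed.

End Caratheodory.

Section FundamentalTheorem.
Context {R : realType}.
Local Notation mu := (@lebesgue_measure R).
Local Notation Intg D f := (mu.-integrable (D : set R) (EFin \o (f : R -> R))).
Local Notation Rint := (@Rintegral _ _ R mu).

Lemma is_derive_continuous (f : R -> R) (x l : R) : is_derive x 1 f l -> {for x, continuous f}.
Proof. by move=> [d _]; apply/differentiable_continuous/derivable1_diffP. Qed.

Lemma Rint_FTC (F f : R -> R) (a b : R) : a <= b ->
  (forall x, a <= x <= b -> is_derive x 1 F (f x)) ->
  (forall x, a <= x <= b -> {for x, continuous f}) ->
  Intg `[a, b]%classic f /\ Rint `[a, b]%classic f = F b - F a.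
Proof.
move=> ab dF cf.
have wc : {within `[a, b], continuous f}.
  by apply: continuous_in_subspaceT => x; rewrite inE /= in_itv /=; exact: cf.
have If : Intg `[a, b]%classic f.
  have := @continuous_compact_integrable R f `[a, b]%classic (@segment_compact _ a b) wc; exact.
split=> //; move: ab; rewrite le_eqVlt => /predU1P[ab|ab].
  by rewrite -ab set_itv1 Rintegral_set1 subrr.
have h := @continuous_FTC2 R f F a b ab wc.
rewrite /Rintegral h //.
  split.
  - by move=> x; rewrite in_itv /= => /andP[/ltW ax /ltW xb]; have [] := dF x; rewrite ?ax.
  - by apply: cvg_at_right_filter; apply: is_derive_continuous (dF _ _); rewrite lexx ltW.
  - by apply: cvg_at_left_filter; apply: is_derive_continuous (dF _ _); rewrite lexx ltW.
by move=> x; rewrite in_itv /= => /andP[/ltW ax /ltW xb]; rewrite derive1E; have [] := dF x; rewrite ?ax.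
Qed.

Lemma Rint_exhaust (D : set R) (u v : nat -> R) (f : R -> R) : measurable D -> Intg D f ->
  (forall n, `[u n, v n]%classic `<=` D) ->
  (forall x, D x -> \forall n \near \oo, u n <= x <= v n) ->
  (fun n => Rint `[u n, v n]%classic f) @ \oo --> Rint D f.
Proof.
move=> mD If sub ev.
have -> : (fun n => Rint `[u n, v n]%classic f) = (fun n => Rint D (f \_ `[u n, v n])).
  by apply/funext => n; rewrite -Rintegral_mkcondr setIidr.
have mf := integrable_measurable If.
apply: (@Rint_dct _ D _ f (fun x => `|f x|) mD _ _ _ _).2.
- move=> n; apply/measurable_restrict => //.
  exact: measurable_funS mD (@subIsetl _ _ _) mf.
- by move=> n x _; rewrite patchE; case: ifP => // _; rewrite normr0.
- exact: integrable_norm.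
- move=> x Dx; apply: cvg_near_cst; have := ev x Dx; apply: filterS => n h.
  by rewrite patchE mem_set//= in_itv.
Qed.

Lemma ge0_integrable_exhaust (D : set R) (u v : nat -> R) (f : R -> R) (M : R) :
  measurable D -> measurable_fun D f -> (forall x, D x -> 0 <= f x) ->
  {homo u : n m / (n <= m)%N >-> m <= n} -> {homo v : n m / (n <= m)%N >-> n <= m} ->
  (forall n, `[u n, v n]%classic `<=` D) ->
  (forall x, D x -> exists n, u n <= x <= v n) ->
  (forall n, Intg `[u n, v n]%classic f /\ Rint `[u n, v n]%classic f <= M) ->
  Intg D f /\ Rint D f <= M.
Proof.
move=> mD mf f0 du iv sub ev IM.
have DE : D = \bigcup_n `[u n, v n]%classic.
  apply/seteqP; split=> [x /ev[n h]|x [n _ /sub//]].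
  by exists n => //=; rewrite in_itv.
have mE : measurable_fun D (EFin \o f) by exact/measurable_EFinP.
have c := @ge0_nondecreasing_set_cvg_integral _ (measurableTypeR R) R (fun n => `[u n, v n]%classic) (EFin \o f) mu.
have {c} c : (\int[mu]_(x in `[u n, v n]) (f x)%:E @[n --> \oo] --> \int[mu]_(x in D) (f x)%:E)%E.
  rewrite DE; apply: c.
  - apply/nondecreasing_seqP => n; apply/subsetPset => x /=; rewrite !in_itv /= => /andP[h1 h2].
    by rewrite (le_trans (du _ _ (leqnSn n)))// (le_trans h2)// iv.
  - by move=> n; exact: measurable_itv.
  - by move=> n; apply: measurable_funS mD _ mE; exact: sub.
  - by move=> n x /sub Dx; rewrite lee_fin f0.
have IME n : (\int[mu]_(x in `[u n, v n]) (f x)%:E <= M%:E)%E.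
  have [I1 I2] := IM n.
  have fin := @integrable_fin_num _ _ R mu _ (measurable_itv `[u n, v n]) (EFin \o f) I1.
  by rewrite -(fineK fin) lee_fin.
have le : (\int[mu]_(x in D) (f x)%:E <= M%:E)%E.
  rewrite -(cvg_lim (@ereal_hausdorff R) c); apply: lime_le; first by apply/cvg_ex; eexists; exact: c.
  exact: nearW.
have ge0 : (0 <= \int[mu]_(x in D) (f x)%:E)%E by apply: integral_ge0 => x /f0; rewrite lee_fin.
have fin : (\int[mu]_(x in D) (f x)%:E)%E \is a fin_num.
  by rewrite ge0_fin_numE// (le_lt_trans le)// ltry.
split; last by rewrite /Rintegral -lee_fin fineK.
apply/integrableP; split=> //.
rewrite (_ : (\int[mu]_(x in D) `|(EFin \o f) x|)%E = (\int[mu]_(x in D) (f x)%:E)%E).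
  by rewrite (le_lt_trans le)// ltry.
by apply: eq_integral => x; rewrite inE => /f0 h /=; rewrite ger0_norm.
Qed.

Let shrinkl (a b : R) (n : nat) : R := a + (b - a) / 3 * n.+1%:R^-1.
Let shrinkr (a b : R) (n : nat) : R := b - (b - a) / 3 * n.+1%:R^-1.

Let harm_le (n m : nat) : (n <= m)%N -> m.+1%:R^-1 <= n.+1%:R^-1 :> R.
Proof. by move=> nm; rewrite lef_pV2 ?posrE ?ltr0n// ler_nat ltnS. Qed.

Let harm01 (n : nat) : 0 < (n.+1%:R^-1 : R) <= 1.
Proof. by rewrite invr_gt0 ltr0n invf_le1 ?ltr0n// ler1n. Qed.

Let harm_small (e : R) : 0 < e -> \forall n \near \oo, n.+1%:R^-1 <= e.
Proof.
move=> e0; have /cvgrPdist_le/(_ e e0) := @cvg_harmonic R.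
by apply: filterS => n; rewrite /harmonic /= sub0r normrN ger0_norm// invr_ge0.
Qed.

Let shrink_sub (a b : R) (n : nat) : a < b ->
  a < shrinkl a b n /\ shrinkl a b n < shrinkr a b n /\ shrinkr a b n < b.
Proof.
move=> ab; have /andP[h0 h1] := harm01 n; rewrite /shrinkl /shrinkr.
set c := n.+1%:R^-1 in h0 h1 *.
have d0 : 0 < (b - a) / 3 by rewrite divr_gt0// subr_gt0.
have dc : (b - a) / 3 * c <= (b - a) / 3 by rewrite ler_piMr// ltW.
have dc0 : 0 < (b - a) / 3 * c by rewrite mulr_gt0.
split; [by lra|split; last by lra]; lra.
Qed.

Let shrink_near (a b x : R) : a < x -> x < b ->
  \forall n \near \oo, shrinkl a b n <= x <= shrinkr a b n.
Proof.
move=> ax xb; have ab := lt_trans ax xb.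
have d0 : 0 < (b - a) / 3 by rewrite divr_gt0// subr_gt0.
pose e := Num.min (x - a) (b - x) / ((b - a) / 3).
have e0 : 0 < e by rewrite divr_gt0// lt_min !subr_gt0 ax.
have := harm_small e0; apply: filterS => n; rewrite /e ler_pdivlMr// le_min => /andP[].
rewrite /shrinkl /shrinkr [_^-1 * _]mulrC; set p := _ * _^-1 => h1 h2; apply/andP; split; lra.
Qed.

Lemma ge0_Rint_primitive (F f : R -> R) (a b M : R) : a < b ->
  (forall x, a < x < b -> 0 <= f x) ->
  (forall x, a < x < b -> is_derive x 1 F (f x)) ->
  (forall x, a < x < b -> {for x, continuous f}) ->
  (forall x y, a < x -> x <= y -> y < b -> F y - F x <= M) ->
  Intg `]a, b[%classic f /\ Rint `]a, b[%classic f <= M.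
Proof.
move=> ab f0 dF cf FM.
have mf : measurable_fun `]a, b[%classic f.
  by apply: open_continuous_measurable_fun; [exact: interval_open|move=> x; rewrite inE /= in_itv; exact: cf].
apply: (@ge0_integrable_exhaust _ (shrinkl a b) (shrinkr a b)) => //.
- by move=> n m nm; rewrite lerD2l ler_pM2l ?divr_gt0 ?subr_gt0// harm_le.
- by move=> n m nm; rewrite lerD2l lerN2 ler_pM2l ?divr_gt0 ?subr_gt0// harm_le.
- move=> n x /=; rewrite !in_itv /=; have [h1 [h2 h3]] := shrink_sub n ab => /andP[h4 h5].
  by rewrite (lt_le_trans h1)//= (le_lt_trans h5).
- move=> x /=; rewrite in_itv /= => /andP[ax xb]; have [n _ h] := shrink_near ax xb.
  by exists n; exact: h (leqnn n).
- move=> n; have [h1 [h2 h3]] := shrink_sub n ab.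
  have inab x : shrinkl a b n <= x <= shrinkr a b n -> a < x < b.
    by move=> /andP[h4 h5]; rewrite (lt_le_trans h1)//= (le_lt_trans h5).
  have [] := @Rint_FTC F f _ _ (ltW h2) (fun x h => dF x (inab x h)) (fun x h => cf x (inab x h)).
  by move=> ? ->; split => //; apply: FM => //; exact: ltW.
Qed.

Lemma ge0_Rint_primitivey (F f : R -> R) (a M : R) :
  (forall x, a < x -> 0 <= f x) ->
  (forall x, a < x -> is_derive x 1 F (f x)) ->
  (forall x, a < x -> {for x, continuous f}) ->
  (forall x y, a < x -> x <= y -> F y - F x <= M) ->
  Intg `]a, +oo[%classic f /\ Rint `]a, +oo[%classic f <= M.
Proof.
move=> f0 dF cf FM.
have mf : measurable_fun `]a, +oo[%classic f.
  apply: open_continuous_measurable_fun; first exact: interval_open.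
  by move=> x; rewrite inE /= in_itv /= andbT; exact: cf.
apply: (@ge0_integrable_exhaust _ (fun n => a + n.+1%:R^-1) (fun n => a + 1 + n%:R)) => //.
- by move=> x /=; rewrite in_itv /= andbT; exact: f0.
- by move=> n m nm; rewrite lerD2l harm_le.
- by move=> n m nm; rewrite lerD2l ler_nat.
- move=> n x /=; rewrite !in_itv /= andbT => /andP[h _]; apply: lt_le_trans h.
  by rewrite ltrDl; have /andP[] := harm01 n.
- move=> x /=; rewrite in_itv /= andbT => ax.
  have xa : 0 < x - a by rewrite subr_gt0.
  have [n1 _ h1] := harm_small xa.
  have /= h2 := archi_boundP (ltW xa).
  set n2 := Num.bound (x - a) in h2.
  exists (maxn n1 n2).
  have := h1 (maxn n1 n2) (leq_maxl _ _); rewrite /=; set q := _^-1 => h3.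
  have : n2%:R <= (maxn n1 n2)%:R :> R by rewrite ler_nat leq_maxr.
  by move=> h4; apply/andP; split; lra.
- move=> n; have /andP[h0 h1] := harm01 n.
  have n0 : 0 <= n%:R :> R by rewrite ler0n.
  have ina x : a + n.+1%:R^-1 <= x <= a + 1 + n%:R -> a < x.
    by move=> /andP[h4 _]; apply: lt_le_trans h4; rewrite ltrDl.
  have le : a + n.+1%:R^-1 <= a + 1 + n%:R by rewrite -addrA lerD2l (le_trans h1)// lerDl.
  have [] := @Rint_FTC F f _ _ le (fun x h => dF x (ina x h)) (fun x h => cf x (ina x h)).
  by move=> ? ->; split => //; apply: FM => //; rewrite ltrDl.
Qed.

Lemma Rint_FTC_open (F f : R -> R) (a b A B : R) : a < b ->
  (forall x, a < x < b -> is_derive x 1 F (f x)) ->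
  (forall x, a < x < b -> {for x, continuous f}) ->
  Intg `]a, b[%classic f ->
  F x @[x --> a^'+] --> A -> F x @[x --> b^'-] --> B ->
  Rint `]a, b[%classic f = B - A.
Proof.
move=> ab dF cf If FA FB.
have c1 : (fun n => Rint `[shrinkl a b n, shrinkr a b n]%classic f) @ \oo --> Rint `]a, b[%classic f.
  apply: Rint_exhaust => //.
  - move=> n x /=; rewrite !in_itv /=; have [h1 [h2 h3]] := shrink_sub n ab => /andP[h4 h5].
    by rewrite (lt_le_trans h1)//= (le_lt_trans h5).
  - by move=> x /=; rewrite in_itv /= => /andP[ax xb]; exact: shrink_near.
have h3 : (fun n => (b - a) / 3 * harmonic n) @ \oo --> (b - a) / 3 * 0.
  by apply: cvgM; [exact: cvg_cst|exact: cvg_harmonic].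
have ul : shrinkl a b n @[n --> \oo] --> a.
  have h4 : (fun n => a + (b - a) / 3 * harmonic n) @ \oo --> a + (b - a) / 3 * 0.
    by apply: cvgD => //; exact: cvg_cst.
  by rewrite mulr0 addr0 in h4; exact: h4.
have vr : shrinkr a b n @[n --> \oo] --> b.
  have h4 : (fun n => b - (b - a) / 3 * harmonic n) @ \oo --> b - (b - a) / 3 * 0.
    by apply: cvgB => //; exact: cvg_cst.
  by rewrite mulr0 subr0 in h4; exact: h4.
have c2 : (fun n => F (shrinkr a b n) - F (shrinkl a b n)) @ \oo --> B - A.
  apply: cvgB.
    by move/cvg_at_leftP : FB; apply; split => // n; have [_ []] := shrink_sub n ab.
  by move/cvg_at_rightP : FA; apply; split => // n; have [] := shrink_sub n ab.
have e : (fun n => Rint `[shrinkl a b n, shrinkr a b n]%classic f) =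
         (fun n => F (shrinkr a b n) - F (shrinkl a b n)).
  apply/funext => n; have [h1 [h2 h4]] := shrink_sub n ab.
  have inab x : shrinkl a b n <= x <= shrinkr a b n -> a < x < b.
    by move=> /andP[h5 h6]; rewrite (lt_le_trans h1)//= (le_lt_trans h6).
  by have [] := @Rint_FTC F f _ _ (ltW h2) (fun x h => dF x (inab x h)) (fun x h => cf x (inab x h)).
rewrite e in c1; exact: (cvg_unique (@Rhausdorff R) c1 c2).
Qed.

Lemma mvt_le (f df : R -> R) (a b M : R) : a <= b ->
  (forall x, a <= x <= b -> is_derive x 1 f (df x)) ->
  (forall x, a <= x <= b -> `|df x| <= M) -> `|f b - f a| <= M * (b - a).
Proof.
move=> ab d dM.
have [||c] := @MVT_segment R f df a b ab.
- by move=> z; rewrite in_itv /= => /andP[/ltW h1 /ltW h2]; apply: d; rewrite h1.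
- apply: continuous_in_subspaceT => x; rewrite inE /= in_itv /= => /d.
  exact: is_derive_continuous.
by rewrite in_itv /= => cab ->; rewrite normrM (ger0_norm (x := b - a)) ?subr_ge0// ler_wpM2r ?subr_ge0// dM.
Qed.

End FundamentalTheorem.

Section Calculus.
Context {R : realType}.
Implicit Types (f g : R -> R) (x df dg : R).

Lemma is_derive_fcst (c x : R) : is_derive x 1 (fun=> c : R) 0.
Proof. exact: is_derive_cst. Qed.

Lemma is_derive_fid x : is_derive x 1 (fun y : R => y) 1.
Proof. exact: is_derive_id. Qed.

Lemma is_derive_fadd f g x df dg : is_derive x 1 f df -> is_derive x 1 g dg ->
  is_derive x 1 (fun y => f y + g y) (df + dg).
Proof. by move=> hf hg; have := is_deriveD hf hg; exact. Qed.

Lemma is_derive_fopp f x df : is_derive x 1 f df -> is_derive x 1 (fun y => - f y) (- df).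
Proof. by move=> hf; have := is_deriveN hf; exact. Qed.

Lemma is_derive_fsub f g x df dg : is_derive x 1 f df -> is_derive x 1 g dg ->
  is_derive x 1 (fun y => f y - g y) (df - dg).
Proof. by move=> hf hg; have := is_deriveB hf hg; exact. Qed.

Lemma is_derive_fscale (c : R) f x df : is_derive x 1 f df ->
  is_derive x 1 (fun y => c * f y) (c * df).
Proof. by move=> hf; have := is_deriveZ c hf; exact. Qed.

Lemma is_derive_fmul f g x df dg : is_derive x 1 f df -> is_derive x 1 g dg ->
  is_derive x 1 (fun y => f y * g y) (df * g x + f x * dg).
Proof.
move=> hf hg; have h := is_deriveM hf hg; apply: (is_derive_eq h).
by rewrite /GRing.scale /= addrC [g x * _]mulrC.
Qed.

Lemma is_derive_fcomp f g x df dg : is_derive (g x) 1 f df -> is_derive x 1 g dg ->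
  is_derive x 1 (fun y => f (g y)) (df * dg).
Proof. by move=> hf hg; have := is_derive1_comp hf hg; exact. Qed.

Lemma is_derive_fexp f x df : is_derive x 1 f df ->
  is_derive x 1 (fun y => expR (f y)) (expR (f x) * df).
Proof. by move=> hf; apply: (@is_derive_fcomp expR f x _ df) => //; exact: is_derive_expR. Qed.

Lemma is_derive_fpowR f (p : R) x df : 0 < f x -> is_derive x 1 f df ->
  is_derive x 1 (fun y => f y `^ p) (p * f x `^ (p - 1) * df).
Proof. by move=> fx hf; apply: (@is_derive_fcomp (fun y => y `^ p) f x _ df) => //; exact: is_derive1_powR. Qed.

Lemma is_derive_fsqr f x df : is_derive x 1 f df ->
  is_derive x 1 (fun y => f y ^+ 2) (2 * f x * df).
Proof.
move=> hf; have := is_derive_fmul hf hf; under eq_fun do rewrite -expr2.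
by move=> h; apply: (is_derive_eq h); ring.
Qed.

Lemma is_derive_ext f g x df : (\forall y \near x, f y = g y) ->
  is_derive x 1 f df -> is_derive x 1 g df.
Proof.
move=> fg [h1 h2]; split; first exact: near_eq_derivable fg h1.
by rewrite -h2; apply/esym; exact: near_eq_derive.
Qed.

Lemma continuous_powR f (p x : R) : 0 < f x -> {for x, continuous f} ->
  {for x, continuous (fun y => f y `^ p)}.
Proof.
move=> fx cf.
apply: (@continuous_comp _ _ _ f (fun y => y `^ p)) => //.
by apply: is_derive_continuous; exact: is_derive1_powR.
Qed.

Lemma powR_mono_neg (p x y : R) : 0 < x -> x <= y -> 0 <= p -> y `^ (- p) <= x `^ (- p).
Proof.
move=> x0 xy p0; have y0 := lt_le_trans x0 xy; rewrite !powRN lef_pV2 ?posrE ?powR_gt0//.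
by apply: ge0_ler_powR => //; rewrite nnegrE ltW.
Qed.

Lemma powR_mono (p x y : R) : 0 <= x -> x <= y -> 0 <= p -> x `^ p <= y `^ p.
Proof.
by move=> x0 xy p0; apply: ge0_ler_powR => //; rewrite nnegrE// (le_trans x0).
Qed.

End Calculus.

Section Weights.
Context {R : realType}.
Local Notation mu := (@lebesgue_measure R).
Local Notation Intg D f := (mu.-integrable (D : set R) (EFin \o (f : R -> R))).
Local Notation Rint := (@Rintegral _ _ R mu).

Definition wt (q s : R) : R := (1 + s ^+ 2) `^ (- q).

Lemma wt_base (s : R) : 1 <= 1 + s ^+ 2.
Proof. by rewrite lerDl sqr_ge0. Qed.

Lemma wt_base_gt0 (s : R) : 0 < 1 + s ^+ 2.
Proof. exact: lt_le_trans ltr01 (wt_base s). Qed.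

Lemma wt_gt0 (q s : R) : 0 < wt q s.
Proof. by rewrite powR_gt0// wt_base_gt0. Qed.

Lemma wt_ge0 (q s : R) : 0 <= wt q s. Proof. exact: ltW (wt_gt0 q s). Qed.

Lemma wt_le1 (q s : R) : 0 <= q -> wt q s <= 1.
Proof.
by move=> q0; have := ler_powR (wt_base s) (_ : - q <= 0); rewrite powRr0; apply; rewrite oppr_le0.
Qed.

Lemma wt_continuous (q : R) : continuous (wt q).
Proof.
move=> s; apply: (@continuous_powR R (fun s => 1 + s ^+ 2)); first exact: wt_base_gt0.
by apply: cvgD; [exact: cvg_cst|exact: exprn_continuous].
Qed.

(* Comparison with the shifted power [(2 + s)^(-2q)], whose primitive is explicit. *)
Lemma integrable_wt (q : R) : 1 / 2 < q -> Intg [set: R] (wt q).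
Proof.
move=> q2; pose e := 2 * q - 1; have e0 : 0 < e by rewrite /e; lra.
pose f (s : R) : R := (2 + s) `^ (- (2 * q)).
have [If _] : Intg `](-1), +oo[%classic f /\ Rint `](-1), +oo[%classic f <= e^-1.
  apply: (@ge0_Rint_primitivey R (fun s => - e^-1 * (2 + s) `^ (- e)) f).
  - by move=> s _; exact: powR_ge0.
  - move=> s s1; have p : 0 < 2 + s by lra.
    have d1 := is_derive_fadd (is_derive_fcst 2 s) (is_derive_fid s).
    have d3 := is_derive_fscale (- e^-1) (is_derive_fpowR (- e) p d1).
    apply: (is_derive_eq d3); rewrite /f add0r mulr1 mulrA mulrNN mulVf ?gt_eqF// mul1r.
    by congr (_ `^ _); rewrite /e; ring.
  - move=> s s1; apply: continuous_powR; first by lra.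
    by apply: cvgD; [exact: cvg_cst|exact: cvg_id].
  - move=> x y x1 xy; rewrite !mulNr opprK addrC -mulrBr -[leRHS]mulr1 ler_pM2l ?invr_gt0//.
    have h1 : (2 + x) `^ (- e) <= 1 `^ (- e) by apply: powR_mono_neg => //; [lra|exact: ltW].
    by rewrite powR1 in h1; have := powR_ge0 (2 + y) (- e); lra.
pose f1 := f \_ `](-1), +oo[.
have f10 s : 0 <= f1 s by rewrite /f1 patchE; case: ifP => // _; exact: powR_ge0.
have If1 : Intg [set: R] f1.
  have /(@integrable_mkcond _ _ R mu _ _ (measurable_itv _)) := If.
  by rewrite restrict_EFin.
have [If2 _] : Intg [set: R] (fun s => f1 (-1 * s + 0)) /\ Rint [set: R] (fun s => f1 (-1 * s + 0)) = `|-1|^-1 * Rint [set: R] f1.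
  by apply: Rint_affine => //; rewrite oppr_eq0 oner_eq0.
have If3 := integrable_scale (8 `^ q) measurableT (integrable_add measurableT If1 If2).
apply: (integrable_dom measurableT _ _ If3).
  exact: continuous_measurable_fun (@wt_continuous q).
have key (s : R) : 0 <= s -> wt q s <= 8 `^ q * f1 s.
  move=> s0; rewrite /f1 patchE mem_set /=; last by rewrite in_itv /= andbT; lra.
  have p : 0 <= 2 + s by lra.
  rewrite /f -mulrN powRrM -[2]/(2%:R) powR_mulrn// powRN /wt powRN.
  have p8 : 0 <= 8 * (1 + s ^+ 2) by rewrite mulr_ge0// ltW// wt_base_gt0.
  have h : ((2 + s) ^+ 2) `^ q <= (8 * (1 + s ^+ 2)) `^ q.
    by apply: powR_mono; [exact: sqr_ge0| have := sqr_ge0 (s - 2 / 7); nra|lra].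
  rewrite powRM// in h; last by rewrite ltW// wt_base_gt0.
  rewrite ler_pdivlMr ?powR_gt0 ?exprn_gt0//; last by lra.
  by rewrite mulrC ler_pdivrMr ?powR_gt0// wt_base_gt0.
move=> s _; rewrite ger0_norm ?wt_ge0// mulrDr.
have [s0|s0] := leP 0 s.
  by apply: le_trans (key s s0) _; rewrite lerDl mulr_ge0 ?powR_ge0.
have -> : wt q s = wt q (-1 * s + 0) by rewrite /wt addr0 mulN1r sqrrN.
apply: le_trans (key _ _) _; first by rewrite addr0 mulN1r oppr_ge0 ltW.
by rewrite lerDr mulr_ge0 ?powR_ge0.
Qed.

Lemma wt_affine (q c e : R) : c != 0 -> 0 <= q -> exists2 K, 0 < K & forall s, wt q (c * s + e) <= K * wt q s.
Proof.
move=> c0 q0; pose k := 1 + 2 * c ^- 2 + 2 * e ^+ 2 * c ^- 2.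
have c2 : 0 < c ^- 2 by rewrite invr_gt0 exprn_even_gt0.
have k0 : 0 < k by rewrite /k; have := sqr_ge0 e; nra.
exists (k `^ q); first exact: powR_gt0.
move=> s; have h : (1 + s ^+ 2) `^ q <= (k * (1 + (c * s + e) ^+ 2)) `^ q.
  apply: powR_mono => //; first exact: ltW (wt_base_gt0 s).
  have sE : s = ((c * s + e) - e) / c by field.
  rewrite {1}sE; set u := c * s + e; rewrite expr_div_n; set w := c ^- 2 in k k0 c2 *.
  have h1 : 0 <= w * (u + e) ^+ 2 by rewrite mulr_ge0 ?sqr_ge0// ltW.
  have h2 : 0 <= w * e ^+ 2 * u ^+ 2.
    by apply: mulr_ge0; [apply: mulr_ge0; [exact: ltW|exact: sqr_ge0]|exact: sqr_ge0].
  rewrite /k; have := sqr_ge0 u; nra.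
rewrite powRM ?(ltW (wt_base_gt0 _)) ?(ltW k0)// in h.
rewrite /wt !powRN ler_pdivlMr ?powR_gt0 ?wt_base_gt0//.
by rewrite mulrC ler_pdivrMr ?powR_gt0 ?wt_base_gt0.
Qed.

Lemma wt_gt_half_ge0 (q : R) : 1 / 2 < q -> 0 <= q. Proof. lra. Qed.

Definition wt_mass (q : R) : R := Rint [set: R] (wt q).

Lemma wt_mass_ge0 (q : R) : 0 <= wt_mass q.
Proof. by apply: Rintegral_ge0 => s _; exact: wt_ge0. Qed.

End Weights.

Section Vectors.
Context {R : realType}.

Lemma cvg_rV (T : Type) (F : set_system T) (k : nat) (u : T -> 'rV[R]_k) (v : 'rV[R]_k) :
  Filter F -> (forall j, (fun t => u t 0 j) @ F --> v 0 j) -> u @ F --> v.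
Proof.
move=> FF h; apply/cvg_ballP => e e0.
have H : \forall t \near F, forall j, ball (v 0 j) e (u t 0 j).
  by apply: filter_forall => j; move/cvg_ballP : (h j); exact.
by apply: filterS H => t ht; split => // i j; rewrite ord1; exact: ht.
Qed.

Lemma cvg_coord (T : Type) (F : set_system T) (k : nat) (u : T -> 'rV[R]_k) (v : 'rV[R]_k) j :
  Filter F -> u @ F --> v -> (fun t => u t 0 j) @ F --> v 0 j.
Proof.
move=> FF h; apply/cvg_ballP => e e0; move/cvg_ballP : h => /(_ e e0).
by apply: filterS => t [_]; apply.
Qed.

(* Pseudometric spaces are first countable. *)
Lemma cvg_of_seq (T : pseudoMetricType R) (f : T -> R) (x : T) (l : R) :
  (forall u : nat -> T, u @ \oo --> x -> (fun n => f (u n)) @ \oo --> l) -> f @ x --> l.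
Proof.
move=> h; apply/cvgrPdist_lt => e e0; apply: contrapT => nh.
have bad (n : nat) : exists t, ball x n.+1%:R^-1 t /\ e <= `|l - f t|.
  apply: contrapT => nn; apply: nh; apply/nbhs_ballP; exists n.+1%:R^-1 => /=.
    by rewrite invr_gt0 ltr0n.
  by move=> t bt; rewrite ltNge; apply/negP => le; apply: nn; exists t.
have [u hu] := choice bad.
have cu : u @ \oo --> x.
  apply/cvg_ballP => d d0; have /cvgrPdist_lt/(_ d d0) := @cvg_harmonic R.
  apply: filterS => n; rewrite /harmonic /= sub0r normrN ger0_norm ?invr_ge0// => nd.
  by apply: le_ball (hu n).1; exact: ltW.
have /cvgrPdist_lt/(_ e e0) [n _ /(_ n (leqnn n))] := h u cu.
by rewrite /= ltNge (hu n).2.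
Qed.

Definition vcons (k : nat) (s : R) (y : 'rV[R]_k) : 'rV[R]_k.+1 :=
  row_mx (const_mx s : 'rV[R]_1) y.

Lemma vcons0 k s (y : 'rV[R]_k) : vcons s y 0 ord0 = s.
Proof.
rewrite /vcons (_ : ord0 = lshift k (ord0 : 'I_1)); last exact/val_inj.
by rewrite (@row_mxEl R 1 1 k (const_mx s) y 0 ord0) mxE.
Qed.

Lemma vconsS k s (y : 'rV[R]_k) j : vcons s y 0 (lift ord0 j) = y 0 j.
Proof.
rewrite /vcons (_ : lift ord0 j = rshift 1 j); last exact/val_inj.
exact: (@row_mxEr R 1 1 k (const_mx s) y 0 j).
Qed.

Lemma vcons_eta k (x : 'rV[R]_k.+1) : x = vcons (x 0 ord0) (\row_j x 0 (lift ord0 j)).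
Proof.
apply/rowP => i; have [j ->|->] := unliftP ord0 i; last by rewrite vcons0.
by rewrite vconsS mxE.
Qed.

Lemma cvg_vcons (T : Type) (F : set_system T) (k : nat) (s : T -> R) (y : T -> 'rV[R]_k) s0 y0 :
  Filter F -> s @ F --> s0 -> y @ F --> y0 -> (fun t => vcons (s t) (y t)) @ F --> vcons s0 y0.
Proof.
move=> FF cs cy; apply: cvg_rV => i; have [j ->|->] := unliftP ord0 i.
  rewrite vconsS; have -> : (fun t => vcons (s t) (y t) 0 (lift ord0 j)) = (fun t => y t 0 j).
    by apply/funext => t; rewrite vconsS.
  exact: cvg_coord cy.
rewrite vcons0; have -> // : (fun t => vcons (s t) (y t) 0 ord0) = s.
by apply/funext => t; rewrite vcons0.
Qed.

Lemma vconsD k (s t : R) (x y : 'rV[R]_k) : vcons s x + vcons t y = vcons (s + t) (x + y).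
Proof.
by apply/rowP => i; have [j ->|->] := unliftP ord0 i; rewrite mxE ?vconsS ?vcons0 ?mxE.
Qed.

Lemma vconsZ k (c s : R) (x : 'rV[R]_k) : c *: vcons s x = vcons (c * s) (c *: x).
Proof.
by apply/rowP => i; have [j ->|->] := unliftP ord0 i; rewrite mxE ?vconsS ?vcons0 ?mxE.
Qed.

Lemma cvg_sum (T : Type) (F : set_system T) (I : Type) (r : seq I) (P : pred I) (f : I -> T -> R) (l : I -> R) :
  Filter F -> (forall i, f i @ F --> l i) ->
  (fun t => \sum_(i <- r | P i) f i t) @ F --> \sum_(i <- r | P i) l i.
Proof.
move=> FF h; elim: r => [|i r IH].
  by rewrite big_nil; under eq_fun do rewrite big_nil; exact: cvg_cst.
rewrite big_cons; under eq_fun do rewrite big_cons.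
by case: (P i) => //; apply: cvgD.
Qed.

Lemma cvg_prod (T : Type) (F : set_system T) (I : Type) (r : seq I) (P : pred I) (f : I -> T -> R) (l : I -> R) :
  Filter F -> (forall i, f i @ F --> l i) ->
  (fun t => \prod_(i <- r | P i) f i t) @ F --> \prod_(i <- r | P i) l i.
Proof.
move=> FF h; elim: r => [|i r IH].
  by rewrite big_nil; under eq_fun do rewrite big_nil; exact: cvg_cst.
rewrite big_cons; under eq_fun do rewrite big_cons.
by case: (P i) => //; apply: cvgM.
Qed.

Lemma continuous_add (T : topologicalType) (f g : T -> R) : continuous f -> continuous g ->
  continuous (fun t => f t + g t).
Proof. by move=> cf cg t; exact: (cvgD (cf t) (cg t)). Qed.

Lemma continuous_mul (T : topologicalType) (f g : T -> R) : continuous f -> continuous g ->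
  continuous (fun t => f t * g t).
Proof. by move=> cf cg t; exact: (cvgM (cf t) (cg t)). Qed.

Lemma continuous_opp (T : topologicalType) (f : T -> R) : continuous f ->
  continuous (fun t => - f t).
Proof. by move=> cf t; exact: (cvgN (cf t)). Qed.

Lemma continuous_fcomp (T : topologicalType) (f : T -> R) (g : R -> R) : continuous f ->
  continuous g -> continuous (fun t => g (f t)).
Proof. by move=> cf cg t; apply: (@continuous_comp _ _ _ f g); [exact: cf|exact: cg]. Qed.

Lemma continuous_vcomp (T U : topologicalType) (f : T -> U) (g : U -> R) : continuous f ->
  continuous g -> continuous (fun t => g (f t)).
Proof. by move=> cf cg t; apply: (@continuous_comp _ _ _ f g); [exact: cf|exact: cg]. Qed.

Lemma continuous_fsum (T : topologicalType) (I : Type) (r : seq I) (P : pred I) (f : I -> T -> R) :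
  (forall i, continuous (f i)) -> continuous (fun t => \sum_(i <- r | P i) f i t).
Proof. by move=> cf t; apply: cvg_sum => i; exact: cf. Qed.

Lemma continuous_prod (T : topologicalType) (I : Type) (r : seq I) (P : pred I) (f : I -> T -> R) :
  (forall i, continuous (f i)) -> continuous (fun t => \prod_(i <- r | P i) f i t).
Proof. by move=> cf t; apply: cvg_prod => i; exact: cf. Qed.

Lemma continuous_seq (T : topologicalType) (f : T -> R) (u : nat -> T) (x : T) :
  {for x, continuous f} -> u @ \oo --> x -> (fun n => f (u n)) @ \oo --> f x.
Proof. by move=> cf ux; exact: (cvg_comp _ _ ux cf). Qed.

Lemma continuous_rV (T : topologicalType) (k : nat) (u : T -> 'rV[R]_k) :
  (forall j, continuous (fun t => u t 0 j)) -> continuous u.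
Proof. by move=> h t; apply: (@cvg_rV T (nbhs t)) => j; exact: h. Qed.

Definition Wt (q : R) (k : nat) (y : 'rV[R]_k) : R := \prod_(j < k) wt q (y 0 j).

Lemma Wt_gt0 q k (y : 'rV[R]_k) : 0 < Wt q y.
Proof. by apply: prodr_gt0 => j _; exact: wt_gt0. Qed.

Lemma Wt_ge0 q k (y : 'rV[R]_k) : 0 <= Wt q y. Proof. exact: ltW (Wt_gt0 q y). Qed.

Lemma Wt_le1 q k (y : 'rV[R]_k) : 0 <= q -> Wt q y <= 1.
Proof. by move=> q0; apply: prodr_ile1 => j _; rewrite wt_ge0 wt_le1. Qed.

Lemma Wt_vcons q k s (y : 'rV[R]_k) : Wt q (vcons s y) = wt q s * Wt q y.
Proof.
rewrite /Wt big_ord_recl vcons0; congr (_ * _).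
by apply: eq_bigr => j _; rewrite vconsS.
Qed.

Lemma Wt_continuous q k : continuous (@Wt q k).
Proof.
apply: continuous_prod => j; apply: (@continuous_fcomp 'rV[R]_k (fun y => y 0 j) (wt q)).
  exact: coord_continuous.
exact: wt_continuous.
Qed.

Lemma Wt_affine (q c : R) k (v : 'rV[R]_k) : c != 0 -> 0 <= q ->
  exists2 K, 0 < K & forall y, Wt q (c *: y + v) <= K * Wt q y.
Proof.
move=> c0 q0; have h j := wt_affine (v 0 j) c0 q0.
have [K hK] := choice (fun j => let: ex_intro2 K a b := h j in ex_intro (fun K => 0 < K /\ forall s, wt q (c * s + v 0 j) <= K * wt q s) K (conj a b)).
exists (\prod_(j < k) K j); first by apply: prodr_gt0 => j _; have [] := hK j.
move=> y; rewrite /Wt -big_split /=; apply: ler_prod => j _.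
by rewrite wt_ge0 /= !mxE; have [_] := hK j; exact.
Qed.

Definition dom (q C : R) (k : nat) (f : 'rV[R]_k -> R) : Prop :=
  continuous f /\ forall y, `|f y| <= C * Wt q y.

Lemma dom_ge0 q C k (f : 'rV[R]_k -> R) : dom q C f -> 0 <= C.
Proof.
move=> [_ /(_ 0)]; rewrite -(pmulr_lge0 _ (Wt_gt0 q (0 : 'rV[R]_k))).
by apply: le_trans.
Qed.

Lemma dom_le q C C' k (f : 'rV[R]_k -> R) : dom q C f -> C <= C' -> dom q C' f.
Proof.
move=> [cf bf] CC; split=> // y; apply: le_trans (bf y) _.
by rewrite ler_wpM2r// Wt_ge0.
Qed.

Lemma dom_add q C C' k (f g : 'rV[R]_k -> R) : dom q C f -> dom q C' g ->
  dom q (C + C') (fun y => f y + g y).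
Proof.
move=> [cf bf] [cg bg]; split; first exact: continuous_add.
by move=> y; rewrite mulrDl (le_trans (ler_normD _ _))// lerD.
Qed.

Lemma dom_scale q C (c : R) k (f : 'rV[R]_k -> R) : dom q C f ->
  dom q (`|c| * C) (fun y => c * f y).
Proof.
move=> [cf bf]; split; first by apply: continuous_mul => //; exact: cst_continuous.
by move=> y; rewrite normrM -mulrA ler_wpM2l.
Qed.

Lemma dom_mul q C C' k (f g : 'rV[R]_k -> R) : continuous g -> (forall y, `|g y| <= C') ->
  dom q C f -> dom q (C' * C) (fun y => g y * f y).
Proof.
move=> cg bg [cf bf]; split; first exact: continuous_mul.
by move=> y; rewrite normrM -mulrA ler_pM.
Qed.

Lemma dom_affine q C (c : R) k (v : 'rV[R]_k) (f : 'rV[R]_k -> R) : c != 0 -> 0 <= q ->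
  dom q C f -> exists C', dom q C' (fun y => f (c *: y + v)).
Proof.
move=> c0 q0 df; have C0 := dom_ge0 df; have [cf bf] := df.
have [K K0 hK] := Wt_affine v c0 q0; exists (C * K); split.
  apply: (@continuous_vcomp 'rV[R]_k 'rV[R]_k (fun y => c *: y + v) f) => //; apply: continuous_rV => j.
  have -> : (fun t : 'rV[R]_k => (c *: t + v) 0 j) = (fun t => c * t 0 j + v 0 j).
    by apply/funext => t; rewrite !mxE.
  have := @continuous_add 'rV[R]_k (fun t : 'rV[R]_k => c * t 0 j) (fun=> v 0 j); apply.
    apply: continuous_mul; [exact: cst_continuous|exact: coord_continuous].
  exact: cst_continuous.
by move=> y; rewrite (le_trans (bf _))// -mulrA ler_wpM2l.
Qed.

Lemma dom_vcons q C k (f : 'rV[R]_k.+1 -> R) s : dom q C f ->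
  dom q (C * wt q s) (fun y => f (vcons s y)).
Proof.
move=> [cf bf]; split; last by move=> y; rewrite -mulrA -Wt_vcons.
apply: (@continuous_vcomp 'rV[R]_k 'rV[R]_k.+1 (fun y => vcons s y) f) => // y.
by apply: (@cvg_vcons _ (nbhs y) k (fun=> s) id s y); [exact: cvg_cst|exact: cvg_id].
Qed.

Lemma dom_vcons_le q C k (f : 'rV[R]_k.+1 -> R) s : 0 <= q -> dom q C f ->
  dom q C (fun y => f (vcons s y)).
Proof.
move=> q0 df; apply: dom_le (dom_vcons s df) _.
by rewrite ler_piMr ?wt_le1// (dom_ge0 df).
Qed.

End Vectors.

Section IteratedIntegral.
Context {R : realType}.
Local Notation mu := (@lebesgue_measure R).
Local Notation Intg D f := (mu.-integrable (D : set R) (EFin \o (f : R -> R))).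
Local Notation Rint := (@Rintegral _ _ R mu).
Variable q : R.
Hypothesis q12 : 1 / 2 < q.

Let q0 : 0 <= q := wt_gt_half_ge0 q12.
Let Iwt := integrable_wt q12.

Lemma iintR_cons k (f : 'rV[R]_k.+1 -> R) :
  iintR f = Rint [set: R] (fun s => iintR (fun y : 'rV[R]_k => f (vcons s y))).
Proof. by []. Qed.

Let Iscale (C : R) : Intg [set: R] (fun s => C * wt q s).
Proof. exact: integrable_scale. Qed.

Let iintR_core k : (forall C (f : 'rV[R]_k -> R), dom q C f -> `|iintR f| <= C * wt_mass q ^+ k) /\
  (forall C (f_ : nat -> 'rV[R]_k -> R) (f : 'rV[R]_k -> R), (forall n, dom q C (f_ n)) -> dom q C f ->
     (forall y, (fun n => f_ n y) @ \oo --> f y) -> (fun n => iintR (f_ n)) @ \oo --> iintR f).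
Proof.
elim: k => [|k [IHb IHc]].
  split=> [C f [_ bf]|C f_ f _ _ cf]; last exact: cf.
  by rewrite expr0 mulr1 (le_trans (bf 0))// /Wt big_ord0 mulr1.
have slice C (f : 'rV[R]_k.+1 -> R) : dom q C f ->
    continuous (fun s => iintR (fun y : 'rV[R]_k => f (vcons s y))).
  move=> df s; apply: cvg_of_seq => u us; apply: (IHc C).
  - by move=> n; exact: dom_vcons_le.
  - exact: dom_vcons_le.
  - move=> y; have [cf _] := df.
    apply: (@continuous_seq R 'rV[R]_k.+1 f); first exact: cf.
    by apply: cvg_vcons => //; exact: cvg_cst.
have bd C (f : 'rV[R]_k.+1 -> R) s : dom q C f ->
    `|iintR (fun y : 'rV[R]_k => f (vcons s y))| <= C * wt_mass q ^+ k * wt q s.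
  by move=> df; rewrite mulrAC; apply: IHb; exact: dom_vcons.
have Is C (f : 'rV[R]_k.+1 -> R) : dom q C f ->
    Intg [set: R] (fun s => iintR (fun y : 'rV[R]_k => f (vcons s y))).
  move=> df; apply: (integrable_dom measurableT _ _ (Iscale (C * wt_mass q ^+ k))).
    exact: continuous_measurable_fun (slice C f df).
  by move=> s _; exact: bd.
split=> [C f df|C f_ f df_ df cf].
  rewrite iintR_cons exprSr mulrA -RintZ//.
  by apply: le_norm_Rint => //; [exact: Is df|move=> s _; exact: bd].
rewrite iintR_cons.
have -> : (fun n => iintR (f_ n)) = (fun n => Rint [set: R] (fun s => iintR (fun y : 'rV[R]_k => f_ n (vcons s y)))).
  by [].
apply: (@Rint_dct R [set: R] _ _ (fun s => C * wt_mass q ^+ k * wt q s) _ _ _ _ _).2 => //.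
- by move=> n; exact: continuous_measurable_fun (slice C _ (df_ n)).
- by move=> n s _; exact: bd.
- by move=> s _; apply: (IHc C) => //; [by move=> n; exact: dom_vcons_le|exact: dom_vcons_le].
Qed.

Lemma iintR_bound k C (f : 'rV[R]_k -> R) : dom q C f -> `|iintR f| <= C * wt_mass q ^+ k.
Proof. exact: (iintR_core k).1. Qed.

Lemma iintR_dct k C (f_ : nat -> 'rV[R]_k -> R) (f : 'rV[R]_k -> R) :
  (forall n, dom q C (f_ n)) -> dom q C f ->
  (forall y, (fun n => f_ n y) @ \oo --> f y) -> (fun n => iintR (f_ n)) @ \oo --> iintR f.
Proof. exact: (iintR_core k).2. Qed.

Lemma iintR_slice_continuous k C (f : 'rV[R]_k.+1 -> R) : dom q C f ->
  continuous (fun s => iintR (fun y : 'rV[R]_k => f (vcons s y))).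
Proof.
move=> df s; apply: cvg_of_seq => u us; apply: (@iintR_dct k C).
- by move=> n; exact: dom_vcons_le.
- exact: dom_vcons_le.
- move=> y; have [cf _] := df.
  apply: (@continuous_seq R 'rV[R]_k.+1 f); first exact: cf.
  by apply: cvg_vcons => //; exact: cvg_cst.
Qed.

Lemma iintR_slice_bound k C (f : 'rV[R]_k.+1 -> R) s : dom q C f ->
  `|iintR (fun y : 'rV[R]_k => f (vcons s y))| <= C * wt_mass q ^+ k * wt q s.
Proof. by move=> df; rewrite mulrAC; apply: iintR_bound; exact: dom_vcons. Qed.

Lemma iintR_slice_integrable k C (f : 'rV[R]_k.+1 -> R) : dom q C f ->
  Intg [set: R] (fun s => iintR (fun y : 'rV[R]_k => f (vcons s y))).
Proof.
move=> df; apply: (integrable_dom measurableT _ _ (Iscale (C * wt_mass q ^+ k))).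
  exact: continuous_measurable_fun (iintR_slice_continuous df).
by move=> s _; exact: iintR_slice_bound.
Qed.

Lemma iintR_add k C C' (f g : 'rV[R]_k -> R) : dom q C f -> dom q C' g ->
  iintR (fun y => f y + g y) = iintR f + iintR g.
Proof.
elim: k C C' f g => [|k IH] C C' f g df dg //.
rewrite !iintR_cons -RintD//; [|exact: iintR_slice_integrable df|exact: iintR_slice_integrable dg].
apply: Rint_eq => s _; rewrite (IH (C * wt q s) (C' * wt q s))//; exact: dom_vcons.
Qed.

Lemma iintR_scale k C (c : R) (f : 'rV[R]_k -> R) : dom q C f ->
  iintR (fun y => c * f y) = c * iintR f.
Proof.
elim: k C f => [|k IH] C f df //.
rewrite !iintR_cons -RintZ//; last exact: iintR_slice_integrable df.
apply: Rint_eq => s _; rewrite (IH (C * wt q s))//; exact: dom_vcons.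
Qed.

Lemma iintR_sub k C C' (f g : 'rV[R]_k -> R) : dom q C f -> dom q C' g ->
  iintR (fun y => f y - g y) = iintR f - iintR g.
Proof.
move=> df dg; have dg' := dom_scale (-1) dg.
transitivity (iintR (fun y => f y + -1 * g y)); first by congr iintR; apply/funext => y; rewrite mulN1r.
by rewrite (iintR_add df dg') (iintR_scale _ dg) mulN1r.
Qed.

Lemma iintR_opp k (f : 'rV[R]_k -> R) C : dom q C f -> iintR (fun y => - f y) = - iintR f.
Proof.
move=> df; transitivity (iintR (fun y => -1 * f y)); first by congr iintR; apply/funext => y; rewrite mulN1r.
by rewrite (iintR_scale _ df) mulN1r.
Qed.

Lemma dom_sum k (I : Type) (r : seq I) (C : I -> R) (f : I -> 'rV[R]_k -> R) :
  (forall i, dom q (C i) (f i)) -> dom q (\sum_(i <- r) C i) (fun y => \sum_(i <- r) f i y).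
Proof.
move=> df; split; first by apply: continuous_fsum => i; have [] := df i.
move=> y; rewrite mulr_suml; apply: le_trans (ler_norm_sum _ _ _) _.
by apply: ler_sum => i _; have [_] := df i; exact.
Qed.

Lemma iintR_sum k (I : Type) (r : seq I) (C : I -> R) (f : I -> 'rV[R]_k -> R) :
  (forall i, dom q (C i) (f i)) ->
  iintR (fun y => \sum_(i <- r) f i y) = \sum_(i <- r) iintR (f i).
Proof.
move=> df; elim: r => [|i r IH].
  rewrite big_nil; under eq_fun do rewrite big_nil.
  have d0 : dom q 0 (fun _ : 'rV[R]_k => 0 : R).
    by split; [exact: cst_continuous|move=> y; rewrite normr0 mul0r].
  by apply/eqP; rewrite -normr_le0 (le_trans (iintR_bound d0))// mul0r.
by rewrite big_cons -IH; under eq_fun do rewrite big_cons; exact: iintR_add (df i) (dom_sum r df).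
Qed.

Lemma iintR_le k C C' (f g : 'rV[R]_k -> R) : dom q C f -> dom q C' g ->
  (forall y, f y <= g y) -> iintR f <= iintR g.
Proof.
elim: k C C' f g => [|k IH] C C' f g df dg fg; first exact: fg.
rewrite !iintR_cons; apply: Rint_le => //; [exact: iintR_slice_integrable df|exact: iintR_slice_integrable dg|].
by move=> s _; apply: (IH (C * wt q s) (C' * wt q s)) => //; exact: dom_vcons.
Qed.

Lemma iintR_norm_le k C C' (f g : 'rV[R]_k -> R) : dom q C f -> dom q C' g ->
  (forall y, `|f y| <= g y) -> `|iintR f| <= iintR g.
Proof.
move=> df dg fg; rewrite ler_norml -(iintR_opp dg); apply/andP; split.
  have dg' : dom q (`|-1| * C') (fun y => - g y).
    by have := dom_scale (-1) dg; under eq_fun do rewrite mulN1r.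
  by apply: (iintR_le dg' df) => y; have := fg y; rewrite ler_norml => /andP[].
by apply: (iintR_le df dg) => y; exact: le_trans (ler_norm _) (fg y).
Qed.

Lemma iintR_ge0 k C (f : 'rV[R]_k -> R) : dom q C f -> (forall y, 0 <= f y) -> 0 <= iintR f.
Proof.
elim: k C f => [|k IH] C f df f0; first exact: f0.
by rewrite iintR_cons; apply: Rintegral_ge0 => s _; apply: (IH (C * wt q s)) => //; exact: dom_vcons.
Qed.

Lemma Rint_pos (f : R -> R) (s0 : R) : continuous f -> Intg [set: R] f -> (forall s, 0 <= f s) ->
  0 < f s0 -> 0 < Rint [set: R] f.
Proof.
move=> cf If f0 fs.
have fs2 : 0 < f s0 / 2 by rewrite divr_gt0.
have /cvgrPdist_lt/(_ _ fs2)/nbhs_ballP[d /= d0 hd] := cf s0.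
have mA := measurable_itv `[s0, s0 + d / 2].
pose A : set R := `[s0, s0 + d / 2]%classic.
have IA : Intg A (fun=> f s0 / 2).
  have c : {within A, continuous (fun=> f s0 / 2 : R)} by apply: continuous_subspaceT; exact: cst_continuous.
  have := @continuous_compact_integrable R _ A (@segment_compact _ _ _) c; exact.
have IfA : Intg A f by exact: (@integrableS _ _ R mu [set: R] A _ measurableT mA (@subsetT _ _) If).
have d2 : 0 < d / 2 by rewrite divr_gt0.
have le1 : Rint A (fun=> f s0 / 2) <= Rint A f.
  apply: Rint_le => // s; rewrite /A /= in_itv /= => /andP[h1 h2].
  have /hd : ball s0 d s.
    by rewrite /ball /= distrC ger0_norm ?subr_ge0// ltrBlDl (le_lt_trans h2)// ltrD2l; lra.
  by rewrite /= ltr_norml => /andP[]; lra.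
have le2 : Rint A f <= Rint [set: R] f.
  rewrite [Rint A f]Rintegral_mkcond; apply: Rint_le => //.
    have /(@integrable_mkcond _ _ R mu _ _ mA) := IfA; by rewrite restrict_EFin.
  by move=> s _; rewrite patchE; case: ifP.
apply: lt_le_trans (le_trans le1 le2).
have mAE : mu A = (d / 2)%:E.
  by rewrite /A lebesgue_measure_itv /= lte_fin ltrDl d2 -EFinD addrC addKr.
have -> : Rint A (fun=> f s0 / 2) = f s0 / 2 * fine (mu A) by exact: Rintegral_cst.
by rewrite mAE mulr_gt0.
Qed.

Lemma iintR_gt0 k C (f : 'rV[R]_k -> R) y0 : dom q C f -> (forall y, 0 <= f y) -> 0 < f y0 ->
  0 < iintR f.
Proof.
elim: k C f y0 => [|k IH] C f y0 df f0 fy; first by rewrite /= (_ : (0 : 'rV[R]_0) = y0)//; apply/rowP => -[].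
rewrite iintR_cons; apply: (@Rint_pos _ (y0 0 ord0)).
- exact: iintR_slice_continuous df.
- exact: iintR_slice_integrable df.
- by move=> s; apply: (@iintR_ge0 k (C * wt q s)) => //; exact: dom_vcons.
- by apply: (IH (C * wt q (y0 0 ord0)) _ (\row_j y0 0 (lift ord0 j))) => //; [exact: dom_vcons|rewrite -vcons_eta].
Qed.

Lemma iintR_affine k C (c : R) (v : 'rV[R]_k) (f : 'rV[R]_k -> R) : c != 0 -> dom q C f ->
  iintR (fun y => f (c *: y + v)) = `|c| ^- k * iintR f.
Proof.
move=> c0; elim: k C v f => [|k IH] C v f df.
  by rewrite expr0 invr1 mul1r /=; congr f; apply/rowP => -[].
rewrite !iintR_cons (vcons_eta v); set s0 := v 0 ord0; set v' := (\row_j _).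
transitivity (Rint [set: R] (fun s => `|c| ^- k * iintR (fun y : 'rV[R]_k => f (vcons (c * s + s0) y)))).
  apply: Rint_eq => s _; rewrite -(IH (C * wt q (c * s + s0)) v'); last exact: dom_vcons.
  by congr iintR; apply/funext => y; rewrite vconsZ vconsD.
have [I1 E1] := Rint_affine s0 c0 (iintR_slice_integrable df).
by rewrite RintZ// E1 mulrA -invfM -exprSr.
Qed.

Lemma iintR_shift k C (v : 'rV[R]_k) (f : 'rV[R]_k -> R) : dom q C f ->
  iintR (fun y => f (y + v)) = iintR f.
Proof.
move=> df; have := iintR_affine v (oner_neq0 R) df; rewrite normr1 expr1n invr1 mul1r.
by under eq_fun do rewrite scale1r.
Qed.

Lemma iintR_reflect k C (v : 'rV[R]_k) (f : 'rV[R]_k -> R) : dom q C f ->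
  iintR (fun y => f (v - y)) = iintR f.
Proof.
move=> df; have n0 : (-1 : R) != 0 by rewrite oppr_eq0 oner_eq0.
have := iintR_affine v n0 df; rewrite normrN normr1 expr1n invr1 mul1r => <-.
by congr iintR; apply/funext => y; rewrite scaleN1r addrC.
Qed.

Lemma iintR_is_derive k (C C' a e : R) (F dF : R -> 'rV[R]_k -> R) : 0 < e ->
  (forall x, `|x - a| < e -> dom q C (F x)) -> (forall x, `|x - a| < e -> dom q C' (dF x)) ->
  (forall x y, `|x - a| < e -> is_derive x 1 (F ^~ y) (dF x y)) ->
  is_derive a 1 (fun x => iintR (F x)) (iintR (dF a)).
Proof.
elim: k C C' F dF a e => [|k IH] C C' F dF a e e0 dF0 dF1 dd.
  by apply: dd; rewrite subrr normr0.
have sub (x z : R) : `|x - a| < e -> `|z - x| < e - `|x - a| -> `|z - a| < e.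
  move=> h1 h2; have -> : z - a = (z - x) + (x - a) by rewrite addrA subrK.
  by apply: le_lt_trans (ler_normD _ _) _; rewrite -ltrBrDr.
apply: (@Rint_is_derive R [set: R] (fun x s => iintR (fun y : 'rV[R]_k => F x (vcons s y)))
   (fun x s => iintR (fun y : 'rV[R]_k => dF x (vcons s y)))
   (fun s => C' * wt_mass q ^+ k * wt q s) a e _ e0 _ _ _ _).2 => //.
- by move=> x xa; exact: iintR_slice_integrable (dF0 x xa).
- move=> x s xa _; apply: (IH (C * wt q s) (C' * wt q s) (fun x y => F x (vcons s y))
    (fun x y => dF x (vcons s y)) x (e - `|x - a|)).
  + by rewrite subr_gt0.
  + by move=> z zx; apply: dom_vcons; apply: dF0; exact: sub zx.
  + by move=> z zx; apply: dom_vcons; apply: dF1; exact: sub zx.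
  + by move=> z y zx; apply: dd; exact: sub zx.
- by move=> x s xa _; exact: iintR_slice_bound (dF1 x xa).
Qed.

Lemma measurable_iintR d (T : measurableType d) (D : set T) k (F : T -> 'rV[R]_k -> R) :
  measurable D -> (forall y, measurable_fun D (F ^~ y)) ->
  (forall t, D t -> exists C, dom q C (F t)) -> measurable_fun D (fun t => iintR (F t)).
Proof.
move=> mD; elim: k F => [|k IH] F mF dF; first exact: mF.
apply: (@measurable_Rint R _ T D [set: R] (fun t s => iintR (fun y : 'rV[R]_k => F t (vcons s y)))) => //.
- exact: openT.
- move=> s _; apply: IH => [y|t Dt]; first exact: mF.
  by have [C dC] := dF t Dt; exists (C * wt q s); exact: dom_vcons.
- by move=> t s Dt _; have [C dC] := dF t Dt; exact: (iintR_slice_continuous dC).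
Qed.

Lemma dom_Rint (D : set R) k (F : R -> 'rV[R]_k -> R) (a : R -> R) : measurable D ->
  Intg D a -> (forall y, measurable_fun D (F ^~ y)) -> (forall t, D t -> dom q (a t) (F t)) ->
  dom q (Rint D a) (fun y => Rint D (F ^~ y)).
Proof.
move=> mD Ia mF dF; split; last first.
  move=> y; rewrite mulrC -RintZ//; apply: le_norm_Rint => //.
  - apply: (integrable_dom mD (mF y) _ (integrable_scale (Wt q y) mD Ia)).
    by move=> t Dt; rewrite mulrC; have [_] := dF t Dt; exact.
  - exact: integrable_scale.
  - by move=> t Dt; rewrite mulrC; have [_] := dF t Dt; exact.
move=> y; apply: cvg_of_seq => u uy.
apply: (@Rint_dct R D (fun n t => F t (u n)) (F ^~ y) a mD _ _ Ia _).2.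
- by move=> n; exact: mF.
- move=> n t Dt; have [_ b] := dF t Dt; apply: le_trans (b _) _.
  by rewrite ler_piMr ?Wt_le1// (dom_ge0 (dF t Dt)).
- by move=> t Dt; have [c _] := dF t Dt; apply: (@continuous_seq R 'rV[R]_k (F t)) => //; exact: c.
Qed.

Lemma Rint_iintR_swap (D : set R) k (F : R -> 'rV[R]_k -> R) (a : R -> R) : measurable D ->
  Intg D a -> (forall y, measurable_fun D (F ^~ y)) -> (forall t, D t -> dom q (a t) (F t)) ->
  Rint D (fun t => iintR (F t)) = iintR (fun y => Rint D (F ^~ y)).
Proof.
move=> mD; elim: k F a => [|k IH] F a Ia mF dF //.
transitivity (Rint D (fun t => Rint [set: R] (fun s => iintR (fun y : 'rV[R]_k => F t (vcons s y))))).
  by [].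
rewrite (@Rint_swap R D [set: R] _ (fun t => a t * wt_mass q ^+ k) (wt q)) //.
- rewrite iintR_cons; apply: Rint_eq => s _.
  apply: (IH (fun t y => F t (vcons s y)) (fun t => a t * wt q s)).
  + by have := integrable_scale (wt q s) mD Ia; apply: integrable_eq => // t _; rewrite mulrC.
  + by move=> y; exact: mF.
  + by move=> t Dt; apply: dom_vcons; exact: dF.
- exact: openT.
- move=> s _; apply: measurable_iintR => // t Dt.
  by exists (a t * wt q s); apply: dom_vcons; exact: dF.
- by move=> t s Dt _; exact: (iintR_slice_continuous (dF t Dt)).
- by have := integrable_scale (wt_mass q ^+ k) mD Ia; apply: integrable_eq => // t _; rewrite mulrC.
- by move=> t s Dt _; exact: iintR_slice_bound (dF t Dt).
Qed.

Lemma dom_iintR k l (F : 'rV[R]_k -> 'rV[R]_l -> R) C : 0 <= C ->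
  (forall x, dom q (C * Wt q x) (F x)) -> (forall y, dom q (C * Wt q y) (F ^~ y)) ->
  dom q (C * wt_mass q ^+ l) (fun x => iintR (F x)).
Proof.
move=> C0 d1 d2; split; last by move=> x; rewrite mulrAC; exact: iintR_bound.
move=> x; apply: cvg_of_seq => u ux; apply: (@iintR_dct l C).
- by move=> n; apply: dom_le (d1 _) _; rewrite ler_piMr// Wt_le1.
- by apply: dom_le (d1 _) _; rewrite ler_piMr// Wt_le1.
- by move=> y; have [c _] := d2 y; apply: (@continuous_seq R 'rV[R]_k (F ^~ y)) => //; exact: c.
Qed.

Lemma iintR_swap k l (F : 'rV[R]_k -> 'rV[R]_l -> R) C : 0 <= C ->
  (forall x, dom q (C * Wt q x) (F x)) -> (forall y, dom q (C * Wt q y) (F ^~ y)) ->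
  iintR (fun x => iintR (F x)) = iintR (fun y => iintR (F ^~ y)).
Proof.
elim: k F C => [|k IH] F C C0 d1 d2 //.
have d1' s x : dom q (C * wt q s * Wt q x) (F (vcons s x)) by rewrite -mulrA -Wt_vcons.
have d2' s y : dom q (C * wt q s * Wt q y) (fun x => F (vcons s x) y).
  by rewrite mulrAC; apply: (dom_vcons s (d2 y)).
have Cw s : 0 <= C * wt q s by rewrite mulr_ge0// wt_ge0.
rewrite iintR_cons.
transitivity (Rint [set: R] (fun s => iintR (fun y => iintR (fun x : 'rV[R]_k => F (vcons s x) y)))).
  by apply: Rint_eq => s _; apply: (IH (fun x y => F (vcons s x) y) (C * wt q s)) => //.
apply: (@Rint_iintR_swap [set: R] l (fun s y => iintR (fun x : 'rV[R]_k => F (vcons s x) y))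
  (fun s => C * wt_mass q ^+ k * wt q s)) => //.
- by move=> y; exact: continuous_measurable_fun (iintR_slice_continuous (d2 y)).
- move=> s _; rewrite mulrAC.
  exact: (@dom_iintR l k (fun y x => F (vcons s x) y) (C * wt q s) (Cw s) (d2' s) (d1' s)).
Qed.

End IteratedIntegral.

Section Translation.
Context {R : realType}.

Lemma wt_peetre (q e s : R) : 0 <= q -> wt q e * wt q (e - s) <= 2 `^ q * wt q s.
Proof.
move=> q0; rewrite /wt !powRN -invfM.
have b (u : R) : 0 <= 1 + u ^+ 2 := ltW (wt_base_gt0 u).
have h : (1 + s ^+ 2) `^ q <= (2 * ((1 + e ^+ 2) * (1 + (e - s) ^+ 2))) `^ q.
  apply: powR_mono => //; have := sqr_ge0 (2 * e - s); have := sqr_ge0 (e * (e - s)).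
  by nra.
rewrite powRM ?mulr_ge0// in h; rewrite powRM// in h.
rewrite ler_pdivlMr ?powR_gt0 ?wt_base_gt0// mulrC ler_pdivrMr ?mulr_gt0 ?powR_gt0 ?wt_base_gt0//.
Qed.

Lemma Wt_peetre (q : R) k (x y : 'rV[R]_k) : 0 <= q ->
  Wt q x * Wt q (x - y) <= (2 `^ q) ^+ k * Wt q y.
Proof.
move=> q0; rewrite /Wt -big_split -[k in _ ^+ k]card_ord -prodr_const -big_split /=.
apply: ler_prod => j _; rewrite mulr_ge0 ?wt_ge0//= !mxE; exact: wt_peetre.
Qed.

Lemma Wt_opp (q : R) k (x : 'rV[R]_k) : Wt q (- x) = Wt q x.
Proof. by apply: eq_bigr => j _; rewrite mxE /wt sqrrN. Qed.

Lemma dom_reflect (q C : R) k (x : 'rV[R]_k) (f : 'rV[R]_k -> R) : 0 <= q -> dom q C f ->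
  dom q (C * (2 `^ q) ^+ k / Wt q x) (fun y => f (x - y)).
Proof.
move=> q0 df; have C0 := dom_ge0 df; split.
  have n0 : (-1 : R) != 0 by rewrite oppr_eq0 oner_eq0.
  have [C' [c _]] := dom_affine x n0 q0 df.
  suff -> : (fun y => f (x - y)) = (fun y => f (-1 *: y + x)) by exact: c.
  by apply/funext => y; rewrite scaleN1r addrC.
move=> y; apply: le_trans (df.2 _) _; rewrite -!mulrA ler_wpM2l//.
rewrite mulrCA mulrC ler_pdivlMr ?Wt_gt0// mulrC [leRHS]mulrC.
by rewrite [X in _ <= X]mulrC; exact: Wt_peetre.
Qed.

Lemma Wt_line (q s : R) k (j : 'I_k) (y : 'rV[R]_k) : 0 <= q -> `|s| <= 1 ->
  Wt q (y + s *: unitv R j) <= (2 `^ q) ^+ k.+1 * Wt q y.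
Proof.
move=> q0 s1.
have h0 : 2 `^ (- q) <= Wt q (s *: unitv R j).
  rewrite /Wt (bigD1 j)//= big1 ?mulr1; last first.
    by move=> i ij; rewrite !mxE eq_sym (negbTE ij) mulr0 /wt expr0n /= addr0 powR1.
  rewrite !mxE eqxx mulr1 /wt; apply: powR_mono_neg => //; first exact: wt_base_gt0.
  by have := normr_ge0 s; rewrite -(real_normK (num_real s)); nra.
have := Wt_peetre (s *: unitv R j) (- y) q0; rewrite opprK Wt_opp => h.
have : 2 `^ (- q) * Wt q (y + s *: unitv R j) <= (2 `^ q) ^+ k * Wt q y.
  by apply: le_trans h; rewrite [y + _]addrC ler_wpM2r ?Wt_ge0.
by rewrite powRN mulrC ler_pdivrMr ?powR_gt0// exprS mulrC mulrA.
Qed.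

Lemma dom_line (q C : R) k (j : 'I_k) (s : R) (f : 'rV[R]_k -> R) : 0 <= q -> `|s| <= 1 ->
  dom q C f -> dom q (C * (2 `^ q) ^+ k.+1) (fun y => f (y + s *: unitv R j)).
Proof.
move=> q0 s1 df; have C0 := dom_ge0 df; split.
  have [C' [c _]] := dom_affine (s *: unitv R j) (oner_neq0 R) q0 df.
  suff -> : (fun y => f (y + s *: unitv R j)) = (fun y => f (1 *: y + s *: unitv R j)) by exact: c.
  by apply/funext => y; rewrite scale1r.
by move=> y; apply: le_trans (df.2 _) _; rewrite -mulrA ler_wpM2l//; exact: Wt_line.
Qed.

(* The integral of a translate does not depend on the translation. *)
Lemma iintR_partial0 (q C C' : R) k (j : 'I_k) (f f' : 'rV[R]_k -> R) : 1 / 2 < q ->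
  dom q C f -> dom q C' f' ->
  (forall y (s : R), is_derive s 1 (fun s : R => f (y + s *: unitv R j)) (f' (y + s *: unitv R j))) ->
  iintR f' = 0.
Proof.
move=> q12 df df' d; have q0 := wt_gt_half_ge0 q12.
have l1 (x : R) : `|x - 0| < 1 -> `|x| <= 1 by rewrite subr0; exact: ltW.
have h : is_derive (0 : R) 1 (fun s => iintR (fun y => f (y + s *: unitv R j)))
    (iintR (fun y => f' (y + 0 *: unitv R j))).
  apply: (@iintR_is_derive R q q12 k _ _ 0 1 (fun s y => f (y + s *: unitv R j))
    (fun s y => f' (y + s *: unitv R j)) ltr01).
  - by move=> x /l1 x1; exact: dom_line df.
  - by move=> x /l1 x1; exact: dom_line df'.
have h2 : is_derive (0 : R) 1 (fun s => iintR (fun y => f (y + s *: unitv R j))) 0.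
  rewrite (_ : (fun s => _) = (fun=> iintR f)); first exact: is_derive_fcst.
  by apply/funext => s; exact: (iintR_shift q12 _ df).
have [_ e1] := h; have [_ e2] := h2; rewrite e1 in e2; rewrite -e2.
by congr iintR; apply/funext => y; rewrite scale0r addr0.
Qed.

Lemma partial_line k (j : 'I_k) (f : 'rV[R]_k -> R) : (forall x, has_partial j f x) ->
  forall x (s : R), is_derive s 1 (fun s : R => f (x + s *: unitv R j)) (partial j f (x + s *: unitv R j)).
Proof.
move=> hf x s; have d : is_derive (0 : R) 1 (fun t : R => f (x + s *: unitv R j + t *: unitv R j))
    (partial j f (x + s *: unitv R j)).
  by split; [exact: hf|rewrite /partial derive1E].
have e : is_derive s 1 (fun u : R => u - s) 1.
  by apply: (is_derive_eq (is_derive_fsub (is_derive_fid s) (is_derive_fcst s s))); rewrite subr0.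
have d' : is_derive (s - s) 1 (fun t : R => f (x + s *: unitv R j + t *: unitv R j))
    (partial j f (x + s *: unitv R j)) by rewrite subrr.
have := @is_derive_fcomp R _ (fun u => u - s) s _ _ d' e; rewrite mulr1.
suff -> : (fun y : R => f (x + s *: unitv R j + (y - s) *: unitv R j)) =
  (fun s : R => f (x + s *: unitv R j)) by [].
by apply/funext => u; rewrite -addrA -scalerDl subrKC.
Qed.

Lemma partial_eq k (j : 'I_k) (f : 'rV[R]_k -> R) x l :
  is_derive (0 : R) 1 (fun s : R => f (x + s *: unitv R j)) l -> partial j f x = l /\ has_partial j f x.
Proof. by move=> [d e]; split; rewrite /partial ?derive1E. Qed.

Lemma partial_reflect k (j : 'I_k) (f : 'rV[R]_k -> R) : (forall x, has_partial j f x) ->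
  forall x y (s : R), is_derive s 1 (fun s : R => f (x - (y + s *: unitv R j)))
    (- partial j f (x - (y + s *: unitv R j))).
Proof.
move=> hf x y s.
have e : is_derive s 1 (fun u : R => - u) (-1) := is_derive_fopp (is_derive_fid s).
have := @is_derive_fcomp R _ (fun u => - u) s _ _ (partial_line hf (x - y) (- s)) e; rewrite mulrN1.
have E t : x - y + (- t) *: unitv R j = x - (y + t *: unitv R j).
  by rewrite scaleNr opprD addrA.
by rewrite E; under eq_fun do rewrite E.
Qed.

End Translation.

Section Kernel.
Context {R : realType} {m : nat}.
Implicit Types (y x : 'rV[R]_m) (z : R) (o : option 'I_m) (j : 'I_m).

Definition sq y : R := \sum_(j < m) y 0 j ^+ 2.
Definition rr y z : R := sq y + z ^+ 2.
Definition pp : R := m.+1%:R / 2.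
(* [None] is the normal direction, [Some j] the tangential direction [j]. *)
Definition cmp o y z : R := if o is Some j then y 0 j else z.
Definition kk o y z : R := cmp o y z * rr y z `^ (- pp).
Definition dkz o y z : R := (o == None)%:R * rr y z `^ (- pp) +
  cmp o y z * (- pp * rr y z `^ (- pp - 1) * (2 * z)).
Definition dky j o y z : R := (o == Some j)%:R * rr y z `^ (- pp) +
  cmp o y z * (- pp * rr y z `^ (- pp - 1) * (2 * y 0 j)).

Lemma sq_ge0 y : 0 <= sq y. Proof. by apply: sumr_ge0 => j _; exact: sqr_ge0. Qed.

Lemma rr_gt0 y z : 0 < z -> 0 < rr y z.
Proof. by move=> z0; rewrite /rr ltr_wpDl ?sq_ge0// exprn_gt0. Qed.

Lemma pp_gt0 : 0 < pp. Proof. by rewrite /pp divr_gt0// ltr0n. Qed.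

Lemma sq_continuous : continuous sq.
Proof. by apply: continuous_fsum => j; apply: (@continuous_fcomp R 'rV[R]_m (fun y => y 0 j) (fun t => t ^+ 2)); [exact: coord_continuous|exact: exprn_continuous]. Qed.

Lemma rr_continuous z : continuous (rr ^~ z).
Proof. by apply: continuous_add; [exact: sq_continuous|exact: cst_continuous]. Qed.

Lemma rr_powR_continuous z (q : R) : 0 < z -> continuous (fun y => rr y z `^ q).
Proof.
move=> z0 y; apply: (@continuous_comp _ _ _ (rr ^~ z) (fun t => t `^ q)); first exact: rr_continuous.
by apply: (@continuous_powR R id) => //; exact: rr_gt0.
Qed.

Lemma cmp_continuous o z : continuous (fun y => cmp o y z).
Proof. by case: o => [j|]; [exact: coord_continuous|exact: cst_continuous]. Qed.

Lemma kk_continuous o z : 0 < z -> continuous (fun y => kk o y z).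
Proof. by move=> z0; apply: continuous_mul; [exact: cmp_continuous|exact: rr_powR_continuous]. Qed.

Lemma dkz_continuous o z : 0 < z -> continuous (fun y => dkz o y z).
Proof.
move=> z0; apply: continuous_add; apply: continuous_mul.
- exact: cst_continuous.
- exact: rr_powR_continuous.
- exact: cmp_continuous.
- apply: continuous_mul; last exact: cst_continuous.
  by apply: continuous_mul; [exact: cst_continuous|exact: rr_powR_continuous].
Qed.

Lemma dky_continuous j o z : 0 < z -> continuous (fun y => dky j o y z).
Proof.
move=> z0; apply: continuous_add; apply: continuous_mul.
- exact: cst_continuous.
- exact: rr_powR_continuous.
- exact: cmp_continuous.
- apply: continuous_mul.
    by apply: continuous_mul; [exact: cst_continuous|exact: rr_powR_continuous].
  by apply: continuous_mul; [exact: cst_continuous|exact: coord_continuous].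
Qed.

Lemma sq_coord_le j y : y 0 j ^+ 2 <= sq y.
Proof. by rewrite /sq (bigD1 j)//= lerDl; apply: sumr_ge0 => i _; exact: sqr_ge0. Qed.

Lemma cmp_sqr_le o y z : cmp o y z ^+ 2 <= rr y z.
Proof.
rewrite /rr; case: o => [j|] /=; last by rewrite lerDr sq_ge0.
by rewrite (le_trans (sq_coord_le j y))// lerDl sqr_ge0.
Qed.

Lemma cmp_norm_le o y z : `|cmp o y z| <= rr y z `^ (1 / 2).
Proof.
rewrite mul1r powR12_sqrt; last by rewrite /rr addr_ge0 ?sq_ge0 ?sqr_ge0.
by rewrite -(sqrtr_sqr (cmp o y z)) ler_wsqrtr// cmp_sqr_le.
Qed.

Lemma kk_bound o y z : 0 < z -> `|kk o y z| <= rr y z `^ (- (m%:R / 2)).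
Proof.
move=> z0; rewrite normrM (ger0_norm (powR_ge0 _ _)).
apply: le_trans (ler_wpM2r (powR_ge0 _ _) (cmp_norm_le o y z)) _.
rewrite -powRD; last by rewrite (gt_eqF (rr_gt0 y z0)) implybT.
rewrite le_eqVlt; apply/orP; left; apply/eqP; congr (_ `^ _).
by rewrite /pp -natr1; lra.
Qed.

Let cmp2_bound o o' y z : 0 < z -> `|cmp o y z * (- pp * rr y z `^ (- pp - 1) * (2 * cmp o' y z))| <=
  2 * pp * rr y z `^ (- pp).
Proof.
move=> z0; have r0 := rr_gt0 y z0.
rewrite [X in `|X|](_ : _ = - (2 * pp) * (cmp o y z * cmp o' y z) * rr y z `^ (- pp - 1)); last by ring.
rewrite normrM (ger0_norm (powR_ge0 _ _)) normrM normrN (ger0_norm (_ : 0 <= 2 * pp)); last first.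
  by rewrite mulr_ge0// ltW// pp_gt0.
rewrite -mulrA ler_wpM2l ?mulr_ge0 ?(ltW pp_gt0)//.
have -> : rr y z `^ (- pp) = rr y z * rr y z `^ (- pp - 1).
  by rewrite -{2}(powRr1 (ltW r0)) -powRD ?(gt_eqF r0) ?implybT//; congr (_ `^ _); ring.
rewrite ler_wpM2r ?powR_ge0//.
have h1 := cmp_sqr_le o y z; have h2 := cmp_sqr_le o' y z.
by rewrite ler_norml; have := sqr_ge0 (cmp o y z + cmp o' y z); have := sqr_ge0 (cmp o y z - cmp o' y z); nra.
Qed.

Let delta_bound (b : bool) y z : `|b%:R * rr y z `^ (- pp)| <= rr y z `^ (- pp).
Proof. by case: b; rewrite ?mul1r ?mul0r ?normr0 ?(ger0_norm (powR_ge0 _ _))// powR_ge0. Qed.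

Lemma dkz_bound o y z : 0 < z -> `|dkz o y z| <= (1 + 2 * pp) * rr y z `^ (- pp).
Proof.
move=> z0; rewrite mulrDl mul1r; apply: le_trans (ler_normD _ _) _; apply: lerD.
  exact: delta_bound.
exact: (cmp2_bound o None).
Qed.

Lemma dky_bound j o y z : 0 < z -> `|dky j o y z| <= (1 + 2 * pp) * rr y z `^ (- pp).
Proof.
move=> z0; rewrite mulrDl mul1r; apply: le_trans (ler_normD _ _) _; apply: lerD.
  exact: delta_bound.
exact: (cmp2_bound o (Some j)).
Qed.

Lemma rr_powR_le y z d (q : R) : 0 < d -> d <= z -> 0 <= q -> rr y z `^ (- q) <= (d ^+ 2) `^ (- q).
Proof.
move=> d0 dz q0; apply: powR_mono_neg => //; first by rewrite exprn_gt0.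
rewrite /rr (@le_trans _ _ (z ^+ 2))// ?lerDr ?sq_ge0//.
by rewrite lerXn2r// ?nnegrE ltW// (lt_le_trans d0).
Qed.

Lemma sq_line j y (s : R) : sq (y + s *: unitv R j) = sq y + 2 * s * y 0 j + s ^+ 2.
Proof.
rewrite /sq (bigD1 j)//= [\sum_(i < m) y 0 i ^+ 2](bigD1 j)//= !mxE eqxx mulr1.
rewrite (eq_bigr (fun i => y 0 i ^+ 2)); last first.
  by move=> i ij; rewrite !mxE eq_sym (negbTE ij) mulr0 addr0.
by ring.
Qed.

Lemma kk_is_derive_z o y z : 0 < z -> is_derive z 1 (kk o y) (dkz o y z).
Proof.
move=> z0; have r0 := rr_gt0 y z0.
have d1 : is_derive z 1 (rr y) (2 * z).
  have := is_derive_fadd (is_derive_fcst (sq y) z) (is_derive_fsqr (is_derive_fid z)).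
  by move=> h; apply: (is_derive_eq h); ring.
have d2 : is_derive z 1 (cmp o y) (o == None)%:R.
  by case: o => [j|] /=; [exact: is_derive_fcst|exact: is_derive_fid].
by have := is_derive_fmul d2 (is_derive_fpowR (- pp) r0 d1); exact.
Qed.

Lemma kk_is_derive_y j o y z (s : R) : 0 < z ->
  is_derive s 1 (fun s => kk o (y + s *: unitv R j) z) (dky j o (y + s *: unitv R j) z).
Proof.
move=> z0; have r0 := rr_gt0 (y + s *: unitv R j) z0.
have yj : (y + s *: unitv R j) 0 j = y 0 j + s by rewrite !mxE eqxx mulr1.
have d1 : is_derive s 1 (fun s => rr (y + s *: unitv R j) z) (2 * (y + s *: unitv R j) 0 j).
  rewrite /rr; under eq_fun do rewrite sq_line.
  have d3 := is_derive_fmul (is_derive_fscale 2 (is_derive_fid s)) (is_derive_fcst (y 0 j) s).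
  have d4 := is_derive_fadd (is_derive_fcst (sq y) s) d3.
  have d5 := is_derive_fadd d4 (is_derive_fsqr (is_derive_fid s)).
  have d6 := is_derive_fadd d5 (is_derive_fcst (z ^+ 2) s).
  by apply: (is_derive_eq d6); rewrite yj; ring.
have d2 : is_derive s 1 (fun s => cmp o (y + s *: unitv R j) z) (o == Some j)%:R.
  case: o => [i|] /=; last exact: is_derive_fcst.
  under eq_fun do rewrite !mxE.
  have d3 := is_derive_fadd (is_derive_fcst (y 0 i) s) (is_derive_fmul (is_derive_fid s) (is_derive_fcst (j == i)%:R s)).
  by apply: (is_derive_eq d3); rewrite (inj_eq Some_inj) eq_sym; ring.
by have := is_derive_fmul d2 (@is_derive_fpowR R (fun s => rr (y + s *: unitv R j) z) (- pp) s _ r0 d1); exact.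
Qed.

Lemma dkz_tangential j y z : dkz (Some j) y z = dky j None y z.
Proof. by rewrite /dkz /dky /= !mul0r; ring. Qed.

Lemma dkz_normal y z : 0 < z -> dkz None y z = - \sum_(j < m) dky j (Some j) y z.
Proof.
move=> z0; have r0 := rr_gt0 y z0; rewrite /dkz /dky /=.
under eq_bigr do rewrite eqxx mul1r.
rewrite big_split /= sumr_const card_ord.
have -> : \sum_(j < m) y 0 j * (- pp * rr y z `^ (- pp - 1) * (2 * y 0 j)) =
    - pp * rr y z `^ (- pp - 1) * 2 * sq y.
  by rewrite /sq mulr_sumr; apply: eq_bigr => j _; ring.
have -> : rr y z `^ (- pp) = rr y z * rr y z `^ (- pp - 1).
  by rewrite -{2}(powRr1 (ltW r0)) -powRD ?(gt_eqF r0) ?implybT//; congr (_ `^ _); ring.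
rewrite /= /pp -[_ *+ m]mulr_natl -natr1; set r := _ `^ _; by rewrite /rr; field.
Qed.

End Kernel.

Section Potentials.
Context {R : realType} {m : nat}.
Hypothesis m0 : (0 < m)%N.
Implicit Types (y x : 'rV[R]_m) (z : R) (o : option 'I_m) (j : 'I_m) (f : 'rV[R]_m -> R).

Definition qK : R := m.+1%:R.

Lemma qK_ge1 : 1 <= qK. Proof. by rewrite /qK ler1n. Qed.
Lemma qK_half : 1 / 2 < qK. Proof. by have := qK_ge1; lra. Qed.
Lemma qK_ge0 : 0 <= qK. Proof. by have := qK_ge1; lra. Qed.

Definition G o f x z : R := iintR (fun y => kk o y z * f (x - y)).
Definition Dz o f x z : R :=
  if o is Some j then G None (partial j f) x z else - \sum_(j < m) G (Some j) (partial j f) x z.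

Fixpoint Cd (k : nat) (C : R) f : Prop := dom qK C f /\
  if k is k'.+1 then forall j, (forall x, has_partial j f x) /\ Cd k' C (partial j f) else True.

Lemma Cd_dom k C f : Cd k C f -> dom qK C f. Proof. by case: k => [|k] []. Qed.

Lemma Cd_pred k C f : Cd k.+1 C f -> Cd k C f.
Proof.
elim: k f => [|k IH] f [d h]; split => // j; have [h1 h2] := h j; split => //.
exact: IH h2.
Qed.

Lemma Cd_partial k C f j : Cd k.+1 C f -> Cd k C (partial j f).
Proof. by move=> [_ h]; have [] := h j. Qed.

Lemma Cd_has k C f j : Cd k.+1 C f -> forall x, has_partial j f x.
Proof. by move=> [_ h]; have [] := h j. Qed.

Lemma Cd_ge0 k C f : Cd k C f -> 0 <= C. Proof. by move/Cd_dom/dom_ge0. Qed.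

Definition kb (d : R) : R := (d ^+ 2) `^ (- (m%:R / 2)) + (1 + 2 * @pp R m) * (d ^+ 2) `^ (- @pp R m).

Let pp0 : 0 <= @pp R m := ltW pp_gt0.
Let p12 : 0 <= 1 + 2 * @pp R m. Proof. by rewrite addr_ge0// mulr_ge0. Qed.

Lemma kk_kb o y z d : 0 < d -> d <= z -> `|kk o y z| <= kb d.
Proof.
move=> d0 dz; have z0 := lt_le_trans d0 dz.
apply: le_trans (kk_bound o y z0) _; rewrite /kb ler_wpDr ?mulr_ge0 ?powR_ge0//.
by apply: rr_powR_le => //; rewrite divr_ge0.
Qed.

Lemma dkz_kb o y z d : 0 < d -> d <= z -> `|dkz o y z| <= kb d.
Proof.
move=> d0 dz; have z0 := lt_le_trans d0 dz.
apply: le_trans (dkz_bound o y z0) _; rewrite /kb ler_wpDl ?powR_ge0// ler_wpM2l//.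
exact: rr_powR_le.
Qed.

Lemma dky_kb j o y z d : 0 < d -> d <= z -> `|dky j o y z| <= kb d.
Proof.
move=> d0 dz; have z0 := lt_le_trans d0 dz.
apply: le_trans (dky_bound j o y z0) _; rewrite /kb ler_wpDl ?powR_ge0// ler_wpM2l//.
exact: rr_powR_le.
Qed.

Definition Px x : R := (2 `^ qK) ^+ m / Wt qK x.

Lemma dom_refl C f x : dom qK C f -> dom qK (C * Px x) (fun y => f (x - y)).
Proof. by move=> df; have := dom_reflect x qK_ge0 df; rewrite -mulrA. Qed.

Lemma G_dom o f C x z d : 0 < d -> d <= z -> dom qK C f ->
  dom qK (kb d * (C * Px x)) (fun y => kk o y z * f (x - y)).
Proof.
move=> d0 dz df; apply: dom_mul; [|by move=> y; exact: kk_kb|exact: dom_refl].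
exact: kk_continuous (lt_le_trans d0 dz).
Qed.

Lemma G_dom_dkz o f C x z d : 0 < d -> d <= z -> dom qK C f ->
  dom qK (kb d * (C * Px x)) (fun y => dkz o y z * f (x - y)).
Proof.
move=> d0 dz df; apply: dom_mul; [|by move=> y; exact: dkz_kb|exact: dom_refl].
exact: dkz_continuous (lt_le_trans d0 dz).
Qed.

Lemma G_dom_dky j o f C x z d : 0 < d -> d <= z -> dom qK C f ->
  dom qK (kb d * (C * Px x)) (fun y => dky j o y z * f (x - y)).
Proof.
move=> d0 dz df; apply: dom_mul; [|by move=> y; exact: dky_kb|exact: dom_refl].
exact: dky_continuous (lt_le_trans d0 dz).
Qed.

Lemma G_partial j o f C x z : 0 < z -> Cd 1 C f ->
  partial j (G o f ^~ z) x = G o (partial j f) x z /\ has_partial j (G o f ^~ z) x.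
Proof.
move=> z0 cf; apply: partial_eq.
have df := Cd_dom cf; have dpf := Cd_dom (Cd_partial j cf).
have l1 (s : R) : `|s - 0| < 1 -> `|- s| <= 1 by rewrite subr0 normrN; exact: ltW.
have E (h : 'rV[R]_m -> R) (s : R) y : h (x - (y + (- s) *: unitv R j)) = h (x + s *: unitv R j - y).
  by rewrite scaleNr opprB addrA.
have D (h : 'rV[R]_m -> R) (s : R) : `|s - 0| < 1 -> dom qK C h ->
    dom qK (kb z * (C * Px x * (2 `^ qK) ^+ m.+1)) (fun y => kk o y z * h (x + s *: unitv R j - y)).
  move=> /l1 s1 dh; apply: dom_mul; [exact: kk_continuous|by move=> y; exact: kk_kb|].
  have := dom_line j qK_ge0 s1 (dom_refl x dh).
  by under eq_fun do rewrite E.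
have h := @iintR_is_derive R qK qK_half m _ _ 0 1
  (fun s y => kk o y z * f (x + s *: unitv R j - y))
  (fun s y => kk o y z * partial j f (x + s *: unitv R j - y)) ltr01
  (fun s s1 => D f s s1 df) (fun s s1 => D _ s s1 dpf).
have {}h := h _; rewrite scale0r addr0 in h; apply: h => s y s1.
apply: is_derive_fscale.
have := partial_line (@Cd_has _ _ _ j cf) (x - y) s.
have E2 (t : R) : x - y + t *: unitv R j = x + t *: unitv R j - y by rewrite addrAC.
by rewrite E2; under eq_fun do rewrite E2.
Qed.

Lemma G_ibp j o f C x z : 0 < z -> Cd 1 C f ->
  iintR (fun y => dky j o y z * f (x - y)) = G o (partial j f) x z.
Proof.
move=> z0 cf; have df := Cd_dom cf; have dpf := Cd_dom (Cd_partial j cf).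
have d1 := G_dom_dky j o x z0 (lexx z) df.
have d2 := G_dom o x z0 (lexx z) dpf.
have d0 := G_dom o x z0 (lexx z) df.
apply/eqP; rewrite -subr_eq0 -(iintR_sub qK_half d1 d2); apply/eqP.
have d2' : dom qK (`|-1| * (kb z * (C * Px x))) (fun y => - (kk o y z * partial j f (x - y))).
  by have := dom_scale (-1) d2; under eq_fun do rewrite mulN1r.
apply: (iintR_partial0 (j := j) qK_half d0 (dom_add d1 d2')) => y s.
have := is_derive_fmul (kk_is_derive_y j o y s z0) (partial_reflect (@Cd_has _ _ _ j cf) x y s).
by rewrite mulrN.
Qed.

Lemma G_is_derive o f C x z : 0 < z -> Cd 1 C f -> is_derive z 1 (G o f x) (Dz o f x z).
Proof.
move=> z0 cf; have df := Cd_dom cf.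
have z2 : 0 < z / 2 by rewrite divr_gt0.
have zz (t : R) : `|t - z| < z / 2 -> z / 2 <= t.
  by rewrite ltr_norml => /andP[h _]; lra.
have h : is_derive z 1 (G o f x) (iintR (fun y => dkz o y z * f (x - y))).
  apply: (@iintR_is_derive R qK qK_half m _ _ z (z / 2)
    (fun t y => kk o y t * f (x - y)) (fun t y => dkz o y t * f (x - y)) z2
    (fun t tz => G_dom o x z2 (zz t tz) df) (fun t tz => G_dom_dkz o x z2 (zz t tz) df)).
  move=> t y /zz tz; have t0 := lt_le_trans z2 tz.
  have := is_derive_fmul (kk_is_derive_z o y t0) (is_derive_fcst (f (x - y)) t).
  by rewrite mulr0 addr0.
apply: (is_derive_eq h); case: o {h} => [j|] /=.
  by rewrite -(G_ibp j None x z0 cf); congr iintR; apply/funext => y; rewrite dkz_tangential.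
transitivity (iintR (fun y => - \sum_(j < m) (dky j (Some j) y z * f (x - y)))).
  by congr iintR; apply/funext => y; rewrite dkz_normal// mulNr mulr_suml.
have ds j := G_dom_dky j (Some j) x z0 (lexx z) df.
rewrite (iintR_opp qK_half (dom_sum _ ds)) (iintR_sum qK_half _ ds).
by congr (- _); apply: eq_bigr => j _; rewrite (G_ibp j (Some j) x z0 cf).
Qed.

Lemma G_lin o f g (a b : R) C C' x z : 0 < z -> dom qK C f -> dom qK C' g ->
  G o (fun y => a * f y + b * g y) x z = a * G o f x z + b * G o g x z.
Proof.
move=> z0 df dg; have d1 := G_dom o x z0 (lexx z) df; have d2 := G_dom o x z0 (lexx z) dg.
rewrite /G -(iintR_scale qK_half a d1) -(iintR_scale qK_half b d2).
rewrite -(iintR_add qK_half (dom_scale a d1) (dom_scale b d2)).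
by congr iintR; apply/funext => y; ring.
Qed.

Definition dec x z : R := (1 + rr x z) `^ (- (m%:R / 2)).

Lemma rr_ge0 x z : 0 <= rr x z. Proof. by rewrite addr_ge0 ?sq_ge0 ?sqr_ge0. Qed.
Lemma br_gt0 x z : 0 < 1 + rr x z. Proof. by rewrite ltr_pwDl ?rr_ge0. Qed.
Lemma dec_gt0 x z : 0 < dec x z. Proof. by rewrite powR_gt0// br_gt0. Qed.

Let m2 : 0 <= m%:R / 2 :> R. Proof. by rewrite divr_ge0. Qed.

Lemma dec_mono x z z' : 0 <= z -> z <= z' -> dec x z' <= dec x z.
Proof.
move=> z0 zz; apply: powR_mono_neg => //; first exact: br_gt0.
by rewrite /rr !lerD2l lerXn2r// nnegrE (le_trans z0).
Qed.

Let ct : R := 4 `^ (m%:R / 2).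

Lemma powR_add_le (u v p : R) : 0 <= u -> 0 <= v -> 0 <= p -> (u + v) `^ p <= 2 `^ p * (u `^ p + v `^ p).
Proof.
move=> u0 v0 p0; wlog uv : u v u0 v0 / u <= v.
  by move=> H; have [/H|/ltW/H] := leP u v; [|rewrite addrC [v `^ p + _]addrC]; apply.
apply: (@le_trans _ _ ((2 * v) `^ p)).
  by apply: powR_mono => //; [rewrite addr_ge0|lra].
by rewrite powRM// ler_wpM2l ?powR_ge0// lerDr powR_ge0.
Qed.

Lemma br_split x y z : (1 + rr x z) `^ (m%:R / 2) <=
  ct * (rr y z `^ (m%:R / 2) + (1 + sq (x - y)) `^ (m%:R / 2)).
Proof.
have s0 := sq_ge0 (x - y).
have h : 1 + rr x z <= 2 * (rr y z + (1 + sq (x - y))).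
  have : sq x <= 2 * sq y + 2 * sq (x - y).
    rewrite /sq !mulr_sumr -big_split /=; apply: ler_sum => j _; rewrite !mxE.
    by have := sqr_ge0 (x 0 j - 2 * y 0 j); nra.
  by rewrite /rr; have := sqr_ge0 z; lra.
have p0 : 0 <= rr y z + (1 + sq (x - y)) by rewrite addr_ge0 ?rr_ge0// addr_ge0.
apply: (@le_trans _ _ ((2 * (rr y z + (1 + sq (x - y)))) `^ (m%:R / 2))).
  by apply: powR_mono => //; exact: ltW (br_gt0 _ _).
rewrite powRM// /ct (_ : 4 = 2 * 2); last by lra.
rewrite powRM// -mulrA ler_wpM2l ?powR_ge0// powR_add_le ?rr_ge0// addr_ge0//.
Qed.

Lemma prod_base_ge (r : seq 'I_m) y :
  1 <= \prod_(j <- r) (1 + y 0 j ^+ 2) /\ 1 + \sum_(j <- r) y 0 j ^+ 2 <= \prod_(j <- r) (1 + y 0 j ^+ 2).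
Proof.
elim: r => [|j r [h1 h2]]; first by rewrite !big_nil addr0.
rewrite !big_cons; set p := \prod_(j <- r) _ in h1 h2 *; have := sqr_ge0 (y 0 j).
set u := y 0 j ^+ 2; set v := \sum_(j <- r) _ in h2 *; split; nra.
Qed.

Lemma powR_bigprod (p : R) (a : 'I_m -> R) : (forall j, 0 <= a j) ->
  \prod_(j < m) a j `^ p = (\prod_(j < m) a j) `^ p.
Proof.
move=> a0; apply: (@proj2 (0 <= \prod_(j < m) a j)).
elim/big_rec2: _ => [|j u v _ [v0 ->]]; first by rewrite powR1.
by rewrite powRM// mulr_ge0.
Qed.

Lemma sq_wt_le (p q : R) y : 0 <= p -> (1 + sq y) `^ p * Wt q y <= Wt (q - p) y.
Proof.
move=> p0; have Wp : Wt (q - p) y = (\prod_(j < m) (1 + y 0 j ^+ 2)) `^ p * Wt q y.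
  rewrite /Wt -powR_bigprod; last by move=> j; exact: ltW (wt_base_gt0 _).
  rewrite -big_split /=; apply: eq_bigr => j _; rewrite /wt -powRD; last first.
    by rewrite (gt_eqF (wt_base_gt0 _)) implybT.
  by congr (_ `^ _); ring.
rewrite Wp ler_wpM2r ?Wt_ge0//; apply: powR_mono => //; first by rewrite addr_ge0// sq_ge0.
by have [] := prod_base_ge (index_enum _) y.
Qed.

Lemma Wt_anti (q q' : R) y : q <= q' -> Wt q' y <= Wt q y.
Proof.
move=> qq; apply: ler_prod => j _; rewrite wt_ge0 /wt /=.
by apply: ler_powR; [exact: wt_base|rewrite lerN2].
Qed.

Lemma dom_anti (q q' C : R) f : q <= q' -> dom q' C f -> dom q C f.
Proof.
move=> qq df; have C0 := dom_ge0 df; have [c b] := df; split=> // y.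
by apply: le_trans (b y) _; rewrite ler_wpM2l// Wt_anti.
Qed.

Definition qm : R := @pp R m / m%:R.

Lemma qm_half : 1 / 2 < qm.
Proof.
have mm : 0 < m%:R :> R by rewrite ltr0n.
by rewrite /qm /pp ltr_pdivlMr// -[m.+1%:R]natr1; lra.
Qed.

Lemma qm_le : qm <= qK.
Proof.
have mm : 1 <= m%:R :> R by rewrite ler1n.
have mm0 : 0 < m%:R :> R by rewrite ltr0n.
by rewrite /qm /qK /pp ler_pdivrMr// -[m.+1%:R]natr1; nra.
Qed.

Lemma normal_dom1 : dom qm 1 (fun y => kk None y 1).
Proof.
split; first exact: kk_continuous.
move=> y; rewrite mul1r /kk /= mul1r ger0_norm ?powR_ge0//.
have mm : 0 < m%:R :> R by rewrite ltr0n.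
have q0 : 0 <= qm by have := qm_half; lra.
have s1 : 1 <= rr y 1 by rewrite /rr expr1n lerDr sq_ge0.
have -> : - @pp R m = - qm * m%:R by rewrite /qm mulNr divfK// gt_eqF.
rewrite powRrM powR_mulrn ?powR_ge0// /Wt -[m in _ ^+ m]card_ord -prodr_const.
apply: ler_prod => j _; rewrite powR_ge0 /= /wt; apply: powR_mono_neg => //; first exact: wt_base_gt0.
by rewrite /rr expr1n addrC lerD2r sq_coord_le.
Qed.

Lemma normal_scaling y z : 0 < z -> kk None y z = z ^- m * kk None (z^-1 *: y + 0) 1.
Proof.
move=> z0; rewrite addr0 /kk /= mul1r.
have -> : rr y z = z ^+ 2 * rr (z^-1 *: y) 1.
  rewrite /rr /sq expr1n mulrDr mulr1 mulr_sumr; congr (_ + _); apply: eq_bigr => j _.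
  by rewrite mxE exprMn mulrA -exprMn mulfV ?gt_eqF// expr1n mul1r.
rewrite powRM ?sqr_ge0//; last by rewrite rr_ge0.
have -> : (z ^+ 2) `^ (- @pp R m) = z ^- m * z^-1.
  rewrite -powR_mulrn ?(ltW z0)// -powRrM /pp.
  rewrite (_ : 2%:R * _ = - m.+1%:R); last by field.
  by rewrite powRN powR_mulrn ?(ltW z0)// exprSr invfM.
by rewrite mulrA mulrCA mulfV ?gt_eqF// mulr1.
Qed.

Lemma normal_dom z : 0 < z -> exists C, dom qm C (fun y => kk None y z).
Proof.
move=> z0; have q0 : 0 <= qm by have := qm_half; lra.
have zi : z^-1 != 0 by rewrite invr_eq0 gt_eqF.
have [C hC] := dom_affine 0 zi q0 normal_dom1.
exists (`|z ^- m| * C); have := dom_scale (z ^- m) hC.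
by under eq_fun do rewrite -normal_scaling//.
Qed.

Definition mass : R := iintR (fun y => kk None y 1).

(* Scaling shows that the Poisson kernel has the same mass at every height. *)
Lemma normal_mass z : 0 < z -> iintR (fun y => kk None y z) = mass.
Proof.
move=> z0; have q0 : 0 <= qm by have := qm_half; lra.
have zi : z^-1 != 0 by rewrite invr_eq0 gt_eqF.
have [C hC] := dom_affine 0 zi q0 normal_dom1.
transitivity (iintR (fun y => z ^- m * kk None (z^-1 *: y + 0) 1)).
  by congr iintR; apply/funext => y; rewrite normal_scaling.
rewrite (iintR_scale qm_half _ hC) (iintR_affine qm_half 0 zi normal_dom1).
rewrite gtr0_norm ?invr_gt0// exprVn invrK mulrA mulVf ?mul1r//.
by rewrite expf_neq0// gt_eqF.
Qed.

Lemma normal_ge0 y z : 0 < z -> 0 <= kk None y z.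
Proof. by move=> z0; rewrite mulr_ge0 ?powR_ge0//= ltW. Qed.

Lemma mass_ge0 : 0 <= mass.
Proof. exact: (@iintR_ge0 R qm m 1 _ normal_dom1 (fun y => normal_ge0 y ltr01)). Qed.

Lemma kk_rr_le o y z : 0 < z -> `|kk o y z| * rr y z `^ (m%:R / 2) <= 1.
Proof.
move=> z0; have r0 := rr_gt0 y z0.
apply: le_trans (ler_wpM2r (powR_ge0 _ _) (kk_bound o y z0)) _.
by rewrite -powRD ?addNr ?powRr0// (gt_eqF r0) implybT.
Qed.

Lemma dec_mul x z (u M : R) : (1 + rr x z) `^ (m%:R / 2) * u <= M -> u <= M * dec x z.
Proof.
by move=> h; rewrite /dec powRN ler_pdivlMr ?powR_gt0 ?br_gt0// mulrC.
Qed.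

Lemma G_normal_bound f C x z (L S : R) : 0 < z -> dom qK C f ->
  iintR (fun y => `|f y|) <= L -> (forall y, (1 + sq y) `^ (m%:R / 2) * `|f y| <= S) ->
  `|G None f x z| <= ct * (L + S * mass) * dec x z.
Proof.
move=> z0 df fL fS; apply: dec_mul.
have [Ck dk] := normal_dom z0.
have da : dom qK C (fun y => `|f y|).
  split; first by apply: (@continuous_fcomp R _ f (fun t => `|t|)); [exact: df.1|exact: norm_continuous].
  by move=> y; rewrite normr_id; exact: df.2.
have dr := dom_anti qm_le (dom_refl x da).
have ct0 : 0 <= ct by exact: powR_ge0.
have dG := dom_anti qm_le (G_dom None x z0 (lexx z) df).
set b := (1 + rr x z) `^ (m%:R / 2); have b0 : 0 <= b by exact: powR_ge0.
rewrite -[b in b * _](ger0_norm b0) -normrM -(iintR_scale qm_half b dG).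
have dR := dom_scale ct (dom_add dr (dom_scale S dk)).
apply: le_trans (iintR_norm_le qm_half (dom_scale b dG) dR _) _.
  move=> y; rewrite normrM (ger0_norm b0) normrM.
  have h := br_split x y z; rewrite -/b in h.
  apply: (@le_trans _ _ (ct * (rr y z `^ (m%:R / 2) + (1 + sq (x - y)) `^ (m%:R / 2)) * (`|kk None y z| * `|f (x - y)|))).
    by rewrite ler_wpM2r// mulr_ge0.
  rewrite -mulrA ler_wpM2l// mulrDl; apply: lerD.
    by rewrite mulrA ler_piMl// mulrC; exact: kk_rr_le.
  rewrite mulrCA [leRHS]mulrC (ger0_norm (normal_ge0 y z0)) ler_wpM2l ?normal_ge0//.
rewrite (iintR_scale qm_half _ (dom_add dr (dom_scale S dk))) ler_wpM2l//.
rewrite (iintR_add qm_half dr (dom_scale S dk)) (iintR_scale qm_half _ dk) normal_mass// lerD2r.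
by have -> := iintR_reflect qK_half x da.
Qed.

Definition nA : R := ct * (wt_mass qK ^+ m + mass).

Lemma G_normal_dec f C x z : 0 < z -> dom qK C f -> `|G None f x z| <= nA * C * dec x z.
Proof.
move=> z0 df; have C0 := dom_ge0 df.
have -> : nA * C = ct * (C * wt_mass qK ^+ m + C * mass) by rewrite /nA; ring.
apply: (@G_normal_bound f C x z (C * wt_mass qK ^+ m) C z0 df) => [|y].
  have da : dom qK C (fun y => `|f y|).
    split; first by apply: (@continuous_fcomp R _ f (fun t => `|t|)); [exact: df.1|exact: norm_continuous].
    by move=> y; rewrite normr_id; exact: df.2.
  exact: le_trans (ler_norm _) (iintR_bound qK_half da).
apply: (@le_trans _ _ ((1 + sq y) `^ (m%:R / 2) * (C * Wt qK y))).
  by rewrite ler_wpM2l ?powR_ge0//; exact: df.2.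
rewrite mulrCA ler_piMr//; apply: le_trans (sq_wt_le qK y m2) _.
by apply: Wt_le1; rewrite /qK -[m.+1%:R]natr1; have : 0 <= m%:R :> R by []; lra.
Qed.

Definition q1 : R := qK - m%:R / 2.

Lemma q1_half : 1 / 2 < q1.
Proof. by rewrite /q1 /qK -[m.+1%:R]natr1; have : 0 <= m%:R :> R by []; lra. Qed.

Definition tA : R := ct * 2 * wt_mass q1 ^+ m.

Lemma G_far_dec o f C x z : 1 <= z -> dom qK C f -> `|G o f x z| <= tA * C * dec x z.
Proof.
move=> z1 df; have z0 := lt_le_trans ltr01 z1; have C0 := dom_ge0 df; apply: dec_mul.
have q1K : q1 <= qK by rewrite /q1 gerBl.
have q10 : 0 <= q1 by have := q1_half; lra.
have ct0 : 0 <= ct by exact: powR_ge0.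
have dG := dom_anti q1K (G_dom o x z0 (lexx z) df).
set b := (1 + rr x z) `^ (m%:R / 2); have b0 : 0 <= b by exact: powR_ge0.
rewrite -[b in b * _](ger0_norm b0) -normrM -(iintR_scale q1_half b dG).
have dW : dom q1 1 (@Wt R q1 m).
  split; first exact: Wt_continuous.
  by move=> y; rewrite mul1r ger0_norm ?Wt_ge0.
have dR := dom_scale (ct * 2 * C) (dom_reflect x q10 dW).
apply: le_trans (iintR_norm_le q1_half (dom_scale b dG) dR _) _.
  move=> y; rewrite normrM (ger0_norm b0) normrM.
  have h := br_split x y z; rewrite -/b in h.
  apply: (@le_trans _ _ (ct * (rr y z `^ (m%:R / 2) + (1 + sq (x - y)) `^ (m%:R / 2)) * (`|kk o y z| * `|f (x - y)|))).
    by rewrite ler_wpM2r// mulr_ge0.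
  have -> : ct * 2 * C * Wt q1 (x - y) = ct * (C * Wt q1 (x - y) + C * Wt q1 (x - y)) by ring.
  rewrite -[leLHS]mulrA ler_wpM2l// mulrDl; apply: lerD.
    rewrite mulrA; apply: (@le_trans _ _ (`|f (x - y)|)); first by rewrite ler_piMl// mulrC; exact: kk_rr_le.
    by apply: le_trans (df.2 _) _; rewrite ler_wpM2l//; exact: Wt_anti.
  have k1 : `|kk o y z| <= 1.
    apply: le_trans (kk_bound o y z0) _; rewrite powRN invf_le1 ?powR_gt0 ?rr_gt0//.
    have := @powR_mono R (m%:R / 2) 1 (rr y z) ler01; rewrite powR1; apply => //.
    rewrite /rr; have := sq_ge0 y; have : 1 <= z ^+ 2 by rewrite expr_ge1// ltW.
    lra.
  apply: (@le_trans _ _ ((1 + sq (x - y)) `^ (m%:R / 2) * (C * Wt qK (x - y)))).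
    rewrite ler_wpM2l ?powR_ge0//; apply: le_trans (df.2 _).
    by rewrite ler_piMl.
  by rewrite mulrCA ler_wpM2l//; exact: sq_wt_le.
rewrite (iintR_scale q1_half _ (dom_reflect x q10 dW)) (iintR_reflect q1_half x dW).
rewrite /tA -!mulrA ler_wpM2l// ler_wpM2l// mulrC ler_wpM2r//.
by apply: le_trans (ler_norm _) _; have := iintR_bound q1_half dW; rewrite mul1r.
Qed.

Definition gA : R := tA + nA.

Lemma nA_ge0 : 0 <= nA.
Proof. by rewrite mulr_ge0 ?powR_ge0// addr_ge0 ?mass_ge0// exprn_ge0// wt_mass_ge0. Qed.

Lemma tA_ge0 : 0 <= tA.
Proof. by rewrite !mulr_ge0 ?powR_ge0// exprn_ge0// wt_mass_ge0. Qed.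

(* Below height one the tangential potential is controlled through its normal
   derivative, which is a normal potential. *)
Lemma G_dec o f C x z : 0 < z -> Cd 1 C f -> `|G o f x z| <= gA * C * dec x z.
Proof.
move=> z0 cf; have df := Cd_dom cf; have C0 := dom_ge0 df.
have [[d0 n0] t0] := (ltW (dec_gt0 x z), nA_ge0, tA_ge0).
have [z1|z1] := leP 1 z.
  apply: le_trans (G_far_dec o x z1 df) _.
  by rewrite ler_wpM2r// ler_wpM2r// /gA lerDl.
case: o => [j|]; last first.
  apply: le_trans (G_normal_dec x z0 df) _.
  by rewrite ler_wpM2r// ler_wpM2r// /gA lerDr.
have d1 : dec x 1 <= dec x z by apply: dec_mono; exact: ltW.
have h1 := G_far_dec (Some j) x (lexx 1) df.
have h2 : `|G (Some j) f x 1 - G (Some j) f x z| <= nA * C * dec x z * (1 - z).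
  apply: (@mvt_le R (G (Some j) f x) (Dz (Some j) f x) z 1); first exact: ltW.
    by move=> t /andP[zt _]; apply: G_is_derive cf; exact: lt_le_trans zt.
  move=> t /andP[zt _] /=; have tt0 := lt_le_trans z0 zt.
  apply: le_trans (G_normal_dec x tt0 (Cd_dom (Cd_partial j cf))) _.
  apply: (ler_wpM2l (mulr_ge0 n0 C0)); exact: (dec_mono x (ltW z0) zt).
have h3 : nA * C * dec x z * (1 - z) <= nA * C * dec x z.
  by have p := mulr_ge0 (mulr_ge0 n0 C0) d0; rewrite ler_piMr//; lra.
have h4 : tA * C * dec x 1 <= tA * C * dec x z by rewrite ler_wpM2l// mulr_ge0.
rewrite -[G _ f x z](subKr (G (Some j) f x 1)) /gA 2!mulrDl.
apply: le_trans (ler_normB _ _) _; lra.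
Qed.

Lemma Dz_dec o f C x z : 0 < z -> Cd 2 C f -> `|Dz o f x z| <= m%:R * gA * C * dec x z.
Proof.
move=> z0 cf; have C0 := Cd_ge0 cf.
have g0 : 0 <= gA by rewrite addr_ge0 ?tA_ge0 ?nA_ge0.
have mm : 1 <= m%:R :> R by rewrite ler1n.
have b0 : 0 <= gA * C * dec x z by rewrite !mulr_ge0// ltW// dec_gt0.
case: o => [j|] /=.
  apply: le_trans (G_dec None x z0 (Cd_partial j cf)) _.
  by rewrite -!mulrA ler_peMl// !mulrA.
rewrite normrN; apply: le_trans (ler_norm_sum _ _ _) _.
apply: (@le_trans _ _ (\sum_(j < m) gA * C * dec x z)).
  by apply: ler_sum => j _; exact: G_dec (Cd_partial j cf).
by rewrite sumr_const card_ord -[_ *+ m]mulr_natl !mulrA.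
Qed.

Definition Dzz o f x z : R :=
  if o is Some j then Dz None (partial j f) x z else - \sum_(j < m) Dz (Some j) (partial j f) x z.

Lemma Dz_is_derive o f C x z : 0 < z -> Cd 2 C f -> is_derive z 1 (Dz o f x) (Dzz o f x z).
Proof.
move=> z0 cf; case: o => [j|]; first exact: G_is_derive z0 (Cd_partial j cf).
apply: is_derive_fopp => /=.
have h (r : seq 'I_m) : is_derive z 1 (fun t => \sum_(j <- r) G (Some j) (partial j f) x t)
    (\sum_(j <- r) G None (partial j (partial j f)) x z).
  elim: r => [|j r IH].
    by rewrite big_nil; under eq_fun do rewrite big_nil; exact: is_derive_fcst.
  rewrite big_cons; under eq_fun do rewrite big_cons.
  apply: is_derive_fadd IH; exact: (G_is_derive (Some j) x z0 (Cd_partial j cf)).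
exact: h.
Qed.

Lemma Dzz_dec o f C x z : 0 < z -> Cd 3 C f ->
  `|Dzz o f x z| <= m%:R * (m%:R * gA) * C * dec x z.
Proof.
move=> z0 cf; have C0 := Cd_ge0 cf.
have g0 : 0 <= gA by rewrite addr_ge0 ?tA_ge0 ?nA_ge0.
have mm : 1 <= m%:R :> R by rewrite ler1n.
have b0 : 0 <= m%:R * gA * C * dec x z by rewrite !mulr_ge0// ltW// dec_gt0.
case: o => [j|] /=.
  apply: le_trans (Dz_dec None x z0 (Cd_partial j cf)) _.
  by rewrite -!mulrA ler_peMl// !mulrA.
rewrite normrN; apply: le_trans (ler_norm_sum _ _ _) _.
apply: (@le_trans _ _ (\sum_(j < m) m%:R * gA * C * dec x z)).
  by apply: ler_sum => j _; exact: (Dz_dec (Some j) x z0 (Cd_partial j cf)).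
by rewrite sumr_const card_ord -[_ *+ m]mulr_natl !mulrA.
Qed.

End Potentials.

Section Gaussian.
Context {R : realType}.

Lemma expR_poly (q c : R) : 0 <= q -> 0 < c -> exists2 K, 0 < K & forall u, 0 <= u ->
  (1 + u) `^ q * expR (- (c * u)) <= K.
Proof.
move=> q0 c0; have q1 : 0 < q + 1 by lra.
pose k := 1 + (q + 1) / c; have k0 : 0 < k by rewrite /k addr_gt0// divr_gt0.
exists (k `^ (q + 1)); first exact: powR_gt0.
move=> u u0; have u1 : 1 <= 1 + u by lra.
have h : 1 + u <= k * expR (c * u / (q + 1)).
  apply: (@le_trans _ _ (k * (1 + c * u / (q + 1)))); last by rewrite ler_pM2l// expR_ge1Dx.
  have -> : k * (1 + c * u / (q + 1)) = 1 + u + (q + 1) / c + c * u / (q + 1).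
    by rewrite /k; field; rewrite !gt_eqF.
  by rewrite -addrA lerDl addr_ge0// divr_ge0 ?mulr_ge0// ltW.
have h2 : (1 + u) `^ (q + 1) <= k `^ (q + 1) * expR (c * u).
  apply: (@le_trans _ _ ((k * expR (c * u / (q + 1))) `^ (q + 1))).
    by apply: powR_mono => //; [lra|exact: ltW].
  rewrite powRM ?(ltW k0) ?expR_ge0// -expRM.
  by rewrite divfK// gt_eqF.
rewrite expRN ler_pdivrMr ?expR_gt0//; apply: le_trans h2.
by apply: ler_powR => //; lra.
Qed.

Lemma gauss_wt (q c : R) : 0 <= q -> 0 < c -> exists2 K, 0 < K & forall s, expR (- (c * s ^+ 2)) <= K * wt q s.
Proof.
move=> q0 c0; have [K K0 hK] := expR_poly q0 c0; exists K => // s.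
rewrite /wt powRN ler_pdivlMr ?powR_gt0 ?wt_base_gt0// mulrC.
by apply: hK; exact: sqr_ge0.
Qed.

End Gaussian.

Section Heat.
Context {R : realType} {m : nat}.
Hypothesis m0 : (0 < m)%N.
Implicit Types (y x w : 'rV[R]_m) (t s : R) (j : 'I_m) (f : 'rV[R]_m -> R).
Local Notation qK := (@qK R m).
Local Notation qK_half := (@qK_half R m).
Local Notation qK_ge0 := (@qK_ge0 R m).

Lemma gauss_Wt (q c : R) : 0 <= q -> 0 < c -> exists2 K, 0 < K &
  forall y, expR (- (c * sq y)) <= K * Wt q y.
Proof.
move=> q0 c0; have [K K0 hK] := gauss_wt q0 c0; exists (K ^+ m); first exact: exprn_gt0.
move=> y; rewrite /sq mulr_sumr -sumrN expR_sum /Wt -[m in K ^+ m]card_ord -prodr_const -big_split /=.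
by apply: ler_prod => j _; rewrite expR_ge0 /=; exact: hK.
Qed.

Definition gk t y : R := (4 * pi * t) `^ (- (m%:R / 2)) * expR (- (sq y / (4 * t))).
Definition N w : R := gk 1 w.

Lemma gk_ge0 t y : 0 <= gk t y. Proof. by rewrite mulr_ge0 ?powR_ge0 ?expR_ge0. Qed.

Lemma gk_gt0 t y : 0 < t -> 0 < gk t y.
Proof. by move=> t0; rewrite mulr_gt0 ?expR_gt0// powR_gt0// !mulr_gt0// pi_gt0. Qed.

Lemma exp_sq_continuous (c : R) : continuous (fun y : 'rV[R]_m => expR (- (sq y / c))).
Proof.
apply: (@continuous_fcomp R _ (fun y => - (sq y / c)) expR); last exact: continuous_expR.
by apply: continuous_opp; apply: continuous_mul; [exact: sq_continuous|exact: cst_continuous].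
Qed.

Lemma gk_continuous t : continuous (gk t).
Proof. by apply: continuous_mul; [exact: cst_continuous|exact: exp_sq_continuous]. Qed.

Lemma gk_local_bound (t0 : R) : 0 < t0 -> exists2 K, 0 < K & forall t y, t0 / 2 <= t <= 2 * t0 ->
  (1 + sq y) * gk t y <= K * Wt qK y.
Proof.
move=> t00; have c0 : 0 < (16 * t0)^-1 by rewrite invr_gt0 mulr_gt0.
have [K1 K10 h1] := @expR_poly R 1 _ ler01 c0.
have [K2 K20 h2] := gauss_Wt qK_ge0 c0.
pose A := (4 * pi * (t0 / 2)) `^ (- (m%:R / 2)) : R.
have b0 : 0 < 4 * pi * (t0 / 2) :> R by rewrite !mulr_gt0// pi_gt0.
have A0 : 0 < A by exact: powR_gt0.
exists (A * K1 * K2); first by rewrite !mulr_gt0.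
move=> t y /andP[t1 t2]; have tp : 0 < t by lra.
have s0 := sq_ge0 y.
have e1 : expR (- (sq y / (4 * t))) <= expR (- ((16 * t0)^-1 * sq y)) * expR (- ((16 * t0)^-1 * sq y)).
  rewrite -expRD ler_expR -opprD lerN2 -mulrDl mulrC ler_wpM2l//.
  rewrite (_ : _ + _ = (8 * t0)^-1); last by field; rewrite gt_eqF.
  by rewrite lef_pV2 ?posrE ?mulr_gt0//; lra.
have a1 : (4 * pi * t) `^ (- (m%:R / 2)) <= A.
  by apply: powR_mono_neg => //; rewrite ler_pM2l ?mulr_gt0// pi_gt0.
rewrite /gk mulrCA (_ : A * K1 * K2 * _ = A * (K1 * (K2 * Wt qK y))); last by ring.
apply: ler_pM => //.
- exact: powR_ge0.
- by rewrite mulr_ge0 ?expR_ge0// addr_ge0.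
- apply: (@le_trans _ _ ((1 + sq y) * (expR (- ((16 * t0)^-1 * sq y)) * expR (- ((16 * t0)^-1 * sq y))))).
    by rewrite ler_wpM2l// addr_ge0.
  rewrite mulrA; apply: ler_pM => //.
  + by rewrite mulr_ge0 ?expR_ge0// addr_ge0.
  + by have := h1 _ s0; rewrite powRr1// addr_ge0.
Qed.

Lemma gk_dom (q t : R) : 0 <= q -> 0 < t -> exists K, dom q K (gk t).
Proof.
move=> q0 t0; have c0 : 0 < (4 * t)^-1 by rewrite invr_gt0 mulr_gt0.
have [K K0 h] := gauss_Wt q0 c0; exists ((4 * pi * t) `^ (- (m%:R / 2)) * K).
split; first exact: gk_continuous.
move=> y; rewrite (ger0_norm (gk_ge0 t y)) /gk -[leRHS]mulrA ler_wpM2l ?powR_ge0//.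
by rewrite [sq y / _]mulrC; exact: h.
Qed.

Definition gky j t y : R := - (y 0 j / (2 * t)) * gk t y.
Definition gkyy i j t y : R := (- ((i == j)%:R / (2 * t)) + y 0 i / (2 * t) * (y 0 j / (2 * t))) * gk t y.
Definition gkt t y : R := (- (m%:R / (2 * t)) + sq y / (4 * t ^+ 2)) * gk t y.

Lemma gky_continuous j t : continuous (gky j t).
Proof.
apply: continuous_mul; last exact: gk_continuous.
by apply: continuous_opp; apply: continuous_mul; [exact: coord_continuous|exact: cst_continuous].
Qed.

Lemma gkyy_continuous i j t : continuous (gkyy i j t).
Proof.
apply: continuous_mul; last exact: gk_continuous.
apply: continuous_add; first exact: cst_continuous.
by apply: continuous_mul; apply: continuous_mul; (exact: coord_continuous || exact: cst_continuous).
Qed.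

Lemma gkt_continuous t : continuous (gkt t).
Proof.
apply: continuous_mul; last exact: gk_continuous.
apply: continuous_add; first exact: cst_continuous.
by apply: continuous_mul; [exact: sq_continuous|exact: cst_continuous].
Qed.

Lemma gk_is_derive_y j t y (s : R) : is_derive s 1 (fun s => gk t (y + s *: unitv R j)) (gky j t (y + s *: unitv R j)).
Proof.
have yj : (y + s *: unitv R j) 0 j = y 0 j + s by rewrite !mxE eqxx mulr1.
have d1 : is_derive s 1 (fun s => sq (y + s *: unitv R j)) (2 * (y 0 j + s)).
  under eq_fun do rewrite sq_line.
  have d3 := is_derive_fmul (is_derive_fscale 2 (is_derive_fid s)) (is_derive_fcst (y 0 j) s).
  have d5 := is_derive_fadd (is_derive_fadd (is_derive_fcst (sq y) s) d3) (is_derive_fsqr (is_derive_fid s)).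
  by apply: (is_derive_eq d5); ring.
have d2 := is_derive_fexp (is_derive_fopp (is_derive_fmul d1 (is_derive_fcst (4 * t)^-1 s))).
apply: (is_derive_eq (is_derive_fscale ((4 * pi * t) `^ (- (m%:R / 2))) d2)).
rewrite /gky /gk yj mulr0 addr0 (_ : (4 * t)^-1 = 2^-1 * (2 * t)^-1); last by rewrite -invfM; congr _^-1; ring.
set e := expR _; set c := _ `^ _; set i := (2 * t)^-1; by field.
Qed.

Lemma gky_is_derive_y i j t y (s : R) : is_derive s 1 (fun s => gky i t (y + s *: unitv R j)) (gkyy i j t (y + s *: unitv R j)).
Proof.
have yj (u : R) : (y + u *: unitv R j) 0 i = y 0 i + u * (i == j)%:R by rewrite !mxE eq_sym.
have d1 : is_derive s 1 (fun u => - ((y + u *: unitv R j) 0 i / (2 * t))) (- ((i == j)%:R / (2 * t))).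
  under eq_fun do rewrite yj.
  have d2 := is_derive_fmul (is_derive_fid s) (is_derive_fcst ((i == j)%:R : R) s).
  have := is_derive_fopp (is_derive_fmul (is_derive_fadd (is_derive_fcst (y 0 i) s) d2) (is_derive_fcst (2 * t)^-1 s)).
  by move=> h; apply: (is_derive_eq h); ring.
apply: (is_derive_eq (is_derive_fmul d1 (gk_is_derive_y j t y s))).
by rewrite /gkyy /gky; ring.
Qed.

Lemma gk_is_derive_t t y : 0 < t -> is_derive t 1 (gk ^~ y) (gkt t y).
Proof.
move=> t0; have b0 : 0 < 4 * pi * t :> R by rewrite !mulr_gt0// pi_gt0.
have d1 := @is_derive_fpowR R (fun t => 4 * pi * t) (- (m%:R / 2)) t _ b0 (is_derive_fscale (4 * pi) (is_derive_fid t)).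
have t4 : 4 * t != 0 by rewrite mulf_neq0// gt_eqF.
have d2 : is_derive t 1 (fun t => - (sq y / (4 * t))) (sq y / (4 * t ^+ 2)).
  have h := is_derive_fopp (is_derive_fscale (sq y) (is_deriveV t4 (is_derive_fscale 4 (is_derive_fid t)))).
  by apply: (is_derive_eq h); rewrite /GRing.scale /=; field; rewrite gt_eqF.
apply: (is_derive_eq (is_derive_fmul d1 (is_derive_fexp d2))).
rewrite /gkt /gk; have -> : (4 * pi * t) `^ (- (m%:R / 2) - 1) = (4 * pi * t) `^ (- (m%:R / 2)) / (4 * pi * t).
  by rewrite powRD ?(gt_eqF b0) ?implybT// powR_inv1// ltW.
set c := _ `^ _; set e := expR _; have p0 := @pi_gt0 R.
have t0' := lt0r_neq0 t0; have p0' := lt0r_neq0 p0.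
move: (c) (e) (pi) p0' => c' e' P p0'.
by field; rewrite t0' p0'.
Qed.

Lemma gkt_laplace t y : 0 < t -> gkt t y = \sum_(j < m) gkyy j j t y.
Proof.
move=> t0; rewrite /gkt /gkyy -mulr_suml big_split /=; congr (_ * _).
rewrite /sq mulr_suml; congr (_ + _).
  rewrite (eq_bigr (fun=> - (2 * t)^-1)) ?sumr_const ?card_ord; last by move=> j _; rewrite eqxx div1r.
  by rewrite mulNrn -[_^-1 *+ m]mulr_natl.
by apply: eq_bigr => j _; field; rewrite gt_eqF.
Qed.

Lemma gky_bound j t y : 0 < t -> `|gky j t y| <= (2 * t)^-1 * ((1 + sq y) * gk t y).
Proof.
move=> t0; rewrite /gky normrM normrN (ger0_norm (gk_ge0 t y)) [leRHS]mulrA ler_wpM2r ?gk_ge0//.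
rewrite normrM [X in _ * X]ger0_norm ?invr_ge0 ?mulr_ge0 ?(ltW t0)// mulrC ler_wpM2l ?invr_ge0 ?mulr_ge0 ?(ltW t0)//.
have h := sq_coord_le j y; rewrite ler_norml.
by have := sqr_ge0 (y 0 j - 1); have := sqr_ge0 (y 0 j + 1); nra.
Qed.

Lemma gkyy_bound i j t y : 0 < t -> `|gkyy i j t y| <= ((2 * t)^-1 + (2 * t) ^- 2) * ((1 + sq y) * gk t y).
Proof.
move=> t0; have i0 : 0 < (2 * t)^-1 by rewrite invr_gt0 mulr_gt0.
rewrite /gkyy normrM (ger0_norm (gk_ge0 t y)) [leRHS]mulrA ler_wpM2r ?gk_ge0//.
rewrite -exprVn mulrACA -expr2; set c := _^-1 in i0 *.
have hi := sq_coord_le i y; have hj := sq_coord_le j y; have s0 := sq_ge0 y.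
have b1 : (i == j)%:R <= 1 :> R by rewrite lern1 leq_b1.
have b0 : 0 <= (i == j)%:R :> R by rewrite ler0n.
have e1 : `|y 0 i * y 0 j| <= sq y.
  by rewrite ler_norml; have := sqr_ge0 (y 0 i - y 0 j); have := sqr_ge0 (y 0 i + y 0 j); nra.
apply: le_trans (ler_normD _ _) _; rewrite normrN [X in X + _]normrM [X in _ + X]normrM.
rewrite (ger0_norm b0) (gtr0_norm i0) (ger0_norm (sqr_ge0 c)) mulrDl; apply: lerD.
  have c1 : 0 <= c * sq y by rewrite mulr_ge0// ltW.
  have c2 : (i == j)%:R * c <= 1 * c by rewrite ler_wpM2r// ltW.
  by nra.
have c3 : `|y 0 i * y 0 j| * c ^+ 2 <= sq y * c ^+ 2 by rewrite ler_wpM2r// sqr_ge0.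
by have := sqr_ge0 c; nra.
Qed.

Lemma gkt_bound t y : 0 < t -> `|gkt t y| <= (m%:R * ((2 * t)^-1 + (2 * t) ^- 2)) * ((1 + sq y) * gk t y).
Proof.
move=> t0; rewrite gkt_laplace//; apply: le_trans (ler_norm_sum _ _ _) _.
apply: (@le_trans _ _ (\sum_(j < m) ((2 * t)^-1 + (2 * t) ^- 2) * ((1 + sq y) * gk t y))).
  by apply: ler_sum => j _; exact: gkyy_bound.
by rewrite sumr_const card_ord -[_ *+ m]mulr_natl mulrA.
Qed.

Lemma conv_dom (K C : R) (k : 'rV[R]_m -> R) f x : dom qK K k -> dom qK C f ->
  dom qK (C * K) (fun y => k y * f (x - y)).
Proof.
move=> dk df; have [cr _] := dom_refl x df.
have h := @dom_mul R qK K C m k (fun y => f (x - y)) cr _ dk.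
rewrite (_ : (fun y => k y * f (x - y)) = (fun y => f (x - y) * k y)); last by apply/funext => y; rewrite mulrC.
apply: h => y; apply: le_trans (df.2 _) _; rewrite ler_piMr ?Wt_le1//; exact: dom_ge0 df.
Qed.

Lemma conv_ibp (K K' C : R) (k k' : 'rV[R]_m -> R) f j x : dom qK K k -> dom qK K' k' ->
  (forall y s, is_derive s 1 (fun s => k (y + s *: unitv R j)) (k' (y + s *: unitv R j))) ->
  Cd 1 C f -> iintR (fun y => k' y * f (x - y)) = iintR (fun y => k y * partial j f (x - y)).
Proof.
move=> dk dk' hk cf; have df := Cd_dom cf; have dpf := Cd_dom (Cd_partial j cf).
have d1 := conv_dom x dk' df; have d2 := conv_dom x dk dpf; have d0 := conv_dom x dk df.
apply/eqP; rewrite -subr_eq0 -(iintR_sub qK_half d1 d2); apply/eqP.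
have d2' : dom qK (`|-1| * (C * K)) (fun y => - (k y * partial j f (x - y))).
  by have := dom_scale (-1) d2; under eq_fun do rewrite mulN1r.
apply: (iintR_partial0 (j := j) qK_half d0 (dom_add d1 d2')) => y s.
have := is_derive_fmul (hk y s) (partial_reflect (@Cd_has _ _ _ _ _ j cf) x y s).
by rewrite mulrN.
Qed.

Definition lap f x : R := \sum_(j < m) partial j (partial j f) x.
Definition H f t x : R := iintR (fun y => gk t y * f (x - y)).

Lemma H_is_derive f C t x : 0 < t -> Cd 2 C f -> is_derive t 1 (fun t => H f t x) (H (lap f) t x).
Proof.
move=> t0 cf; have df := Cd_dom cf.
have [K K0 hK] := gk_local_bound t0.
have t2 : 0 < t / 2 by rewrite divr_gt0.
have tt (u : R) : `|u - t| < t / 2 -> t / 2 <= u <= 2 * t.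
  by rewrite ltr_norml => /andP[h1 h2]; apply/andP; split; lra.
have db (u : R) : `|u - t| < t / 2 -> dom qK K (gk u).
  move=> /tt ut; split; first exact: gk_continuous.
  move=> y; rewrite (ger0_norm (gk_ge0 u y)); apply: le_trans (hK u y ut).
  by rewrite ler_peMl ?gk_ge0// lerDl sq_ge0.
pose c := m%:R * (t^-1 + t ^- 2) : R.
have cle (u : R) : t / 2 <= u -> (2 * u)^-1 + (2 * u) ^- 2 <= t^-1 + t ^- 2.
  move=> ut; have u0 : t <= 2 * u by lra.
  by apply: lerD; rewrite lef_pV2 ?posrE ?exprn_gt0 ?(lt_le_trans t0)// lerXn2r// nnegrE ltW// (lt_le_trans t0).
have dt (u : R) : `|u - t| < t / 2 -> dom qK (c * K) (gkt u).
  move=> /tt ut; have /andP[u1 u2] := ut; have u0 : 0 < u := lt_le_trans t2 u1.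
  split; first exact: gkt_continuous.
  move=> y; apply: le_trans (gkt_bound y u0) _; rewrite -[leRHS]mulrA; apply: ler_pM.
  - by rewrite mulr_ge0// addr_ge0 ?invr_ge0 ?exprn_ge0 ?mulr_ge0 ?(ltW u0).
  - by rewrite mulr_ge0 ?gk_ge0// addr_ge0// sq_ge0.
  - by rewrite /c ler_wpM2l// cle.
  - exact: hK.
have h : is_derive t 1 (fun t => H f t x) (iintR (fun y => gkt t y * f (x - y))).
  apply: (@iintR_is_derive R qK qK_half m _ _ t (t / 2) (fun t y => gk t y * f (x - y))
    (fun t y => gkt t y * f (x - y)) t2 (fun u ut => conv_dom x (db u ut) df)
    (fun u ut => conv_dom x (dt u ut) df)).
  move=> u y /tt /andP[u1 _]; have u0 := lt_le_trans t2 u1.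
  have := is_derive_fmul (gk_is_derive_t y u0) (is_derive_fcst (f (x - y)) u).
  by rewrite mulr0 addr0.
apply: (is_derive_eq h).
have tt0 : t / 2 <= t <= 2 * t by apply/andP; split; lra.
have dg : dom qK K (gk t) by apply: db; rewrite subrr normr0.
have i0 : 0 <= (2 * t)^-1 by rewrite invr_ge0 mulr_ge0// ltW.
have dgy j : dom qK ((2 * t)^-1 * K) (gky j t).
  split; first exact: gky_continuous.
  by move=> y; apply: le_trans (gky_bound j y t0) _; rewrite -[leRHS]mulrA ler_wpM2l// hK.
have dgyy j : dom qK (((2 * t)^-1 + (2 * t) ^- 2) * K) (gkyy j j t).
  split; first exact: gkyy_continuous.
  move=> y; apply: le_trans (gkyy_bound j j y t0) _; rewrite -[leRHS]mulrA ler_wpM2l ?hK//.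
  by rewrite addr_ge0// invr_ge0 exprn_ge0// mulr_ge0// ltW.
transitivity (iintR (fun y => \sum_(j < m) gkyy j j t y * f (x - y))).
  by congr iintR; apply/funext => y; rewrite gkt_laplace// mulr_suml.
rewrite (iintR_sum qK_half _ (fun j => conv_dom x (dgyy j) df)).
transitivity (iintR (fun y => \sum_(j < m) gk t y * partial j (partial j f) (x - y))); last first.
  by congr iintR; apply/funext => y; rewrite /lap mulr_sumr.
have dpp j := Cd_dom (Cd_partial j (Cd_partial j cf)).
rewrite (iintR_sum qK_half _ (fun j => conv_dom x dg (dpp j))).
apply: eq_bigr => j _.
rewrite (conv_ibp x (dgy j) (dgyy j) (gky_is_derive_y j j t) (Cd_pred cf)).
exact: (conv_ibp x dg (dgy j) (gk_is_derive_y j t) (Cd_partial j cf)).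
Qed.

End Heat.

Section Semigroup.
Context {R : realType} {m : nat}.
Hypothesis m0 : (0 < m)%N.
Implicit Types (y x w : 'rV[R]_m) (t s T : R) (j : 'I_m) (f : 'rV[R]_m -> R).
Local Notation qK := (@qK R m).
Local Notation qK_half := (@qK_half R m).
Local Notation qK_ge0 := (@qK_ge0 R m).
Local Notation N := (@gk R m 1).
Local Notation mu := (@lebesgue_measure R).
Local Notation Intg D f := (mu.-integrable (D : set R) (EFin \o (f : R -> R))).
Local Notation Rint := (@Rintegral _ _ R mu).

Lemma partial_of_line (f f' : 'rV[R]_m -> R) j :
  (forall y (s : R), is_derive s 1 (fun s => f (y + s *: unitv R j)) (f' (y + s *: unitv R j))) ->
  partial j f = f' /\ forall x, has_partial j f x.
Proof.
move=> h; have h0 x := partial_eq (h x 0).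
split; first by apply/funext => x; rewrite (h0 x).1 scale0r addr0.
by move=> x; exact: (h0 x).2.
Qed.

Lemma gk_Cd (t : R) : 0 < t -> exists K, Cd 2 K (@gk R m t).
Proof.
move=> t0; have i0 : 0 <= (2 * t)^-1 by rewrite invr_ge0 mulr_ge0// ltW.
have i1 : 0 <= (2 * t)^-1 + (2 * t) ^- 2 by rewrite addr_ge0// invr_ge0 exprn_ge0// mulr_ge0// ltW.
have [K1 h1] := @gk_dom R m _ _ qK_ge0 t0.
have [K2 h2] : exists K2, forall j, dom qK K2 (gky j t).
  have [K Kp hK] := @gk_local_bound R m t t0; exists ((2 * t)^-1 * K) => j; split; first exact: gky_continuous.
  move=> y; apply: le_trans (gky_bound j y t0) _; rewrite -[leRHS]mulrA ler_wpM2l// hK//.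
  by apply/andP; split; lra.
have [K3 h3] : exists K3, forall i j, dom qK K3 (gkyy i j t).
  have [K Kp hK] := @gk_local_bound R m t t0; exists (((2 * t)^-1 + (2 * t) ^- 2) * K) => i j.
  split; first exact: gkyy_continuous.
  move=> y; apply: le_trans (gkyy_bound i j y t0) _; rewrite -[leRHS]mulrA ler_wpM2l// hK//.
  by apply/andP; split; lra.
have k1 := dom_ge0 h1; have k2 : 0 <= K2 := dom_ge0 (h2 (Ordinal m0)).
have k3 : 0 <= K3 := dom_ge0 (h3 (Ordinal m0) (Ordinal m0)).
exists (K1 + K2 + K3); split; first by apply: dom_le h1 _; lra.
move=> j; have [e1 p1] := partial_of_line (gk_is_derive_y j t); split; [exact: p1|rewrite e1].
split; first by apply: dom_le (h2 j) _; lra.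
move=> k; have [e2 p2] := partial_of_line (gky_is_derive_y j k t); split; [exact: p2|rewrite e2].
by split; first by apply: dom_le (h3 j k) _; lra.
Qed.

Lemma cvg_le_near (u : nat -> R) (l M : R) : u @ \oo --> l -> (forall n, u n <= M) -> l <= M.
Proof. by move=> cu h; apply: (ler_cvg_to cu (@cvg_cst _ M _ _ _)); exact: nearW. Qed.

Lemma cvg_ge_near (u : nat -> R) (l M : R) : u @ \oo --> l -> (forall n, M <= u n) -> M <= l.
Proof. by move=> cu h; apply: (ler_cvg_to (@cvg_cst _ M _ _ _) cu); exact: nearW. Qed.

Definition U f t x : R := iintR (fun w => N w * f (x - Num.sqrt t *: w)).

Lemma U_dom T : 0 <= T -> exists2 A, 0 < A & forall C f t x, 0 <= t <= T -> dom qK C f ->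
  dom qK (A * C * Wt qK x) (fun w => N w * f (x - Num.sqrt t *: w)).
Proof.
move=> T0; have [K [_ hK]] := @gk_dom R m (qK + qK) 1 (addr_ge0 qK_ge0 qK_ge0) ltr01.
pose P := (2 `^ qK) ^+ m : R; have P0 : 0 < P by rewrite exprn_gt0// powR_gt0.
pose B := ((1 + T) `^ qK) ^+ m : R; have B0 : 0 < B by rewrite exprn_gt0// powR_gt0//; lra.
exists ((`|K| + 1) * P * B); first by rewrite !mulr_gt0// ltr_wpDl.
move=> C f t x /andP[t0 tT] df; have C0 := dom_ge0 df; split.
  apply: continuous_mul; first exact: gk_continuous.
  apply: (@continuous_vcomp R 'rV[R]_m 'rV[R]_m (fun w => x - Num.sqrt t *: w)); last exact: df.1.
  apply: continuous_rV => j; under eq_fun do rewrite !mxE.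
  apply: continuous_add; first exact: cst_continuous.
  by apply: continuous_opp; apply: continuous_mul; [exact: cst_continuous|exact: coord_continuous].
move=> w; rewrite normrM (ger0_norm (gk_ge0 _ _)).
have h1 := df.2 (x - Num.sqrt t *: w).
have h2 := Wt_peetre (Num.sqrt t *: w) x qK_ge0.
rewrite -(Wt_opp _ (Num.sqrt t *: w - x)) opprB in h2.
have h3 : Wt qK w <= B * Wt qK (Num.sqrt t *: w).
  rewrite /B -[m in _ ^+ m]card_ord -prodr_const -big_split /=.
  apply: ler_prod => j _; rewrite wt_ge0 /= /wt !mxE exprMn sqr_sqrtr//.
  have T1 : 0 < 1 + T by lra.
  rewrite (_ : (1 + T) `^ qK = (1 + T)^-1 `^ (- qK)); last first.
    by rewrite -powR_inv1 ?(ltW T1)// -powRrM mulN1r opprK.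
  have w2 := sqr_ge0 (w 0 j); have tw : 0 <= t * w 0 j ^+ 2 by rewrite mulr_ge0.
  rewrite -powRM; [|by rewrite invr_ge0 ltW|by rewrite addr_ge0].
  apply: powR_mono_neg; [by rewrite mulr_gt0 ?invr_gt0// ltr_wpDr| |exact: qK_ge0].
  by rewrite ler_pdivrMl//; nra.
have h4 : N w <= (`|K| + 1) * Wt qK w * Wt qK w.
  apply: le_trans (ler_norm _) _; apply: le_trans (hK w) _; rewrite -mulrA.
  have -> : Wt (qK + qK) w = Wt qK w * Wt qK w.
    rewrite /Wt -big_split /=; apply: eq_bigr => j _; rewrite /wt opprD powRD//.
    by apply/implyP => _; rewrite gt_eqF// wt_base_gt0.
  by rewrite ler_wpM2r ?mulr_ge0 ?Wt_ge0//; have := ler_norm K; lra.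
have w0 := Wt_gt0 qK w; have x0 := Wt_gt0 qK x; have v0 := Wt_gt0 qK (x - Num.sqrt t *: w).
apply: (@le_trans _ _ ((`|K| + 1) * Wt qK w * Wt qK w * (C * Wt qK (x - Num.sqrt t *: w)))).
  by apply: ler_pM => //; exact: gk_ge0.
have h5 : Wt qK w * Wt qK (x - Num.sqrt t *: w) <= B * P * Wt qK x.
  apply: (@le_trans _ _ (B * Wt qK (Num.sqrt t *: w) * Wt qK (x - Num.sqrt t *: w))).
    by rewrite ler_wpM2r// ltW.
  by rewrite -!mulrA ler_wpM2l// ltW.
have -> : (`|K| + 1) * Wt qK w * Wt qK w * (C * Wt qK (x - Num.sqrt t *: w)) =
  ((`|K| + 1) * C * Wt qK w) * (Wt qK w * Wt qK (x - Num.sqrt t *: w)) by ring.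
have -> : (`|K| + 1) * P * B * C * Wt qK x * Wt qK w = ((`|K| + 1) * C * Wt qK w) * (B * P * Wt qK x) by ring.
by rewrite ler_wpM2l// !mulr_ge0// ltW.
Qed.

Lemma U_bound T : 0 <= T -> exists2 A, 0 < A & forall C f t x, 0 <= t <= T -> dom qK C f ->
  `|U f t x| <= A * C * Wt qK x.
Proof.
move=> T0; have [A A0 h] := U_dom T0; exists (A * (wt_mass qK ^+ m + 1)).
  by rewrite mulr_gt0// ltr_wpDl// exprn_ge0// wt_mass_ge0.
move=> C f t x ht df; have C0 := dom_ge0 df; apply: le_trans (iintR_bound qK_half (h _ _ _ x ht df)) _.
have -> : A * (wt_mass qK ^+ m + 1) * C * Wt qK x = A * C * Wt qK x * (wt_mass qK ^+ m + 1) by ring.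
by rewrite ler_wpM2l// ?lerDl//; rewrite !mulr_ge0 ?Wt_ge0 ?(ltW A0).
Qed.

Lemma U_cvg C f (t_ : nat -> R) (x_ : nat -> 'rV[R]_m) t x T : dom qK C f -> (forall n, 0 <= t_ n <= T) ->
  t_ @ \oo --> t -> x_ @ \oo --> x -> (fun n => U f (t_ n) (x_ n)) @ \oo --> U f t x.
Proof.
move=> df ht ct cx.
have T0 : 0 <= T by have /andP[h1 h2] := ht 0%N; exact: le_trans h2.
have tT : 0 <= t <= T.
  apply/andP; split.
    by apply: (cvg_ge_near ct) => n; have /andP[] := ht n.
  by apply: (cvg_le_near ct) => n; have /andP[] := ht n.
have [A A0 h] := U_dom T0; have C0 := dom_ge0 df.
have hd s y : 0 <= s <= T -> dom qK (A * C) (fun w => N w * f (y - Num.sqrt s *: w)).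
  move=> hs; apply: dom_le (h _ _ _ y hs df) _.
  by rewrite ler_piMr ?Wt_le1 ?qK_ge0// mulr_ge0// ltW.
apply: (iintR_dct qK_half (fun n => hd _ _ (ht n)) (hd _ _ tT)) => w.
apply: cvgM; first exact: cvg_cst.
apply: (continuous_seq (x := x - Num.sqrt t *: w)); first exact: df.1.
apply: cvgB => //; apply: cvgZ; last exact: cvg_cst.
exact: (continuous_seq (@sqrt_continuous R t) ct).
Qed.

Lemma U_continuous C f t : 0 <= t -> dom qK C f -> continuous (U f t).
Proof.
move=> t0 df x; apply: cvg_of_seq => u cu.
by apply: (@U_cvg C f (fun=> t) u t x t df) => //; [move=> _; rewrite t0 lexx|exact: cvg_cst].
Qed.

Lemma U_partial C f t j : 0 <= t -> Cd 1 C f ->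
  partial j (U f t) = U (partial j f) t /\ forall x, has_partial j (U f t) x.
Proof.
move=> t0 cf; have df := Cd_dom cf; have dp := Cd_dom (Cd_partial j cf).
have tt : 0 <= t <= t by rewrite t0 lexx.
have [A A0 h] := U_dom t0; have C0 := dom_ge0 df.
have hd (f0 : 'rV[R]_m -> R) y : dom qK C f0 -> dom qK (A * C) (fun w => N w * f0 (y - Num.sqrt t *: w)).
  move=> df0; apply: dom_le (h _ _ _ y tt df0) _.
  by rewrite ler_piMr ?Wt_le1 ?qK_ge0// mulr_ge0// ltW.
apply: partial_of_line => x s.
apply: (@iintR_is_derive R qK qK_half m _ _ s 1
  (fun s w => N w * f (x + s *: unitv R j - Num.sqrt t *: w))
  (fun s w => N w * partial j f (x + s *: unitv R j - Num.sqrt t *: w)) ltr01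
  (fun u _ => hd f _ df) (fun u _ => hd _ _ dp)).
move=> u w _; apply: is_derive_fscale.
have e (v : R) : x + v *: unitv R j - Num.sqrt t *: w = (x - Num.sqrt t *: w) + v *: unitv R j by rewrite addrAC.
under eq_fun do rewrite e; rewrite e.
by apply: partial_line => x'; exact: (Cd_has cf).
Qed.

Lemma U_Cd T : 0 <= T -> exists2 A, 0 < A & forall k C f t, 0 <= t <= T -> Cd k C f -> Cd k (A * C) (U f t).
Proof.
move=> T0; have [A A0 h] := U_bound T0; exists A => // k.
have hd C f t : 0 <= t <= T -> dom qK C f -> dom qK (A * C) (U f t).
  move=> ht df; have /andP[t0 _] := ht; split; first exact: U_continuous df.
  by move=> x; exact: h.
elim: k => [|k IH] C f t ht cf; first by split=> //; apply: hd => //; exact: Cd_dom cf.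
split; first by apply: hd => //; exact: Cd_dom cf.
have /andP[t0 _] := ht.
have cf1 : Cd 1 C f by split; [exact: Cd_dom cf|move=> j; split; [exact: (Cd_has cf)|split=> //; exact: Cd_dom (Cd_partial j cf)]].
move=> j; have [e p] := U_partial j t0 cf1; split=> //; rewrite e.
by apply: IH => //; exact: (Cd_partial j cf).
Qed.

Lemma gk_scale t w : 0 < t -> gk t (Num.sqrt t *: w + 0) = Num.sqrt t ^- m * N w.
Proof.
move=> t0; have s0 : 0 < Num.sqrt t by rewrite sqrtr_gt0.
rewrite addr0 /gk /sq; under eq_bigr do rewrite mxE exprMn sqr_sqrtr ?(ltW t0)//.
rewrite -mulr_sumr mulr1 mulrA; congr (_ * expR (- _)); last first.
  by rewrite mulr1; field; rewrite gt_eqF.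
rewrite powRM ?(ltW t0)//; last by rewrite mulr_ge0// pi_ge0.
rewrite mulrC; congr (_ * _).
rewrite powRN; congr (_^-1); rewrite -powR_mulrn ?(ltW s0)//.
by rewrite -powR12_sqrt ?(ltW t0)// -powRrM; congr (_ `^ _); ring.
Qed.

Lemma H_U C f t x : 0 < t -> dom qK C f -> H f t x = U f t x.
Proof.
move=> t0 df; have s0 : 0 < Num.sqrt t by rewrite sqrtr_gt0.
have [K dK] := @gk_dom R m _ _ qK_ge0 t0.
have h := iintR_affine qK_half 0 (lt0r_neq0 s0) (conv_dom x dK df).
rewrite /H; move: h; rewrite (gtr0_norm s0) => h.
have sm : Num.sqrt t ^+ m != 0 by rewrite expf_neq0// lt0r_neq0.
apply: (mulfI (x := Num.sqrt t ^- m)); first by rewrite invr_neq0.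
rewrite -h /U.
have tt : 0 <= t <= t by rewrite (ltW t0) lexx.
have [A A0 hU] := U_dom (ltW t0).
rewrite -(iintR_scale qK_half _ (hU _ _ _ x tt df)); congr iintR; apply/funext => w.
by rewrite gk_scale// addr0 mulrA.
Qed.

Definition cN : R := iintR N.

Lemma cN_gt0 : 0 < cN.
Proof.
have [K dK] := @gk_dom R m _ _ qK_ge0 ltr01.
by apply: (iintR_gt0 (y0 := 0) qK_half dK) => [y|]; [exact: gk_ge0|exact: gk_gt0].
Qed.

Lemma U0 f x : U f 0 x = cN * f x.
Proof.
have [K dK] := @gk_dom R m _ _ qK_ge0 ltr01.
rewrite /U /cN mulrC -(iintR_scale qK_half _ dK); congr iintR; apply/funext => w.
by rewrite sqrtr0 scale0r subr0 mulrC.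
Qed.

Lemma lap_dom k C f : Cd k.+2 C f -> dom qK (m%:R * C) (lap f).
Proof.
move=> cf; rewrite (_ : m%:R * C = \sum_(j < m) C); last by rewrite sumr_const card_ord mulr_natl.
exact: (dom_sum (index_enum 'I_m) (fun j => Cd_dom (Cd_partial j (Cd_partial j cf)))).
Qed.

Lemma U_diff T : 0 <= T -> exists2 A, 0 < A & forall C f t x, 0 < t <= T -> Cd 2 C f ->
  `|U f t x - cN * f x| <= A * C * t * Wt qK x.
Proof.
move=> T0; have [A A0 h] := U_bound T0; exists (A * m%:R); first by rewrite mulr_gt0// ltr0n.
move=> C f t x /andP[t0 tT] cf; have C0 := Cd_ge0 cf; have df := Cd_dom cf; have dl := lap_dom cf.
pose e (n : nat) : R := t * n.+1%:R^-1.
have e0 n : 0 < e n by rewrite mulr_gt0// invr_gt0.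
have et n : e n <= t by rewrite ler_piMr ?(ltW t0)// invf_le1// ler1n.
have ce : e @ \oo --> (0 : R).
  by rewrite -[X in _ --> X](mulr0 t); apply: cvgM; [exact: cvg_cst|exact: cvg_harmonic].
have c1 : (fun n => U f (e n) x) @ \oo --> cN * f x.
  rewrite -U0; apply: (@U_cvg C f e (fun=> x) 0 x t df) => //; last exact: cvg_cst.
  by move=> n; rewrite (ltW (e0 n)) et.
have c2 : (fun n => `|U f t x - U f (e n) x|) @ \oo --> `|U f t x - cN * f x|.
  by apply: cvg_norm; apply: cvgB => //; exact: cvg_cst.
apply: (cvg_le_near c2) => n.
have b : `|H f t x - H f (e n) x| <= A * (m%:R * C) * Wt qK x * (t - e n).
  apply: (mvt_le (f := fun t => H f t x) (df := fun t => H (lap f) t x)); first exact: et.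
    by move=> s /andP[s1 _]; exact: (H_is_derive x (lt_le_trans (e0 n) s1) cf).
  move=> s /andP[s1 s2]; have s0 := lt_le_trans (e0 n) s1.
  by rewrite (H_U x s0 dl); apply: h => //; rewrite (ltW s0) (le_trans s2).
rewrite !(H_U x _ df) // in b; apply: le_trans b _.
have -> : A * m%:R * C * t * Wt qK x = A * (m%:R * C) * Wt qK x * t by ring.
rewrite ler_wpM2l//; first by rewrite !mulr_ge0 ?Wt_ge0// ltW.
by have := e0 n; lra.
Qed.

Lemma U_diff_Cd T : 0 <= T -> exists2 A, 0 < A & forall C f t, 0 < t <= T -> Cd 3 C f ->
  Cd 1 (A * C * t) (fun x => U f t x - cN * f x).
Proof.
move=> T0; have [A A0 h] := U_diff T0; exists A => // C f t ht cf; have /andP[t0 _] := ht.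
have hd g : Cd 2 C g -> dom qK (A * C * t) (fun x => U g t x - cN * g x).
  move=> cg; have dg := Cd_dom cg; split; last by move=> x; exact: h.
  apply: continuous_add; first exact: (U_continuous (ltW t0) dg).
  by apply: continuous_opp; apply: continuous_mul; [exact: cst_continuous|exact: dg.1].
split; first by apply: hd; exact: (Cd_pred cf).
move=> j; have cf1 : Cd 1 C f by do 2 apply: Cd_pred.
have [e p] := U_partial j (ltW t0) cf1.
have [e2 p2] : partial j (fun x => U f t x - cN * f x) = (fun x => U (partial j f) t x - cN * partial j f x) /\
    forall x, has_partial j (fun x => U f t x - cN * f x) x.
  apply: partial_of_line => y s; apply: is_derive_fsub.
    by have := partial_line p y s; rewrite e.
  by apply: is_derive_fscale; apply: partial_line => x; exact: (Cd_has cf).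
split; first exact: p2.
by rewrite e2; split; first exact: (hd _ (Cd_partial j cf)).
Qed.

Lemma gk_mass t : 0 < t -> iintR (@gk R m t) = cN.
Proof.
move=> t0; pose one := fun y : 'rV[R]_m => gk t (0 - y).
have s0 : 0 < Num.sqrt t by rewrite sqrtr_gt0.
have [K dK] := @gk_dom R m _ _ qK_ge0 t0.
have h := iintR_affine qK_half 0 (lt0r_neq0 s0) dK.
have sm : Num.sqrt t ^- m != 0 by rewrite invr_neq0// expf_neq0// lt0r_neq0.
apply: (mulfI sm); rewrite -[X in X ^- m * _](gtr0_norm s0) -h.
have [K1 dK1] := @gk_dom R m _ _ qK_ge0 ltr01.
rewrite /cN -(iintR_scale qK_half _ dK1); congr iintR; apply/funext => w.
exact: gk_scale.
Qed.

Lemma gk_sq_bound : exists2 K, 0 < K & forall t y, 0 < t -> sq y `^ (m%:R / 2) * @gk R m t y <= K.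
Proof.
have m2 : 0 <= m%:R / 2 :> R by rewrite divr_ge0.
have c4 : 0 < 4^-1 :> R by rewrite invr_gt0.
have [K K0 hK] := @expR_poly R (m%:R / 2) _ m2 c4; exists ((4 * pi) `^ (- (m%:R / 2)) * K).
  by rewrite mulr_gt0// powR_gt0// mulr_gt0// pi_gt0.
move=> t y t0; have s0 := sq_ge0 y; have u0 : 0 <= sq y / t by rewrite divr_ge0// ltW.
have p4 : 0 <= 4 * pi :> R by rewrite mulr_ge0// pi_ge0.
rewrite /gk powRM ?(ltW t0)//.
have -> : sq y `^ (m%:R / 2) = (sq y / t) `^ (m%:R / 2) * t `^ (m%:R / 2).
  by rewrite -powRM ?(ltW t0)// divfK// gt_eqF.
set A := (4 * pi) `^ _; set B := _ `^ (m%:R / 2).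
have -> : B * t `^ (m%:R / 2) * (A * t `^ (- (m%:R / 2)) * expR (- (sq y / (4 * t)))) =
  A * (B * expR (- (4^-1 * (sq y / t)))) * (t `^ (m%:R / 2) * t `^ (- (m%:R / 2))).
  have -> : sq y / (4 * t) = 4^-1 * (sq y / t) by rewrite invfM; ring.
  by ring.
rewrite powRN mulfV ?gt_eqF ?powR_gt0// mulr1 ler_wpM2l ?powR_ge0//.
apply: le_trans (hK _ u0); rewrite ler_wpM2r ?expR_ge0//.
by apply: powR_mono => //; lra.
Qed.

Lemma H_dom t C f : 0 < t -> dom qK C f -> exists K, dom qK K (H f t).
Proof.
move=> t0 df; have [A A0 h] := U_bound (ltW t0); exists (A * C); split.
  suff -> : H f t = U f t by exact: (U_continuous (ltW t0) df).
  by apply/funext => x; exact: (H_U x t0 df).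
by move=> x; rewrite (H_U x t0 df); apply: h => //; rewrite (ltW t0) lexx.
Qed.

Lemma H_L1 t C f : 0 < t -> dom qK C f -> iintR (fun x => `|H f t x|) <= cN * iintR (fun x => `|f x|).
Proof.
move=> t0 df; have C0 := dom_ge0 df.
have dabs (D : R) (f0 : 'rV[R]_m -> R) : dom qK D f0 -> dom qK D (fun x => `|f0 x|).
  case=> c b; split; last by move=> x; rewrite normr_id.
  by move=> x; apply: (continuous_comp (c x)); exact: norm_continuous.
have daf := dabs _ _ df.
have [K dK] := @gk_dom R m _ _ qK_ge0 t0.
have [K2 [_ hK2]] := @gk_dom R m (qK + qK) t (addr_ge0 qK_ge0 qK_ge0) t0.
have [K3 dH] := H_dom t0 df.
pose F (x y : 'rV[R]_m) := gk t y * `|f (x - y)|.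
pose P := (2 `^ qK) ^+ m : R; have P0 : 0 < P by rewrite exprn_gt0// powR_gt0.
pose M := `|K2| * C * P; have M0 : 0 <= M by rewrite !mulr_ge0// ltW.
have hF x y : `|F x y| <= M * Wt qK x * Wt qK y.
  rewrite /F normrM normr_id.
  have h2 := Wt_peetre y x qK_ge0; rewrite -(Wt_opp _ (y - x)) opprB in h2.
  have h4 : `|gk t y| <= `|K2| * Wt qK y * Wt qK y.
    apply: le_trans (hK2 y) _; rewrite -mulrA.
    have -> : Wt (qK + qK) y = Wt qK y * Wt qK y.
      rewrite /Wt -big_split /=; apply: eq_bigr => j _; rewrite /wt opprD powRD//.
      by apply/implyP => _; rewrite gt_eqF// wt_base_gt0.
    by rewrite ler_wpM2r ?mulr_ge0 ?Wt_ge0//; exact: ler_norm.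
  apply: (@le_trans _ _ (`|K2| * Wt qK y * Wt qK y * (C * Wt qK (x - y)))).
    by apply: ler_pM => //; exact: df.2.
  have -> : `|K2| * Wt qK y * Wt qK y * (C * Wt qK (x - y)) = (`|K2| * C * Wt qK y) * (Wt qK y * Wt qK (x - y)) by ring.
  have -> : M * Wt qK x * Wt qK y = (`|K2| * C * Wt qK y) * (P * Wt qK x) by rewrite /M; ring.
  by rewrite ler_wpM2l// !mulr_ge0 ?Wt_ge0.
have d1 x : dom qK (M * Wt qK x) (F x).
  by split; [exact: (conv_dom x dK daf).1|move=> y; exact: hF].
have d2 y : dom qK (M * Wt qK y) (F ^~ y).
  split; last by move=> x; rewrite mulrAC; exact: hF.
  apply: continuous_mul; first exact: cst_continuous.
  apply: (@continuous_vcomp R 'rV[R]_m 'rV[R]_m (fun x => x - y) (fun x => `|f x|)); last exact: daf.1.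
  apply: continuous_rV => j; under eq_fun do rewrite !mxE.
  by apply: continuous_add; [exact: coord_continuous|exact: cst_continuous].
have i1 : iintR (fun x => `|H f t x|) <= iintR (fun x => iintR (F x)).
  apply: (iintR_le qK_half (dabs _ _ dH) (dom_iintR qK_half M0 d1 d2)) => x.
  apply: (iintR_norm_le qK_half (conv_dom x dK df) (d1 x)) => y.
  by rewrite /F normrM (ger0_norm (gk_ge0 t y)).
apply: le_trans i1 _; rewrite (iintR_swap qK_half M0 d1 d2) -(gk_mass t0) mulrC.
rewrite -(iintR_scale qK_half _ dK) le_eqVlt; apply/orP; left; apply/eqP; congr iintR; apply/funext => y.
have [C' d'] := @dom_affine R qK C 1 m (- y) _ (oner_neq0 _) qK_ge0 daf.
have d3 : dom qK C' (fun x => `|f (x - y)|) by move: d'; under eq_fun do rewrite scale1r.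
by rewrite /F (iintR_scale qK_half _ d3) (iintR_shift qK_half (- y) daf) mulrC.
Qed.

Lemma H_sup t C f (S : R) x : 0 < t -> dom qK C f ->
  (forall y, (1 + sq y) `^ (m%:R / 2) * `|f y| <= S) -> forall K : R,
  (forall y, sq y `^ (m%:R / 2) * @gk R m t y <= K) ->
  (1 + sq x) `^ (m%:R / 2) * `|H f t x| <= 4 `^ (m%:R / 2) * (K * iintR (fun y => `|f y|) + S * cN).
Proof.
move=> t0 df hS K hK; have m2 : 0 <= m%:R / 2 :> R by rewrite divr_ge0.
have [K1 dK] := @gk_dom R m _ _ qK_ge0 t0.
have daf : dom qK C (fun x => `|f x|).
  split; last by move=> y; rewrite normr_id; exact: df.2.
  by move=> y; apply: (continuous_comp (df.1 y)); exact: norm_continuous.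
have dr := dom_refl x daf; have dc := conv_dom x dK daf.
set b := (1 + sq x) `^ (m%:R / 2); set ct := 4 `^ (m%:R / 2).
have b0 : 0 <= b by exact: powR_ge0.
have h1 : `|H f t x| <= iintR (fun y => gk t y * `|f (x - y)|).
  apply: (iintR_norm_le qK_half (conv_dom x dK df) dc) => y.
  by rewrite normrM (ger0_norm (gk_ge0 t y)).
apply: (@le_trans _ _ (b * iintR (fun y => gk t y * `|f (x - y)|))); first by rewrite ler_wpM2l.
rewrite -(iintR_scale qK_half _ dc) -(gk_mass t0) -(iintR_reflect qK_half x daf).
rewrite -(iintR_scale qK_half K dr) -(iintR_scale qK_half S dK).
have da := dom_add (dom_scale K dr) (dom_scale S dK).
rewrite -(iintR_add qK_half (dom_scale K dr) (dom_scale S dK)) -(iintR_scale qK_half _ da).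
apply: (iintR_le qK_half (dom_scale b dc) (dom_scale ct da)) => y.
have hb := br_split x y 0.
have rr0 (v : 'rV[R]_m) : rr v 0 = sq v by rewrite /rr expr0n addr0.
rewrite !rr0 -/b -/ct in hb.
have g0 : 0 <= @gk R m t y by exact: gk_ge0.
have hs := hS (x - y); have hk := hK y.
have f0 : 0 <= `|f (x - y)| by [].
set u := (1 + sq (x - y)) `^ _ in hs hb; set v := sq y `^ _ in hk hb.
have c0 : 0 <= ct by exact: powR_ge0.
apply: (@le_trans _ _ (ct * (v + u) * (gk t y * `|f (x - y)|))).
  by rewrite ler_wpM2r// mulr_ge0.
rewrite -mulrA ler_wpM2l//.
have -> : (v + u) * (gk t y * `|f (x - y)|) = (v * gk t y) * `|f (x - y)| + (u * `|f (x - y)|) * gk t y by ring.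
by apply: lerD; rewrite ler_wpM2r.
Qed.

(* Unlike [G_dec] this bound is uniform in the heat time. *)
Lemma G_heat_dec C f (S : R) : dom qK C f -> (forall y, (1 + sq y) `^ (m%:R / 2) * `|f y| <= S) ->
  exists2 M, 0 < M & forall t x z, 0 < t -> 0 < z -> `|G None (H f t) x z| <= M * dec x z.
Proof.
move=> df hS; have [K K0 hK] := gk_sq_bound.
pose L := cN * iintR (fun x => `|f x|).
pose S' := 4 `^ (m%:R / 2) * (K * iintR (fun y => `|f y|) + S * cN).
exists (`|4 `^ (m%:R / 2) * (L + S' * @mass R m)| + 1) => [|t x z t0 z0]; first by rewrite ltr_wpDl.
have [K3 dH] := H_dom t0 df.
have hs y : (1 + sq y) `^ (m%:R / 2) * `|H f t y| <= S' by apply: (H_sup y t0 df hS) => y'; exact: hK.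
have h := G_normal_bound m0 x z0 dH (H_L1 t0 df) hs; apply: (le_trans h).
rewrite (ler_wpM2r (ltW (dec_gt0 x z)))//; apply: le_trans (ler_norm _) _.
by rewrite lerDl.
Qed.

End Semigroup.

Section Primitive.
Context {R : realType}.
Local Notation mu := (@lebesgue_measure R).
Local Notation Intg D f := (mu.-integrable (D : set R) (EFin \o (f : R -> R))).
Local Notation Rint := (@Rintegral _ _ R mu).

Implicit Types (x y z : R).

Lemma measurable_open_itv (f : R -> R) (a b : R) : (forall x, a < x < b -> {for x, continuous f}) ->
  measurable_fun `]a, b[%classic f.
Proof.
by move=> cf; apply: open_continuous_measurable_fun; [exact: interval_open|move=> x; rewrite inE /= in_itv; exact: cf].
Qed.

Lemma integrable_cst_itv (c : R) (i : interval R) : (mu [set` i] < +oo)%E -> Intg [set` i] (fun=> c).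
Proof.
move=> mi; apply/integrableP; split; first exact: measurable_cst.
rewrite integral_cst//=; have mf : mu [set` i] \is a fin_num by rewrite ge0_fin_numE.
by rewrite -(fineK mf) -EFinM ltry.
Qed.

Lemma itv_mu_fin (a b : R) (b0 b1 : bool) : (mu [set` Interval (BSide b0 a) (BSide b1 b)] < +oo)%E.
Proof. by rewrite lebesgue_measure_itv /=; case: ifP => _; rewrite ?ltry// -EFinB ltry. Qed.

Lemma integrable_bounded_itv (f : R -> R) (a b M : R) : (forall x, a < x < b -> {for x, continuous f}) ->
  (forall x, a < x < b -> `|f x| <= M) -> Intg `]a, b[%classic f.
Proof.
move=> cf fM; apply: (@integrable_dom _ _ f (fun=> M)) => //.
- exact: measurable_open_itv.
- by apply: integrable_cst_itv; exact: itv_mu_fin.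
Qed.

Lemma Rint_itv_cc (f : R -> R) (a b : R) : measurable_fun `]a, b[%classic f ->
  Rint `[a, b]%classic f = Rint `]a, b[%classic f.
Proof.
move=> mf; rewrite /Rintegral; congr fine.
by apply: integral_itv_bndoo; apply/measurable_EFinP.
Qed.

Lemma Rint_cst_itv (a b c : R) : a <= b -> Rint `]a, b[%classic (fun=> c) = c * (b - a).
Proof.
move=> ab; rewrite Rintegral_cst//= lebesgue_measure_itv /=; case: ifPn => //=.
by rewrite lte_fin -leNgt => ba; rewrite (_ : b - a = 0) ?mulr0//; apply/eqP; rewrite subr_eq0 eq_le ab ba.
Qed.

Lemma Rint_itv_split (f : R -> R) (a c b : R) : a <= c -> c <= b -> Intg `]a, b[%classic f ->
  Rint `]a, b[%classic f = Rint `]a, c[%classic f + Rint `]c, b[%classic f.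
Proof.
move=> ac cb If; have [<-|cb'] := eqVneq c b; first by rewrite [X in _ + X](_ : _ = 0) ?addr0// set_itvoo0 Rintegral_set0.
have {cb}cb : c < b by rewrite lt_neqAle cb'.
have h := @Rintegral_itvB R f (BRight a) (BLeft b) c If _ _.
rewrite -(h _ _) ?bnd_simp// [X in _ = X + _](@Rintegral_itv_bndo_bndc R (BRight a) c f) ?subrKC//.
apply: (@integrableS _ _ _ mu `]a, b[%classic) => //.
by apply: subset_itvl; rewrite bnd_simp ltW.
Qed.

(* The value at the left end of an antiderivative is read off at height one. *)
Definition trace0 (F f : R -> R) : R := F 1 - Rint `]0, 1[%classic f.

Lemma trace0_diff (F f : R -> R) (M z : R) : (forall x, 0 < x -> is_derive x 1 F (f x)) ->
  (forall x, 0 < x -> {for x, continuous f}) -> (forall x, 0 < x -> `|f x| <= M) -> 0 < z <= 1 ->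
  `|F z - trace0 F f| <= M * z.
Proof.
move=> dF cf fM /andP[z0 z1].
have If (a b : R) : 0 <= a -> Intg `]a, b[%classic f.
  move=> a0; apply: (@integrable_bounded_itv f a b M) => x /andP[ax _]; [apply: cf|apply: fM]; exact: le_lt_trans ax.
have e : Rint `]z, 1[%classic f = F 1 - F z.
  have zx (x : R) : z <= x <= 1 -> 0 < x by move=> /andP[zx _]; exact: lt_le_trans zx.
  have [_ <-] := @Rint_FTC R F f z 1 z1 (fun x hx => dF x (zx x hx)) (fun x hx => cf x (zx x hx)).
  rewrite Rint_itv_cc//; apply: measurable_open_itv => x /andP[h1 _]; apply: cf; exact: lt_trans h1.
rewrite /trace0 (@Rint_itv_split f 0 z 1 (ltW z0) z1 (If 0 1 (lexx _))) e.
have -> : F z - (F 1 - (Rint `]0, z[%classic f + (F 1 - F z))) = Rint `]0, z[%classic f by ring.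
have -> : M * z = Rint `]0, z[%classic (fun=> M) by rewrite Rint_cst_itv ?subr0// ltW.
apply: le_norm_Rint => //; first exact: If.
  by apply: integrable_cst_itv; exact: itv_mu_fin.
by move=> x /=; rewrite in_itv /= => /andP[x0 _]; exact: fM.
Qed.

Lemma trace0_cvg (F f : R -> R) (M : R) : (forall x, 0 < x -> is_derive x 1 F (f x)) ->
  (forall x, 0 < x -> {for x, continuous f}) -> (forall x, 0 < x -> `|f x| <= M) ->
  F z @[z --> 0^'+] --> trace0 F f.
Proof.
move=> dF cf fM; apply/cvgrPdist_le => /= e e0.
have M0 : 0 <= M by apply: le_trans (fM 1 ltr01).
have d0 : 0 < Num.min 1 (e / (M + 1)) by rewrite lt_min ltr01 divr_gt0// ltr_wpDl.
near=> z; have z0 : 0 < z by near: z; exact: nbhs_right_gt.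
have zd : z < Num.min 1 (e / (M + 1)) by near: z; exact: nbhs_right_lt.
move: zd; rewrite lt_min => /andP[z1 ze]; rewrite distrC.
apply: le_trans (trace0_diff dF cf fM _) _; first by rewrite z0 ltW.
have := ltW ze; rewrite ler_pdivlMr ?ltr_wpDl// mulrDr mulr1 mulrC; lra.
Unshelve. all: by end_near.
Qed.

Lemma trace0_bound (F f : R -> R) (M B : R) : (forall x, 0 < x -> is_derive x 1 F (f x)) ->
  (forall x, 0 < x -> {for x, continuous f}) -> (forall x, 0 < x -> `|f x| <= M) ->
  (forall x, 0 < x <= 1 -> `|F x| <= B) -> `|trace0 F f| <= B.
Proof.
move=> dF cf fM FB; have c : `|F z| @[z --> 0^'+] --> `|trace0 F f| by apply: cvg_norm; exact: trace0_cvg dF cf fM.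
apply: (ler_cvg_to c (@cvg_cst _ B _ _ _)); near=> z; apply: FB; apply/andP; split.
  by near: z; exact: nbhs_right_gt.
by near: z; exact: nbhs_right_le.
Unshelve. all: by end_near.
Qed.

Lemma is_derive_dominated0 (g L : R -> R) : is_derive (0 : R) 1 L 0 -> L 0 = 0 ->
  (forall y, `|g y| <= `|L y|) -> is_derive (0 : R) 1 g 0.
Proof.
move=> dL L0 gL; have g0 : g 0 = 0 by apply/eqP; rewrite -normr_le0; apply: le_trans (gL 0) _; rewrite L0 normr0.
have [d1 d2] := dL.
have c1 : h^-1 * L h @[h --> 0^'] --> (0 : R).
  have := d1; rewrite /derivable => /cvg_ex[l hl].
  have e : l = 0 by rewrite -d2 /derive; apply/esym/cvg_lim => //; exact: hl.
  rewrite e in hl; suff -> : (fun h : R => h^-1 * L h) = (fun h : R => h^-1 *: ((L \o shift 0) (h *: 1) - L 0)) by [].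
  by apply/funext => h; rewrite L0 subr0 /= addr0 /GRing.scale /= mulr1.
have c2 : h^-1 * g h @[h --> 0^'] --> (0 : R).
  apply/cvgrPdist_le => /= e e0; move/cvgrPdist_le: c1 => /(_ e e0); apply: filterS => h.
  rewrite !sub0r !normrN !normrM => ?; apply: le_trans (_ : _ <= _ * _) _; last by eassumption.
  by rewrite ler_wpM2l.
have c3 : (fun h : R => h^-1 *: ((g \o shift 0) (h *: 1) - g 0)) @ 0^' --> (0 : R).
  suff -> : (fun h : R => h^-1 *: ((g \o shift 0) (h *: 1) - g 0)) = (fun h : R => h^-1 * g h) by [].
  by apply/funext => h; rewrite g0 subr0 /= addr0 /GRing.scale /= mulr1.
split; first by apply/cvg_ex; exists 0.
by rewrite /derive; apply/cvg_lim.
Qed.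

(* With [L' = k] and [L 0 = k 0 = 0] the kernel [L] cut off at zero stays
   differentiable, so that no boundary term appears on a fixed interval. *)
Lemma convolution_is_derive (L k F f : R -> R) (M Mk : R) (x : R) : 0 < x ->
  (forall y, is_derive y 1 L (k y)) -> continuous k -> L 0 = 0 -> k 0 = 0 ->
  (forall y, `|k y| <= Mk) ->
  (forall z, 0 < z -> is_derive z 1 F (f z)) ->
  (forall z, 0 < z -> {for z, continuous f}) -> (forall z, 0 < z -> `|f z| <= M) ->
  is_derive x 1 (fun x => Rint `[0, x]%classic (fun z => k (x - z) * F z))
    (k x * trace0 F f + Rint `]0, x[%classic (fun z => k (x - z) * f z)).
Proof.
move=> x0 dL ck L0 k0 kM dF cf fM.
have M0 : 0 <= M := le_trans (normr_ge0 _) (fM 1 ltr01).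
have Mk0 : 0 <= Mk := le_trans (normr_ge0 _) (kM 0).
have cF z : 0 < z -> {for z, continuous F} by move=> z0; exact: is_derive_continuous (dF z z0).
have cL : continuous L by move=> y; exact: is_derive_continuous (dL y).
have sub_cont (h : R -> R) (u z : R) : continuous h -> {for z, continuous (fun z => h (u - z))}.
  move=> ch; apply: (@continuous_comp _ _ _ (fun z : R => u - z) h); last exact: ch.
  by apply: cvgB; [exact: cvg_cst|exact: cvg_id].
pose T := trace0 F f.
have FT (z X : R) : 0 < z -> z < X -> `|F z| <= `|T| + `|F 1| + M * (X + 1).
  move=> z0 zX; have [z1|z1] := leP z 1.
    have h := trace0_diff dF cf fM (introT andP (conj z0 z1)).
    have -> : F z = T + (F z - T) by ring.
    apply: le_trans (ler_normD _ _) _; rewrite -addrA lerD2l; apply: le_trans h _.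
    have : M * z <= M * (X + 1) by rewrite ler_wpM2l//; lra.
    by have := normr_ge0 (F 1); lra.
  have h : `|F z - F 1| <= M * (z - 1).
    by apply: (mvt_le (df := f)) (ltW z1) _ _ => y /andP[y1 _]; [apply: dF|apply: fM]; exact: lt_le_trans y1.
  have -> : F z = F 1 + (F z - F 1) by ring.
  apply: le_trans (ler_normD _ _) _.
  have : M * (z - 1) <= M * (X + 1) by rewrite ler_wpM2l//; lra.
  by have := normr_ge0 T; lra.
pose Lt (y : R) := if 0 < y then L y else 0.
pose kt (y : R) := if 0 < y then k y else 0.
have LM y : `|L y| <= Mk * `|y|.
  have [y0|y0] := leP 0 y.
    by have := mvt_le (M := Mk) y0 (fun x _ => dL x) (fun x _ => kM x); rewrite L0 !subr0 (ger0_norm y0).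
  have := mvt_le (M := Mk) (ltW y0) (fun x _ => dL x) (fun x _ => kM x).
  by rewrite L0 !sub0r normrN (ltr0_norm y0).
have dLt y : is_derive y 1 Lt (kt y).
  have [y0|y0|->] := ltgtP y 0.
  - rewrite /kt ltNge (ltW y0) /=; apply: (is_derive_ext _ (is_derive_fcst 0 y)).
    by near=> u; rewrite /Lt ltNge; have -> : u <= 0 by apply: ltW; near: u; exact: lt_nbhsl.
  - rewrite /kt y0; apply: (is_derive_ext _ (dL y)).
    by near=> u; rewrite /Lt; have -> : 0 < u by near: u; exact: lt_nbhsr.
  - rewrite /kt ltxx; apply: (@is_derive_dominated0 Lt L) => //; first by have := dL 0; rewrite k0.
    by move=> u; rewrite /Lt; case: ifP => // _; rewrite normr0.
have ktM y : `|kt y| <= Mk by rewrite /kt; case: ifP => // _; rewrite normr0.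
have cLt : continuous Lt by move=> y; exact: is_derive_continuous (dLt y).
pose X := x + x; pose D := `]0, X[%classic : set R.
have X0 : 0 < X by rewrite /X addr_gt0.
have Itf (u : R) : Intg D (fun z => Lt (u - z) * f z).
  have b : forall z, 0 < z < X -> `|Lt (u - z) * f z| <= Mk * (`|u| + X) * M.
    move=> z /andP[z0 zX]; rewrite normrM; apply: ler_pM => //; last exact: fM.
    rewrite /Lt; case: ifP => _; last by rewrite normr0 mulr_ge0// addr_ge0// ltW.
    apply: le_trans (LM _) _; rewrite ler_wpM2l//; apply: le_trans (ler_normB _ _) _.
    by rewrite lerD2l gtr0_norm// ltW.
  apply: (integrable_bounded_itv _ b) => z /andP[z0 _].
  by apply: continuousM; [exact: sub_cont|exact: cf].
have [Ik d1] : Intg D (fun z => kt (x - z) * f z) /\ is_derive x 1 (fun u => Rint D (fun z => Lt (u - z) * f z)) (Rint D (fun z => kt (x - z) * f z)).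
  apply: (@Rint_is_derive R D (fun u z => Lt (u - z) * f z) (fun u z => kt (u - z) * f z) (fun=> Mk * M) x 1 _ ltr01) => //.
  - exact: measurable_itv.
  - move=> u z _ _; have := is_derive_fmul (@is_derive_fcomp R Lt (fun u => u - z) u _ _ (dLt _) (is_derive_fsub (is_derive_fid u) (is_derive_fcst z u))) (is_derive_fcst (f z) u).
    by rewrite subr0 mulr1 mulr0 addr0.
  - by apply: integrable_cst_itv; exact: itv_mu_fin.
  - by move=> u z _; rewrite /D /= in_itv /= => /andP[z0 _]; rewrite normrM ler_pM// fM.
have main (u : R) : 0 < u -> u < X ->
    Rint `[0, u]%classic (fun z => k (u - z) * F z) = L u * T + Rint D (fun z => Lt (u - z) * f z).
  move=> u0 uX.
  have I1 : Intg `]0, u[%classic (fun z => k (u - z) * F z).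
    apply: (@integrable_bounded_itv _ 0 u (Mk * (`|T| + `|F 1| + M * (u + 1)))).
      by move=> z /andP[z0 _]; apply: continuousM; [exact: sub_cont|exact: cF].
    by move=> z /andP[z0 zu]; rewrite normrM ler_pM// FT.
  have I2 : Intg `]0, u[%classic (fun z => L (u - z) * f z).
    apply: (@integrable_bounded_itv _ 0 u (Mk * (u + u) * M)).
      by move=> z /andP[z0 _]; apply: continuousM; [exact: sub_cont|exact: cf].
    move=> z /andP[z0 zu]; rewrite normrM; apply: ler_pM => //; last exact: fM.
    apply: le_trans (LM _) _; rewrite ler_wpM2l// ger0_norm; lra.
  have -> : Rint D (fun z => Lt (u - z) * f z) = Rint `]0, u[%classic (fun z => L (u - z) * f z).
    rewrite (@Rint_itv_split _ 0 u X (ltW u0) (ltW uX) (Itf u)) [X in _ + X](_ : _ = 0) ?addr0.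
      by apply: Rint_eq => z /=; rewrite in_itv /= => /andP[_ zu]; rewrite /Lt subr_gt0 zu.
    rewrite (@Rint_eq _ _ _ (fun=> 0)) ?Rint_cst_itv ?mul0r// 1?ltW// => z /=.
    by rewrite in_itv /= => /andP[uz _]; rewrite /Lt subr_gt0 ltNge (ltW uz) /= mul0r.
  rewrite Rint_itv_cc; last exact: integrable_measurable I1.
  apply/eqP; rewrite -subr_eq; apply/eqP; rewrite -RintB//.
  have ftc := @Rint_FTC_open R (fun z => - (L (u - z) * F z)) (fun z => k (u - z) * F z - L (u - z) * f z) 0 u
     (- (L u * T)) (- (0 * F u)) u0.
  rewrite mul0r oppr0 sub0r opprK in ftc; apply: ftc.
  - move=> z /andP[z0 _].
    have h := is_derive_fopp (is_derive_fmul (@is_derive_fcomp R L (fun z => u - z) z _ _ (dL _) (is_derive_fsub (is_derive_fcst u z) (is_derive_fid z))) (dF z z0)).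
    by apply: (is_derive_eq h); ring.
  - move=> z /andP[z0 _]; apply: continuousB.
      by apply: continuousM; [exact: sub_cont|exact: cF].
    by apply: continuousM; [exact: sub_cont|exact: cf].
  - exact: integrable_sub.
  - apply: cvgN; apply: cvgM; last exact: trace0_cvg dF cf fM.
    have h : L (u - z) @[z --> (0 : R)] --> L (u - 0) := @sub_cont L u 0 cL.
    by rewrite subr0 in h; exact: cvg_at_right_filter.
  - rewrite -[in X in _ --> X]oppr0 -[in X in _ --> X](mul0r (F u)); apply: cvgN; apply: cvgM.
      have h : L (u - z) @[z --> u] --> L (u - u) := @sub_cont L u u cL.
      by rewrite subrr L0 in h; exact: cvg_at_left_filter.
    by apply: cvg_at_left_filter; exact: cF.
have -> : Rint `]0, x[%classic (fun z => k (x - z) * f z) = Rint D (fun z => kt (x - z) * f z).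
  rewrite (@Rint_itv_split _ 0 x X (ltW x0) _ Ik); last by rewrite /X lerDl ltW.
  rewrite [X in _ + X](_ : _ = 0) ?addr0.
    by apply: Rint_eq => z /=; rewrite in_itv /= => /andP[_ zu]; rewrite /kt subr_gt0 zu.
  rewrite (@Rint_eq _ _ _ (fun=> 0)) ?Rint_cst_itv ?mul0r//; first by rewrite /X lerDl ltW.
  by move=> z /=; rewrite in_itv /= => /andP[uz _]; rewrite /kt subr_gt0 ltNge (ltW uz) /= mul0r.
have dm : is_derive x 1 (fun u => L u * T + Rint D (fun z => Lt (u - z) * f z)) (k x * T + Rint D (fun z => kt (x - z) * f z)).
  have := is_derive_fadd (is_derive_fmul (dL x) (is_derive_fcst T x)) d1.
  by rewrite mulr0 addr0.
apply: is_derive_ext dm; near=> u; rewrite main//; near: u; first exact: lt_nbhsr.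
by apply: lt_nbhsl; rewrite /X ltrDl.
Unshelve. all: by end_near.
Qed.

End Primitive.

Section LineHeat.
Context {R : realType}.
Local Notation mu := (@lebesgue_measure R).
Local Notation Intg D f := (mu.-integrable (D : set R) (EFin \o (f : R -> R))).
Local Notation Rint := (@Rintegral _ _ R mu).
Implicit Types (t s y x b q : R).

Definition hk t s : R := (4 * pi * t) `^ (- (1 / 2)) * expR (- (s ^+ 2 / (4 * t))).
Definition hk1 t s : R := - (s / (2 * t)) * hk t s.
Definition hk2 t s : R := (- (2 * t)^-1 + (s / (2 * t)) ^+ 2) * hk t s.

Lemma powR_pred t p : 0 < t -> t `^ (p - 1) = t `^ p / t.
Proof.
move=> t0; rewrite powRD; last by apply/implyP => _; rewrite gt_eqF.
by rewrite powR_inv1// ltW.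
Qed.

Lemma hk_ge0 t s : 0 <= hk t s. Proof. by rewrite mulr_ge0 ?powR_ge0 ?expR_ge0. Qed.

Lemma hk_is_derive t s : is_derive s 1 (hk t) (hk1 t s).
Proof.
have d2 := is_derive_fexp (is_derive_fopp (is_derive_fmul (is_derive_fsqr (is_derive_fid s)) (is_derive_fcst (4 * t)^-1 s))).
apply: (is_derive_eq (is_derive_fscale ((4 * pi * t) `^ (- (1 / 2))) d2)).
rewrite /hk1 /hk mulr0 addr0 (_ : (4 * t)^-1 = 2^-1 * (2 * t)^-1); last by rewrite -invfM; congr _^-1; ring.
set e := expR _; set c := _ `^ _; set i := (2 * t)^-1; by field.
Qed.

Lemma hk1_is_derive t s : is_derive s 1 (hk1 t) (hk2 t s).
Proof.
have d := is_derive_fopp (is_derive_fmul (is_derive_fid s) (is_derive_fcst (2 * t)^-1 s)).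
apply: (is_derive_eq (is_derive_fmul d (hk_is_derive t s))).
by rewrite /hk2 /hk1; ring.
Qed.

Lemma hk_is_derive_t t s : 0 < t -> is_derive t 1 (hk ^~ s) (hk2 t s).
Proof.
move=> t0; have e (u : R) : hk u s = @gk R 1 u (\row_j s) by rewrite /hk /gk /sq big_ord1 mxE.
have := @gk_is_derive_t R 1 t (\row_j s) t0.
rewrite (_ : gkt t (\row_j s) = hk2 t s); last first.
  rewrite /gkt /hk2 -e /sq big_ord1 mxE; congr (_ * _).
  by field; rewrite gt_eqF.
by rewrite (_ : hk ^~ s = (fun u => @gk R 1 u (\row_j s)))//; apply/funext.
Qed.

Lemma hk1_continuous t : continuous (hk1 t).
Proof. by move=> s; exact: is_derive_continuous (hk1_is_derive t s). Qed.

Lemma hk_continuous_t t s : 0 < t -> {for t, continuous (hk ^~ s)}.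
Proof. by move=> t0; exact: is_derive_continuous (hk_is_derive_t s t0). Qed.

Lemma hk1_continuous_t t s : 0 < t -> {for t, continuous (hk1 ^~ s)}.
Proof.
move=> t0; apply: continuousM; last exact: hk_continuous_t.
apply: cvgN; apply: cvgM; first exact: cvg_cst.
apply: cvgV; first by rewrite mulf_neq0// gt_eqF.
by apply: cvgM; [exact: cvg_cst|exact: cvg_id].
Qed.

Lemma hk2_continuous_t t s : 0 < t -> {for t, continuous (hk2 ^~ s)}.
Proof.
move=> t0; apply: continuousM; last exact: hk_continuous_t.
have c : (2 * u)^-1 @[u --> t] --> (2 * t)^-1.
  apply: cvgV; first by rewrite mulf_neq0// gt_eqF.
  by apply: cvgM; [exact: cvg_cst|exact: cvg_id].
by apply: cvgD; [exact: cvgN|rewrite /= !expr2; apply: cvgM; apply: cvgM => //; exact: cvg_cst].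
Qed.

Definition Ek t y : R := t `^ (- (3 / 2)) * expR (- (y ^+ 2 / (16 * t))).

Lemma Ek_ge0 t y : 0 <= Ek t y. Proof. by rewrite mulr_ge0 ?powR_ge0 ?expR_ge0. Qed.

Lemma Ek_le t y : 0 < t -> Ek t y <= t `^ (- (3 / 2)).
Proof.
move=> t0; rewrite ler_piMr ?powR_ge0// expR_le1 oppr_le0 divr_ge0// ?sqr_ge0//.
by rewrite mulr_ge0// ltW.
Qed.

(* [exp(-y^2/4t)] is split into three factors: one absorbs the polynomial weight
   in [y], one the polynomial in [y^2/t], one is kept. *)
Lemma hk_weight q : 0 <= q -> exists2 K, 0 < K & forall t y, 0 < t <= 2 ->
  (1 + y ^+ 2) `^ q * ((1 + y ^+ 2 / t) * hk t y) <= K * (t * Ek t y).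
Proof.
move=> q0; have c16 : 0 < 16^-1 :> R by rewrite invr_gt0.
have [K1 K10 h1] := expR_poly q0 c16; have [K2 K20 h2] := @expR_poly R 1 _ ler01 c16.
exists (K1 * K2) => [|t y /andP[t0 t2]]; first by rewrite mulr_gt0.
have y0 := sqr_ge0 y; have u0 : 0 <= y ^+ 2 / t by rewrite divr_ge0// ltW.
have hq := h1 _ y0; have := h2 _ u0; rewrite powRr1; last by rewrite addr_ge0.
set u := y ^+ 2 / t in u0 *; move=> hu.
have e1 : expR (- (y ^+ 2 / (4 * t))) <= expR (- (16^-1 * y ^+ 2)) * (expR (- (16^-1 * u)) * expR (- (y ^+ 2 / (16 * t)))).
  have -> : y ^+ 2 / (4 * t) = 4^-1 * u by rewrite /u; field; rewrite gt_eqF.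
  have -> : y ^+ 2 / (16 * t) = 16^-1 * u by rewrite /u; field; rewrite gt_eqF.
  rewrite -!expRD ler_expR.
  have yu : y ^+ 2 <= 2 * u by rewrite /u mulrCA -[leLHS]mulr1 ler_wpM2l// ler_pdivlMr// mul1r.
  by lra.
have tE : t * Ek t y = t `^ (- (1 / 2)) * expR (- (y ^+ 2 / (16 * t))).
  rewrite /Ek mulrA -{1}[t]powRr1 ?(ltW t0)// -powRD; last by apply/implyP => _; rewrite gt_eqF.
  by congr (_ `^ _ * _); lra.
have a1 : (4 * pi * t) `^ (- (1 / 2)) <= t `^ (- (1 / 2)).
  by apply: powR_mono_neg => //; rewrite ler_peMl ?(ltW t0)//; have := @pi_ge2 R; lra.
rewrite tE /hk; set e2 := expR (- (y ^+ 2 / (16 * t))) in e1 *.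
set e4 := expR _ in e1 *; set ey := expR _ in e1 hq; set eu := expR _ in e1 hu.
have ge2 : 0 <= e2 by exact: expR_ge0.
have ge4 : 0 <= e4 by exact: expR_ge0.
have t12 : 0 <= t `^ (- (1 / 2)) by exact: powR_ge0.
set Q := (1 + y ^+ 2) `^ q in hq *; have Q0 : 0 <= Q by exact: powR_ge0.
have ey0 : 0 <= ey by exact: expR_ge0.
have eu0 : 0 <= eu by exact: expR_ge0.
have u1 : 0 <= 1 + u by rewrite addr_ge0.
apply: (@le_trans _ _ (Q * ((1 + u) * (t `^ (- (1 / 2)) * (ey * (eu * e2)))))).
  by rewrite ler_wpM2l// ler_wpM2l// ler_pM// ?powR_ge0.
have -> : Q * ((1 + u) * (t `^ (- (1 / 2)) * (ey * (eu * e2)))) =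
  (Q * ey) * ((1 + u) * eu) * (t `^ (- (1 / 2)) * e2) by ring.
rewrite ler_wpM2r//; first by rewrite mulr_ge0.
by apply: ler_pM => //; exact: mulr_ge0.
Qed.

Lemma hk1_bound q : 0 <= q -> exists2 K, 0 < K & forall t y, 0 < t <= 2 -> 0 <= y ->
  (1 + y ^+ 2) `^ q * `|hk1 t y| <= K * (y * Ek t y).
Proof.
move=> q0; have [K K0 h] := hk_weight q0; exists K => // t y t02 y0; have /andP[t0 _] := t02.
have := h t y t02; set Q := _ `^ q => hh.
have Q0 : 0 <= Q by exact: powR_ge0.
rewrite /hk1 normrM normrN (ger0_norm (hk_ge0 t y)) ger0_norm ?divr_ge0// ?mulr_ge0// ?(ltW t0)//.
have c0 : 0 <= y / t by rewrite divr_ge0// ltW.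
have h2 : (y / t) * (Q * ((1 + y ^+ 2 / t) * hk t y)) <= (y / t) * (K * (t * Ek t y)) by rewrite ler_wpM2l.
apply: (@le_trans _ _ ((y / t) * (K * (t * Ek t y)))); last first.
  by rewrite (_ : y / t * _ = K * (y * Ek t y))//; field; rewrite gt_eqF.
apply: le_trans h2.
have -> : y / (2 * t) = 2^-1 * (y / t) by field; rewrite gt_eqF.
have u0 : 0 <= y ^+ 2 / t by rewrite divr_ge0 ?sqr_ge0// ltW.
set u := y ^+ 2 / t in u0 *; set c := y / t in c0 *.
have -> : Q * (2^-1 * c * hk t y) = c * (2^-1 * (Q * hk t y)) by ring.
have -> : c * (Q * ((1 + u) * hk t y)) = c * (Q * hk t y + u * (Q * hk t y)) by ring.
rewrite ler_wpM2l//; have hq : 0 <= Q * hk t y by rewrite mulr_ge0// hk_ge0.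
have : 0 <= u * (Q * hk t y) by rewrite mulr_ge0.
by lra.
Qed.

Lemma hk2_bound q : 0 <= q -> exists2 K, 0 < K & forall t y, 0 < t <= 2 ->
  (1 + y ^+ 2) `^ q * `|hk2 t y| <= K * Ek t y.
Proof.
move=> q0; have [K K0 h] := hk_weight q0; exists K => // t y t02; have /andP[t0 _] := t02.
have := h t y t02; set Q := _ `^ q => hh.
have Q0 : 0 <= Q by exact: powR_ge0.
have u0 : 0 <= y ^+ 2 / t by rewrite divr_ge0 ?sqr_ge0// ltW.
have i0 : 0 < t^-1 by rewrite invr_gt0.
have b : `|hk2 t y| <= t^-1 * ((1 + y ^+ 2 / t) * hk t y).
  rewrite /hk2 normrM (ger0_norm (hk_ge0 t y)) [leRHS]mulrA ler_wpM2r ?hk_ge0//.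
  have -> : - (2 * t)^-1 + (y / (2 * t)) ^+ 2 = t^-1 * (4^-1 * (y ^+ 2 / t) - 2^-1) by field; rewrite gt_eqF.
  rewrite normrM (gtr0_norm i0) ler_wpM2l ?(ltW i0)// ler_norml; apply/andP; split; lra.
apply: (@le_trans _ _ (t^-1 * (K * (t * Ek t y)))); last first.
  by rewrite (_ : t^-1 * _ = K * Ek t y)//; field; rewrite gt_eqF.
apply: le_trans (ler_wpM2l (ltW i0) hh).
by rewrite mulrCA ler_wpM2l.
Qed.

Lemma Ek_space t x : 0 < t -> 0 < x ->
  Intg `]0, x[%classic (fun z => (x - z) * Ek t (x - z)) /\
  Rint `]0, x[%classic (fun z => (x - z) * Ek t (x - z)) <= 8 * t `^ (- (1 / 2)).
Proof.
move=> t0 x0; pose F z := 8 * t `^ (- (1 / 2)) * expR (- ((x - z) ^+ 2 / (16 * t))).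
have cE : continuous (fun z => (x - z) * Ek t (x - z)).
  have cs : continuous (fun z => x - z) by move=> z; apply: cvgB; [exact: cvg_cst|exact: cvg_id].
  apply: continuous_mul => //; apply: continuous_mul; first exact: cst_continuous.
  apply: (@continuous_fcomp R _ (fun z => - ((x - z) ^+ 2 / (16 * t))) expR); last exact: continuous_expR.
  apply: continuous_opp; apply: continuous_mul; last exact: cst_continuous.
  by apply: (@continuous_fcomp R _ (fun z => x - z) (fun u => u ^+ 2)) => //; exact: exprn_continuous.
apply: (@ge0_Rint_primitive R F) => //.
- by move=> z /andP[_ zx]; rewrite mulr_ge0 ?Ek_ge0// subr_ge0 ltW.
- move=> z _.
  have d := is_derive_fexp (is_derive_fopp (is_derive_fmul (is_derive_fsqr (is_derive_fsub (is_derive_fcst x z) (is_derive_fid z))) (is_derive_fcst (16 * t)^-1 z))).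
  apply: (is_derive_eq (is_derive_fscale (8 * t `^ (- (1 / 2))) d)).
  rewrite /Ek (_ : t `^ (- (3 / 2)) = t `^ (- (1 / 2)) / t); last first.
    by rewrite -powR_pred//; congr (_ `^ _); lra.
  by set c := _ `^ _; set e := expR _; field; rewrite gt_eqF.
- by move=> z _; exact: cE.
- move=> u v _ _ _; have p0 : 0 <= 8 * t `^ (- (1 / 2)) by rewrite mulr_ge0// powR_ge0.
  apply: (@le_trans _ _ (F v)); first by rewrite lerBlDr lerDl mulr_ge0// expR_ge0.
  rewrite ler_piMr// expR_le1 oppr_le0 divr_ge0 ?sqr_ge0// mulr_ge0// ltW//.
Qed.

Lemma integrable_pow (p T : R) : -1 < p -> 0 < T -> Intg `]0, T[%classic (fun t => t `^ p).
Proof.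
move=> p1 T0; have p0 : 0 < p + 1 by lra.
have [] // := @ge0_Rint_primitive R (fun t => (p + 1)^-1 * t `^ (p + 1)) (fun t => t `^ p) 0 T ((p + 1)^-1 * T `^ (p + 1)) T0.
- by move=> t _; exact: powR_ge0.
- move=> t /andP[t0 _]; have d := is_derive_fscale (p + 1)^-1 (@is_derive_fpowR R id (p + 1) t _ t0 (is_derive_fid t)).
  by apply: (is_derive_eq d); rewrite addrK mulr1 mulrA mulVf ?mul1r// gt_eqF.
- by move=> t /andP[t0 _]; apply: continuous_powR => //; exact: cvg_id.
- move=> u v u0 uv vT; have i0 : 0 <= (p + 1)^-1 by rewrite invr_ge0 ltW.
  rewrite lerBlDr -[leLHS]addr0; apply: lerD; last by rewrite mulr_ge0// powR_ge0.
  by rewrite ler_wpM2l//; apply: powR_mono; [exact: ltW (lt_le_trans u0 uv)|exact: ltW|exact: ltW].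
Qed.

Let diff_le (k A B C : R) : 0 <= k -> 0 <= A -> B <= C -> - k * A - (- k * B) <= k * C.
Proof. by move=> k0 A0 BC; have := ler_wpM2l k0 BC; have := mulr_ge0 k0 A0; lra. Qed.

Lemma Ek_time b : 0 <= b < 1 / 2 -> exists2 K, 0 < K & forall y, 0 < y ->
  Intg `]0, 2[%classic (fun t => t `^ b * Ek t y) /\
  Rint `]0, 2[%classic (fun t => t `^ b * Ek t y) <= K * y `^ (2 * b - 1).
Proof.
move=> /andP[b0 b2]; have c16 : 0 < 16^-1 :> R by rewrite invr_gt0.
pose p := 2 - 2 * b; have p0 : 0 <= p by rewrite /p; lra.
have [K K0 hK] := expR_poly p0 c16.
pose r := 1 - 2 * b; have r0 : 0 < r by rewrite /r; lra.
pose c := 2 `^ p * K; have cp : 0 < c by rewrite mulr_gt0// powR_gt0.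
exists (c * (2 / r)) => [|y y0]; first by rewrite mulr_gt0// divr_gt0.
pose f t := t `^ (- (1 / 2)) * (t `^ (1 / 2) + y) `^ (- p).
pose F t := - (2 / r) * (t `^ (1 / 2) + y) `^ (- r).
have sy t : 0 < t `^ (1 / 2) + y by rewrite ltr_wpDl// powR_ge0.
have [If hf] : Intg `]0, 2[%classic f /\ Rint `]0, 2[%classic f <= (2 / r) * y `^ (- r).
  apply: (@ge0_Rint_primitive R F f 0 2 (2 / r * y `^ (- r))); first exact: ltr0n.
  - by move=> t _; rewrite mulr_ge0 ?powR_ge0.
  - move=> t /andP[t0 _].
    have d1 := is_derive_fadd (@is_derive_fpowR R id (1 / 2) t _ t0 (is_derive_fid t)) (is_derive_fcst y t).
    have d2 := is_derive_fscale (- (2 / r)) (@is_derive_fpowR R (fun t => t `^ (1 / 2) + y) (- r) t _ (sy t) d1).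
    apply: (is_derive_eq d2); rewrite /f (_ : - r - 1 = - p); last by rewrite /r /p; lra.
    rewrite (_ : 1 / 2 - 1 = - (1 / 2)); last lra.
    by field; rewrite gt_eqF.
  - move=> t /andP[t0 _]; apply: continuousM; first by apply: continuous_powR => //; exact: cvg_id.
    apply: continuous_powR => //; apply: cvgD; last exact: cvg_cst.
    by apply: continuous_powR => //; exact: cvg_id.
  - move=> u v _ _ _; have i0 : 0 <= 2 / r by rewrite divr_ge0// ltW.
    have h1 := powR_ge0 (v `^ (1 / 2) + y) (- r).
    have h2 : (u `^ (1 / 2) + y) `^ (- r) <= y `^ (- r).
      by apply: powR_mono_neg => //; [rewrite lerDr powR_ge0|exact: ltW].
    exact: diff_le i0 h1 h2.
have le t : 0 < t -> t `^ b * Ek t y <= c * f t.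
  move=> t0; have s0 : 0 < t `^ (1 / 2) by exact: powR_gt0.
  have ss : t `^ (1 / 2) ^+ 2 = t by rewrite -powR_mulrn ?powR_ge0// -powRrM (_ : 1 / 2 * 2%:R = 1) ?powRr1 ?ltW//; lra.
  pose u := y / t `^ (1 / 2); have u0 : 0 <= u by rewrite divr_ge0// ltW.
  have uu : u ^+ 2 = y ^+ 2 / t by rewrite /u expr_div_n ss.
  have -> : t `^ b * Ek t y = t `^ (b - 3 / 2) * expR (- (16^-1 * u ^+ 2)).
    rewrite /Ek mulrA -powRD; last by apply/implyP => _; rewrite gt_eqF.
    by congr (_ * expR (- _)); rewrite uu; field; rewrite gt_eqF.
  have -> : f t = t `^ (b - 3 / 2) * (1 + u) `^ (- p).
    rewrite /f (_ : t `^ (1 / 2) + y = t `^ (1 / 2) * (1 + u)); last by rewrite /u; field; rewrite gt_eqF.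
    rewrite powRM ?(ltW s0) ?addr_ge0// mulrA -powRrM -powRD; last by apply/implyP => _; rewrite gt_eqF.
    by congr (_ `^ _ * _); rewrite /p; lra.
  rewrite [leRHS]mulrCA ler_wpM2l ?powR_ge0// powRN ler_pdivlMr ?powR_gt0 ?ltr_wpDr// mulrC.
  apply: (@le_trans _ _ ((2 * (1 + u ^+ 2)) `^ p * expR (- (16^-1 * u ^+ 2)))).
    rewrite ler_wpM2r ?expR_ge0//; apply: powR_mono => //; first by rewrite addr_ge0.
    by have := sqr_ge0 (u - 1); nra.
  rewrite powRM ?addr_ge0 ?sqr_ge0// /c -mulrA ler_wpM2l ?powR_ge0//.
  exact: hK (sqr_ge0 _).
have mE : measurable_fun (`]0, 2[%classic : set R) (fun t => t `^ b * Ek t y).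
  apply: measurable_open_itv => t /andP[t0 _]; apply: continuousM; first by apply: continuous_powR => //; exact: cvg_id.
  apply: continuousM; first by apply: continuous_powR => //; exact: cvg_id.
  apply: (@continuous_comp _ _ _ (fun t => - (y ^+ 2 / (16 * t))) expR); last exact: continuous_expR.
  apply: cvgN; apply: cvgM; first exact: cvg_cst.
  apply: cvgV; first by rewrite mulf_neq0// gt_eqF.
  by apply: cvgM; [exact: cvg_cst|exact: cvg_id].
have IE : Intg `]0, 2[%classic (fun t => t `^ b * Ek t y).
  apply: (@integrable_dom R _ _ (fun t => c * f t)) => //; last exact: integrable_scale.
  move=> t /=; rewrite in_itv /= => /andP[t0 _]; rewrite ger0_norm ?le//.
  by rewrite mulr_ge0 ?powR_ge0 ?Ek_ge0.
split=> //; apply: (@le_trans _ _ (Rint `]0, 2[%classic (fun t => c * f t))).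
  apply: Rint_le => //; first exact: integrable_scale.
  by move=> t /=; rewrite in_itv /= => /andP[t0 _]; exact: le.
rewrite RintZ// -[leRHS]mulrA ler_wpM2l ?(ltW cp)//.
by rewrite (_ : 2 * b - 1 = - r)// /r; lra.
Qed.

Lemma Rint_mkcond (D : set R) (f : R -> R) : measurable D -> Rint D f = Rint [set: R] (f \_ D).
Proof. by move=> mD; rewrite /Rintegral integral_mkcond; congr fine; apply: eq_integral => x _; rewrite restrict_EFin. Qed.

Lemma time_reflect (h k : R -> R) (T t : R) : 0 <= t <= T -> (forall s, s <= 0 -> h s = 0) ->
  Intg `]0, T[%classic (fun u => h (t - u) * k u) ->
  Rint `[0, t]%classic (fun s => h s * k (t - s)) = Rint `]0, T[%classic (fun u => h (t - u) * k u).
Proof.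
move=> /andP[t0 tT] h0 I.
pose P := (fun u => h (t - u) * k u) \_ `]0, T[%classic.
have IP : Intg [set: R] P.
  have := (@integrable_mkcond _ _ R mu _ (EFin \o (fun u => h (t - u) * k u)) (measurable_itv `]0, T[)).1 I.
  by rewrite restrict_EFin.
have n1 : -1 != 0 :> R by rewrite oppr_eq0 oner_neq0.
have [IQ e] := Rint_affine t n1 IP.
have Q s : P (-1 * s + t) = ((fun s => h s * k (t - s)) \_ `]0, t[%classic) s.
  rewrite mulN1r addrC /P !patchE !mem_setE !in_itv /= subKr subr_gt0.
  have [st|st] := ltP s t; rewrite ?andbT ?andbF //=.
  case: (ltP 0 s) => s0.
    by rewrite (_ : t - s < T = true)//; apply/idP; lra.
  by rewrite h0 ?mul0r//; case: ifP.
have m : measurable_fun `]0, t[%classic (fun s => h s * k (t - s)).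
  apply/(measurable_restrictT _ (measurable_itv _)).
  by have := integrable_measurable IQ; congr measurable_fun; apply/funext => s; rewrite Q.
rewrite Rint_itv_cc// (Rint_mkcond _ (measurable_itv `]0, t[)).
rewrite [X in _ = X](Rint_mkcond _ (measurable_itv `]0, T[)).
rewrite normrN1 invr1 mul1r in e; rewrite -e; congr Rintegral; apply/funext => s; exact/esym/Q.
Qed.

End LineHeat.

Section Convolution.
Context {R : realType} {m : nat}.
Hypothesis m0 : (0 < m)%N.
Implicit Types (y x w : 'rV[R]_m) (t s z K C M : R) (j : 'I_m) (o : option 'I_m) (f g : 'rV[R]_m -> R).
Local Notation qK := (@qK R m).
Local Notation qK_half := (@qK_half R m).
Local Notation qK_ge0 := (@qK_ge0 R m).
Local Notation mu := (@lebesgue_measure R).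
Local Notation Intg D f := (mu.-integrable (D : set R) (EFin \o (f : R -> R))).
Local Notation Rint := (@Rintegral _ _ R mu).

Lemma continuous_reflect (f : 'rV[R]_m -> R) x : continuous f -> continuous (fun y => f (x - y)).
Proof.
move=> cf; apply: (@continuous_vcomp R 'rV[R]_m 'rV[R]_m (fun y => x - y)) => //.
apply: continuous_rV => j; under eq_fun do rewrite !mxE.
by apply: continuous_add; [exact: cst_continuous|apply: continuous_opp; exact: coord_continuous].
Qed.

Lemma G_reflect o f C x z : 0 < z -> dom qK C f -> G o f x z = iintR (fun y => kk o (x - y) z * f y).
Proof.
move=> z0 df; rewrite /G -(iintR_reflect qK_half x (G_dom o x z0 (lexx z) df)).
by congr iintR; apply/funext => y; rewrite subKr.
Qed.

Lemma G_continuous o f C z : 0 < z -> dom qK C f -> continuous (fun x => G o f x z).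
Proof.
move=> z0 df x; apply: cvg_of_seq => u cu; rewrite (G_reflect o x z0 df).
rewrite (_ : (fun n => G o f (u n) z) = (fun n => iintR (fun y => kk o (u n - y) z * f y))); last first.
  by apply/funext => n; rewrite (G_reflect o (u n) z0 df).
have d v : dom qK (@kb R m z * C) (fun y => kk o (v - y) z * f y).
  apply: dom_mul df; last by move=> y; exact: (kk_kb o (v - y) z0 (lexx z)).
  exact: (@continuous_reflect (fun y => kk o y z) v (@kk_continuous R m o z z0)).
apply: (iintR_dct qK_half (fun n => d (u n)) (d x)) => y.
apply: cvgM; last exact: cvg_cst.
apply: (@continuous_seq R 'rV[R]_m (fun y => kk o y z) (fun n => u n - y) (x - y) (@kk_continuous R m o z z0 _)).
by apply: cvgB => //; exact: cvg_cst.
Qed.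

Definition conv f g x : R := iintR (fun y => f y * g (x - y)).

Lemma conv_reflect K C f g x : dom qK K f -> dom qK C g ->
  conv f g x = iintR (fun y => f (x - y) * g y).
Proof.
move=> df dg; rewrite /conv -(iintR_reflect qK_half x (conv_dom x df dg)).
by congr iintR; apply/funext => y; rewrite subKr.
Qed.

Let qh : R := qK / 2.
Let qh_half : 1 / 2 < qh.
Proof. by rewrite /qh /qK; have : 2 <= m.+1%:R :> R; [rewrite ler_nat|lra]. Qed.
Let qh_ge0 : 0 <= qh := wt_gt_half_ge0 qh_half.

Let Wt_sqr y : Wt qK y = Wt qh y * Wt qh y.
Proof.
rewrite /Wt -big_split /=; apply: eq_bigr => j _; rewrite /wt -powRD.
  by congr (_ `^ _); rewrite /qh; lra.
by apply/implyP => _; rewrite gt_eqF// wt_base_gt0.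
Qed.

(* The swap is done with half of the decay exponent, the other half being used up
   by Peetre's inequality. *)
Lemma G_conv o K C f g x z : 0 < z -> dom qK K f -> dom qK C g ->
  iintR (fun xi => G o f (x - xi) z * g xi) = G o (conv f g) x z.
Proof.
move=> z0 df dg; pose F (xi y : 'rV[R]_m) := kk o y z * f (x - xi - y) * g xi.
have K0 := dom_ge0 df; have C0 := dom_ge0 dg; have k0 : 0 <= @kb R m z.
  by apply: le_trans (normr_ge0 _) (kk_kb o 0 z0 (lexx z)).
pose P := (2 `^ qh) ^+ m : R; have P0 : 0 <= P by rewrite exprn_ge0// powR_ge0.
have x0 := Wt_gt0 qh x.
pose B := @kb R m z * K * C * P * (P / Wt qh x).
have B0 : 0 <= B by rewrite !mulr_ge0// invr_ge0 ltW.
have hF xi y : `|F xi y| <= B * Wt qh xi * Wt qh y.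
  have h1 := Wt_peetre xi (x - y) qh_ge0.
  rewrite -(Wt_opp _ (xi - (x - y))) opprB addrAC in h1.
  have h2 := Wt_peetre x y qh_ge0.
  set v := x - xi - y in h1 *.
  have h3 : Wt qh (x - y) <= P / Wt qh x * Wt qh y by rewrite mulrAC ler_pdivlMr// mulrC.
  have v1 : Wt qK v <= Wt qh v.
    by rewrite Wt_sqr ler_piMr ?Wt_ge0 ?Wt_le1.
  rewrite /F normrM normrM -/v.
  have a1 : `|f v| <= K * Wt qh v by apply: le_trans (df.2 v) _; rewrite ler_wpM2l.
  have a2 := dg.2 xi; rewrite Wt_sqr in a2.
  apply: (@le_trans _ _ (@kb R m z * (K * Wt qh v) * (C * (Wt qh xi * Wt qh xi)))).
    by apply: ler_pM => //; apply: ler_pM => //; exact: (kk_kb o y z0 (lexx z)).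
  have -> : @kb R m z * (K * Wt qh v) * (C * (Wt qh xi * Wt qh xi)) =
    @kb R m z * K * C * Wt qh xi * (Wt qh xi * Wt qh v) by ring.
  have -> : B * Wt qh xi * Wt qh y = @kb R m z * K * C * Wt qh xi * (P * (P / Wt qh x * Wt qh y)) by rewrite /B; ring.
  rewrite ler_wpM2l ?mulr_ge0 ?Wt_ge0//; apply: le_trans h1 _.
  by rewrite ler_wpM2l.
have d1 xi : dom qh (B * Wt qh xi) (F xi).
  split; last exact: hF.
  apply: continuous_mul; last exact: cst_continuous.
  by apply: continuous_mul; [exact: kk_continuous|apply: continuous_reflect; exact: df.1].
have d2 y : dom qh (B * Wt qh y) (F ^~ y).
  split; last by move=> xi; rewrite mulrAC; exact: hF.
  apply: continuous_mul; last exact: dg.1.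
  apply: continuous_mul; first exact: cst_continuous.
  rewrite (_ : (fun xi => f (x - xi - y)) = (fun xi => f (x - y - xi))); last first.
    by apply/funext => xi; rewrite addrAC.
  by apply: continuous_reflect; exact: df.1.
transitivity (iintR (fun xi => iintR (F xi))).
  congr iintR; apply/funext => xi; rewrite mulrC -(iintR_scale qK_half _ (G_dom o (x - xi) z0 (lexx z) df)).
  by congr iintR; apply/funext => y; rewrite mulrC.
rewrite (iintR_swap qh_half B0 d1 d2); congr iintR; apply/funext => y.
rewrite (conv_reflect (x - y) df dg).
have dc : dom qK (C * (K * Px (x - y))) (fun xi => f (x - y - xi) * g xi).
  have [c1 b1] := dom_refl (x - y) df.
  split; first by apply: continuous_mul => //; exact: dg.1.
  move=> xi; rewrite normrM mulrC -mulrA; apply: ler_pM => //.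
    by apply: le_trans (dg.2 xi) _; rewrite ler_piMr ?Wt_le1.
rewrite -(iintR_scale qK_half _ dc); congr iintR; apply/funext => xi.
by rewrite /F mulrA addrAC.
Qed.

Lemma conv_gky C g t j : 0 < t -> Cd 2 C g -> conv (gky j t) g = partial j (U g t) .
Proof.
move=> t0 cg; have [K cK] := gk_Cd m0 t0; have dK := Cd_dom cK.
have [e1 p1] := partial_of_line (gk_is_derive_y j t).
have dK1 := Cd_dom (Cd_partial j cK); rewrite e1 in dK1.
rewrite (U_partial j (ltW t0) (Cd_pred cg)).1; apply/funext => x.
by rewrite -(H_U x t0 (Cd_dom (Cd_partial j cg))) /conv (conv_ibp x dK dK1 (gk_is_derive_y j t) (Cd_pred cg)).
Qed.

Lemma conv_gk C g t : 0 < t -> dom qK C g -> conv (@gk R m t) g = U g t.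
Proof. by move=> t0 dg; apply/funext => x; rewrite -(H_U x t0 dg). Qed.

Lemma dom_prod_bounded C M f g : continuous f -> (forall y, `|f y| <= M) -> dom qK C g ->
  dom qK (M * C) (fun y => f y * g y).
Proof. by move=> cf fM dg; exact: dom_mul cf fM dg. Qed.

Lemma dec_le1 x z : dec x z <= 1.
Proof.
have b : 1 <= 1 + rr x z by rewrite lerDl rr_ge0.
rewrite /dec powRN invf_le1 ?powR_gt0 ?(lt_le_trans ltr01 b)//.
apply: (@le_trans _ _ (1 `^ (m%:R / 2))); first by rewrite powR1.
by apply: powR_mono => //; rewrite divr_ge0.
Qed.

Lemma G_bounded o K f x z : 0 < z -> Cd 1 K f -> `|G o f x z| <= @gA R m * K.
Proof.
move=> z0 cf; apply: le_trans (G_dec m0 o x z0 cf) _; rewrite ler_piMr ?mulr_ge0 ?(Cd_ge0 cf) ?addr_ge0 ?tA_ge0 ?nA_ge0//.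
exact: dec_le1.
Qed.

(* The boundary trace [G o f x 0+]. *)
Definition kT o f x : R := trace0 (G o f x) (Dz o f x).

Section Trace.
Context (f : 'rV[R]_m -> R) (C : R).
Hypothesis cf : Cd 2 C f.

Let DM : R := m%:R * @gA R m * C.

Lemma Dz_bounded o x z : 0 < z -> `|Dz o f x z| <= DM.
Proof.
move=> z0; apply: le_trans (Dz_dec m0 o x z0 cf) _; rewrite ler_piMr ?dec_le1//.
by rewrite !mulr_ge0 ?(Cd_ge0 cf) ?addr_ge0 ?tA_ge0 ?nA_ge0.
Qed.

Lemma G_derive o x z : 0 < z -> is_derive z 1 (G o f x) (Dz o f x z).
Proof. by move=> z0; exact: G_is_derive (Cd_pred cf). Qed.

Lemma Dz_continuous o x z : 0 < z -> {for z, continuous (Dz o f x)}.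
Proof. by move=> z0; exact: is_derive_continuous (Dz_is_derive o x z0 cf). Qed.

Lemma kT_diff o x z : 0 < z <= 1 -> `|G o f x z - kT o f x| <= DM * z.
Proof. by apply: trace0_diff; [exact: G_derive|exact: Dz_continuous|exact: Dz_bounded]. Qed.

Lemma Dz_integrable o x (a b : R) : 0 <= a -> Intg `]a, b[%classic (Dz o f x).
Proof.
move=> a0; apply: (@integrable_bounded_itv R _ a b DM) => z /andP[az _].
  by apply: Dz_continuous; exact: le_lt_trans az.
by apply: Dz_bounded; exact: le_lt_trans az.
Qed.

End Trace.

Lemma kT_bound o f C C' x : Cd 2 C' f -> Cd 1 C f -> `|kT o f x| <= @gA R m * C * dec x 0.
Proof.
move=> cf2 cf1.
apply: (@trace0_bound R _ _ (m%:R * @gA R m * C')).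
- by move=> z; exact: G_derive cf2 o x z.
- by move=> z z0; exact: Dz_continuous cf2 o x z z0.
- by move=> z z0; exact: Dz_bounded.
move=> z /andP[z0 _].
apply: le_trans (G_dec m0 o x z0 cf1) _.
rewrite ler_wpM2l ?mulr_ge0 ?(Cd_ge0 cf1) ?addr_ge0 ?tA_ge0 ?nA_ge0//.
by apply: dec_mono => //; exact: ltW.
Qed.

Lemma kT_lin o f g (a b C C' : R) x : Cd 2 C f -> Cd 2 C' g ->
  (forall j, partial j (fun y => a * f y + b * g y) = fun y => a * partial j f y + b * partial j g y) ->
  kT o (fun y => a * f y + b * g y) x = a * kT o f x + b * kT o g x.
Proof.
move=> cf cg hp; rewrite /kT /trace0 (G_lin o a b x ltr01 (Cd_dom cf) (Cd_dom cg)).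
have e z : 0 < z -> Dz o (fun y => a * f y + b * g y) x z = a * Dz o f x z + b * Dz o g x z.
  move=> z0; have L j o' := G_lin o' a b x z0 (Cd_dom (Cd_partial j cf)) (Cd_dom (Cd_partial j cg)).
  case: o => [j|] /=; first by rewrite hp L.
  rewrite !mulrN -opprD !mulr_sumr -big_split /=; congr (- _); apply: eq_bigr => j _.
  by rewrite hp L.
rewrite (@Rint_eq _ _ _ (fun z => a * Dz o f x z + b * Dz o g x z)); last first.
  by move=> z /=; rewrite in_itv /= => /andP[z0 _]; exact: e.
have I1 := Dz_integrable cf o x 1 (lexx 0); have I2 := Dz_integrable cg o x 1 (lexx 0).
rewrite RintD ?RintZ//; last 2 first.
- exact: integrable_scale.
- exact: integrable_scale.
move: (Rint _ (Dz o f x)) (Rint _ (Dz o g x)) (G o f x 1) (G o g x 1) => p r s t.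
by ring.
Qed.

End Convolution.

Section Kernel.
Context {R : realType} {m : nat}.
Hypothesis m0 : (0 < m)%N.
Implicit Types (y x : 'rV[R]_m) (t s z K C M kap : R) (j : 'I_m) (o : option 'I_m) (f g : 'rV[R]_m -> R).
Local Notation qK := (@qK R m).
Local Notation qK_half := (@qK_half R m).
Local Notation qK_ge0 := (@qK_ge0 R m).
Local Notation mu := (@lebesgue_measure R).
Local Notation Intg D f := (mu.-integrable (D : set R) (EFin \o (f : R -> R))).
Local Notation Rint := (@Rintegral _ _ R mu).

Lemma hk1_bounded t : 0 < t -> exists2 M, 0 < M & forall s, `|@hk1 R t s| <= M.
Proof.
move=> t0; have c0 : 0 < (4 * t)^-1 by rewrite invr_gt0 mulr_gt0.
have [K K0 hK] := @expR_poly R 1 _ ler01 c0.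
pose c := (4 * pi * t) `^ (- (1 / 2)) : R; have c1 : 0 < c by rewrite powR_gt0// !mulr_gt0// pi_gt0.
exists ((2 * t)^-1 * c * K) => [|s]; first by rewrite !mulr_gt0// invr_gt0 mulr_gt0.
rewrite /hk1 /hk !normrM normrN normrM (ger0_norm (expR_ge0 _)) -/c (gtr0_norm c1).
rewrite [X in _ * X * _]gtr0_norm ?invr_gt0 ?mulr_gt0//.
have h := hK _ (sqr_ge0 s); rewrite powRr1 ?addr_ge0 ?sqr_ge0// in h.
have i0 : 0 < (2 * t)^-1 by rewrite invr_gt0 mulr_gt0.
rewrite [s ^+ 2 / _]mulrC; set e := expR _ in h *; have e0 : 0 <= e by exact: expR_ge0.
have -> : `|s| * (2 * t)^-1 * (c * e) = (2 * t)^-1 * c * (`|s| * e) by ring.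
rewrite ler_wpM2l ?mulr_ge0 ?(ltW i0) ?(ltW c1)//; apply: le_trans h; rewrite ler_wpM2r//.
by rewrite -[s ^+ 2]real_normK ?num_real//; have := sqr_ge0 (`|s| - 1); nra.
Qed.

Definition An o kap f x : R := - 2 * (o == None)%:R * f x - 4 * kap * kT o f x.
Definition Kn o kap f t x z : R := hk1 t z * An o kap f x -
  4 * kap * Rint `]0, z[%classic (fun s => hk1 t (z - s) * Dz o f x s).

Lemma G_slice_continuous o f C x s : 0 < s -> dom qK C f -> continuous (fun xi : 'rV[R]_m => G o f (x - xi) s).
Proof. by move=> s0 df; have h := @continuous_reflect R m _ x (G_continuous (o := o) s0 df); exact: h. Qed.

Lemma Dz_slice_dom o K f C g x s : 0 < s -> Cd 2 K f -> dom qK C g ->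
  dom qK (m%:R * @gA R m * K * C) (fun xi => Dz o f (x - xi) s * g xi).
Proof.
move=> s0 cf dg; apply: dom_prod_bounded => //; last by move=> xi; exact: Dz_bounded.
have cG o' j : continuous (fun xi : 'rV[R]_m => G o' (partial j f) (x - xi) s).
  exact: G_slice_continuous (Cd_dom (Cd_partial j cf)).
case: o => [j|]; first exact: cG.
by apply: continuous_opp; apply: continuous_fsum => j; exact: cG.
Qed.

Section Heated.
Context (t : R) (g : 'rV[R]_m -> R) (C : R).
Hypotheses (t0 : 0 < t) (cg : Cd 2 C g).

Lemma Dz_conv o x s : 0 < s -> iintR (fun xi => Dz o (@gk R m t) (x - xi) s * g xi) = Dz o (U g t) x s.
Proof.
move=> s0; have [K cK] := gk_Cd m0 t0; have dg := Cd_dom cg.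
have h o' j : iintR (fun xi => G o' (partial j (@gk R m t)) (x - xi) s * g xi) = G o' (partial j (U g t)) x s.
  rewrite (G_conv m0 o' x s0 (Cd_dom (Cd_partial j cK)) dg) -(conv_gky m0 j t0 cg).
  by rewrite (partial_of_line (gk_is_derive_y j t)).1.
case: o => [j|]; first exact: h.
have d j : dom qK (@gA R m * K * C) (fun xi => G (Some j) (partial j (@gk R m t)) (x - xi) s * g xi).
  apply: dom_prod_bounded => //; last by move=> xi; exact: (G_bounded m0 _ _ s0 (Cd_partial j cK)).
  exact: G_slice_continuous (Cd_dom (Cd_partial j cK)).
transitivity (iintR (fun xi => - \sum_(j < m) G (Some j) (partial j (@gk R m t)) (x - xi) s * g xi)).
  by congr iintR; apply/funext => xi; rewrite /= mulNr mulr_suml.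
rewrite (iintR_opp qK_half (dom_sum (index_enum 'I_m) d)) (iintR_sum qK_half _ d) /=.
by congr (- _); apply: eq_bigr => j _; rewrite h.
Qed.

Lemma Rint_Dz_conv o x (w : R -> R) (b M : R) : continuous w -> (forall s, `|w s| <= M) ->
  (exists K, dom qK K (fun xi => Rint `]0, b[%classic (fun s => w s * Dz o (@gk R m t) (x - xi) s) * g xi)) /\
  iintR (fun xi => Rint `]0, b[%classic (fun s => w s * Dz o (@gk R m t) (x - xi) s) * g xi) =
  Rint `]0, b[%classic (fun s => w s * Dz o (U g t) x s).
Proof.
move=> cw wM; have [K cK] := gk_Cd m0 t0; have dg := Cd_dom cg.
pose a := M * (m%:R * @gA R m * K * C).
pose D := `]0, b[%classic : set R; have mD : measurable D by exact: measurable_itv.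
have Ia : Intg D (fun=> a) by apply: integrable_cst_itv; exact: itv_mu_fin.
pose F (s : R) (xi : 'rV[R]_m) := w s * (Dz o (@gk R m t) (x - xi) s * g xi).
have mF xi : measurable_fun D (F ^~ xi).
  apply: measurable_open_itv => s /andP[s0 _]; apply: continuousM; first exact: cw.
  by apply: continuousM; [exact: Dz_continuous cK _ _ s s0|exact: cst_continuous].
have dF s : D s -> dom qK a (F s).
  rewrite /D /= in_itv /= => /andP[s0 _].
  have [c1 b1] := Dz_slice_dom o x s0 cK dg.
  split; first by apply: continuous_mul => //; exact: cst_continuous.
  move=> xi; rewrite normrM /a -mulrA; apply: ler_pM => //; exact: b1.
have e : (fun xi => Rint D (fun s => w s * Dz o (@gk R m t) (x - xi) s) * g xi) = (fun xi => Rint D (F ^~ xi)).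
  apply/funext => xi; rewrite mulrC -RintZ//.
    by apply: Rint_eq => s _; rewrite /F mulrCA [_ * g xi]mulrC.
  apply: (@integrable_bounded_itv R _ 0 b (M * (m%:R * @gA R m * K))) => s /andP[s0 _].
    by apply: continuousM; [exact: cw|exact: Dz_continuous cK _ _ s s0].
  by rewrite normrM ler_pM//; exact: Dz_bounded.
rewrite -/D e; split; first by exists (Rint D (fun=> a)); exact: (dom_Rint qK_half mD Ia mF dF).
rewrite -(Rint_iintR_swap qK_half mD Ia mF dF); apply: Rint_eq => s.
rewrite /D /= in_itv /= => /andP[s0 _].
by rewrite /F (iintR_scale qK_half _ (Dz_slice_dom o x s0 cK dg)) Dz_conv.
Qed.

Lemma Kn_conv o kap x z (c : R) :
  iintR (fun xi => Kn o kap (@gk R m t) t (x - xi) z * (g xi * c)) = c * Kn o kap (U g t) t x z.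
Proof.
have [K cK] := gk_Cd m0 t0; have dg := Cd_dom cg; have dK := Cd_dom cK.
have [M M0 hM] := hk1_bounded t0.
have cw : continuous (fun s => @hk1 R t (z - s)).
  by apply: (@continuous_fcomp R _ (fun s : R => z - s) (@hk1 R t)); [move=> s; apply: cvgB; [exact: cvg_cst|exact: cvg_id]|exact: hk1_continuous].
have [[K1 d1] e1] := @Rint_Dz_conv o x _ z M cw (fun s => hM _).
have c1 : continuous (fun _ : R => 1 : R) by exact: cst_continuous.
have b1 (s : R) : `|1| <= 1 :> R by rewrite normr1.
have [[K2 d2] e2] := @Rint_Dz_conv o x _ 1 1 c1 b1.
have one f y : Rint `]0, 1[%classic (fun s => 1 * Dz o f y s) = Rint `]0, 1[%classic (Dz o f y).
  by apply: Rint_eq => s _; rewrite mul1r.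
have d3 : dom qK (@gA R m * K * C) (fun xi => G o (@gk R m t) (x - xi) 1 * g xi).
  apply: dom_prod_bounded => //; last by move=> xi; exact: (G_bounded m0 _ _ ltr01 (Cd_pred cK)).
  exact: G_slice_continuous dK.
have e3 := G_conv m0 o x ltr01 dK dg; rewrite (conv_gk t0 dg) in e3.
have [K4 d4] : exists K4, dom qK K4 (fun xi => gk t (x - xi) * g xi).
  have [c4 _] := dom_refl x dK; exists (K * C); apply: dom_prod_bounded => // y.
  by apply: le_trans (dK.2 _) _; rewrite ler_piMr ?Wt_le1// (dom_ge0 dK).
have e4 : iintR (fun xi => gk t (x - xi) * g xi) = U g t x.
  by rewrite -(conv_reflect x dK dg) (conv_gk t0 dg).
pose a4 := c * hk1 t z * (- 2 * (o == None)%:R); pose a3 := - (4 * kap * c * hk1 t z).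
pose a1 := - (4 * kap * c); pose a2 := 4 * kap * c * hk1 t z.
transitivity (iintR (fun xi => a4 * (gk t (x - xi) * g xi) + a3 * (G o (@gk R m t) (x - xi) 1 * g xi) +
   a2 * (Rint `]0, 1[%classic (fun s => 1 * Dz o (@gk R m t) (x - xi) s) * g xi) +
   a1 * (Rint `]0, z[%classic (fun s => hk1 t (z - s) * Dz o (@gk R m t) (x - xi) s) * g xi))).
  congr iintR; apply/funext => xi; rewrite one /Kn /An /kT /trace0 /a1 /a2 /a3 /a4.
  move: (Rint _ _) (Rint _ _) (G _ _ _ _) (gk _ _) (hk1 _ _) => u1 u2 u3 u4 u5; ring.
have s4 := dom_scale a4 d4; have s3 := dom_scale a3 d3; have s2 := dom_scale a2 d2; have s1 := dom_scale a1 d1.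
rewrite (iintR_add qK_half (dom_add (dom_add s4 s3) s2) s1) (iintR_add qK_half (dom_add s4 s3) s2).
rewrite (iintR_add qK_half s4 s3) (iintR_scale qK_half a4 d4) (iintR_scale qK_half a3 d3).
rewrite (iintR_scale qK_half a2 d2) (iintR_scale qK_half a1 d1) e1 e2 e3 e4 one.
rewrite /Kn /An /kT /trace0 /a1 /a2 /a3 /a4.
move: (Rint _ _) (Rint _ _) (G _ _ _ _) (U _ _ _) (hk1 _ _) => u1 u2 u3 u4 u5; ring.
Qed.

End Heated.

Lemma vec_decomp (x : 'rV[R]_m.+1) : x = emb (xprime x) (xlast x).
Proof.
apply/rowP => i; rewrite mxE; case: unliftP => [j ->|->]//.
by rewrite mxE; congr (x 0 _); apply: val_inj => /=; rewrite /bump leqNgt ltn_ord.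
Qed.

Lemma xlast_emb x z : xlast (emb x z) = z.
Proof. by rewrite /xlast mxE unlift_none. Qed.

Lemma widen_lift j : widen_ord (leqnSn m) j = lift ord_max j.
Proof. by apply: val_inj => /=; rewrite /bump leqNgt ltn_ord. Qed.

Lemma xprime_emb x z : xprime (emb x z) = x.
Proof. by apply/rowP => j; rewrite !mxE widen_lift liftK. Qed.

Lemma emb_sub x y z s : emb x z - emb y s = emb (x - y) (z - s).
Proof. by apply/rowP => i; rewrite !mxE; case: unlift => [j|]; rewrite ?mxE. Qed.

Lemma emb_normal x z s : emb x z + s *: unitv R ord_max = emb x (z + s).
Proof.
apply/rowP => i; rewrite !mxE; case: unliftP => [j ->|->].
  by rewrite (negbTE (neq_lift _ _)) mulr0 addr0.
by rewrite eqxx mulr1.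
Qed.

Lemma emb_tangential x z s j : emb x z + s *: unitv R (lift ord_max j) = emb (x + s *: unitv R j) z.
Proof.
apply/rowP => i; rewrite !mxE; case: unliftP => [k ->|->]; last by rewrite eq_sym (negbTE (neq_lift _ _)) mulr0 addr0.
by rewrite !mxE (inj_eq lift_inj).
Qed.

Lemma enorm_emb x z : enorm (emb x z) ^+ 2 = rr x z.
Proof.
rewrite /enorm sqr_sqrtr; last by apply: sumr_ge0 => i _; exact: sqr_ge0.
rewrite big_ord_recr /= /rr /sq; congr (_ + _); last by rewrite mxE unlift_none.
apply: eq_bigr => j _; rewrite mxE (_ : widen_ord _ j = lift ord_max j) ?liftK//.
by apply: val_inj => /=; rewrite /bump leqNgt ltn_ord.
Qed.

Lemma GamE x z t : 0 < t -> Gam (emb x z) t = hk t z * gk t x.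
Proof.
move=> t0; rewrite /Gam t0 enorm_emb /rr /hk /gk mulrACA -powRD; last first.
  by apply/implyP => _; rewrite gt_eqF// !mulr_gt0// pi_gt0.
rewrite -expRD; congr (_ `^ _ * expR _); last by rewrite mulrDl opprD addrC.
by rewrite -[m.+1%:R]natr1; lra.
Qed.

Lemma partial_normal (F : 'rV[R]_m.+1 -> R) x z l :
  is_derive z 1 (fun s => F (emb x s)) l -> partial ord_max F (emb x z) = l /\ has_partial ord_max F (emb x z).
Proof.
move=> d; apply: partial_eq; under eq_fun do rewrite emb_normal.
have d0 : is_derive (0 : R) 1 (fun s : R => z + s) (0 + 1) := is_derive_fadd (is_derive_fcst z 0) (is_derive_fid 0).
have d' : is_derive (z + 0) 1 (fun s => F (emb x s)) l by rewrite addr0.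
by have := is_derive_fcomp d' d0; rewrite add0r mulr1.
Qed.

Lemma partial_tangential (F : 'rV[R]_m.+1 -> R) x z j l :
  is_derive (0 : R) 1 (fun s : R => F (emb (x + s *: unitv R j) z)) l ->
  partial (lift ord_max j) F (emb x z) = l /\ has_partial (lift ord_max j) F (emb x z).
Proof. by move=> d; apply: partial_eq; under eq_fun do rewrite emb_tangential. Qed.

Lemma dnGamE x z t : 0 < t -> dnGam (emb x z) t = hk1 t z * gk t x.
Proof.
move=> t0; apply: (partial_normal _).1.
under eq_fun do rewrite GamE//.
by have := is_derive_fmul (hk_is_derive t z) (is_derive_fcst (gk t x) z); rewrite mulr0 addr0.
Qed.

(* The constant in [d_i E = kappa x_i |x|^(-n)]. *)
Definition kappa : R :=
  if (3 <= m.+1)%N then (m.+1%:R * (m.+1%:R - 2) * volB1 R m)^-1 * (2 - m.+1%:R) else - (2 * pi)^-1.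

Definition Eprof (r : R) : R :=
  if (3 <= m.+1)%N then (m.+1%:R * (m.+1%:R - 2) * volB1 R m)^-1 * r `^ ((2 - m.+1%:R) / 2)
  else - (2 * pi)^-1 * (ln r / 2).

Lemma EfundE x z : 0 < z -> Efund (emb x z) = Eprof (rr x z).
Proof.
move=> z0; have r0 := rr_gt0 x z0; rewrite /Efund /Eprof.
have -> : enorm (emb x z) = rr x z `^ (1 / 2).
  by rewrite -enorm_emb -powR_mulrn ?sqrtr_ge0// -powRrM (_ : 2%:R * (1 / 2) = 1) ?powRr1 ?sqrtr_ge0//; lra.
case: ifP => _; first by rewrite -powRrM; congr (_ * _ `^ _); lra.
by rewrite ln_powR; congr (_ * _); lra.
Qed.

Lemma Eprof_is_derive (r : R) : 0 < r -> is_derive r 1 Eprof (kappa / 2 * r `^ (- @pp R m)).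
Proof.
move=> r0; rewrite /Eprof /kappa; case: ifP => m3.
  apply: (is_derive_eq (is_derive_fscale _ (@is_derive_fpowR R id _ r _ r0 (is_derive_fid r)))).
  rewrite (_ : (2 - m.+1%:R) / 2 - 1 = - @pp R m); last by rewrite /pp; lra.
  by move: (_^-1) (r `^ _) => u v; field.
have m1 : m = 1%N by apply/eqP; rewrite eqn_leq m0 -ltnS leqNgt m3.
have d := is_derive_fmul (is_derive1_ln r0) (is_derive_fcst (1 / 2) r).
rewrite (_ : (fun r : R => _) = (fun r => - (2 * pi)^-1 * (ln r * (1 / 2)))); last first.
  by apply/funext => s; congr (_ * _); lra.
apply: (is_derive_eq (is_derive_fscale _ d)).
rewrite /pp m1 (_ : 2%:R / 2 = 1) ?powR_inv1 ?(ltW r0)//; last by rewrite divff.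
by rewrite mulr0 addr0; lra.
Qed.

Lemma dEE (i : 'I_m.+1) x z : 0 < z -> dE i (emb x z) = kappa * kk (unlift ord_max i) x z.
Proof.
move=> z0; have r0 := rr_gt0 x z0; case: unliftP => [j ->|->] /=.
  apply: (partial_tangential _).1.
  under eq_fun do rewrite EfundE//.
  have d1 : is_derive (0 : R) 1 (fun s : R => rr (x + s *: unitv R j) z) (2 * x 0 j).
    rewrite /rr; under eq_fun do rewrite sq_line.
    have d3 := is_derive_fmul (is_derive_fscale 2 (is_derive_fid 0)) (is_derive_fcst (x 0 j) 0).
    have d5 := is_derive_fadd (is_derive_fadd (is_derive_fadd (is_derive_fcst (sq x) 0) d3) (is_derive_fsqr (is_derive_fid 0))) (is_derive_fcst (z ^+ 2) 0).
    by apply: (is_derive_eq d5); ring.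
  have r00 : 0 < rr (x + 0 *: unitv R j) z by rewrite scale0r addr0.
  apply: (is_derive_eq (@is_derive_fcomp R Eprof (fun s => rr (x + s *: unitv R j) z) 0 _ _ (Eprof_is_derive r00) d1)).
  by rewrite scale0r addr0 /kk /=; lra.
apply: (partial_normal _).1.
have d1 : is_derive z 1 (rr x) (2 * z).
  have := is_derive_fadd (is_derive_fcst (sq x) z) (is_derive_fsqr (is_derive_fid z)).
  by rewrite add0r mulr1.
have d2 := @is_derive_fcomp R Eprof (rr x) z _ _ (Eprof_is_derive r0) d1.
have d3 : is_derive z 1 (fun s => Efund (emb x s)) (kappa / 2 * rr x z `^ (- @pp R m) * (2 * z)).
  by apply: is_derive_ext d2; near=> s; rewrite EfundE//; near: s; exact: lt_nbhsr.
by apply: (is_derive_eq d3); rewrite /kk /=; move: (rr x z `^ _) => u; field.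
Unshelve. all: by end_near.
Qed.



Lemma Rint_cc_eq (f k : R -> R) (a b : R) : (forall s, a < s < b -> f s = k s) ->
  (forall s, a < s < b -> {for s, continuous k}) ->
  Rint `[a, b]%classic f = Rint `]a, b[%classic k.
Proof.
move=> fk ck; have mk := measurable_open_itv ck.
have e s : `]a, b[%classic s -> f s = k s by rewrite /= in_itv /=; exact: fk.
rewrite Rint_itv_cc; first exact: Rint_eq.
by apply: eq_measurable_fun mk => s; rewrite inE => hs; exact/esym/e.
Qed.

Section Kernel0.
Context (i : 'I_m.+1) (t : R).
Hypothesis t0 : 0 < t.
Let o := unlift ord_max i.

Let sub_cont (k : R -> R) (u s : R) : continuous k -> {for s, continuous (fun s => k (u - s))}.
Proof.
move=> ck; apply: (@continuous_comp _ _ _ (fun s : R => u - s) k); last exact: ck.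
by apply: cvgB; [exact: cvg_cst|exact: cvg_id].
Qed.

Lemma CfunE x z : 0 < z ->
  Cfun i (emb x z) t = Rint `[0, z]%classic (fun s => hk1 t (z - s) * (kappa * G o (@gk R m t) x s)).
Proof.
move=> z0; have [K cK] := gk_Cd m0 t0; have dK := Cd_dom cK.
have c s : 0 < s < z -> {for s, continuous (fun s => hk1 t (z - s) * (kappa * G o (@gk R m t) x s))}.
  move=> /andP[s0 _]; apply: continuousM; first by apply: sub_cont; exact: hk1_continuous.
  apply: continuousM; first exact: cst_continuous.
  exact: is_derive_continuous (G_derive cK o x s0).
rewrite /Cfun xlast_emb /oint (ltW z0) (@Rint_cc_eq _ _ _ _ _ c).
  by rewrite Rint_itv_cc//; exact: measurable_open_itv.
move=> s /andP[s0 _].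
have dG := G_dom o x s0 (lexx s) dK.
rewrite /G mulrA -(iintR_scale qK_half _ dG); congr iintR; apply/funext => y.
by rewrite emb_sub dnGamE// dEE//; move: (kk _ _ _) (gk _ _) (hk1 _ _) => u1 u2 u3; ring.
Qed.

Lemma KtilE x z : 0 < z -> Ktil i (emb x z) t = Kn o kappa (@gk R m t) t x z.
Proof.
move=> z0; have [K cK] := gk_Cd m0 t0; have [M M0 hM] := hk1_bounded t0.
set F := G o (@gk R m t) x; set f := Dz o (@gk R m t) x.
have dL (s : R) : is_derive s 1 (fun s => hk t s - hk t 0) (hk1 t s).
  by have := is_derive_fsub (hk_is_derive t s) (is_derive_fcst (hk t 0) s); rewrite subr0.
have k0 : hk1 t 0 = 0 :> R by rewrite /hk1 mul0r oppr0 mul0r.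
have fM s : 0 < s -> `|kappa * f s| <= `|kappa| * (m%:R * @gA R m * K).
  by move=> s0; rewrite normrM ler_wpM2l//; exact: Dz_bounded.
have cf s : 0 < s -> {for s, continuous (fun s => kappa * f s)}.
  by move=> s0; apply: continuousM; [exact: cst_continuous|exact: Dz_continuous cK o x s s0].
have d := @convolution_is_derive R (fun s => hk t s - hk t 0) (hk1 t) (fun s => kappa * F s) (fun s => kappa * f s)
  _ M z z0 dL (@hk1_continuous R t) (subrr _) k0 hM
  (fun s (hs : 0 < s) => is_derive_fscale kappa (G_derive cK o x hs)) cf fM.
have d2 : is_derive z 1 (fun s => Cfun i (emb x s) t) (kappa * (hk1 t z * kT o (@gk R m t) x + Rint `]0, z[%classic (fun s => hk1 t (z - s) * f s))).
  apply: is_derive_ext (is_derive_eq d _).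
    by near=> s; rewrite CfunE//; near: s; exact: lt_nbhsr.
  have If := Dz_integrable m0 cK o x 1 (lexx 0).
  have Ih : Intg `]0, z[%classic (fun s => hk1 t (z - s) * f s).
    apply: (@integrable_bounded_itv R _ 0 z (M * (m%:R * @gA R m * K))) => s /andP[s0 _].
      by apply: continuousM; [apply: sub_cont; exact: hk1_continuous|exact: Dz_continuous cK o x s s0].
    by rewrite normrM ler_pM//; exact: Dz_bounded.
  have e2 : Rint `]0, z[%classic (fun s => hk1 t (z - s) * (kappa * f s)) = kappa * Rint `]0, z[%classic (fun s => hk1 t (z - s) * f s).
    by rewrite -(RintZ kappa (measurable_itv _) Ih); apply: Rint_eq => s _; rewrite mulrCA.
  have e1 : trace0 (fun s => kappa * F s) (fun s => kappa * f s) = kappa * kT o (@gk R m t) x.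
    by rewrite /kT /trace0 mulrBr -(RintZ kappa (measurable_itv _) If).
  by rewrite e1 e2; move: (kT _ _ _) (Rint _ _) (hk1 _ _) => u1 u2 u3; ring.
rewrite /Ktil dnGamE// (partial_normal d2).1 /Kn /An -/f.
have -> : (i == ord_max) = (o == None) by rewrite /o; case: unliftP => [j ->|->]; rewrite ?eqxx// eq_sym (negbTE (neq_lift _ _)).
by move: (Rint _ _) (kT _ _ _) (hk1 _ _) (gk _ _) => u1 u2 u3 u4; ring.
Unshelve. all: by end_near.
Qed.

Lemma Ktil_conv g C x z (c : R) : 0 < z -> Cd 2 C g ->
  iintR (fun xi => Ktil i (emb x z - emb xi 0) t * (g xi * c)) = c * Kn o kappa (U g t) t x z.
Proof.
move=> z0 cg; rewrite -(Kn_conv t0 cg); congr iintR; apply/funext => xi.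
by rewrite emb_sub subr0 KtilE.
Qed.

End Kernel0.

End Kernel.

Section Estimates.
Context {R : realType} {m : nat}.
Hypothesis m0 : (0 < m)%N.
Implicit Types (y x w : 'rV[R]_m) (t s z C M kap : R) (j : 'I_m) (o : option 'I_m) (f g : 'rV[R]_m -> R).
Local Notation qK := (@qK R m).
Local Notation qK_half := (@qK_half R m).
Local Notation qK_ge0 := (@qK_ge0 R m).
Local Notation mu := (@lebesgue_measure R).
Local Notation Intg D f := (mu.-integrable (D : set R) (EFin \o (f : R -> R))).
Local Notation Rint := (@Rintegral _ _ R mu).
Let m2 : 0 <= m%:R / 2 :> R. Proof. by rewrite divr_ge0. Qed.

Lemma dec_peetre x z s : dec x s <= 2 `^ (m%:R / 2) * ((1 + (z - s) ^+ 2) `^ (m%:R / 2) * dec x z).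
Proof.
have b1 := br_gt0 x z; have b2 := br_gt0 x s; have b3 := wt_base_gt0 (z - s).
rewrite /dec mulrA -powRM ?(ltW b3)// !powRN ler_pdivlMr ?powR_gt0// mulrC ler_pdivrMr ?powR_gt0//.
rewrite -powRM ?mulr_ge0 ?(ltW b3) ?(ltW b2)//; apply: powR_mono => //; first exact: ltW.
have r0 := sq_ge0 x; have e0 := sqr_ge0 (z - s); have e1 := sqr_ge0 s; have e2 := sqr_ge0 (z - 2 * s).
rewrite /rr; have : 0 <= (z - s) ^+ 2 * (sq x + s ^+ 2) by rewrite mulr_ge0// addr_ge0.
by nra.
Qed.

Lemma dom_dec C f x : dom qK C f -> `|f x| <= C * dec x 0.
Proof.
move=> df; have C0 := dom_ge0 df; apply: le_trans (df.2 x) _; rewrite ler_wpM2l//.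
rewrite -[leRHS]mul1r; apply: dec_mul; rewrite /rr expr0n addr0.
apply: le_trans (sq_wt_le _ x m2) _; rewrite Wt_le1// /qK -natr1.
have : 0 <= m%:R :> R by []. 
by lra.
Qed.

Lemma partial_lin (a b : R) j f g : (forall x, has_partial j f x) -> (forall x, has_partial j g x) ->
  partial j (fun y => a * f y + b * g y) = (fun y => a * partial j f y + b * partial j g y) /\
  forall x, has_partial j (fun y => a * f y + b * g y) x.
Proof.
move=> hf hg; apply: partial_of_line => y s.
by apply: is_derive_fadd; apply: is_derive_fscale; exact: partial_line.
Qed.

Lemma Cd_lin k (a b C C' : R) f g : Cd k C f -> Cd k C' g ->
  Cd k (`|a| * C + `|b| * C') (fun y => a * f y + b * g y).
Proof.
elim: k f g => [|k IH] f g cf cg.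
  by split=> //; exact: dom_add (dom_scale a (Cd_dom cf)) (dom_scale b (Cd_dom cg)).
split; first exact: dom_add (dom_scale a (Cd_dom cf)) (dom_scale b (Cd_dom cg)).
move=> j; have [e p] := partial_lin a b (@Cd_has _ _ _ _ _ j cf) (@Cd_has _ _ _ _ _ j cg).
split; first exact: p.
by rewrite e; exact: IH (Cd_partial j cf) (Cd_partial j cg).
Qed.

Lemma An_bound o kap C C' f x : Cd 2 C' f -> Cd 1 C f ->
  `|An o kap f x| <= (2 + 4 * `|kap| * @gA R m) * C * dec x 0.
Proof.
move=> c2 c1; have h1 := dom_dec x (Cd_dom c1); have h2 := kT_bound m0 o x c2 c1.
rewrite /An; apply: le_trans (ler_normB _ _) _.
rewrite [X in X + _ <= _]normrM [X in _ + X <= _]normrM.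
have -> : (2 + 4 * `|kap| * @gA R m) * C * dec x 0 = 2 * (C * dec x 0) + 4 * `|kap| * (@gA R m * C * dec x 0) by ring.
apply: lerD.
  apply: ler_pM => //; rewrite normrM normrN normr_nat; case: (_ == _); rewrite ?normr1 ?normr0; lra.
by rewrite normrM normr_nat ler_wpM2l// mulr_ge0.
Qed.

Lemma An_lin o kap (a b C C' : R) f g x : Cd 2 C f -> Cd 2 C' g ->
  An o kap (fun y => a * f y + b * g y) x = a * An o kap f x + b * An o kap g x.
Proof.
move=> cf cg; rewrite /An (@kT_lin R m m0 o f g a b C C' x cf cg).
  by move: (kT _ _ _) (kT _ _ _) => u v; ring.
by move=> j; exact: (partial_lin a b (@Cd_has _ _ _ _ _ j cf) (@Cd_has _ _ _ _ _ j cg)).1.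
Qed.

Definition Rn o kap f t x z : R := - (4 * kap) *
  (hk1 t z * trace0 (Dz o f x) (Dzz o f x) + Rint `]0, z[%classic (fun s => hk1 t (z - s) * Dzz o f x s)).
Definition dKn o kap f t x z : R := hk2 t z * An o kap f x + Rn o kap f t x z.

Lemma Dzz_continuous o C f x z : 0 < z -> Cd 3 C f -> {for z, continuous (Dzz o f x)}.
Proof.
move=> z0 cf; have c o' j : {for z, continuous (Dz o' (partial j f) x)}  := Dz_continuous (Cd_partial j cf) z0.
case: o => [j|] /=; first exact: c.
apply: continuousN; have := @cvg_sum R _ (nbhs z) 'I_m (index_enum _) predT (fun j s => Dz (Some j) (partial j f) x s) _ _ (fun j => c (Some j) j).
exact.
Qed.

Lemma Dzz_bounded o C f x z : 0 < z -> Cd 3 C f -> `|Dzz o f x z| <= m%:R * (m%:R * @gA R m) * C.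
Proof.
move=> z0 cf; apply: le_trans (Dzz_dec m0 o x z0 cf) _; rewrite ler_piMr ?dec_le1//.
by rewrite !mulr_ge0 ?(Cd_ge0 cf) ?addr_ge0 ?tA_ge0 ?nA_ge0.
Qed.

Lemma Kn_is_derive o kap C f t x z : 0 < t -> 0 < z -> Cd 3 C f ->
  is_derive z 1 (Kn o kap f t x) (dKn o kap f t x z).
Proof.
move=> t0 z0 cf; have [M M0 hM] := hk1_bounded t0.
have dL s : is_derive s 1 (fun s => hk t s - hk t 0) (hk1 t s).
  by have := is_derive_fsub (hk_is_derive t s) (is_derive_fcst (hk t 0) s); rewrite subr0.
have k0 : hk1 t 0 = 0 :> R by rewrite /hk1 mul0r oppr0 mul0r.
have d := @convolution_is_derive R (fun s => hk t s - hk t 0) (hk1 t) (Dz o f x) (Dzz o f x)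
  _ M z z0 dL (@hk1_continuous R t) (subrr _) k0 hM
  (fun s (hs : 0 < s) => Dz_is_derive o x hs (Cd_pred cf)) (fun s (hs : 0 < s) => Dzz_continuous hs cf)
  (fun s (hs : 0 < s) => Dzz_bounded o x hs cf).
have d2 : is_derive z 1 (fun z => Rint `]0, z[%classic (fun s => hk1 t (z - s) * Dz o f x s))
   (hk1 t z * trace0 (Dz o f x) (Dzz o f x) + Rint `]0, z[%classic (fun s => hk1 t (z - s) * Dzz o f x s)).
  rewrite (_ : (fun z => Rint `]0, z[%classic (fun s => hk1 t (z - s) * Dz o f x s)) = (fun z => Rint `[0, z]%classic (fun s => hk1 t (z - s) * Dz o f x s)))//.
  apply/funext => u; apply/esym; apply: Rint_cc_eq => // s /andP[s0 _].
  apply: continuousM; last exact: (Dz_continuous (Cd_pred cf) s0).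
  apply: (@continuous_comp _ _ _ (fun s : R => u - s) (hk1 t)); last exact: hk1_continuous.
  by apply: cvgB; [exact: cvg_cst|exact: cvg_id].
have d3 := is_derive_fsub (is_derive_fmul (hk1_is_derive t z) (is_derive_fcst (An o kap f x) z)) (is_derive_fscale (4 * kap) d2).
by apply: (is_derive_eq d3); rewrite /dKn /Rn mulr0 addr0 mulNr.
Qed.

Lemma hk1_dec : exists2 K, 0 < K & forall t x z, 0 < t <= 2 -> 0 <= z ->
  `|hk1 t z| * dec x 0 <= K * (z * Ek t z) * dec x z.
Proof.
have [K K0 hK] := @hk1_bound R _ m2; exists (2 `^ (m%:R / 2) * K) => [|t x z t02 z0].
  by rewrite mulr_gt0// powR_gt0.
have h := dec_peetre x z 0; rewrite subr0 in h; have d0 := ltW (dec_gt0 x z).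
have p0 : 0 <= 2 `^ (m%:R / 2) :> R by exact: powR_ge0.
apply: le_trans (ler_wpM2l (normr_ge0 _) h) _.
have := ler_wpM2l (mulr_ge0 p0 d0) (hK t z t02 z0).
by move: (2 `^ _) ((1 + _) `^ _) (dec x z) `|hk1 t z| (Ek t z) => u1 u2 u3 u4 u5; lra.
Qed.

Lemma hk2_dec : exists2 K, 0 < K & forall t x z, 0 < t <= 2 ->
  `|hk2 t z| * dec x 0 <= K * Ek t z * dec x z.
Proof.
have [K K0 hK] := @hk2_bound R _ m2; exists (2 `^ (m%:R / 2) * K) => [|t x z t02].
  by rewrite mulr_gt0// powR_gt0.
have h := dec_peetre x z 0; rewrite subr0 in h; have d0 := ltW (dec_gt0 x z).
have p0 : 0 <= 2 `^ (m%:R / 2) :> R by exact: powR_ge0.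
apply: le_trans (ler_wpM2l (normr_ge0 _) h) _.
have := ler_wpM2l (mulr_ge0 p0 d0) (hK t z t02).
by move: (2 `^ _) ((1 + _) `^ _) (dec x z) `|hk2 t z| (Ek t z) => u1 u2 u3 u4 u5; lra.
Qed.

Lemma hk1_conv_bound : exists2 K, 0 < K & forall t x z M (B : R -> R), 0 < t <= 2 -> 0 < z -> 0 <= M ->
  (forall s, 0 < s -> {for s, continuous B}) -> (forall s, 0 < s -> `|B s| <= M * dec x s) ->
  `|Rint `]0, z[%classic (fun s => hk1 t (z - s) * B s)| <= K * M * t `^ (- (1 / 2)) * dec x z.
Proof.
have [K K0 hK] := @hk1_bound R _ m2; exists (2 `^ (m%:R / 2) * K * 8) => [|t x z M B t02 z0 M0 cB hB].
  by rewrite !mulr_gt0// powR_gt0.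
have /andP[t0 _] := t02; have [I h] := Ek_space t0 z0; have d0 := ltW (dec_gt0 x z).
have p0 : 0 <= 2 `^ (m%:R / 2) :> R by exact: powR_ge0.
pose c := 2 `^ (m%:R / 2) * K * M * dec x z; have c0 : 0 <= c by rewrite !mulr_ge0// ltW.
have le s : `]0, z[%classic s -> `|hk1 t (z - s) * B s| <= c * ((z - s) * Ek t (z - s)).
  rewrite /= in_itv /= => /andP[s0 sz]; rewrite normrM.
  have zs : 0 <= z - s by rewrite subr_ge0 ltW.
  apply: le_trans (ler_wpM2l (normr_ge0 _) (hB s s0)) _.
  apply: le_trans (ler_wpM2l (normr_ge0 _) (ler_wpM2l M0 (dec_peetre x z s))) _.
  have := ler_wpM2l (mulr_ge0 (mulr_ge0 p0 M0) d0) (hK t (z - s) t02 zs).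
  rewrite /c; move: (_ `^ _) (_ `^ _) `|_| (Ek _ _) => u1 u2 u3 u4 h1.
  by move: (dec x z) h1 => u5 h1; lra.
have Is : Intg `]0, z[%classic (fun s => c * ((z - s) * Ek t (z - s))) by exact: integrable_scale.
have m1 : measurable_fun `]0, z[%classic (fun s => hk1 t (z - s) * B s).
  apply: measurable_open_itv => s /andP[s0 _]; apply: continuousM; last exact: cB.
  apply: (@continuous_comp _ _ _ (fun s : R => z - s) (hk1 t)); last exact: hk1_continuous.
  by apply: cvgB; [exact: cvg_cst|exact: cvg_id].
have I1 := integrable_dom (measurable_itv _) m1 le Is.
apply: le_trans (le_norm_Rint (measurable_itv _) I1 Is le) _.
rewrite RintZ//; apply: le_trans (ler_wpM2l c0 h) _.
by rewrite /c le_eqVlt; apply/orP; left; apply/eqP; move: (_ `^ _) (_ `^ _) => u1 u2; ring.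
Qed.

Lemma Kn_bound kap : exists2 K, 0 < K & forall o C f t x z, 0 < t <= 2 -> 0 < z -> Cd 2 C f ->
  `|Kn o kap f t x z| <= K * C * (z * Ek t z + t `^ (- (1 / 2))) * dec x z.
Proof.
have [K1 K10 h1] := hk1_dec; have [K2 K20 h2] := hk1_conv_bound.
have g0 : 0 <= @gA R m by rewrite addr_ge0 ?tA_ge0 ?nA_ge0.
pose a := 2 + 4 * `|kap| * @gA R m; have a0 : 0 <= a by rewrite addr_ge0// !mulr_ge0.
pose b := 4 * `|kap| * (m%:R * @gA R m); have b0 : 0 <= b by rewrite !mulr_ge0.
exists (a * K1 + b * K2 + 1) => [|o C f t x z t02 z0 cf].
  by rewrite ltr_wpDl// addr_ge0// mulr_ge0// ltW.
have C0 := Cd_ge0 cf; have d0 := ltW (dec_gt0 x z).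
have b1 : `|hk1 t z * An o kap f x| <= a * C * (K1 * (z * Ek t z) * dec x z).
  rewrite normrM; apply: le_trans (ler_wpM2l (normr_ge0 _) (An_bound o kap x cf (Cd_pred cf))) _.
  rewrite -/a mulrCA; rewrite ler_wpM2l ?mulr_ge0//; apply: h1 => //; exact: ltW.
have b2 := h2 t x z (m%:R * @gA R m * C) (Dz o f x) t02 z0 (mulr_ge0 (mulr_ge0 (ler0n _ _) g0) C0)
  (fun s (hs : 0 < s) => Dz_continuous cf hs) (fun s (hs : 0 < s) => Dz_dec m0 o x hs cf).
rewrite /Kn; apply: le_trans (ler_normB _ _) _; rewrite [X in _ + X <= _]normrM [X in _ + X * _ <= _]normrM normr_nat.
have k0 : 0 <= 4 * `|kap| by rewrite mulr_ge0.
have b3 := ler_wpM2l k0 b2; apply: le_trans (lerD b1 b3) _.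
have E0 : 0 <= z * Ek t z by rewrite mulr_ge0 ?Ek_ge0// ltW.
have T0 : 0 <= t `^ (- (1 / 2)) by exact: powR_ge0.
move: E0 T0; set E := z * Ek t z; set T := t `^ _ => E0 T0.
have -> : a * C * (K1 * E * dec x z) + 4 * `|kap| * (K2 * (m%:R * @gA R m * C) * T * dec x z) =
  (a * K1 * E + b * K2 * T) * (C * dec x z) by rewrite /b; ring.
have -> : (a * K1 + b * K2 + 1) * C * (E + T) * dec x z = (a * K1 + b * K2 + 1) * (E + T) * (C * dec x z) by ring.
rewrite ler_wpM2r ?mulr_ge0//.
have := mulr_ge0 (mulr_ge0 a0 (ltW K10)) T0.
have := mulr_ge0 (mulr_ge0 b0 (ltW K20)) E0.
by nra.
Qed.

Lemma Rn_bound kap : exists2 K, 0 < K & forall o C f t x z, 0 < t <= 2 -> 0 < z -> Cd 3 C f ->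
  `|Rn o kap f t x z| <= K * C * (z * Ek t z + t `^ (- (1 / 2))) * dec x z.
Proof.
have [K1 K10 h1] := hk1_dec; have [K2 K20 h2] := hk1_conv_bound.
have g0 : 0 <= @gA R m by rewrite addr_ge0 ?tA_ge0 ?nA_ge0.
pose a := m%:R * @gA R m; have a0 : 0 <= a by rewrite !mulr_ge0.
pose b := m%:R * a; have b0 : 0 <= b by rewrite !mulr_ge0.
have k0 : 0 <= 4 * `|kap| by rewrite mulr_ge0.
exists (4 * `|kap| * (a * K1 + b * K2) + 1) => [|o C f t x z t02 z0 cf].
  by rewrite ltr_wpDl// mulr_ge0// addr_ge0// mulr_ge0// ltW.
have C0 := Cd_ge0 cf; have d0 := ltW (dec_gt0 x z).
have tb : `|trace0 (Dz o f x) (Dzz o f x)| <= a * C * dec x 0.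
  apply: (@trace0_bound R _ _ (m%:R * (m%:R * @gA R m) * C)).
  - by move=> s s0; exact: (Dz_is_derive o x s0 (Cd_pred cf)).
  - by move=> s s0; exact: (Dzz_continuous s0 cf).
  - by move=> s s0; exact: (Dzz_bounded o x s0 cf).
  move=> s /andP[s0 _]; apply: le_trans (Dz_dec m0 o x s0 (Cd_pred cf)) _.
  by rewrite ler_wpM2l ?mulr_ge0//; apply: dec_mono => //; exact: ltW.
have b1 : `|hk1 t z * trace0 (Dz o f x) (Dzz o f x)| <= a * C * (K1 * (z * Ek t z) * dec x z).
  rewrite normrM; apply: le_trans (ler_wpM2l (normr_ge0 _) tb) _.
  by rewrite mulrCA; rewrite ler_wpM2l ?mulr_ge0//; apply: h1 => //; exact: ltW.
have b2 := h2 t x z (b * C) (Dzz o f x) t02 z0 (mulr_ge0 b0 C0)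
  (fun s (hs : 0 < s) => Dzz_continuous hs cf) (fun s (hs : 0 < s) => Dzz_dec m0 o x hs cf).
rewrite /Rn normrM normrN normrM normr_nat.
have b3 := ler_wpM2l k0 (le_trans (ler_normD _ _) (lerD b1 b2)); apply: le_trans b3 _.
have E0 : 0 <= z * Ek t z by rewrite mulr_ge0 ?Ek_ge0// ltW.
have T0 : 0 <= t `^ (- (1 / 2)) by exact: powR_ge0.
move: E0 T0; set E := z * Ek t z; set T := t `^ _ => E0 T0.
have -> : 4 * `|kap| * (a * C * (K1 * E * dec x z) + K2 * (b * C) * T * dec x z) =
  (4 * `|kap| * (a * K1 * E + b * K2 * T)) * (C * dec x z) by ring.
have -> : (4 * `|kap| * (a * K1 + b * K2) + 1) * C * (E + T) * dec x z = (4 * `|kap| * (a * K1 + b * K2) + 1) * (E + T) * (C * dec x z) by ring.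
rewrite ler_wpM2r ?mulr_ge0// [leRHS]mulrDl mul1r; apply: (@le_trans _ _ (4 * `|kap| * (a * K1 + b * K2) * (E + T))); last first.
  by rewrite lerDl addr_ge0.
rewrite -[leRHS]mulrA ler_wpM2l//.
have := mulr_ge0 (mulr_ge0 a0 (ltW K10)) T0.
have := mulr_ge0 (mulr_ge0 b0 (ltW K20)) E0.
by nra.
Qed.

Lemma continuous_of_seq (f : R -> R) (a b t : R) : a < t < b ->
  (forall u : nat -> R, (forall n, a < u n < b) -> u @ \oo --> t -> (fun n => f (u n)) @ \oo --> f t) ->
  {for t, continuous f}.
Proof.
move=> tab h; apply: cvg_of_seq => u cu.
pose v n := if a < u n < b then u n else t.
have nv : \forall n \near \oo, v n = u n.
  have /andP[h1 h2] := tab; near=> n; rewrite /v; have -> // : a < u n < b.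
  apply/andP; split; near: n; [exact: (cu _ (lt_nbhsr h1))|exact: (cu _ (lt_nbhsl h2))].
have hv n : a < v n < b by rewrite /v; case: ifP.
have cv : v @ \oo --> t by apply: cvg_trans cu; apply: near_eq_cvg; near=> n; apply/esym; near: n.
apply: cvg_trans (h v hv cv); apply: near_eq_cvg; near=> n; congr (f _); near: n; exact: nv.
Unshelve. all: by end_near.
Qed.

Lemma Rint_itv_cvg (b M : R) (F_ : nat -> R -> R) (F : R -> R) :
  (forall n s, 0 < s < b -> {for s, continuous (F_ n)}) ->
  (forall n s, 0 < s < b -> `|F_ n s| <= M) ->
  (forall s, 0 < s < b -> F_ ^~ s @ \oo --> F s) ->
  (fun n => Rint `]0, b[%classic (F_ n)) @ \oo --> Rint `]0, b[%classic F.
Proof.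
move=> cF bF lF; apply: (@Rint_dct R _ _ _ (fun=> M) _ _ _ _ _).2 => //.
- by move=> n; apply: measurable_open_itv => s; exact: cF.
- by apply: integrable_cst_itv; exact: itv_mu_fin.
Qed.

Section TimeContinuity.
Context (t_ : nat -> R) (t a : R).
Hypotheses (a0 : 0 < a) (ht : forall n, a <= t_ n <= 2) (ct : t_ @ \oo --> t).

Let ht0 n : 0 <= t_ n <= 2. Proof. by have /andP[h ->] := ht n; rewrite (le_trans (ltW a0) h). Qed.
Let t0 : 0 < t. Proof. by apply: lt_le_trans a0 (cvg_ge_near ct _) => n; have /andP[] := ht n. Qed.
Let t2 : t <= 2. Proof. by apply: (cvg_le_near ct) => n; have /andP[] := ht n. Qed.

Let hk1_cvg z : (fun n => hk1 (t_ n) z) @ \oo --> hk1 t z.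
Proof. by apply: (continuous_seq (f := hk1 ^~ z) _ ct); exact: hk1_continuous_t. Qed.

Lemma G_U_cvg o C f x z : 0 < z -> dom qK C f -> (fun n => G o (U f (t_ n)) x z) @ \oo --> G o (U f t) x z.
Proof.
move=> z0 df; have [A A0 hA] := @U_Cd R m 2 (ler0n R 2).
have d s : 0 <= s <= 2 -> dom qK (@kb R m z * (A * C * Px x)) (fun y => kk o y z * U f s (x - y)).
  by move=> hs; apply: G_dom (lexx z) _ => //; have := hA 0%N C f s hs (conj df I); case.
apply: (iintR_dct qK_half (fun n => d _ (ht0 n)) (d t _)); first by rewrite (ltW t0) t2.
move=> y; apply: cvgM; first exact: cvg_cst.
by apply: (@U_cvg R m C f t_ (fun=> x - y) t (x - y) 2) => //; exact: cvg_cst.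
Qed.

Lemma Dz_U_cvg o C f x z : 0 < z -> Cd 2 C f -> (fun n => Dz o (U f (t_ n)) x z) @ \oo --> Dz o (U f t) x z.
Proof.
move=> z0 cf; have h o' j : (fun n => G o' (partial j (U f (t_ n))) x z) @ \oo --> G o' (partial j (U f t)) x z.
  rewrite (U_partial j (ltW t0) (Cd_pred cf)).1.
  rewrite (_ : (fun n => _) = (fun n => G o' (U (partial j f) (t_ n)) x z)); first exact: G_U_cvg (Cd_dom (Cd_partial j cf)).
  by apply/funext => n; have /andP[h _] := ht0 n; rewrite (U_partial j h (Cd_pred cf)).1.
case: o => [j|]; first exact: h.
by apply: cvgN; apply: cvg_sum => j; exact: h.
Qed.

Lemma hk1_conv_cvg (B_ : nat -> R -> R) (B : R -> R) (M z : R) : 0 < z ->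
  (forall n s, 0 < s -> {for s, continuous (B_ n)}) -> (forall n s, 0 < s -> `|B_ n s| <= M) ->
  (forall s, 0 < s -> B_ ^~ s @ \oo --> B s) ->
  (fun n => Rint `]0, z[%classic (fun s => hk1 (t_ n) (z - s) * B_ n s)) @ \oo -->
  Rint `]0, z[%classic (fun s => hk1 t (z - s) * B s).
Proof.
move=> z0 cB bB lB; have [K K0 hK] := @hk1_bound R 0 (lexx 0).
have a32 : 0 <= a `^ (- (3 / 2)) by exact: powR_ge0.
apply: (@Rint_itv_cvg z (K * (z * a `^ (- (3 / 2))) * M)) => [n s /andP[s0 _]|n s /andP[s0 sz]|s /andP[s0 _]].
- apply: continuousM; last exact: cB.
  apply: (@continuous_comp _ _ _ (fun s : R => z - s) (hk1 (t_ n))); last exact: hk1_continuous.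
  by apply: cvgB; [exact: cvg_cst|exact: cvg_id].
- have /andP[h1 h2] := ht n; have tn := lt_le_trans a0 h1.
  rewrite normrM; apply: ler_pM => //; last exact: bB.
  have zs : 0 <= z - s by lra.
  have := hK (t_ n) (z - s) _ zs; rewrite tn h2 powRr0 mul1r => h; apply: le_trans (h isT) _.
  rewrite ler_wpM2l ?(ltW K0)//; apply: ler_pM => //; [exact: Ek_ge0|lra|].
  by apply: le_trans (Ek_le _ tn) _; apply: powR_mono_neg.
- by apply: cvgM; [exact: hk1_cvg|exact: lB].
Qed.

Lemma An_U_cvg o kap C f x : Cd 2 C f -> (fun n => An o kap (U f (t_ n)) x) @ \oo --> An o kap (U f t) x.
Proof.
move=> cf; have [A A0 hA] := @U_Cd R m 2 (ler0n R 2).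
have cU n : Cd 2 (A * C) (U f (t_ n)) by exact: hA.
have df := Cd_dom cf.
apply: cvgB; first by apply: cvgM; [exact: cvg_cst|apply: (@U_cvg R m C f t_ (fun=> x) t x 2) => //; exact: cvg_cst].
apply: cvgM; first exact: cvg_cst.
apply: cvgB; first exact: G_U_cvg df.
apply: (@Rint_itv_cvg 1 (m%:R * @gA R m * (A * C))) => [n s /andP[s0 _]|n s /andP[s0 _]|s /andP[s0 _]].
- exact: (Dz_continuous (cU n) s0).
- exact: (Dz_bounded m0 (cU n) o x s0).
- exact: Dz_U_cvg cf.
Qed.

Lemma Kn_U_cvg o kap C f x z : 0 < z -> Cd 2 C f ->
  (fun n => Kn o kap (U f (t_ n)) (t_ n) x z) @ \oo --> Kn o kap (U f t) t x z.
Proof.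
move=> z0 cf; have [A A0 hA] := @U_Cd R m 2 (ler0n R 2).
have cU n : Cd 2 (A * C) (U f (t_ n)) by exact: hA.
have df := Cd_dom cf.
apply: cvgB; last first.
  apply: cvgM; first exact: cvg_cst.
  apply: (@hk1_conv_cvg (fun n => Dz o (U f (t_ n)) x) _ (m%:R * @gA R m * (A * C))) => //.
  - by move=> n s s0; exact: (Dz_continuous (cU n) s0).
  - by move=> n s s0; exact: (Dz_bounded m0 (cU n) o x s0).
  - by move=> s s0; exact: Dz_U_cvg cf.
by apply: cvgM; [exact: hk1_cvg|exact: An_U_cvg cf].
Qed.

End TimeContinuity.

Lemma continuous_time (F : R -> R) (t : R) : 0 < t < 2 ->
  (forall (u : nat -> R) (a : R), 0 < a -> (forall n, a <= u n <= 2) -> u @ \oo --> t -> (fun n => F (u n)) @ \oo --> F t) ->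
  {for t, continuous F}.
Proof.
move=> /andP[t0 t2] h; have a0 : 0 < t / 2 by rewrite divr_gt0.
apply: (@continuous_of_seq F (t / 2) 2); first by rewrite t2 andbT; lra.
by move=> u hu cu; apply: (h u (t / 2)) => // n; have /andP[h1 h2] := hu n; rewrite !ltW.
Qed.

End Estimates.

Section Velocity.
Context {R : realType} {m : nat}.
Hypothesis m0 : (0 < m)%N.
Implicit Types (y x w : 'rV[R]_m) (t s z C M kap : R) (j : 'I_m) (o : option 'I_m) (f g : 'rV[R]_m -> R).
Local Notation qK := (@qK R m).
Local Notation qK_half := (@qK_half R m).
Local Notation qK_ge0 := (@qK_ge0 R m).
Local Notation mu := (@lebesgue_measure R).
Local Notation Intg D f := (mu.-integrable (D : set R) (EFin \o (f : R -> R))).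
Local Notation Rint := (@Rintegral _ _ R mu).
Local Notation D2 := (`]0%R, 2%R[%classic : set R).

Definition Wz z t : R := z * Ek t z + t `^ (- (1 / 2)).

Lemma Wz_ge0 z t : 0 <= z -> 0 <= Wz z t.
Proof. by move=> z0; rewrite addr_ge0 ?powR_ge0// mulr_ge0 ?Ek_ge0. Qed.

Lemma integrable_Ek (b z : R) : 0 <= b < 1 / 2 -> 0 < z -> Intg D2 (fun t => t `^ b * Ek t z).
Proof. by move=> hb z0; have [K K0 h] := @Ek_time R b hb; have [I _] := h z z0. Qed.

Lemma integrable_Ek0 z : 0 < z -> Intg D2 (fun t => Ek t z).
Proof.
move=> z0; have h0 : 0 <= (0 : R) < 1 / 2 by rewrite lexx; lra.
have := integrable_Ek h0 z0; apply: integrable_eq => // t _; by rewrite powRr0 mul1r.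
Qed.

Lemma Wz_integral : exists2 K, 0 < K & forall z, 0 < z -> Intg D2 (Wz z) /\ Rint D2 (Wz z) <= K.
Proof.
have h0 : 0 <= (0 : R) < 1 / 2 by rewrite lexx; lra.
have [K K0 hK] := @Ek_time R 0 h0.
have I2 : Intg D2 (fun t : R => t `^ (- (1 / 2))) by apply: integrable_pow => //; lra.
exists (K + `|Rint D2 (fun t : R => t `^ (- (1 / 2)))|) => [|z z0]; first by rewrite ltr_wpDr.
have IE := integrable_Ek0 z0; have I1 := integrable_scale z (measurable_itv _) IE.
split; first exact: integrable_add.
rewrite RintD// RintZ//; apply: lerD; last exact: ler_norm.
have [_ h] := hK z z0.
have e : Rint D2 (fun t => t `^ 0 * Ek t z) = Rint D2 (fun t => Ek t z).
  by apply: Rint_eq => t _; rewrite powRr0 mul1r.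
rewrite e mulr0 sub0r powR_inv1 ?(ltW z0)// in h.
by have := ler_wpM2l (ltW z0) h; rewrite mulrCA divff ?mulr1// gt_eqF.
Qed.

Lemma U_Cd2 : exists2 A, 0 < A & forall k C f t, 0 < t < 2 -> Cd k C f -> Cd k (A * C) (@U R m f t).
Proof.
have [A A0 hA] := @U_Cd R m 2 (ler0n R 2); exists A => // k C f t /andP[t0 t2]; apply: hA.
by rewrite !ltW.
Qed.

Section Fixed.
Context (kap : R) (o : option 'I_m) (g : 'rV[R]_m -> R) (C : R).

Definition Kg t x z : R := Kn o kap (U g t) t x z.

Lemma Kg_continuous t x z : 0 < t < 2 -> 0 < z -> Cd 2 C g -> {for t, continuous (fun t => Kg t x z)}.
Proof.
by move=> ht z0 cg; apply: continuous_time ht _ => u a a0 hu cu; exact: (Kn_U_cvg m0 a0 hu cu z0 cg).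
Qed.

Lemma Kg_bound : Cd 2 C g -> exists2 K, 0 < K & forall t x z, 0 < t < 2 -> 0 < z ->
  `|Kg t x z| <= K * Wz z t * dec x z.
Proof.
move=> cg; have [A A0 hA] := U_Cd2; have [K K0 hK] := Kn_bound m0 kap; have C0 := Cd_ge0 cg.
exists (K * (A * C) + 1) => [|t x z ht z0]; first by rewrite ltr_wpDl// !mulr_ge0// ltW.
have /andP[t0 t2] := ht; have t02 : 0 < t <= 2 by rewrite t0 ltW.
apply: le_trans (hK o _ _ t x z t02 z0 (hA _ _ _ _ ht cg)) _.
rewrite ler_wpM2r ?(ltW (dec_gt0 _ _))//; rewrite ler_wpM2r ?lerDl//; exact: Wz_ge0 (ltW z0).
Qed.

(* The time factor is only required to be bounded: with [phi] a difference of two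
   translates of [h] this bounds time increments as well. *)
Lemma time_integral_bound : Cd 2 C g -> exists2 K, 0 < K & forall (phi : R -> R) B x z, 0 < z -> 0 <= B ->
  (forall t, 0 < t < 2 -> {for t, continuous phi}) -> (forall t, 0 < t < 2 -> `|phi t| <= B) ->
  Intg D2 (fun t => phi t * Kg t x z) /\ `|Rint D2 (fun t => phi t * Kg t x z)| <= K * B * dec x z.
Proof.
move=> cg; have [K K0 hK] := Kg_bound cg; have [W W0 hW] := Wz_integral.
exists (K * W) => [|phi B x z z0 B0 cphi bphi]; first exact: mulr_gt0.
have [IW bW] := hW z z0; have d0 := ltW (dec_gt0 x z).
pose c := B * K * dec x z; have c0 : 0 <= c by rewrite !mulr_ge0// ltW.
have le t : D2 t -> `|phi t * Kg t x z| <= c * Wz z t.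
  rewrite /= in_itv /= => ht; rewrite normrM.
  apply: le_trans (ler_pM (normr_ge0 _) (normr_ge0 _) (bphi t ht) (hK t x z ht z0)) _.
  by rewrite /c le_eqVlt; apply/orP; left; apply/eqP; ring.
have mF : measurable_fun D2 (fun t => phi t * Kg t x z).
  by apply: measurable_open_itv => t ht; apply: continuousM; [exact: cphi|exact: Kg_continuous].
have Ic := integrable_scale c (measurable_itv _) IW.
have IF := integrable_dom (measurable_itv _) mF le Ic; split=> //.
apply: le_trans (le_norm_Rint (measurable_itv _) IF Ic le) _; rewrite RintZ//.
by apply: le_trans (ler_wpM2l c0 bW) _; rewrite /c le_eqVlt; apply/orP; left; apply/eqP; ring.
Qed.

End Fixed.

Section Tangential.
Context (j : 'I_m).

Definition Tz o f x s : R :=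
  if o is Some k then G None (partial j (partial k f)) x s else - \sum_(k < m) G (Some k) (partial j (partial k f)) x s.
Definition Tn o kap f t x z : R := hk1 t z * (- 2 * (o == None)%:R * partial j f x -
    4 * kap * (G o (partial j f) x 1 - Rint `]0, 1[%classic (Tz o f x))) -
  4 * kap * Rint `]0, z[%classic (fun s => hk1 t (z - s) * Tz o f x s).

Lemma Tz_dec o C f x s : 0 < s -> Cd 3 C f -> `|Tz o f x s| <= m%:R * @gA R m * C * dec x s.
Proof.
move=> s0 cf; have h o' k : `|G o' (partial j (partial k f)) x s| <= @gA R m * C * dec x s.
  exact: (G_dec m0 o' x s0 (Cd_partial j (Cd_partial k cf))).
have nn : 0 <= @gA R m * C * dec x s by apply: le_trans (normr_ge0 _) (h None j).
case: o => [k|] /=.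
  by apply: le_trans (h _ _) _; rewrite -[leRHS]mulrA -[leRHS]mulrA [_ * (C * _)]mulrA ler_peMl ?ler1n.
rewrite normrN; apply: le_trans (ler_norm_sum _ _ _) _.
apply: (@le_trans _ _ (\sum_(k < m) @gA R m * C * dec x s)); first by apply: ler_sum => k _; exact: h.
by rewrite sumr_const card_ord -[_ *+ m]mulr_natl !mulrA.
Qed.

Lemma Tz_continuous o C f x s : 0 < s -> Cd 3 C f -> {for s, continuous (Tz o f x)}.
Proof.
move=> s0 cf; have c o' k : {for s, continuous (G o' (partial j (partial k f)) x)}.
  exact: is_derive_continuous (G_is_derive o' x s0 (Cd_partial j (Cd_partial k cf))).
case: o => [k|] /=; first exact: c.
apply: continuousN; have := @cvg_sum R _ (nbhs s) 'I_m (index_enum _) predT (fun k s => G (Some k) (partial j (partial k f)) x s) _ _ (fun k => c (Some k) k).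
exact.
Qed.

Lemma G_line o C f x z s : 0 < z -> Cd 1 C f ->
  is_derive s 1 (fun s => G o f (x + s *: unitv R j) z) (G o (partial j f) (x + s *: unitv R j) z).
Proof.
move=> z0 cf; have h y := G_partial j o y z0 cf.
have p y : has_partial j (G o f ^~ z) y := (h y).2.
by have := partial_line p x s; rewrite (h _).1.
Qed.

Lemma Dz_line o C f x z s : 0 < z -> Cd 2 C f ->
  is_derive s 1 (fun s => Dz o f (x + s *: unitv R j) z) (Tz o f (x + s *: unitv R j) z).
Proof.
move=> z0 cf; case: o => [k|] /=; first exact: G_line (Cd_partial k cf).
apply: is_derive_fopp.
have h (r : seq 'I_m) : is_derive s 1 (fun s => \sum_(k <- r) G (Some k) (partial k f) (x + s *: unitv R j) z)
    (\sum_(k <- r) G (Some k) (partial j (partial k f)) (x + s *: unitv R j) z).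
  elim: r => [|k r IH].
    by rewrite big_nil; under eq_fun do rewrite big_nil; exact: is_derive_fcst.
  rewrite big_cons; under eq_fun do rewrite big_cons.
  by apply: is_derive_fadd IH; exact: G_line (Cd_partial k cf).
exact: h.
Qed.

Lemma Tn_bound kap : exists2 K, 0 < K & forall o C f t x z, 0 < t <= 2 -> 0 < z -> Cd 3 C f ->
  `|Tn o kap f t x z| <= K * C * Wz z t * dec x z.
Proof.
have [K1 K10 h1] := @hk1_dec R m; have [K2 K20 h2] := @hk1_conv_bound R m.
have g0 : 0 <= @gA R m by rewrite addr_ge0 ?tA_ge0 ?nA_ge0.
pose b := 4 * `|kap| * (m%:R * @gA R m); have b0 : 0 <= b by rewrite !mulr_ge0.
pose a := 2 + 4 * `|kap| * @gA R m + b; have a0 : 0 <= a by rewrite !addr_ge0// !mulr_ge0.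
exists (a * K1 + b * K2 + 1) => [|o C f t x z t02 z0 cf].
  by rewrite ltr_wpDl// addr_ge0// mulr_ge0// ltW.
have C0 := Cd_ge0 cf; have d0 := ltW (dec_gt0 x z); have e0 := ltW (dec_gt0 x (0 : R)).
have cj := Cd_partial j cf.
pose c := m%:R * @gA R m * C * dec x 0.
have i1 : `|Rint `]0, 1[%classic (Tz o f x)| <= c.
  have -> : c = Rint `]0, 1[%classic (fun=> c) by rewrite Rint_cst_itv// subr0 mulr1.
  have hT s : 0 < s < 1 -> `|Tz o f x s| <= c.
    move=> /andP[s0 _]; apply: le_trans (Tz_dec o x s0 cf) _.
    by rewrite ler_wpM2l ?mulr_ge0//; apply: dec_mono => //; exact: ltW.
  apply: le_norm_Rint => //.
  - apply: (@integrable_bounded_itv R _ 0 1 c) => // s /andP[s0 _]; exact: Tz_continuous cf.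
  - by apply: integrable_cst_itv; exact: itv_mu_fin.
have i2 : `|G o (partial j f) x 1| <= @gA R m * C * dec x 0.
  apply: le_trans (G_dec m0 o x ltr01 (Cd_pred cj)) _.
  by rewrite ler_wpM2l ?mulr_ge0//; exact: dec_mono.
have i3 := dom_dec x (Cd_dom cj).
have b1 : `|hk1 t z * (- 2 * (o == None)%:R * partial j f x - 4 * kap * (G o (partial j f) x 1 - Rint `]0, 1[%classic (Tz o f x)))| <=
    a * C * (K1 * (z * Ek t z) * dec x z).
  rewrite normrM; apply: (@le_trans _ _ (`|hk1 t z| * (a * C * dec x 0))).
    rewrite ler_wpM2l//; apply: le_trans (ler_normB _ _) _.
    have -> : a * C * dec x 0 = 2 * (C * dec x 0) + (4 * `|kap|) * (@gA R m * C * dec x 0 + c) by rewrite /a /b /c; ring.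
    apply: lerD.
      rewrite normrM; apply: ler_pM => //; rewrite normrM normrN normr_nat; case: (_ == _); rewrite ?normr1 ?normr0; lra.
    rewrite normrM [X in X * _ <= _]normrM normr_nat ler_wpM2l ?mulr_ge0//.
    by apply: le_trans (ler_normB _ _) _; exact: lerD.
  rewrite mulrCA; rewrite ler_wpM2l ?mulr_ge0//; apply: h1 => //; exact: ltW.
have b2 := h2 t x z (m%:R * @gA R m * C) (Tz o f x) t02 z0 (mulr_ge0 (mulr_ge0 (ler0n _ _) g0) C0)
  (fun s (hs : 0 < s) => Tz_continuous hs cf) (fun s (hs : 0 < s) => Tz_dec o x hs cf).
rewrite /Tn; apply: le_trans (ler_normB _ _) _; rewrite [X in _ + X <= _]normrM [X in _ + X * _ <= _]normrM normr_nat.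
have k0 : 0 <= 4 * `|kap| by rewrite mulr_ge0.
have b3 := ler_wpM2l k0 b2; apply: le_trans (lerD b1 b3) _.
have E0 : 0 <= z * Ek t z by rewrite mulr_ge0 ?Ek_ge0// ltW.
have T0 : 0 <= t `^ (- (1 / 2)) by exact: powR_ge0.
rewrite /Wz; move: E0 T0; set E := z * Ek t z; set T := t `^ _ => E0 T0.
have -> : a * C * (K1 * E * dec x z) + 4 * `|kap| * (K2 * (m%:R * @gA R m * C) * T * dec x z) =
  (a * K1 * E + b * K2 * T) * (C * dec x z) by rewrite /b; ring.
have -> : (a * K1 + b * K2 + 1) * C * (E + T) * dec x z = (a * K1 + b * K2 + 1) * (E + T) * (C * dec x z) by ring.
rewrite ler_wpM2r ?mulr_ge0//.
have := mulr_ge0 (mulr_ge0 a0 (ltW K10)) T0.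
have := mulr_ge0 (mulr_ge0 b0 (ltW K20)) E0.
by nra.
Qed.

Lemma Kn_tangential o kap C f t x z s : 0 < t -> 0 < z -> Cd 3 C f ->
  is_derive s 1 (fun s => Kn o kap f t (x + s *: unitv R j) z) (Tn o kap f t (x + s *: unitv R j) z).
Proof.
move=> t0 z0 cf; have [M M0 hM] := @hk1_bounded R t t0; have cf2 := Cd_pred cf.
have g0 : 0 <= @gA R m by rewrite addr_ge0 ?tA_ge0 ?nA_ge0.
have C0 := Cd_ge0 cf; pose c := m%:R * @gA R m * C; have c0 : 0 <= c by rewrite !mulr_ge0.
have hT y u : 0 < u -> `|Tz o f y u| <= c.
  by move=> u0; apply: le_trans (Tz_dec o y u0 cf) _; rewrite ler_piMr ?dec_le1.
have hD (b : R) (w : R -> R) Mw : (forall u, 0 < u < b -> {for u, continuous w}) -> (forall u, `|w u| <= Mw) ->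
    is_derive s 1 (fun s => Rint `]0, b[%classic (fun u => w u * Dz o f (x + s *: unitv R j) u))
      (Rint `]0, b[%classic (fun u => w u * Tz o f (x + s *: unitv R j) u)).
  move=> cw wM; apply: (@Rint_is_derive R _ (fun s u => w u * Dz o f (x + s *: unitv R j) u)
    (fun s u => w u * Tz o f (x + s *: unitv R j) u) (fun=> Mw * c) s 1 (measurable_itv _) ltr01 _ _ _ _).2.
  - move=> v _; apply: (@integrable_bounded_itv R _ 0 b (Mw * c)) => u /andP[u0 ub].
      by apply: continuousM; [apply: cw; rewrite u0|exact: (Dz_continuous cf2 u0)].
    by rewrite normrM; apply: ler_pM => //; exact: (Dz_bounded m0 cf2).
  - by move=> v u _; rewrite /= in_itv /= => /andP[u0 _]; apply: is_derive_fscale; exact: Dz_line cf2.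
  - by apply: integrable_cst_itv; exact: itv_mu_fin.
  - by move=> v u _; rewrite /= in_itv /= => /andP[u0 _]; rewrite normrM ler_pM// hT.
have dT : is_derive s 1 (fun s => kT o f (x + s *: unitv R j)) (G o (partial j f) (x + s *: unitv R j) 1 - Rint `]0, 1[%classic (Tz o f (x + s *: unitv R j))).
  have c1 u : 0 < u < 1 -> {for u, continuous (fun _ : R => 1 : R)} by move=> _; exact: cst_continuous.
  have b1 (u : R) : `|1| <= 1 :> R by rewrite normr1.
  have e1 (F : R -> R) : Rint `]0, 1[%classic (fun u => 1 * F u) = Rint `]0, 1[%classic F.
    by apply: Rint_eq => u _; rewrite mul1r.
  have h := hD 1 _ 1 c1 b1; rewrite e1 in h.
  have h' : is_derive s 1 (fun s => Rint `]0, 1[%classic (Dz o f (x + s *: unitv R j))) (Rint `]0, 1[%classic (Tz o f (x + s *: unitv R j))).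
    rewrite (_ : (fun s => Rint `]0, 1[%classic (Dz o f (x + s *: unitv R j))) =
      (fun s => Rint `]0, 1[%classic (fun u => 1 * Dz o f (x + s *: unitv R j) u)))//.
    by apply/funext => v; rewrite e1.
  exact: (is_derive_fsub (G_line o x s ltr01 (Cd_pred cf2)) h').
have df : is_derive s 1 (fun s => f (x + s *: unitv R j)) (partial j f (x + s *: unitv R j)).
  by apply: partial_line => y; exact: (Cd_has cf).
have dA := is_derive_fsub (is_derive_fscale (- 2 * (o == None)%:R) df) (is_derive_fscale (4 * kap) dT).
apply: (is_derive_fsub (is_derive_fscale (hk1 t z) dA) (is_derive_fscale (4 * kap) (hD z (fun u => hk1 t (z - u)) M _ _))) => // u _.
apply: (@continuous_comp _ _ _ (fun u : R => z - u) (hk1 t)); last exact: hk1_continuous.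
by apply: cvgB; [exact: cvg_cst|exact: cvg_id].
Qed.



End Tangential.

Lemma Ek_anti t (y y' : R) : 0 < t -> 0 <= y -> y <= y' -> Ek t y' <= @Ek R t y.
Proof.
move=> t0 y0 yy; rewrite ler_wpM2l ?powR_ge0// ler_expR lerN2 ler_wpM2r ?invr_ge0 ?mulr_ge0 ?(ltW t0)//.
by rewrite lerXn2r// nnegrE (le_trans y0).
Qed.

Section Solution.
Context (kap : R) (o : option 'I_m) (g : 'rV[R]_m -> R) (C : R) (h : R -> R) (Hb : R).
Hypotheses (cg : Cd 3 C g) (ch : continuous h) (hb : forall s, `|h s| <= Hb).

Definition vel x z t : R := Rint D2 (fun s => h (t - s) * Kg kap o g s x z) - 2 * kap * h t * G o g x z.
Definition vel_j j x z t : R :=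
  Rint D2 (fun s => h (t - s) * Tn j o kap (U g s) s x z) - 2 * kap * h t * G o (partial j g) x z.
Definition vel_n x z t : R :=
  Rint D2 (fun s => h (t - s) * dKn o kap (U g s) s x z) - 2 * kap * h t * Dz o g x z.

Let Hb0 : 0 <= Hb := le_trans (normr_ge0 _) (hb 0).
Let cg2 : Cd 2 C g := Cd_pred cg.
Let cg1 : Cd 1 C g := Cd_pred cg2.
Let C0 : 0 <= C := Cd_ge0 cg.
Let gA0 : 0 <= @gA R m. Proof. by rewrite addr_ge0 ?tA_ge0 ?nA_ge0. Qed.

Lemma shift_continuous t s : {for s, continuous (fun s => h (t - s))}.
Proof.
apply: (@continuous_comp _ _ _ (fun s : R => t - s) h); last exact: ch.
by apply: cvgB; [exact: cvg_cst|exact: cvg_id].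
Qed.

Lemma Kg_integrable x z t : 0 < z -> Intg D2 (fun s => h (t - s) * Kg kap o g s x z).
Proof.
move=> z0; have [K K0 hK] := time_integral_bound kap o cg2.
by have [] := hK (fun s => h (t - s)) Hb x z z0 Hb0 (fun s _ => @shift_continuous t s) (fun s _ => hb (t - s)).
Qed.

Lemma vel_bound : exists2 M, 0 < M & forall x z t, 0 < z -> `|vel x z t| <= M * dec x z.
Proof.
have [K K0 hK] := time_integral_bound kap o cg2.
pose a := 2 * `|kap| * Hb * (@gA R m * C); have a0 : 0 <= a by rewrite !mulr_ge0.
exists (K * Hb + a + 1) => [|x z t z0]; first by rewrite ltr_wpDl// addr_ge0// mulr_ge0// ltW.
have [_ b] := hK (fun s => h (t - s)) Hb x z z0 Hb0 (fun s _ => @shift_continuous t s) (fun s _ => hb (t - s)).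
have d0 := ltW (dec_gt0 x z).
apply: le_trans (ler_normB _ _) _; rewrite -addrA [leRHS]mulrDl; apply: lerD => //.
apply: (@le_trans _ _ (a * dec x z)); last by rewrite [leRHS]mulrDl mul1r lerDl.
rewrite !normrM normr_nat /a -!mulrA ler_wpM2l// ler_wpM2l// !mulrA -[leRHS]mulrA -[leRHS]mulrA.
by apply: ler_pM => //; rewrite mulrA; exact: G_dec.
Qed.

Lemma vel_time : exists2 M, 0 < M & forall x z t s B, 0 < z -> 0 <= B -> (forall r, `|h (t - r) - h (s - r)| <= B) ->
  `|vel x z t - vel x z s| <= M * B.
Proof.
have [K K0 hK] := time_integral_bound kap o cg2.
pose a := 2 * `|kap| * (@gA R m * C); have a0 : 0 <= a by rewrite !mulr_ge0.
exists (K + a) => [|x z t s B z0 B0 hB]; first by rewrite ltr_wpDr.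
have [I b] := hK (fun r => h (t - r) - h (s - r)) B x z z0 B0
  (fun r _ => continuousB (@shift_continuous t r) (@shift_continuous s r)) (fun r _ => hB r).
have -> : vel x z t - vel x z s = Rint D2 (fun r => (h (t - r) - h (s - r)) * Kg kap o g r x z) - 2 * kap * (h t - h s) * G o g x z.
  rewrite (@Rint_eq _ _ _ (fun r => h (t - r) * Kg kap o g r x z - h (s - r) * Kg kap o g r x z)); last first.
    by move=> r _; rewrite mulrBl.
  rewrite (RintB (measurable_itv _) (Kg_integrable x t z0) (Kg_integrable x s z0)) /vel.
  by move: (Rint _ _) (Rint _ _) (G _ _ _ _) => u1 u2 u3; ring.
apply: le_trans (ler_normB _ _) _; rewrite [leRHS]mulrDl; apply: lerD.
  by apply: le_trans b _; rewrite ler_piMr ?dec_le1// mulr_ge0// ltW.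
have := hB 0; rewrite !subr0 => hB0; rewrite !normrM normr_nat.
have G1 : `|G o g x z| <= @gA R m * C by apply: G_bounded.
rewrite /a -!mulrA ler_wpM2l// ler_wpM2l// mulrC mulrA.
by apply: ler_pM.
Qed.

Lemma vel_tangential j x z t : 0 < z ->
  is_derive (0 : R) 1 (fun s : R => vel (x + s *: unitv R j) z t) (vel_j j x z t) /\
  Intg D2 (fun s => h (t - s) * Tn j o kap (U g s) s x z).
Proof.
move=> z0; have [A A0 hA] := U_Cd2; have [K K0 hK] := Tn_bound j kap; have [W W0 hW] := Wz_integral.
have [IW _] := hW z z0; pose c := Hb * (K * (A * C)); have c0 : 0 <= c by rewrite !mulr_ge0// ltW.
have hder (s r : R) : `|s - 0| < 1 -> D2 r ->
    is_derive s 1 (fun s => h (t - r) * Kg kap o g r (x + s *: unitv R j) z) (h (t - r) * Tn j o kap (U g r) r (x + s *: unitv R j) z).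
  move=> _; rewrite /= in_itv /= => /andP[r0 r2]; apply: is_derive_fscale.
  by apply: (Kn_tangential j o kap x s r0 z0 (hA _ _ _ _ _ cg)); rewrite r0.
have hbnd (s r : R) : `|s - 0| < 1 -> D2 r -> `|h (t - r) * Tn j o kap (U g r) r (x + s *: unitv R j) z| <= c * Wz z r.
  move=> _; rewrite /= in_itv /= => /andP[r0 r2]; rewrite normrM /c -mulrA; apply: ler_pM => //.
  have r02 : 0 < r <= 2 by rewrite r0 ltW.
  have r02' : 0 < r < 2 by rewrite r0.
  apply: le_trans (hK o _ _ r (x + s *: unitv R j) z r02 z0 (hA _ _ _ _ r02' cg)) _.
  by rewrite ler_piMr ?dec_le1// mulr_ge0 ?Wz_ge0 ?(ltW z0)// !mulr_ge0// ltW.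
have [I d] := @Rint_is_derive R D2 (fun s r => h (t - r) * Kg kap o g r (x + s *: unitv R j) z)
  (fun s r => h (t - r) * Tn j o kap (U g r) r (x + s *: unitv R j) z) (fun r => c * Wz z r) 0 1 (measurable_itv _) ltr01
  (fun s _ => Kg_integrable _ t z0) hder (integrable_scale c (measurable_itv _) IW) hbnd.
rewrite scale0r addr0 in I; split; last exact: I.
have d2 := is_derive_fsub d (is_derive_fscale (2 * kap * h t) (G_line j o x 0 z0 cg1)).
by apply: (is_derive_eq d2); rewrite scale0r addr0.
Qed.

Lemma vel_j_bound j : exists2 M, 0 < M & forall x z t, 0 < z -> `|vel_j j x z t| <= M * dec x z.
Proof.
have [A A0 hA] := U_Cd2; have [K K0 hK] := Tn_bound j kap; have [W W0 hW] := Wz_integral.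
pose a := 2 * `|kap| * Hb * (@gA R m * C); have a0 : 0 <= a by rewrite !mulr_ge0.
pose c := Hb * (K * (A * C)); have c0 : 0 <= c by rewrite !mulr_ge0// ltW.
exists (c * W + a + 1) => [|x z t z0]; first by rewrite ltr_wpDl// addr_ge0// mulr_ge0// ltW.
have d0 := ltW (dec_gt0 x z); have [IW bW] := hW z z0; have [_ I] := vel_tangential j x t z0.
have Ic := integrable_scale (c * dec x z) (measurable_itv _) IW.
have b : `|Rint D2 (fun s => h (t - s) * Tn j o kap (U g s) s x z)| <= c * W * dec x z.
  apply: le_trans (le_norm_Rint (measurable_itv _) I Ic _) _.
    move=> r; rewrite /= in_itv /= => hr; have /andP[r0 r2] := hr.
    have r02 : 0 < r <= 2 by rewrite r0 ltW.
    rewrite normrM; apply: le_trans (ler_pM (normr_ge0 _) (normr_ge0 _) (hb _) (hK o _ _ r x z r02 z0 (hA _ _ _ _ hr cg))) _.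
    by rewrite /c le_eqVlt; apply/orP; left; apply/eqP; ring.
  rewrite RintZ//; have := ler_wpM2l (mulr_ge0 c0 d0) bW; rewrite [c * W * _]mulrAC; exact.
apply: le_trans (ler_normB _ _) _; rewrite -addrA [leRHS]mulrDl; apply: lerD => //.
apply: (@le_trans _ _ (a * dec x z)); last by rewrite [leRHS]mulrDl mul1r lerDl.
rewrite !normrM normr_nat /a -!mulrA ler_wpM2l// ler_wpM2l// !mulrA -[leRHS]mulrA -[leRHS]mulrA.
by apply: ler_pM => //; rewrite mulrA; rewrite -mulrA; apply: le_trans (G_dec m0 o x z0 (Cd_pred (Cd_partial j cg))) _; rewrite !mulrA.
Qed.

Lemma vel_normal x z t : 0 < z -> is_derive z 1 (fun z => vel x z t) (vel_n x z t) /\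
  Intg D2 (fun s => h (t - s) * dKn o kap (U g s) s x z).
Proof.
move=> z0; have [A A0 hA] := U_Cd2; have [K K0 hK] := Rn_bound m0 kap; have [K2 K20 hK2] := @hk2_dec R m.
have z2 : 0 < z / 2 by rewrite divr_gt0.
pose a := 2 + 4 * `|kap| * @gA R m; have a0 : 0 <= a by rewrite addr_ge0// !mulr_ge0.
pose c := a * (A * C) * K2 + K * (A * C) * (2 * z); pose c' := K * (A * C).
have AC : 0 <= A * C by rewrite mulr_ge0// ltW.
have IE := integrable_Ek0 z2.
have I12 : Intg D2 (fun s : R => s `^ (- (1 / 2))) by apply: integrable_pow => //; lra.
have IG := integrable_scale Hb (measurable_itv _) (integrable_add (measurable_itv _)
  (integrable_scale c (measurable_itv _) IE) (integrable_scale c' (measurable_itv _) I12)).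
have near_z u : `|u - z| < z / 2 -> z / 2 < u /\ u < 2 * z.
  by rewrite ltr_norml => /andP[h1 h2]; split; lra.
have hder (u r : R) : `|u - z| < z / 2 -> D2 r ->
    is_derive u 1 (fun u => h (t - r) * Kg kap o g r x u) (h (t - r) * dKn o kap (U g r) r x u).
  move=> /near_z[u1 u2]; rewrite /= in_itv /= => hr; have /andP[r0 r2] := hr; apply: is_derive_fscale.
  exact: (Kn_is_derive m0 o kap x r0 (lt_trans z2 u1) (hA _ _ _ _ hr cg)).
have hbnd (u r : R) : `|u - z| < z / 2 -> D2 r ->
    `|h (t - r) * dKn o kap (U g r) r x u| <= Hb * (c * Ek r (z / 2) + c' * r `^ (- (1 / 2))).
  move=> /near_z[u1 u2]; rewrite /= in_itv /= => hr; have /andP[r0 r2] := hr.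
  have r02 : 0 < r <= 2 by rewrite r0 ltW.
  have u0 := lt_trans z2 u1; have cU := hA _ _ _ _ hr cg.
  have eE : Ek r u <= Ek r (z / 2) by apply: Ek_anti => //; exact: ltW.
  have E0 := Ek_ge0 r u; have d0 := ltW (dec_gt0 x u); have d1 := dec_le1 x u.
  have T0 : 0 <= r `^ (- (1 / 2)) by exact: powR_ge0.
  rewrite normrM; apply: ler_pM => //; apply: le_trans (ler_normD _ _) _.
  have b1 : `|hk2 r u * An o kap (U g r) x| <= a * (A * C) * K2 * Ek r (z / 2).
    rewrite normrM; apply: le_trans (ler_wpM2l (normr_ge0 _) (An_bound m0 o kap x (Cd_pred cU) (Cd_pred (Cd_pred cU)))) _.
    rewrite -/a (_ : `|hk2 r u| * _ = a * (A * C) * (`|hk2 r u| * dec x 0)); last by ring.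
    rewrite -[leRHS]mulrA; apply: (ler_wpM2l (mulr_ge0 a0 AC)); apply: le_trans (hK2 r x u r02) _.
    apply: (@le_trans _ _ (K2 * Ek r u)); first by rewrite ler_piMr// mulr_ge0// ltW.
    by rewrite ler_wpM2l// ltW.
  have b2 : `|Rn o kap (U g r) r x u| <= K * (A * C) * (2 * z) * Ek r (z / 2) + c' * r `^ (- (1 / 2)).
    apply: le_trans (hK o _ _ r x u r02 u0 cU) _; have KAC : 0 <= K * (A * C) by rewrite mulr_ge0// ltW.
    apply: (@le_trans _ _ (K * (A * C) * (u * Ek r u + r `^ (- (1 / 2))))).
      by rewrite ler_piMr// mulr_ge0// addr_ge0// mulr_ge0// ltW.
    by rewrite mulrDr lerD2r -[leRHS]mulrA ler_wpM2l//; apply: ler_pM => //; exact: ltW.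
  by apply: le_trans (lerD b1 b2) _; rewrite /c [X in _ <= X + _]mulrDl addrA.
have [I d] := @Rint_is_derive R D2 (fun u r => h (t - r) * Kg kap o g r x u)
  (fun u r => h (t - r) * dKn o kap (U g r) r x u) _ z (z / 2) (measurable_itv _) z2
  (fun u hu => Kg_integrable x t (lt_trans z2 (near_z u hu).1)) hder IG hbnd.
have d2 := is_derive_fsub d (is_derive_fscale (2 * kap * h t) (G_is_derive o x z0 cg1)).
by split; [exact: d2|exact: I].
Qed.

End Solution.

Lemma vhatE (i : 'I_m.+1) (g : 'rV[R]_m -> R) C (h : R -> R) (Hb : R) x z t : Cd 3 C g -> continuous h -> (forall s, `|h s| <= Hb) ->
  (forall s, s <= 0 -> h s = 0) -> 0 < z -> 0 <= t <= 2 ->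
  vhat g h i (emb x z) t = vel (@kappa R m) (unlift ord_max i) g h x z t.
Proof.
move=> cg ch hb h0 z0 ht; have /andP[t0 t2] := ht; have cg2 := Cd_pred cg.
set o := unlift ord_max i; rewrite /vhat /vel /oint t0; congr (_ - _).
  have ck s : 0 < s < t -> {for s, continuous (fun s => h s * Kg (@kappa R m) o g (t - s) x z)}.
    move=> /andP[s0 st]; apply: continuousM; first exact: ch.
    apply: (@continuous_comp _ _ _ (fun s : R => t - s) (fun s => Kg (@kappa R m) o g s x z)).
      by apply: cvgB; [exact: cvg_cst|exact: cvg_id].
    by apply: Kg_continuous cg2 => //; apply/andP; split; lra.
  have ek s : 0 < s < t -> iintR (fun xi => Ktil i (emb x z - emb xi 0) (t - s) * phin g h xi s) = h s * Kg (@kappa R m) o g (t - s) x z.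
    by move=> /andP[s0 st]; rewrite -(Ktil_conv m0 i _ x (h s) z0 cg2)// subr_gt0.
  rewrite (Rint_cc_eq ek ck).
  rewrite -Rint_itv_cc; last exact: measurable_open_itv.
  by apply: (time_reflect ht h0); exact: Kg_integrable cg ch hb _ _ _ z0.
rewrite (G_reflect o x z0 (Cd_dom cg)).
have dK : dom qK (@kb R m z * C) (fun xi => kk o (x - xi) z * g xi).
  apply: dom_prod_bounded (Cd_dom cg); last by move=> xi; exact: (kk_kb o (x - xi) z0 (lexx z)).
  exact: (@continuous_reflect R m (fun y => kk o y z) x (@kk_continuous R m o z z0)).
rewrite -mulrA -mulrA; congr (_ * _); rewrite mulrA -(iintR_scale qK_half _ dK); congr iintR; apply/funext => xi.
by rewrite emb_sub subr0 dEE// /phin; move: (kk _ _ _) => u; ring.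
Qed.

End Velocity.

Section NormalDerivative.
Context {R : realType} {m : nat}.
Hypothesis m0 : (0 < m)%N.
Implicit Types (x : 'rV[R]_m) (t s z M : R) (o : option 'I_m).
Local Notation mu := (@lebesgue_measure R).
Local Notation Intg D f := (mu.-integrable (D : set R) (EFin \o (f : R -> R))).
Local Notation Rint := (@Rintegral _ _ R mu).
Local Notation D2 := (`]0%R, 2%R[%classic : set R).

Lemma hk2_Ek : exists2 K, 0 < K & forall t z, 0 < t <= 2 -> `|@hk2 R t z| <= K * Ek t z.
Proof.
have [K K0 h] := @hk2_bound R 0 (lexx 0); exists K => // t z t02.
by have := h t z t02; rewrite powRr0 mul1r.
Qed.

Lemma hk_weight_bound (q : R) : 0 <= q -> exists2 K, 0 < K & forall t z, 0 < t <= 2 ->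
  (1 + z ^+ 2) `^ q * hk t z <= K * (t * Ek t z).
Proof.
move=> q0; have [K K0 h] := hk_weight q0; exists K => // t z t02; apply: le_trans (h t z t02).
have /andP[t0 _] := t02; by rewrite ler_wpM2l ?powR_ge0// ler_peMl ?hk_ge0// lerDl divr_ge0 ?sqr_ge0// ltW.
Qed.

Lemma tEk_le t z : 0 < t -> t * Ek t z <= t `^ (- (1 / 2)).
Proof.
move=> t0; apply: le_trans (ler_wpM2l (ltW t0) (Ek_le z t0)) _.
rewrite -{1}[t]powRr1 ?(ltW t0)// -powRD; last by apply/implyP => _; rewrite gt_eqF.
by rewrite (_ : 1 + - (3 / 2) = - (1 / 2) :> R)//; lra.
Qed.

Lemma hk_cvg0 (p z : R) : 0 <= p -> 0 < z -> t `^ p * hk t z @[t --> 0^'+] --> (0 : R).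
Proof.
move=> p0 z0; have [K K0 h] := @hk_weight_bound 0 (lexx 0).
have c16 : 0 < 16^-1 :> R by rewrite invr_gt0.
pose c := K * (16 / z ^+ 2).
have c0 : 0 < c by rewrite mulr_gt0// divr_gt0// exprn_gt0.
have b t : 0 < t -> t <= 1 -> `|t `^ p * hk t z| <= c * t `^ (1 / 2).
  move=> t0 t1; have t02 : 0 < t <= 2 by apply/andP; split=> //; lra.
  have := h t z t02; rewrite powRr0 mul1r => h1.
  rewrite normrM (ger0_norm (hk_ge0 t z)) (ger0_norm (powR_ge0 _ _)).
  have tp : t `^ p <= 1 by rewrite -(powRr0 t); apply: ger_powR => //; rewrite t0.
  apply: le_trans (_ : _ <= hk t z) _; first by rewrite ler_piMl// hk_ge0.
  apply: le_trans h1 _; rewrite /c -mulrA ler_wpM2l ?(ltW K0)//.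
  have -> : t * Ek t z = t `^ (- (1 / 2)) * expR (- (z ^+ 2 / (16 * t))).
    rewrite /Ek mulrA -{1}[t]powRr1 ?(ltW t0)// -powRD; last by apply/implyP => _; rewrite gt_eqF.
    by congr (_ `^ _ * _); lra.
  have -> : t `^ (1 / 2) = t `^ (- (1 / 2)) * t.
    rewrite -{3}[t]powRr1 ?(ltW t0)// -powRD; last by apply/implyP => _; rewrite gt_eqF.
    by congr (_ `^ _); lra.
  rewrite mulrCA ler_wpM2l ?powR_ge0//.
  have u0 : 0 < z ^+ 2 / (16 * t) by rewrite divr_gt0 ?exprn_gt0 ?mulr_gt0.
  have -> : 16 / z ^+ 2 * t = (z ^+ 2 / (16 * t))^-1 by field; rewrite !gt_eqF.
  rewrite expRN lef_pV2 ?posrE ?expR_gt0//; apply: le_trans (expR_ge1Dx _).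
  by rewrite lerDr.
apply/cvgrPdist_le => /= e e0; near=> t; rewrite sub0r normrN.
have t0 : 0 < t by near: t; exact: nbhs_right_gt.
apply: le_trans (b t t0 _) _; first by near: t; exact: nbhs_right_le.
have te : t <= (e / c) ^+ 2 by near: t; apply: nbhs_right_le; rewrite exprn_gt0// divr_gt0.
rewrite mulrC -ler_pdivlMr// div1r powR12_sqrt ?(ltW t0)//.
have ec : 0 <= e / c by rewrite divr_ge0// ltW.
by rewrite -(ger0_norm ec) -sqrtr_sqr ler_wsqrtr.
Unshelve. all: by end_near.
Qed.

Lemma integrable_hk2 (psi : R -> R) B z : 0 < z -> 0 <= B -> (forall t, 0 < t < 2 -> {for t, continuous psi}) ->
  (forall t, 0 < t < 2 -> `|psi t| <= B) -> Intg D2 (fun t => psi t * hk2 t z).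
Proof.
move=> z0 B0 cpsi bpsi; have [K K0 hK] := hk2_Ek.
apply: (@integrable_dom R _ _ (fun t => B * K * Ek t z)) => //.
- apply: measurable_open_itv => t ht; have /andP[t0 _] := ht.
  by apply: continuousM; [exact: cpsi|exact: hk2_continuous_t].
- move=> t; rewrite /= in_itv /= => ht; have /andP[t0 t2] := ht.
  by rewrite normrM -mulrA; apply: ler_pM => //; [exact: bpsi|apply: hK; rewrite t0 ltW].
- by apply: integrable_scale => //; exact: integrable_Ek0.
Qed.

Lemma Rint_hk2 z : 0 < z -> Rint D2 (fun t => hk2 t z) = hk 2 z.
Proof.
move=> z0; have c1 t : 0 < t < 2 -> {for t, continuous (fun _ : R => 1 : R)} by move=> _; exact: cst_continuous.
have b1 t : 0 < t < 2 -> `|1| <= 1 :> R by rewrite normr1.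
have I := integrable_hk2 z0 ler01 c1 b1.
have I' : Intg D2 (fun t => hk2 t z) by apply: integrable_eq I => // t _; rewrite mul1r.
rewrite -[hk 2 z]subr0; apply: (@Rint_FTC_open R (hk ^~ z)) => //.
- by move=> t /andP[t0 _]; exact: hk_is_derive_t.
- by move=> t /andP[t0 _]; exact: hk2_continuous_t.
- by have := hk_cvg0 (lexx 0) z0; under eq_fun do rewrite powRr0 mul1r.
- by apply: cvg_at_left_filter; exact: hk_continuous_t.
Qed.

Section Decomposition.
Context (kap : R) (o : option 'I_m) (g : 'rV[R]_m -> R) (C : R) (h : R -> R) (Hb : R).
Hypotheses (cg : Cd 3 C g) (ch : continuous h) (hb : forall s, `|h s| <= Hb).
Let Hb0 : 0 <= Hb := le_trans (normr_ge0 _) (hb 0).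
Let C0 : 0 <= C := Cd_ge0 cg.
Let gA0 : 0 <= @gA R m. Proof. by rewrite addr_ge0 ?tA_ge0 ?nA_ge0. Qed.

Definition main_t t z : R := Rint D2 (fun s => h (t - s) * hk2 s z).

Lemma An_diff : exists2 M, 0 < M & forall x s, 0 < s <= 2 ->
  `|An o kap (U g s) x - @cN R m * An o kap g x| <= M * s * dec x 0.
Proof.
have [A A0 hA] := U_diff_Cd m0 (ler0n R 2); have [B B0 hB] := @U_Cd R m 2 (ler0n R 2).
pose a := 2 + 4 * `|kap| * @gA R m; have a0 : 0 <= a by rewrite addr_ge0// !mulr_ge0.
exists (a * (A * C) + 1) => [|x s hs]; first by rewrite ltr_wpDl// !mulr_ge0// ltW.
have /andP[s0 s2] := hs; have hs' : 0 <= s <= 2 by rewrite (ltW s0).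
have c2 := Cd_pred (hB _ _ _ _ hs' cg); have cg2 := Cd_pred cg.
have e f : (fun y => 1 * f y + - @cN R m * g y) = (fun y => f y - @cN R m * g y).
  by apply/funext => y; rewrite mul1r mulNr.
have l := An_lin m0 o kap 1 (- @cN R m) x c2 cg2; rewrite e mul1r mulNr in l.
have cd2 := Cd_lin 1 (- @cN R m) c2 cg2; rewrite e in cd2.
rewrite -l; apply: le_trans (An_bound m0 o kap x cd2 (hA _ _ _ hs cg)) _.
have d0 := ltW (dec_gt0 x (0 : R)); rewrite ler_wpM2r// -/a !mulrA ler_wpM2r ?(ltW s0)//.
by rewrite lerDl.
Qed.

Lemma vel_n_decomp : exists2 M, 0 < M & forall x z t, 0 < z ->
  `|vel_n kap o g h x z t - @cN R m * An o kap g x * main_t t z| <= M * dec x z.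
Proof.
have [A A0 hA] := @U_Cd2 R m; have [K K0 hK] := Rn_bound m0 kap; have [K2 K20 hK2] := @hk2_dec R m.
have [M M0 hM] := An_diff; have [W W0 hW] := @Wz_integral R.
pose c := M * K2 + K * (A * C); have AC : 0 <= A * C by rewrite mulr_ge0// ltW.
have c0 : 0 <= c by rewrite addr_ge0// mulr_ge0// ltW.
pose a := 2 * `|kap| * Hb * (m%:R * @gA R m * C); have a0 : 0 <= a by rewrite !mulr_ge0.
exists (Hb * c * W + a + 1) => [|x z t z0]; first by rewrite ltr_wpDl// addr_ge0// !mulr_ge0// ltW.
have d0 := ltW (dec_gt0 x z); have [IW bW] := hW z z0.
have [_ I1] := vel_normal m0 kap o cg ch hb x t z0.
have I2 : Intg D2 (fun s => h (t - s) * hk2 s z).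
  by apply: (integrable_hk2 z0 Hb0) => s _; [exact: shift_continuous|exact: hb].
have I2' := integrable_scale (@cN R m * An o kap g x) (measurable_itv _) I2.
have I3 := integrable_sub (measurable_itv _) I1 I2'.
have e : vel_n kap o g h x z t - @cN R m * An o kap g x * main_t t z =
  Rint D2 (fun s => h (t - s) * dKn o kap (U g s) s x z - @cN R m * An o kap g x * (h (t - s) * hk2 s z)) - 2 * kap * h t * Dz o g x z.
  rewrite (RintB (measurable_itv _) I1 I2') (RintZ _ (measurable_itv _) I2) /vel_n /main_t.
  by move: (Rint _ _) (Rint _ _) (Dz _ _ _ _) => u1 u2 u3; ring.
have Ic := integrable_scale (Hb * c * dec x z) (measurable_itv _) IW.
have b : `|Rint D2 (fun s => h (t - s) * dKn o kap (U g s) s x z - @cN R m * An o kap g x * (h (t - s) * hk2 s z))| <= Hb * c * W * dec x z.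
  apply: le_trans (le_norm_Rint (measurable_itv _) I3 Ic _) _; last first.
    by rewrite RintZ// [leRHS]mulrAC; rewrite ler_wpM2l// !mulr_ge0.
  move=> s; rewrite /= in_itv /= => hs; have /andP[s0 s2] := hs.
  have s02 : 0 < s <= 2 by rewrite s0 ltW.
  have -> : h (t - s) * dKn o kap (U g s) s x z - @cN R m * An o kap g x * (h (t - s) * hk2 s z) =
    h (t - s) * (hk2 s z * (An o kap (U g s) x - @cN R m * An o kap g x) + Rn o kap (U g s) s x z).
    by rewrite /dKn; move: (An _ _ _ _) (An _ _ _ _) (Rn _ _ _ _ _ _) => u1 u2 u3; ring.
  rewrite normrM (_ : Hb * c * dec x z * Wz z s = Hb * (c * (dec x z * Wz z s))); last by ring.
  apply: ler_pM => //; apply: le_trans (ler_normD _ _) _.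
  have b1 : `|hk2 s z * (An o kap (U g s) x - @cN R m * An o kap g x)| <= M * K2 * Wz z s * dec x z.
    rewrite normrM; apply: le_trans (ler_wpM2l (normr_ge0 _) (hM x s s02)) _.
    have h3 := hK2 s x z s02; have h4 := tEk_le z s0.
    have Ms : 0 <= M * s by rewrite mulr_ge0// ltW.
    have h5 := ler_wpM2l Ms h3.
    apply: le_trans (_ : _ <= M * s * (K2 * Ek s z * dec x z)) _.
      by move: h5; rewrite mulrCA.
    have h6 : s * Ek s z <= Wz z s by apply: le_trans h4 _; rewrite lerDr mulr_ge0 ?Ek_ge0// ltW.
    have := ler_wpM2l (mulr_ge0 (mulr_ge0 (ltW M0) (ltW K20)) d0) h6.
    by move: (Ek s z) (Wz z s) (dec x z) => u1 u2 u3; lra.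
  have b2 := hK o _ _ s x z s02 z0 (hA _ _ _ _ hs cg).
  apply: le_trans (lerD b1 b2) _; rewrite /c -/(Wz z s) le_eqVlt; apply/orP; left; apply/eqP.
  by move: (Wz z s) (dec x z) => u1 u2; ring.
rewrite e; apply: le_trans (ler_normB _ _) _; rewrite -addrA [leRHS]mulrDl; apply: lerD => //.
apply: (@le_trans _ _ (a * dec x z)); last by rewrite [leRHS]mulrDl mul1r lerDl.
rewrite [X in X <= _]normrM; have -> : a * dec x z = 2 * `|kap| * Hb * (m%:R * @gA R m * C * dec x z) by rewrite /a; ring.
apply: ler_pM => //; last exact: (Dz_dec m0 o x z0 (Cd_pred cg)).
by rewrite !normrM normr_nat; apply: ler_pM.
Qed.

(* The increment [h (t - s) - h t] tames the singularity of [hk2] at [s = 0]; the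
   constant part integrates to a boundary term. *)
Lemma main_t_bound : exists2 M, 0 < M & forall (psi : R -> R) B x z t, 0 < z -> 0 <= B ->
  (forall s, 0 < s < 2 -> 0 <= psi s) -> Intg D2 (fun s => psi s * Ek s z) ->
  (forall s, 0 < s < 2 -> `|h (t - s) - h t| <= B * psi s) ->
  dec x 0 * `|main_t t z| <= M * (B * Rint D2 (fun s => psi s * Ek s z) + 1) * dec x z.
Proof.
have [K2 K20 hK2] := @hk2_dec R m.
have m2 : 0 <= m%:R / 2 :> R by rewrite divr_ge0.
have [K K0 hK] := hk_weight_bound m2.
pose c := 2 `^ (m%:R / 2) * (K * 2 `^ (- (1 / 2))) * Hb; have c0 : 0 <= c.
  by rewrite !mulr_ge0 ?powR_ge0// ltW.
exists (K2 + c) => [|psi B x z t z0 B0 psi0 Ipsi hpsi]; first by rewrite ltr_wpDr.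
have d0 := ltW (dec_gt0 x z); have e0 := ltW (dec_gt0 x (0 : R)).
have I1 : Intg D2 (fun s => (h (t - s) - h t) * hk2 s z).
  apply: (@integrable_hk2 _ (Hb + Hb)) => //; first by rewrite addr_ge0.
    by move=> s _; apply: continuousB; [exact: shift_continuous|exact: cst_continuous].
  by move=> s _; apply: le_trans (ler_normB _ _) _; exact: lerD.
have I2 : Intg D2 (fun s => h t * hk2 s z).
  by apply: (integrable_hk2 z0 Hb0) => s _; [exact: cst_continuous|exact: hb].
have J : Intg D2 (fun s => hk2 s z).
  have J1 : Intg D2 (fun s => 1 * hk2 s z).
    by apply: (integrable_hk2 z0 ler01) => s _; [exact: cst_continuous|rewrite normr1].
  by apply: integrable_eq J1 => // s _; rewrite mul1r.
have -> : main_t t z = Rint D2 (fun s => (h (t - s) - h t) * hk2 s z) + h t * hk 2 z.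
  rewrite -(Rint_hk2 z0) -(RintZ _ (measurable_itv _) J) -(RintD (measurable_itv _) I1 I2).
  by apply: Rint_eq => s _; rewrite -mulrDl subrK.
have b1 : dec x 0 * `|Rint D2 (fun s => (h (t - s) - h t) * hk2 s z)| <= K2 * B * dec x z * Rint D2 (fun s => psi s * Ek s z).
  rewrite -{1}(ger0_norm e0) -normrM -(RintZ _ (measurable_itv _) I1) -(RintZ _ (measurable_itv _) Ipsi).
  apply: le_norm_Rint => //; try exact: integrable_scale.
  move=> s; rewrite /= in_itv /= => hs; have /andP[s0 s2] := hs.
  have s02 : 0 < s <= 2 by rewrite s0 ltW.
  rewrite normrM (ger0_norm e0) normrM mulrCA.
  have h3 := hK2 s x z s02; rewrite mulrC in h3.
  have h4 := ler_pM (normr_ge0 _) (mulr_ge0 e0 (normr_ge0 _)) (hpsi s hs) h3.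
  by apply: (le_trans h4); rewrite le_eqVlt; apply/orP; left; apply/eqP; ring.
have b2 : dec x 0 * `|h t * hk 2 z| <= c * dec x z.
  rewrite normrM (ger0_norm (hk_ge0 2 z)) mulrCA.
  have h3 := dec_peetre x z 0; rewrite subr0 in h3.
  have h22 : 0 < (2 : R) <= 2 by rewrite lexx ltr0n.
  have h4 := le_trans (hK 2 z h22) (ler_wpM2l (ltW K0) (@tEk_le 2 z (ltr0n _ _))).
  have h5 : dec x 0 * hk 2 z <= 2 `^ (m%:R / 2) * (K * 2 `^ (- (1 / 2))) * dec x z.
    apply: le_trans (ler_wpM2r (hk_ge0 2 z) h3) _.
    have := ler_wpM2l (mulr_ge0 (powR_ge0 2 (m%:R / 2)) d0) h4.
    by move: (2 `^ _) (_ `^ (m%:R / 2)) (2 `^ _) (hk 2 z) (dec x z) => u1 u2 u3 u4 u5; lra.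
  apply: le_trans (ler_pM (normr_ge0 _) (mulr_ge0 e0 (hk_ge0 _ _)) (hb t) h5) _.
  by rewrite /c le_eqVlt; apply/orP; left; apply/eqP; ring.
apply: le_trans (ler_wpM2l e0 (ler_normD _ _)) _; rewrite mulrDr; apply: le_trans (lerD b1 b2) _.
have P0 : 0 <= Rint D2 (fun s => psi s * Ek s z).
  by apply: Rintegral_ge0 => s; rewrite /= in_itv /= => hs; rewrite mulr_ge0 ?psi0 ?Ek_ge0.
have BP := mulr_ge0 B0 P0; move: BP; move: (Rint _ _) => P BP.
have -> : K2 * B * dec x z * P + c * dec x z = (K2 * (B * P) + c) * dec x z by ring.
rewrite ler_wpM2r//; have := mulr_ge0 c0 BP; have := mulr_ge0 (ltW K20) BP.
by move: (B * P) BP => X BP; nra.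
Qed.


End Decomposition.

End NormalDerivative.

Section BoundaryData.
Context {R : realType}.
Local Open Scope ring_scope.

Lemma powR_one (p : R) : 1 `^ p = 1.
Proof. by rewrite powR1. Qed.

Lemma powR_split (x r s : R) : 0 < x -> x `^ (r + s) = x `^ r * x `^ s.
Proof. by move=> x0; rewrite powRD// (gt_eqF x0) implybT. Qed.

Lemma powR_anti (p x y : R) : 0 < x -> x <= y -> p <= 0 -> y `^ p <= x `^ p.
Proof. by move=> x0 xy p0; rewrite -(opprK p) powR_mono_neg// oppr_ge0. Qed.

Section Profile.
Variables (a : R) (h : R -> R).
Hypotheses (ha : 0 < a <= 1 / 2) (hh0 : forall s, 0 <= h s) (hhcont : continuous h)
  (hhsupp : forall s, s < 1 / 4 \/ 1 < s -> h s = 0)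
  (hhC1 : forall s, 0 < s < 1 -> derivable h s 1 /\ {for s, continuous (derive1 h)})
  (hhform : forall s, 1 / 2 <= s <= 1 -> h s = (1 - s) `^ a).
Implicit Types (s t : R).

Let a0 : 0 < a. Proof. by case/andP: ha. Qed.
Let a12 : a <= 1 / 2. Proof. by case/andP: ha. Qed.

Lemma profile_ge1 s : 1 <= s -> h s = 0.
Proof.
rewrite le_eqVlt => /orP[/eqP <-|s1]; last by apply: hhsupp; right.
by rewrite hhform ?subrr ?powR0 ?gt_eqF//; lra.
Qed.

Lemma profile_bounded : exists2 H, 0 < H & forall s, `|h s| <= H.
Proof.
have hc : {within `[0, 1], continuous h} by apply: continuous_subspaceT => s; exact: hhcont.
have [c _ hcm] := EVT_max ler01 hc.
exists (h c + 1) => [|s]; first by rewrite ltr_wpDl.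
rewrite ger0_norm//; case: (ltP s (1 / 4)) => s1.
  by rewrite hhsupp ?addr_ge0//; left.
case: (ltP 1 s) => s2; first by rewrite hhsupp ?addr_ge0//; right.
have := hcm s; rewrite in_itv /= => H; have := H _; move: (hh0 c) => h0.
have s01 : 0 <= s <= 1 by lra.
by move=> /(_ s01); lra.
Qed.

Lemma profile_is_derive s : s < 1 -> is_derive s 1 h (derive1 h s).
Proof.
move=> s1; case: (ltP 0 s) => s0.
  have s01 : 0 < s < 1 by rewrite s0 s1.
  have [d _] := hhC1 s01.
  by rewrite derive1E; exact: derivableP.
have E : \forall y \near s, 0 = h y.
  have s14 : s < 1 / 4 by lra.
  by near=> y; rewrite hhsupp//; left; near: y; exact: lt_nbhsl.
have d := is_derive_ext E (is_derive_fcst (0 : R) s).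
by rewrite derive1E; have [d1 d2] := d; rewrite d2.
Unshelve. all: by end_near. Qed.

Lemma profile_derive_bound : exists2 D, 0 < D & forall s, s < 1 -> `|derive1 h s| <= D * (1 - s) `^ (a - 1).
Proof.
have hc : {within `[1 / 8, 3 / 4], continuous (fun s => `|derive1 h s|)}.
  apply: continuous_in_subspaceT => s; rewrite inE /= in_itv /= => hs.
  apply: continuous_comp; last exact: norm_continuous.
  by apply: (hhC1 _).2; lra.
have h8 : 1 / 8 <= 3 / 4 :> R by lra.
have [c _ hcm] := EVT_max h8 hc.
exists (`|derive1 h c| + 1) => [|s s1]; first by rewrite ltr_wpDl.
have c0 : 0 <= `|derive1 h c| by [].
have p0 := powR_ge0 (1 - s) (a - 1).
case: (ltP s (1 / 8)) => s8.
  have -> : derive1 h s = 0.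
    have E : \forall y \near s, 0 = h y.
      by near=> y; rewrite hhsupp//; left; apply: (@lt_le_trans _ _ (1 / 8)); [near: y; exact: lt_nbhsl|lra].
    by rewrite derive1E; have [d1 d2] := is_derive_ext E (is_derive_fcst (0 : R) s).
  by rewrite normr0 mulr_ge0// addr_ge0.
case: (leP s (3 / 4)) => s34.
  have h1 : 1 <= (1 - s) `^ (a - 1).
    rewrite -[leLHS](powR_one (a - 1)). have am : a - 1 <= 0 by move: (a12); lra. apply: powR_anti. lra. lra. lra.
  have := hcm s; rewrite in_itv /= => /(_ _) h2.
  have h3 : 1 / 8 <= s <= 3 / 4 by lra.
  by have := h2 h3; nra.
have -> : derive1 h s = - (a * (1 - s) `^ (a - 1)).
  have E : \forall y \near s, (1 - y) `^ a = h y.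
    near=> y; rewrite hhform//; apply/andP; split; first apply: ltW; last apply: ltW.
      by near: y; apply: lt_nbhsr; lra.
    by near: y; exact: lt_nbhsl.
  have d0 : is_derive s 1 (fun y => 1 - y) (- 1).
    have := is_derive_fsub (is_derive_fcst (1 : R) s) (is_derive_fid s).
    by rewrite sub0r.
  have s10 : 0 < 1 - s by lra.
  have d := is_derive_ext E (@is_derive_fpowR _ (fun y => 1 - y) a s _ s10 d0).
  by rewrite derive1E; have [d1 ->] := d; rewrite mulrN1.
rewrite normrN ger0_norm ?mulr_ge0 ?(ltW a0)// ler_wpM2r//; move: (a12); lra.
Unshelve. all: by end_near. Qed.

Lemma powR_sub_le (p u v : R) : 0 <= u -> 0 <= v -> 0 < p <= 1 -> `|u `^ p - v `^ p| <= `|u - v| `^ p.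
Proof.
have W (x y : R) : 0 <= x -> x <= y -> 0 < p <= 1 -> `|x `^ p - y `^ p| <= `|x - y| `^ p.
  move=> x0 xy /andP[p0 p1]; have y0 := le_trans x0 xy.
  rewrite distrC ger0_norm ?subr_ge0 ?(powR_mono x0 xy (ltW p0))//.
  rewrite distrC ger0_norm ?subr_ge0//.
  move: x0; rewrite le_eqVlt => /orP[/eqP <-|x0]; first by rewrite powR0 ?gt_eqF// !subr0.
  have yy : 0 < y by exact: lt_le_trans xy.
  move: xy; rewrite le_eqVlt => /orP[/eqP <-|xy]; first by rewrite !subrr powR_ge0.
  have e0 : 0 < y - x by rewrite subr_gt0.
  (* y^p = x y^(p-1) + (y-x) y^(p-1), and y^(p-1) is smaller than x^(p-1) and (y-x)^(p-1) *)
  have E (w : R) : 0 < w -> w `^ p = w * w `^ (p - 1).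
    by move=> w0; rewrite -[X in X * _](powRr1 (ltW w0)) -powR_split//; congr (_ `^ _); ring.
  have L (w : R) : 0 < w -> w <= y -> w * y `^ (p - 1) <= w `^ p.
    move=> w0 wy; rewrite (E _ w0) ler_wpM2l ?(ltW w0)//.
    apply: powR_anti => //; lra.
  have L1 := L x x0 (ltW xy); have L2 : (y - x) * y `^ (p - 1) <= (y - x) `^ p by apply: L => //; lra.
  rewrite (E _ yy); move: L1 L2; move: (y `^ (p - 1)) (x `^ p) ((y - x) `^ p) => u1 u2 u3; lra.
move=> u0 v0 hp; case: (leP u v) => [uv|/ltW vu]; first exact: W.
by rewrite distrC (distrC u); apply: W.
Qed.

Lemma profile_holder (b : R) : 0 < b <= a -> exists2 K, 0 < K & forall s t, `|h s - h t| <= K * `|s - t| `^ b.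
Proof.
move=> /andP[b0 ba]; have [H H0 hH] := profile_bounded; have [D D0 hD] := profile_derive_bound.
pose D1 := D * (1 / 4) `^ (a - 1); have D10 : 0 <= D1 by rewrite mulr_ge0 ?powR_ge0// ltW.
pose K := 2 * H * 4 `^ b + D1 + 1.
have K0 : 0 < K by rewrite /K ltr_wpDl// addr_ge0// mulr_ge0 ?powR_ge0// mulr_ge0// ltW.
have W (s t : R) : s <= t -> `|h s - h t| <= K * (t - s) `^ b.
  move=> st; have p0 := powR_ge0 (t - s) b; have q0 := powR_ge0 4 b.
  case: (leP (1 / 4) (t - s)) => far.
    apply: le_trans (ler_normB _ _) _.
    have h1 : 1 <= 4 `^ b * (t - s) `^ b.
      by rewrite -powRM ?subr_ge0// -[leLHS](powR_one b); apply: powR_mono; lra.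
    have h2 : 2 * H <= 2 * H * 4 `^ b * (t - s) `^ b.
      by rewrite -mulrA ler_peMr// mulr_ge0// ltW.
    apply: (@le_trans _ _ (2 * H)); first by have := hH s; have := hH t; lra.
    apply: le_trans h2 _; rewrite /K; apply: ler_wpM2r => //; lra.
  have pw (c : R) : b <= c -> (t - s) `^ c <= (t - s) `^ b.
    move=> bc; move: (st); rewrite le_eqVlt => /orP[/eqP <-|lt].
      by rewrite subrr !powR0 ?gt_eqF//; lra.
    have t0 : 0 < t - s <= 1 by lra.
    by apply: ger_powR.
  case: (leP t (3 / 4)) => t34.
    have d1 (x : R) : s <= x <= t -> is_derive x 1 h (derive1 h x).
      by move=> hx; apply: profile_is_derive; lra.
    have d2 (x : R) : s <= x <= t -> `|derive1 h x| <= D1.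
      move=> hx; have x1 : x < 1 by lra.
      apply: le_trans (hD x x1) _; rewrite ler_wpM2l ?(ltW D0)//.
      have am : a - 1 <= 0 by move: (a12); lra. apply: powR_anti am. lra. lra.
    rewrite distrC; apply: le_trans (mvt_le st d1 d2) _.
    have := pw 1 _; rewrite powRr1 ?subr_ge0// => /(_ _) h3.
    have b1 : b <= 1 by move: (a12); lra.
    have h4 := ler_wpM2l D10 (h3 b1); apply: le_trans h4 _; rewrite ler_wpM2r// /K; nra.
  have s12 : 1 / 2 <= s by lra.
  have E (x : R) : 1 / 2 <= x -> h x = Num.max 0 (1 - x) `^ a.
    move=> x12; case: (leP x 1) => x1.
      by rewrite hhform ?x12//; congr (_ `^ _); rewrite max_r//; lra.
    by rewrite profile_ge1 ?(ltW x1)// max_l ?powR0 ?gt_eqF//; lra.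
  rewrite (E _ s12) E; last lra.
  have a1 : 0 < a <= 1 by move: (a0) (a12); lra.
  have m1 : 0 <= Num.max 0 (1 - s) by rewrite le_max lexx.
  have m2 : 0 <= Num.max 0 (1 - t) by rewrite le_max lexx.
  apply: le_trans (powR_sub_le m1 m2 a1) _.
  have h5 : `|Num.max 0 (1 - s) - Num.max 0 (1 - t)| <= t - s.
    by rewrite ler_norml; case: (leP 0 (1 - s)); case: (leP 0 (1 - t)); lra.
  apply: le_trans (powR_mono (normr_ge0 _) h5 (ltW a0)) _.
  apply: le_trans (pw a ba) _; rewrite ler_peMl// /K.
  have : 0 <= 2 * H * 4 `^ b by rewrite mulr_ge0// mulr_ge0// ltW.
  by lra.
exists K => // s t; case: (leP s t) => st; first by rewrite (distrC s) (ger0_norm (_ : 0 <= t - s)) ?subr_ge0// W.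
by rewrite distrC (ger0_norm (_ : 0 <= s - t)) ?subr_ge0 ?W ?ltW.
Qed.

(* Interpolates the bound (1-t)^(a-1) tau with the Hoelder bound tau^a. *)
Lemma profile_increment : exists2 K, 0 < K & forall t tau, t != 1 -> 0 < tau ->
  `|h (t - tau) - h t| <= K * `|1 - t| `^ ((a - 1) / 2) * tau `^ ((1 + a) / 2).
Proof.
have aa : 0 < a <= a by rewrite a0 lexx.
have [K K0 hK] := profile_holder aa; have [D D0 hD] := profile_derive_bound.
exists (K + D) => [|t tau t1 tau0]; first by rewrite addr_gt0.
have w0 : 0 < `|1 - t| by rewrite normr_gt0 subr_eq0 eq_sym.
have P1 := powR_ge0 `|1 - t| ((a - 1) / 2); have P2 := powR_ge0 tau ((1 + a) / 2).
have P12 := mulr_ge0 P1 P2.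
case: (ltP `|1 - t| tau) => far.
  apply: le_trans (hK _ _) _.
  have -> : `|t - tau - t| = tau by rewrite addrAC subrr sub0r normrN gtr0_norm.
  have -> : tau `^ a = tau `^ ((a - 1) / 2) * tau `^ ((1 + a) / 2).
    by rewrite -powR_split//; congr (_ `^ _); field.
  have h1 : tau `^ ((a - 1) / 2) <= `|1 - t| `^ ((a - 1) / 2).
    have am : (a - 1) / 2 <= 0 by move: (a12); lra. exact: powR_anti w0 (ltW far) am.
  rewrite -!mulrA; apply: ler_pM; [exact: ltW|by rewrite mulr_ge0 ?powR_ge0| |exact: ler_wpM2r].
  by rewrite lerDl ltW.
case: (ltP t 1) => t1'; last first.
  have tt : 0 <= t - 1 by lra.
  have E : `|1 - t| = t - 1 by rewrite distrC ger0_norm.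
  rewrite E in far *; rewrite !profile_ge1 ?subrr ?normr0//; last lra.
  by rewrite !mulr_ge0 ?powR_ge0// addr_ge0 ?ltW.
have E : `|1 - t| = 1 - t by rewrite gtr0_norm// subr_gt0.
rewrite E in far P1 P12 w0 *.
have ts : t - tau <= t by rewrite gerBl ltW.
have d1 (x : R) : t - tau <= x <= t -> is_derive x 1 h (derive1 h x).
  by move=> hx; apply: profile_is_derive; lra.
have d2 (x : R) : t - tau <= x <= t -> `|derive1 h x| <= D * (1 - t) `^ (a - 1).
  move=> hx; have x1 : x < 1 by lra.
  apply: le_trans (hD x x1) _; rewrite ler_wpM2l ?(ltW D0)//.
  have am : a - 1 <= 0 by move: (a12); lra. apply: powR_anti am. lra. lra.
rewrite distrC; apply: le_trans (mvt_le ts d1 d2) _.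
have -> : t - (t - tau) = tau by ring.
have -> : (1 - t) `^ (a - 1) = (1 - t) `^ ((a - 1) / 2) * (1 - t) `^ ((a - 1) / 2).
  by rewrite -powR_split//; congr (_ `^ _); field.
have h2 : tau = tau `^ ((1 + a) / 2) * tau `^ ((1 - a) / 2).
  by rewrite -powR_split// -[LHS](powRr1 (ltW tau0)); congr (_ `^ _); field.
have h3 : tau `^ ((1 - a) / 2) <= (1 - t) `^ ((1 - a) / 2).
  by apply: powR_mono => //; [lra|move: (a12); lra].
have h4 : (1 - t) `^ ((1 - a) / 2) * (1 - t) `^ ((a - 1) / 2) = 1.
  by rewrite -powR_split// -[RHS](powRr0 (1 - t)); congr (_ `^ _); field.
have h5 : (1 - t) `^ ((a - 1) / 2) * tau <= tau `^ ((1 + a) / 2).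
  have h3' := ler_wpM2l P1 h3; rewrite [X in _ <= X]mulrC h4 in h3'.
  by rewrite {1}h2 mulrCA -[leRHS]mulr1 ler_wpM2l.
have h6 := ler_wpM2l (mulr_ge0 (ltW D0) P1) h5.
have h7 := mulr_ge0 (ltW K0) P12.
move: h6 h7; move: ((1 - t) `^ ((a - 1) / 2)) (tau `^ ((1 + a) / 2)) => u1 u2; lra.
Qed.

End Profile.

Section Weight.
Context {m : nat}.
Implicit Types (f : 'rV[R]_m -> R) (x : 'rV[R]_m).

Lemma Cd_le k C C' f : Cd k C f -> C <= C' -> Cd k C' f.
Proof.
elim: k f => [|k IH] f [d p] cc; split => //; try exact: dom_le cc.
by move=> j; have [h1 h2] := p j; split => //; exact: IH.
Qed.

Lemma enorm_sq x : enorm x = Num.sqrt (sq x).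
Proof. by []. Qed.

Lemma enorm_continuous : continuous (@enorm R m).
Proof.
move=> x; apply: (@continuous_comp _ _ _ (@sq R m) (@Num.sqrt R)); first exact: sq_continuous.
exact: sqrt_continuous.
Qed.

Lemma supported_dom (q r : R) f : continuous f -> (forall x, r < enorm x -> f x = 0) -> exists C, dom q C f.
Proof.
move=> cf sf.
have cF : continuous (fun x => `|f x / Wt q x|).
  move=> x; apply: (@continuous_comp _ _ _ (fun x => f x / Wt q x) Num.norm); last exact: norm_continuous.
  apply: continuousM; first exact: cf.
  by apply: continuousV; [rewrite gt_eqF ?Wt_gt0|exact: Wt_continuous].
pose A (j : 'I_m) : set R := `[- `|r|, `|r|]%classic.
have cA : compact [set v : 'rV[R]_m | forall j, A j (v ord0 j)] by apply: rV_compact => j; exact: segment_compact.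
have := continuous_compact (continuous_subspaceT cF) cA.
move=> /compact_bounded [B [_ hB]].
exists (`|B| + 1); split=> // y.
case: (ltP r (enorm y)) => ry; first by rewrite sf// normr0 mulr_ge0 ?Wt_ge0// addr_ge0.
have yA : forall j, A j (y ord0 j).
  move=> j; rewrite /A /= in_itv /= -ler_norml; apply: le_trans (ler_norm r); apply: le_trans ry.
  rewrite enorm_sq -sqrtr_sqr; apply: ler_wsqrtr; exact: sq_coord_le.
have := hB (`|B| + 1) _ `|f y / Wt q y| _; rewrite /= normr_id normf_div (ger0_norm (Wt_ge0 q y)).
rewrite ler_pdivrMr ?Wt_gt0// => H; apply: H; last by exists y => //; rewrite normf_div (ger0_norm (Wt_ge0 q y)).
by apply: le_lt_trans (ler_norm _) _; rewrite ltrDl.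
Qed.

Lemma supported_partial (r : R) f j : (forall x, r < enorm x -> f x = 0) ->
  forall x, r < enorm x -> partial j f x = 0.
Proof.
move=> sf x rx; rewrite /partial.
have E : \forall s \near (0 : R), 0 = f (x + s *: unitv R j).
  have c : {for (0 : R), continuous (fun s : R => enorm (x + s *: unitv R j))}.
    apply: (@continuous_comp _ _ _ (fun s : R => x + s *: unitv R j) (@enorm R m)); last exact: enorm_continuous.
    by apply: cvgD; [exact: cvg_cst|apply: cvgZl; exact: cvg_id].
  have nx : r < enorm (x + (0 : R) *: unitv R j) by rewrite scale0r addr0.
  have gt0 := cvgr_gt (enorm (x + (0 : R) *: unitv R j)) c r nx.
  by near=> s; rewrite sf//; near: s; exact: gt0.
by rewrite derive1E; have [d1 ->] := is_derive_ext E (is_derive_fcst (0 : R) 0).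
Unshelve. all: by end_near. Qed.

Lemma supported_Cd (r : R) k f : Ck k f -> (forall x, r < enorm x -> f x = 0) -> exists C, Cd k C f.
Proof.
elim: k f => [|k IH] f.
  by move=> cf sf; have [C hC] := supported_dom (@qK R m) cf sf; exists C; split.
move=> [cf pf] sf; have [C hC] := supported_dom (@qK R m) cf sf.
have H j : exists C, Cd k C (partial j f) by apply: IH; [exact: (pf j).2|exact: supported_partial].
have [c hc] := choice H.
have c0 j : 0 <= c j := Cd_ge0 (hc j).
exists (C + \sum_j c j); split; first by apply: dom_le hC _; rewrite lerDl sumr_ge0.
move=> j; split; first exact: (pf j).1.
apply: Cd_le (hc j) _; rewrite (bigD1 j)//= addrCA lerDl addr_ge0 ?(dom_ge0 hC)//.
by apply: sumr_ge0.
Qed.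

End Weight.
End BoundaryData.

Section Energy.
Context {R : realType} {m : nat}.
Local Open Scope ring_scope.
Hypothesis m0 : (0 < m)%N.
Implicit Types (x y : 'rV[R]_m) (t s z w M : R) (o : option 'I_m).
Local Notation mu := (@lebesgue_measure R).
Local Notation Intg D f := (mu.-integrable (D : set R) (EFin \o f)).
Local Notation Rint D f := (@Rintegral _ _ R mu D f).
Local Notation D2 := `]0, 2[%classic.

Lemma uniform_bound (I : finType) (P : I -> R -> Prop) :
  (forall i M M', P i M -> M <= M' -> P i M') -> (forall i, exists2 M, 0 < M & P i M) ->
  exists2 M, 0 < M & forall i, P i M.
Proof.
move=> mono H; have [c hc] := choice (fun i => let: ex_intro2 M a b := H i in ex_intro _ M (conj a b)).
exists (1 + \sum_i c i) => [|i].
  by rewrite ltr_wpDr// sumr_ge0// => i _; exact: ltW (hc i).1.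
apply: mono (hc i).2 _; rewrite (bigD1 i)//= addrCA lerDl addr_ge0// sumr_ge0// => j _; exact: ltW (hc j).1.
Qed.

Lemma mvt_compare (f df F dF : R -> R) (a b : R) : a <= b ->
  (forall x : R, a <= x <= b -> is_derive x 1 f (df x)) ->
  (forall x : R, a <= x <= b -> is_derive x 1 F (dF x)) ->
  (forall x : R, a <= x <= b -> `|df x| <= dF x) -> `|f b - f a| <= F b - F a.
Proof.
move=> ab d D dD.
have W (e : R) : `|e| <= 1 -> 0 <= (F b + e * f b) - (F a + e * f a).
  move=> e1; have dd (x : R) : a <= x <= b -> is_derive x 1 (fun x : R => F x + e * f x) (dF x + e * df x).
    by move=> hx; apply: is_derive_fadd; [exact: D|apply: is_derive_fscale; exact: d].
  have [||c] := @MVT_segment R (fun x : R => F x + e * f x) (fun x : R => dF x + e * df x) a b ab.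
  - by move=> z; rewrite in_itv /= => /andP[/ltW h1 /ltW h2]; apply: dd; rewrite h1.
  - apply: continuous_in_subspaceT => x; rewrite inE /= in_itv /= => /dd.
    exact: is_derive_continuous.
  rewrite in_itv /= => cab ->; rewrite mulr_ge0 ?subr_ge0//.
  have h := dD _ cab; have : `|e * df c| <= dF c.
    by rewrite normrM; apply: le_trans h; rewrite ler_piMl.
  by rewrite ler_norml; lra.
have := W 1 _; have := W (- 1) _; rewrite normrN normr1 lexx => /(_ isT) h1 /(_ isT) h2.
by rewrite ler_norml; lra.
Qed.

Lemma coordinate_lipschitz (f : 'rV[R]_m -> R) (L : R) x y :
  (forall x j s, `|f (x + s *: unitv R j) - f x| <= L * `|s|) ->
  `|f x - f y| <= L * \sum_j `|x 0 j - y 0 j|.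
Proof.
move=> hL.
have W (r : seq 'I_m) : `|f (y + \sum_(j <- r) (x 0 j - y 0 j) *: unitv R j) - f y| <= L * \sum_(j <- r) `|x 0 j - y 0 j|.
  elim: r => [|j r IH]; first by rewrite !big_nil addr0 subrr normr0 mulr0.
  rewrite !big_cons addrCA [_ *: _ + _]addrC mulrDr.
  by apply: le_trans (ler_distD (f (y + \sum_(j <- r) (x 0 j - y 0 j) *: unitv R j)) _ _) _; exact: lerD.
have E : x = y + \sum_j (x 0 j - y 0 j) *: unitv R j.
  apply/rowP => k; rewrite mxE summxE (bigD1 k)//= big1 => [|j jk]; last by rewrite !mxE (negbTE jk) mulr0.
  by rewrite !mxE eqxx mulr1 addr0 addrC subrK.
by rewrite {1}E.
Qed.

Section Bounds.
Context (a : R) (g : 'rV[R]_m -> R) (C : R) (h : R -> R) (Hb : R).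
Hypotheses (cg : Cd 3 C g) (ch : continuous h) (hb : forall s, `|h s| <= Hb).

Let Hb0 : 0 <= Hb := le_trans (normr_ge0 _) (hb 0).
Let cg2 : Cd 2 C g := Cd_pred cg.
Let cg1 : Cd 1 C g := Cd_pred cg2.
Let C0 : 0 <= C := Cd_ge0 cg.

Lemma vel_n_near_boundary kap o (b Hc : R) : 0 < b < 1 / 2 -> (forall s t, `|h s - h t| <= Hc * `|s - t| `^ b) ->
  exists2 M, 0 < M & forall x z t, 0 < z -> `|vel_n kap o g h x z t| <= M * (z `^ (2 * b - 1) + 1).
Proof.
move=> hb12 hc.
have [M1 M10 hM1] := vel_n_decomp m0 kap o cg ch hb; have [M2 M20 hM2] := @main_t_bound R m h Hb ch hb.
have b12 : 0 <= b < 1 / 2 by lra.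
have [K K0 hK] := Ek_time b12.
have Hc0 : 0 <= Hc.
  by have := hc 1 0; rewrite subr0 normr1 powR_one mulr1; apply: le_trans.
pose A := `|@cN R m| * ((2 + 4 * `|kap| * @gA R m) * C).
have gA0 : 0 <= @gA R m by rewrite addr_ge0 ?tA_ge0 ?nA_ge0.
have A0 : 0 <= A by rewrite !mulr_ge0// addr_ge0// mulr_ge0// mulr_ge0.
exists (M1 + A * M2 * (Hc * K + 1)) => [|x z t z0].
  by rewrite ltr_pwDl// (mulr_ge0 (mulr_ge0 A0 (ltW M20)))// addr_ge0// mulr_ge0// ltW.
have [IK hK1] := hK z z0.
have d1 := dec_le1 x z; have d0 := ltW (dec_gt0 x z).
have hm : dec x 0 * `|main_t h t z| <= M2 * (Hc * Rint D2 (fun s => s `^ b * Ek s z) + 1) * dec x z.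
  apply: hM2 => //; first by move=> s _; exact: powR_ge0.
  move=> s /andP[s0 _]; apply: le_trans (hc _ _) _.
  by rewrite addrAC subrr sub0r normrN gtr0_norm.
have h1 : `|@cN R m * An o kap g x * main_t h t z| <= A * M2 * (Hc * K + 1) * (z `^ (2 * b - 1) + 1).
  rewrite normrM normrM; have hA := An_bound m0 o kap x cg2 cg1.
  apply: (@le_trans _ _ (A * (dec x 0 * `|main_t h t z|))).
    rewrite mulrA ler_wpM2r// /A -mulrA ler_wpM2l//.
  have -> : A * M2 * (Hc * K + 1) * (z `^ (2 * b - 1) + 1) = A * (M2 * ((Hc * K + 1) * (z `^ (2 * b - 1) + 1))) by ring.
  rewrite ler_wpM2l//; apply: le_trans hm _; rewrite -mulrA ler_wpM2l ?(ltW M20)//.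
  have P0 := powR_ge0 z (2 * b - 1).
  have I0 : 0 <= Rint D2 (fun s => s `^ b * Ek s z).
    by apply: Rintegral_ge0 => s _; rewrite mulr_ge0 ?powR_ge0 ?Ek_ge0.
  have h2 := ler_wpM2l Hc0 hK1.
  apply: (@le_trans _ _ (Hc * Rint D2 (fun s => s `^ b * Ek s z) + 1)).
    by rewrite ler_piMr// addr_ge0// mulr_ge0.
  have := mulr_ge0 Hc0 (ltW K0); move: h2 P0; move: (Rint _ _) (z `^ _) => u v h2 P0 HK; nra.
have h3 : M1 * dec x z <= M1 * (z `^ (2 * b - 1) + 1).
  by rewrite ler_wpM2l ?(ltW M10)// (le_trans d1)// lerDr powR_ge0.
have h4 := hM1 x z t z0.
rewrite -[vel_n _ _ _ _ _ _ _](subrK (@cN R m * An o kap g x * main_t h t z)).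
by apply: le_trans (ler_normD _ _) _; rewrite mulrDl; apply: lerD => //; exact: le_trans h3.
Qed.

Lemma vel_holder kap o (b Hc : R) : 0 < b < 1 / 2 -> (forall s t, `|h s - h t| <= Hc * `|s - t| `^ b) ->
  exists2 M, 0 < M & forall x y z w t s, 0 < z -> 0 < w ->
  `|vel kap o g h x z t| <= M /\
  `|vel kap o g h x z t - vel kap o g h y w s| <= M * (enorm (emb x z - emb y w) `^ (2 * b) + `|t - s| `^ b).
Proof.
move=> hb12 hc; have b0 : 0 < b by lra.
have Hc0 : 0 <= Hc.
  by have := hc 1 0; rewrite subr0 normr1 powR_one mulr1; apply: le_trans.
have [M1 M10 hM1] := vel_bound m0 kap o cg ch hb.
have [M2 M20 hM2] := vel_time m0 kap o cg ch hb.
have [M3 M30 hM3] := @uniform_bound 'I_m (fun j M => forall x z t, 0 < z -> `|vel_j kap o g h j x z t| <= M * dec x z)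
  (fun i M M' H le x z t (z0 : 0 < z) => le_trans (H x z t z0) (ler_wpM2r (ltW (dec_gt0 x z)) le))
  (vel_j_bound m0 kap o cg ch hb).
have [M4 M40 hM4] := vel_n_near_boundary kap o hb12 hc.
pose M5 := M4 * ((2 * b)^-1 + 1); have b2 : 0 < 2 * b by lra.
have M50 : 0 < M5 by rewrite mulr_gt0// addr_gt0// invr_gt0.
exists (2 * M1 + M2 * Hc + M3 * m%:R + M5) => [|x y z w t s z0 w0].
  by rewrite ltr_wpDl// !addr_ge0// ?mulr_ge0// ltW.
have bd x' z' t' : 0 < z' -> `|vel kap o g h x' z' t'| <= M1.
  move=> z'0; apply: le_trans (hM1 x' z' t' z'0) _.
  by rewrite ler_piMr ?(ltW M10)//; exact: dec_le1.
have P1 := mulr_ge0 (ltW M20) Hc0.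
have P2 := mulr_ge0 (ltW M30) (ler0n R m).
split; first by apply: le_trans (bd _ _ _ z0) _; lra.
set d := enorm _; have d0 : 0 <= d by exact: sqrtr_ge0.
have Pd := powR_ge0 d (2 * b); have Pt := powR_ge0 `|t - s| b.
have T : `|vel kap o g h y w t - vel kap o g h y w s| <= M2 * Hc * `|t - s| `^ b.
  rewrite -mulrA; apply: hM2 => //; first by rewrite mulr_ge0.
  by move=> r; have := hc (t - r) (s - r); rewrite opprB addrA subrK.
suff S : `|vel kap o g h x z t - vel kap o g h y w t| <= (2 * M1 + M3 * m%:R + M5) * d `^ (2 * b).
  apply: le_trans (ler_distD (vel kap o g h y w t) _ _) _.
  apply: le_trans (lerD S T) _; move: Pd Pt P1 P2; move: (d `^ _) (_ `^ b) (M2 * Hc) (M3 * _) => u1 u2 u3 u4.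
  by move=> *; nra.
case: (leP 1 d) => d1.
  have : 1 <= d `^ (2 * b) by rewrite -[leLHS](powR_one (2 * b)) powR_mono// ltW.
  have := bd x z t z0; have := bd y w t w0; rewrite !ler_norml.
  by move: (d `^ _) (M3 * _) P2 => u v P2; nra.
have dd : d ^+ 2 = rr (x - y) (z - w) by rewrite /d emb_sub enorm_emb.
have dp : d <= d `^ (2 * b).
  move: d0; rewrite le_eqVlt => /orP[/eqP <-|d0']; first exact: powR_ge0.
  by rewrite -{1}(powRr1 (ltW d0')); apply: ger_powR; [rewrite d0' ltW|lra].
have dj j : `|x 0 j - y 0 j| <= d.
  rewrite -(ger0_norm d0) -ler_sqr ?nnegrE// !real_normK ?num_real// dd /rr.
  have := sq_coord_le j (x - y); rewrite !mxE; have := sqr_ge0 (z - w); lra.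
have dz : `|z - w| <= d.
  rewrite -(ger0_norm d0) -ler_sqr ?nnegrE// !real_normK ?num_real// dd /rr.
  have := sq_ge0 (x - y); lra.
have X : `|vel kap o g h x z t - vel kap o g h y z t| <= M3 * m%:R * d `^ (2 * b).
  have L x' j s' : `|vel kap o g h (x' + s' *: unitv R j) z t - vel kap o g h x' z t| <= M3 * `|s'|.
    have dl (s1 : R) : is_derive s1 1 (fun s : R => vel kap o g h (x' + s *: unitv R j) z t)
        (vel_j kap o g h j (x' + s1 *: unitv R j) z t).
      have e0 : is_derive (s1 - s1) 1 (fun s : R => vel kap o g h (x' + s1 *: unitv R j + s *: unitv R j) z t)
          (vel_j kap o g h j (x' + s1 *: unitv R j) z t).
        by rewrite subrr; exact: (vel_tangential m0 kap o cg ch hb j (x' + s1 *: unitv R j) t z0).1.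
      have e1 := is_derive_fsub (is_derive_fid s1) (is_derive_fcst s1 s1).
      have e2 := @is_derive_fcomp R _ (fun r => r - s1) s1 _ _ e0 e1; rewrite subr0 mulr1 in e2.
      have -> : (fun s : R => vel kap o g h (x' + s *: unitv R j) z t) =
          (fun s : R => vel kap o g h (x' + s1 *: unitv R j + (s - s1) *: unitv R j) z t).
        by apply/funext => r; rewrite -addrA -scalerDl [s1 + _]addrC subrK.
      exact: e2.
    have db (s1 : R) : `|vel_j kap o g h j (x' + s1 *: unitv R j) z t| <= M3.
      by apply: le_trans (hM3 j _ z t z0) _; rewrite ler_piMr ?(ltW M30) ?dec_le1.
    case: (leP 0 s') => s0.
      have := @mvt_le R _ _ 0 s' M3 s0 (fun s1 _ => dl s1) (fun s1 _ => db s1).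
      by rewrite /= scale0r addr0 subr0 (ger0_norm s0).
    have := @mvt_le R _ _ s' 0 M3 (ltW s0) (fun s1 _ => dl s1) (fun s1 _ => db s1).
    by rewrite /= scale0r addr0 sub0r distrC (ltr0_norm s0).
  apply: le_trans (coordinate_lipschitz x y L) _.
  rewrite -mulrA ler_wpM2l ?(ltW M30)//.
  apply: (@le_trans _ _ (\sum_(j < m) d `^ (2 * b))).
    by apply: ler_sum => j _; exact: le_trans (dj j) dp.
  by rewrite sumr_const card_ord -[leLHS]mulr_natl.
have Z (z1 z2 : R) : 0 < z1 -> z1 <= z2 -> z2 - z1 <= d -> `|vel kap o g h y z2 t - vel kap o g h y z1 t| <= M5 * d `^ (2 * b).
  move=> z10 z12 zd.
  have D1 (r : R) : z1 <= r <= z2 -> is_derive r 1 (fun r => vel kap o g h y r t) (vel_n kap o g h y r t).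
    by case/andP=> hr _; exact: (vel_normal m0 kap o cg ch hb y t (lt_le_trans z10 hr)).1.
  have D2' (r : R) : z1 <= r <= z2 -> is_derive r 1 (fun r => M4 * ((2 * b)^-1 * r `^ (2 * b) + r)) (M4 * (r `^ (2 * b - 1) + 1)).
    case/andP=> hr _; have r0 := lt_le_trans z10 hr.
    have e := is_derive_fscale M4 (is_derive_fadd (is_derive_fscale (2 * b)^-1 (is_derive_fpowR (2 * b) r0 (is_derive_fid r))) (is_derive_fid r)).
    by rewrite mulr1 mulrA mulVf ?gt_eqF// mul1r in e.
  have D3 (r : R) : z1 <= r <= z2 -> `|vel_n kap o g h y r t| <= M4 * (r `^ (2 * b - 1) + 1).
    by move=> hr; apply: hM4; lra.
  apply: le_trans (mvt_compare z12 D1 D2' D3) _.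
  have b21 : 0 < 2 * b <= 1 by lra.
  have z20 := le_trans (ltW z10) z12.
  have := powR_sub_le z20 (ltW z10) b21; rewrite !ger0_norm ?subr_ge0//; last exact: powR_mono (ltW z10) z12 (ltW b2).
  have zz : 0 <= z2 - z1 by rewrite subr_ge0.
  have := powR_mono zz zd (ltW b2).
  have i0 : 0 <= (2 * b)^-1 by rewrite invr_ge0 ltW.
  move=> h1 h2; have h3 := le_trans h2 h1.
  have h4 := ler_wpM2l i0 h3; have h5 : z2 - z1 <= d `^ (2 * b) by exact: le_trans zd dp.
  have h6 := ler_wpM2l (ltW M40) (lerD h4 h5).
  by move: h6; rewrite /M5; move: (z1 `^ _) (z2 `^ _) (d `^ _) (_^-1) => u1 u2 u3 u4; lra.
have Z' : `|vel kap o g h y z t - vel kap o g h y w t| <= M5 * d `^ (2 * b).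
  move: dz; case: (leP w z) => wz.
    by rewrite ger0_norm ?subr_ge0// => dz; exact: Z.
  by rewrite distrC [`|vel _ _ _ _ _ _ _ - _|]distrC ger0_norm ?subr_ge0 ?(ltW wz)// => dz; apply: Z => //; exact: ltW.
apply: le_trans (ler_distD (vel kap o g h y z t) _ _) _; apply: le_trans (lerD X Z') _.
by rewrite -mulrDl ler_wpM2r// lerD2r lerDr mulr_ge0// ltW.
Qed.

End Bounds.
End Energy.

Section FiniteEnergy.
Context {R : realType}.
Local Open Scope ring_scope.
Local Notation mu := (@lebesgue_measure R).
Local Notation Intg D f := (mu.-integrable (D : set R) (EFin \o (f : R -> R))).
Local Notation Rint := (@Rintegral _ _ R mu).
Local Notation D2 := (`]0%R, 2%R[%classic : set R).

Lemma ge0_integral_mono (D : set R) (f g : R -> \bar R) :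
  (forall x, D x -> (0 <= f x <= g x)%E) -> (\int[mu]_(x in D) f x <= \int[mu]_(x in D) g x)%E.
Proof.
move=> H.
have f0 x : D x -> (0 <= f x)%E by move=> /H /andP[].
have g0 x : D x -> (0 <= g x)%E by move=> /H /andP[h1 h2]; exact: le_trans h2.
rewrite !ge0_integralE//; apply: le_ereal_sup => _ [s hs <-]; exists s => // x /=.
apply: le_trans (hs x) _; rewrite /patch; case: ifPn => // /set_mem Dx; by have /andP[] := H x Dx.
Qed.

Lemma EFin_Rint (D : set R) (f : R -> R) : measurable D -> Intg D f ->
  (\int[mu]_(x in D) (f x)%:E = (Rint D f)%:E)%E.
Proof. by move=> mD If; rewrite /Rintegral fineK//; exact: integrable_fin_num. Qed.

Lemma iintE_bound (q : R) k C (f : 'rV[R]_k -> \bar R) : 1 / 2 < q -> 0 <= C ->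
  (forall y, (0 <= f y <= (C * Wt q y)%:E)%E) -> (0 <= iintE f <= (C * wt_mass q ^+ k)%:E)%E.
Proof.
move=> q12; elim: k C f => [|k IH] C f C0 hf.
  by have := hf 0; rewrite /= /Wt big_ord0 expr0.
have S s : (0 <= iintE (fun y : 'rV[R]_k => f (vcons s y)) <= (C * wt_mass q ^+ k * wt q s)%:E)%E.
  rewrite mulrAC; apply: IH; first by rewrite mulr_ge0// wt_ge0.
  by move=> y; have := hf (vcons s y); rewrite Wt_vcons mulrA.
apply/andP; split; first by apply: integral_ge0 => s _; have /andP[] := S s.
have Iw := integrable_scale (C * wt_mass q ^+ k) measurableT (integrable_wt q12).
have -> : C * wt_mass q ^+ k.+1 = Rint [set: R] (fun s => C * wt_mass q ^+ k * wt q s).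
  by rewrite (RintZ _ measurableT (integrable_wt q12)) exprSr mulrA.
by rewrite -(EFin_Rint measurableT Iw); apply: ge0_integral_mono => s _; exact: S.
Qed.

Lemma iintE_ge0 k (f : 'rV[R]_k -> \bar R) : (forall y, (0 <= f y)%E) -> (0 <= iintE f)%E.
Proof.
elim: k f => [|k IH] f f0; first exact: f0.
by apply: integral_ge0 => s _; apply: IH.
Qed.

Lemma radial_Wt k (q : R) (y : 'rV[R]_k) : 0 <= q -> (1 + enorm y ^+ 2) `^ (- (q * k%:R)) <= Wt q y.
Proof.
move=> q0; have y0 : 0 <= enorm y by exact: sqrtr_ge0.
rewrite -mulNr powRrM powR_mulrn ?powR_ge0// /Wt -[k in _ ^+ k]card_ord -prodr_const.
apply: ler_prod => j _; rewrite powR_ge0 /= /wt; apply: powR_mono_neg => //; first exact: wt_base_gt0.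
by rewrite lerD2l enorm_sq sqr_sqrtr ?sq_ge0// sq_coord_le.
Qed.

Section Decay.
Context {m : nat}.
Hypothesis m2 : (1 < m)%N.

Definition qE : R := m%:R / m.+1%:R.

Lemma qE_half : 1 / 2 < qE.
Proof.
have mm : 2 <= m%:R :> R by rewrite ler_nat.
by rewrite /qE ltr_pdivlMr ?ltr0n// -[m.+1%:R]natr1; lra.
Qed.

Lemma dec_sq_Wt (y : 'rV[R]_m.+1) : dec (xprime y) (xlast y) ^+ 2 <= Wt qE y.
Proof.
have q0 : 0 <= qE by have := qE_half; lra.
apply: le_trans (radial_Wt y q0); rewrite /dec -enorm_emb -vec_decomp.
by rewrite -powR_mulrn ?powR_ge0// -powRrM /qE divfK ?pnatr_eq0// mulNr divfK.
Qed.

Lemma iintE_dec (F : 'rV[R]_m.+1 -> R) (K : R) : 0 <= K ->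
  (forall x z, 0 < z -> 0 <= F (emb x z) <= K * dec x z ^+ 2) ->
  (0 <= iintE (fun y : 'rV[R]_m.+1 => if (0 < xlast y)%R then (F y)%:E else 0%E)
     <= (K * wt_mass qE ^+ m.+1)%:E)%E.
Proof.
move=> K0 hF; apply: iintE_bound => //; first exact: qE_half.
move=> y; case: ifPn => y0; last by rewrite lexx lee_fin mulr_ge0// Wt_ge0.
rewrite !lee_fin; have := hF (xprime y) (xlast y) y0; rewrite -vec_decomp => /andP[-> h] /=.
by apply: le_trans h _; rewrite ler_wpM2l// dec_sq_Wt.
Qed.

End Decay.

Lemma integrable_singularity (p : R) : -1 < p ->
  Intg `]0, 1[%classic (fun t => `|1 - t| `^ p) /\ Intg `]1, 2[%classic (fun t => `|1 - t| `^ p).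
Proof.
move=> p1; have p0 : 0 < p + 1 by lra.
have i0 : 0 <= (p + 1)^-1 by rewrite invr_ge0 ltW.
have e0 : (p + 1)^-1 * (p + 1) = 1 by rewrite mulVf// gt_eqF.
split.
  apply: (@integrable_eq _ _ (fun t => (1 - t) `^ p)) => //.
    by move=> t; rewrite /= in_itv /= => /andP[_ t1]; rewrite gtr0_norm// subr_gt0.
  apply: (@ge0_Rint_primitive R (fun t => - ((p + 1)^-1 * (1 - t) `^ (p + 1))) _ 0 1 (p + 1)^-1 _ _ _ _ _).1.
  - exact: ltr01.
  - by move=> x _; exact: powR_ge0.
  - move=> x /andP[_ x1]; have x0 : 0 < 1 - x by lra.
    have d := is_derive_fsub (is_derive_fcst (1 : R) x) (is_derive_fid x).
    have e := is_derive_fopp (is_derive_fscale (p + 1)^-1 (@is_derive_fpowR R (fun x => 1 - x) (p + 1) x _ x0 d)).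
    rewrite addrK sub0r in e; rewrite [X in is_derive _ _ _ X](_ : _ = - ((p + 1)^-1 * ((p + 1) * (1 - x) `^ p * - 1)))//.
    by rewrite mulrN1 mulrN opprK mulrA e0 mul1r.
  - move=> x /andP[_ x1]; apply: (@continuous_powR R (fun x => 1 - x)); first lra.
    by apply: cvgB; [exact: cvg_cst|exact: cvg_id].
  - move=> x y x0 xy y1; rewrite opprK addrC.
    have h1 : (1 - x) `^ (p + 1) <= 1.
      by rewrite -[leRHS](powR_one (p + 1)); apply: powR_mono; lra.
    have := ler_wpM2l i0 h1; have := mulr_ge0 i0 (powR_ge0 (1 - y) (p + 1)); lra.
apply: (@integrable_eq _ _ (fun t => (t - 1) `^ p)) => //.
  by move=> t; rewrite /= in_itv /= => /andP[t1 _]; rewrite distrC gtr0_norm// subr_gt0.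
apply: (@ge0_Rint_primitive R (fun t => (p + 1)^-1 * (t - 1) `^ (p + 1)) _ 1 2 (p + 1)^-1 _ _ _ _ _).1.
- by rewrite ltr1n.
- by move=> x _; exact: powR_ge0.
- move=> x /andP[x1 _]; have x0 : 0 < x - 1 by lra.
  have d := is_derive_fsub (is_derive_fid x) (is_derive_fcst (1 : R) x).
  have e := is_derive_fscale (p + 1)^-1 (@is_derive_fpowR R (fun x => x - 1) (p + 1) x _ x0 d).
  rewrite addrK subr0 in e; rewrite [X in is_derive _ _ _ X](_ : _ = (p + 1)^-1 * ((p + 1) * (x - 1) `^ p * 1))//.
  by rewrite mulr1 mulrA e0 mul1r.
- move=> x /andP[x1 _]; apply: (@continuous_powR R (fun x => x - 1)); first lra.
  by apply: cvgB; [exact: cvg_id|exact: cvg_cst].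
- move=> x y x0 xy y1.
  have h1 : (y - 1) `^ (p + 1) <= 1.
    by rewrite -[leRHS](powR_one (p + 1)); apply: powR_mono; lra.
  have := ler_wpM2l i0 h1; have := mulr_ge0 i0 (powR_ge0 (x - 1) (p + 1)); lra.
Qed.

Lemma integral_singularity_finite (F : R -> \bar R) (K p : R) : -1 < p -> 0 <= K ->
  (forall t, 0 < t < 2 -> (0 <= F t)%E) ->
  (forall t, 0 < t < 2 -> t != 1 -> (F t <= (K * (1 + `|1 - t| `^ p))%:E)%E) ->
  (\int[mu]_(t in D2) F t < +oo)%E.
Proof.
move=> p1 K0 F0 FK.
pose W t := K * (1 + `|1 - t| `^ p).
have W0 t : 0 <= W t by rewrite mulr_ge0// addr_ge0// powR_ge0.
pose G (t : R) : \bar R := if t == 1 then +oo%E else (W t)%:E.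
have G0 t : (0 <= G t)%E by rewrite /G; case: ifP => // _; rewrite lee_fin.
have mW : measurable_fun [set: R] W.
  apply: measurable_funM; first exact: measurable_cst.
  apply: measurable_funD; first exact: measurable_cst.
  apply: (measurableT_comp (measurable_powR p)); apply: measurableT_comp.
    by apply: continuous_measurable_fun; exact: norm_continuous.
  by apply: measurable_funB; [exact: measurable_cst|exact: measurable_id].
have mG : measurable_fun [set: R] G.
  apply: measurable_fun_ifT; first by apply: measurable_fun_eqr; [exact: measurable_id|exact: measurable_cst].
    exact: measurable_cst.
  by apply/measurable_EFinP.
have FG : (\int[mu]_(t in D2) F t <= \int[mu]_(t in D2) G t)%E.
  apply: ge0_integral_mono => t; rewrite /= in_itv /= => ht; rewrite F0//= /G.
  by case: eqP => [_|/eqP t1]; [exact: leey|exact: FK].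
apply: le_lt_trans FG _.
have [I1 I2] := integrable_singularity p1.
have IW a b : Intg `]a, b[%classic (fun t => `|1 - t| `^ p) -> Intg `]a, b[%classic W.
  move=> Iab; apply: integrable_scale => //; apply: integrable_add => //.
  by apply: integrable_cst_itv; exact: itv_mu_fin.
have fin (a b : R) : Intg `]a, b[%classic W -> (forall t, a < t < b -> t != 1) ->
    (\int[mu]_(t in `]a, b[%classic) G t < +oo)%E.
  move=> Iab ne; have -> : (\int[mu]_(t in `]a, b[%classic) G t = \int[mu]_(t in `]a, b[%classic) (W t)%:E)%E.
    by apply: eq_integral => t; rewrite inE /= in_itv /= => /ne /negbTE h; rewrite /G h.
  by rewrite EFin_Rint// ltry.
have E : D2 = (`]0, 1[%classic `|` [set 1] `|` `]1, 2[%classic : set R).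
  apply/seteqP; split => t; rewrite /= !in_itv /=.
    move=> ht; case: (ltgtP t 1) => t1; last by left; right.
      by left; left; lra.
    by right; lra.
  by move=> [[|->]|]; lra.
rewrite E ge0_integral_setU//; last 3 first.
- by apply: measurableU.
- exact: measurable_funS mG.
- by apply/disj_setPS => t; rewrite /= !in_itv /= => -[[h1|->] h2]; lra.
rewrite ge0_integral_setU//; last 2 first.
- exact: measurable_funS mG.
- by apply/disj_setPS => t; rewrite /= !in_itv /= => -[h1 tE]; move: h1; rewrite tE; lra.
rewrite integral_set1 adde0 lte_add_pinfty//; apply: fin; try exact: IW.
  by move=> t ht; rewrite lt_eqF//; lra.
by move=> t ht; rewrite gt_eqF//; lra.
Qed.

Section VelocityEnergy.
Context {m : nat} (a : R) (g : 'rV[R]_m -> R) (C : R) (h : R -> R).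
Hypotheses (m2 : (1 < m)%N) (cg : Cd 3 C g).
Hypotheses (ha : 0 < a <= 1 / 2) (hh0 : forall s, 0 <= h s) (hhcont : continuous h)
  (hhsupp : forall s, s < 1 / 4 \/ 1 < s -> h s = 0)
  (hhC1 : forall s, 0 < s < 1 -> derivable h s 1 /\ {for s, continuous (derive1 h)})
  (hhform : forall s, 1 / 2 <= s <= 1 -> h s = (1 - s) `^ a).
Implicit Types (x : 'rV[R]_m) (t s z w M : R) (o : option 'I_m).

Let m0 : (0 < m)%N. Proof. exact: ltnW. Qed.
Let cg2 : Cd 2 C g := Cd_pred cg.
Let cg1 : Cd 1 C g := Cd_pred cg2.
Let C0 : 0 <= C := Cd_ge0 cg.

Lemma vel_n_time kap o : exists2 M, 0 < M & forall x z t, 0 < z -> t != 1 ->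
  `|vel_n kap o g h x z t| <= M * (1 + `|1 - t| `^ ((a - 1) / 2)) * dec x z.
Proof.
have [Hb Hb0 hb] := profile_bounded hh0 hhcont hhsupp.
have [H1 H10 hH1] := profile_increment ha hh0 hhcont hhsupp hhC1 hhform.
have [M1 M10 hM1] := vel_n_decomp m0 kap o cg hhcont hb.
have [M2 M20 hM2] := @main_t_bound R m h Hb hhcont hb.
pose A := `|@cN R m| * ((2 + 4 * `|kap| * @gA R m) * C).
have gA0 : 0 <= @gA R m by rewrite addr_ge0 ?tA_ge0 ?nA_ge0.
have A0 : 0 <= A by rewrite !mulr_ge0// addr_ge0// mulr_ge0// mulr_ge0.
pose psi s : R := s `^ ((1 + a) / 2).
have I0 : Intg D2 (fun s => s `^ (a / 2 - 1)) by apply: integrable_pow => //; move: ha; lra.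
have bnd (z s : R) : 0 < s -> psi s * Ek s z <= s `^ (a / 2 - 1).
  move=> s0; apply: le_trans (ler_wpM2l (powR_ge0 _ _) (Ek_le z s0)) _.
  rewrite /psi -powR_split// (_ : (1 + a) / 2 + - (3 / 2) = a / 2 - 1)//; by field.
pose I := Rint D2 (fun s => s `^ (a / 2 - 1)).
have I00 : 0 <= I by apply: Rintegral_ge0 => s _; exact: powR_ge0.
exists (M1 + A * M2 * (H1 * I + 1)) => [|x z t z0 t1].
  by rewrite ltr_pwDl// (mulr_ge0 (mulr_ge0 A0 (ltW M20)))// addr_ge0// mulr_ge0// ltW.
have Ipsi : Intg D2 (fun s => psi s * Ek s z).
  apply: integrable_dom I0 => //.
    apply: measurable_funM; last exact: (integrable_measurable (integrable_Ek0 z0)).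
    by apply: measurable_open_itv => s /andP[s0 _]; apply: continuous_powR => //; exact: cvg_id.
  move=> s; rewrite /= in_itv /= => /andP[s0 _].
  by rewrite ger0_norm ?bnd// mulr_ge0 ?powR_ge0 ?Ek_ge0.
have d0 := ltW (dec_gt0 x z); have P0 := powR_ge0 `|1 - t| ((a - 1) / 2).
have B0 : 0 <= H1 * `|1 - t| `^ ((a - 1) / 2) by rewrite mulr_ge0// ltW.
have hm := hM2 psi (H1 * `|1 - t| `^ ((a - 1) / 2)) x z t z0 B0 (fun s _ => powR_ge0 _ _) Ipsi
  (fun s hs => hH1 t s t1 (proj1 (andP hs))).
have RI : Rint D2 (fun s => psi s * Ek s z) <= I.
  by apply: Rint_le => // s; rewrite /= in_itv /= => /andP[s0 _]; exact: bnd.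
have h1 : `|@cN R m * An o kap g x * main_t h t z| <= A * M2 * (H1 * I + 1) * (1 + `|1 - t| `^ ((a - 1) / 2)) * dec x z.
  rewrite normrM normrM; have hA := An_bound m0 o kap x cg2 cg1.
  apply: (@le_trans _ _ (A * (dec x 0 * `|main_t h t z|))).
    by rewrite mulrA ler_wpM2r// /A -mulrA ler_wpM2l.
  have -> : A * M2 * (H1 * I + 1) * (1 + `|1 - t| `^ ((a - 1) / 2)) * dec x z =
     A * (M2 * ((H1 * I + 1) * (1 + `|1 - t| `^ ((a - 1) / 2))) * dec x z) by ring.
  rewrite ler_wpM2l//; apply: le_trans hm _; rewrite ler_wpM2r// ler_wpM2l ?(ltW M20)//.
  have h2 := ler_wpM2l B0 RI; have := mulr_ge0 (ltW H10) I00; move: RI.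
  by move: h2 P0 I00; move: (Rint _ (fun s => psi s * _)) (_ `^ _) I => u v w h2 P0 I00; nra.
have h3 : M1 * dec x z <= M1 * (1 + `|1 - t| `^ ((a - 1) / 2)) * dec x z.
  by rewrite ler_wpM2r// ler_peMr ?(ltW M10)// lerDl.
have h4 := hM1 x z t z0.
rewrite -[vel_n _ _ _ _ _ _ _](subrK (@cN R m * An o kap g x * main_t h t z)).
by apply: le_trans (ler_normD _ _) _; rewrite [(M1 + _) * _]mulrDl [leRHS]mulrDl; apply: lerD => //; exact: le_trans h3.
Qed.

Lemma vhat_partial (i : 'I_m.+1) x z t : 0 < z -> 0 <= t <= 2 ->
  partial ord_max (fun y => vhat g h i y t) (emb x z) = vel_n (@kappa R m) (unlift ord_max i) g h x z t /\
  forall j, partial (lift ord_max j) (fun y => vhat g h i y t) (emb x z) = vel_j (@kappa R m) (unlift ord_max i) g h j x z t.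
Proof.
move=> z0 ht; have [Hb Hb0 hb] := profile_bounded hh0 hhcont hhsupp.
have h00 s : s <= 0 -> h s = 0 by move=> s0; apply: hhsupp; left; lra.
have E x' z' : 0 < z' -> vel (@kappa R m) (unlift ord_max i) g h x' z' t = vhat g h i (emb x' z') t.
  by move=> z'0; rewrite (vhatE m0 i x' cg hhcont hb h00 z'0 ht).
split=> [|j].
  have [d _] := vel_normal m0 (@kappa R m) (unlift ord_max i) cg hhcont hb x t z0.
  apply: (@partial_normal _ _ (fun y => vhat g h i y t) x z _ _).1.
  by apply: is_derive_ext d; near=> s; apply: E; near: s; exact: lt_nbhsr.
have [d _] := vel_tangential m0 (@kappa R m) (unlift ord_max i) cg hhcont hb j x t z0.
apply: (@partial_tangential _ _ (fun y => vhat g h i y t) x z j _ _).1.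
have -> : (fun s : R => vhat g h i (emb (x + s *: unitv R j) z) t) = (fun s : R => vel (@kappa R m) (unlift ord_max i) g h (x + s *: unitv R j) z t).
  by apply/funext => s; rewrite E.
exact: d.
Unshelve. all: by end_near. Qed.

Lemma finite_energy : exists M : R,
   {ae mu, forall t : R, 0 < t < 2 ->
      (iintE (fun x : 'rV[R]_m.+1 =>
         if (0 < xlast x)%R then (\sum_(i < m.+1) vhat g h i x t ^+ 2)%:E else 0%E)
       <= M%:E)%E}
   /\
   (\int[mu]_(t in `]0%R, 2%R[)
      iintE (fun x : 'rV[R]_m.+1 =>
         if (0 < xlast x)%R then
           (\sum_(i < m.+1) \sum_(j < m.+1)
               partial j (fun y => vhat g h i y t) x ^+ 2)%:E
         else 0%E) < +oo)%E.
Proof.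
have [Hb Hb0 hb] := profile_bounded hh0 hhcont hhsupp.
have h00 s : s <= 0 -> h s = 0 by move=> s0; apply: hhsupp; left; lra.
have mono (F : 'rV[R]_m -> R -> R -> R) (M M' : R) :
    (forall x z t, 0 < z -> `|F x z t| <= M * dec x z) -> M <= M' -> forall x z t, 0 < z -> `|F x z t| <= M' * dec x z.
  by move=> H le x z t z0; apply: le_trans (H x z t z0) _; rewrite ler_wpM2r// ltW// dec_gt0.
have [M1 M10 hM1] := @uniform_bound R _ (fun (i : 'I_m.+1) M => forall x z t, 0 < z -> `|vel (@kappa R m) (unlift ord_max i) g h x z t| <= M * dec x z)
  (fun i => @mono _) (fun i => vel_bound m0 (@kappa R m) (unlift ord_max i) cg hhcont hb).
have sq_le (u M d : R) : `|u| <= M * d -> u ^+ 2 <= M ^+ 2 * d ^+ 2.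
  by move=> hu; rewrite -exprMn -real_normK ?num_real// lerXn2r// nnegrE (le_trans _ hu).
have M20 := sqr_ge0 M1.
exists (m.+1%:R * M1 ^+ 2 * wt_mass (@qE m) ^+ m.+1); split.
  apply: aeW => t /andP[t0 t2].
  pose F (y : 'rV[R]_m.+1) : R := \sum_(i < m.+1) vhat g h i y t ^+ 2.
  suff H x z : 0 < z -> 0 <= F (emb x z) <= m.+1%:R * M1 ^+ 2 * dec x z ^+ 2.
    have k0 : 0 <= m.+1%:R * M1 ^+ 2 by rewrite mulr_ge0.
    by have /andP[_] := @iintE_dec _ m2 F _ k0 H.
  rewrite /F => z0; rewrite sumr_ge0 => [|i _]; last exact: sqr_ge0.
  apply: (@le_trans _ _ (\sum_(i < m.+1) M1 ^+ 2 * dec x z ^+ 2)).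
    apply: ler_sum => i _; rewrite (vhatE m0 i x cg hhcont hb h00 z0); last by rewrite !ltW.
    by apply: sq_le; exact: hM1.
  by rewrite sumr_const card_ord -[leLHS]mulr_natl mulrA.
have [M2 M2p hM2] := @uniform_bound R _ (fun (p : 'I_m.+1 * 'I_m) M => forall x z t, 0 < z -> `|vel_j (@kappa R m) (unlift ord_max p.1) g h p.2 x z t| <= M * dec x z)
  (fun p => @mono _) (fun p => vel_j_bound m0 (@kappa R m) (unlift ord_max p.1) cg hhcont hb p.2).
have [M3 M3p hM3] := @uniform_bound R _ (fun (i : 'I_m.+1) M => forall x z t, 0 < z -> t != 1 ->
    `|vel_n (@kappa R m) (unlift ord_max i) g h x z t| <= M * (1 + `|1 - t| `^ ((a - 1) / 2)) * dec x z)
  (fun i M M' H (le : M <= M') x z t (z0 : 0 < z) (t1 : t != 1) => le_trans (H x z t z0 t1)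
     (ler_wpM2r (ltW (dec_gt0 x z)) (ler_wpM2r (addr_ge0 ler01 (powR_ge0 _ _)) le)))
  (fun i => vel_n_time (@kappa R m) (unlift ord_max i)).
pose K := 2 * (m.+1%:R * (m.+1%:R * (M2 + M3) ^+ 2)) * wt_mass (@qE m) ^+ m.+1.
have w0 : 0 <= wt_mass (@qE m) ^+ m.+1 :> R by rewrite exprn_ge0// wt_mass_ge0.
have K0 : 0 <= m.+1%:R * (m.+1%:R * (M2 + M3) ^+ 2) by rewrite mulr_ge0// mulr_ge0// sqr_ge0.
apply: (@integral_singularity_finite _ K (a - 1)).
- by case/andP: ha; lra.
- by rewrite mulr_ge0// mulr_ge0.
- move=> t ht; apply: iintE_ge0 => y; case: ifP => // _.
  by rewrite lee_fin sumr_ge0// => i _; rewrite sumr_ge0// => j _; exact: sqr_ge0.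
- move=> t ht t1; set u := `|1 - t| `^ ((a - 1) / 2); have u0 : 0 <= u by exact: powR_ge0.
  have uu : `|1 - t| `^ (a - 1) = u ^+ 2.
    by rewrite -powR_mulrn// /u -powRrM; congr (_ `^ _); field.
  have KK : K * (1 + `|1 - t| `^ (a - 1)) = m.+1%:R * (m.+1%:R * (M2 + M3) ^+ 2) * (2 * (1 + u ^+ 2)) * wt_mass (@qE m) ^+ m.+1.
    by rewrite uu /K; ring.
  rewrite KK; pose F (y : 'rV[R]_m.+1) : R := \sum_(i < m.+1) \sum_(j < m.+1) partial j (fun y => vhat g h i y t) y ^+ 2.
  suff H x z : 0 < z -> 0 <= F (emb x z)
      <= m.+1%:R * (m.+1%:R * (M2 + M3) ^+ 2) * (2 * (1 + u ^+ 2)) * dec x z ^+ 2.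
    have k0 : 0 <= m.+1%:R * (m.+1%:R * (M2 + M3) ^+ 2) * (2 * (1 + u ^+ 2)) by rewrite mulr_ge0// mulr_ge0// addr_ge0// sqr_ge0.
    by have /andP[_] := @iintE_dec _ m2 F _ k0 H.
  rewrite /F => z0; rewrite sumr_ge0 => [|i _]; last by rewrite sumr_ge0// => j _; exact: sqr_ge0.
  apply: (@le_trans _ _ (\sum_(i < m.+1) \sum_(j < m.+1) ((M2 + M3) * (1 + u)) ^+ 2 * dec x z ^+ 2)).
    apply: ler_sum => i _; apply: ler_sum => j _; apply: sq_le.
    have ht2 : 0 <= t <= 2 by case/andP: ht => /ltW -> /ltW ->.
    have [p1 p2] := vhat_partial i x z0 ht2; have dd := ltW (dec_gt0 x z).
    case: (unliftP ord_max j) => [j'|] ->.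
      rewrite p2; apply: le_trans (hM2 (i, j') x z t z0) _; rewrite ler_wpM2r//.
      by have := mulr_ge0 (ltW M2p) u0; have := mulr_ge0 (ltW M3p) u0; nra.
    rewrite p1; apply: le_trans (hM3 i x z t z0 t1) _; rewrite ler_wpM2r// -/u.
    by have := mulr_ge0 (ltW M2p) u0; have := mulr_ge0 (ltW M3p) u0; nra.
  rewrite !sumr_const !card_ord -[leLHS]mulr_natl -[X in _ * X <= _]mulr_natl exprMn.
  have h1 : (1 + u) ^+ 2 <= 2 * (1 + u ^+ 2) by have := sqr_ge0 (1 - u); nra.
  have := ler_wpM2l (mulr_ge0 K0 (sqr_ge0 (dec x z))) h1.
  by move: ((M2 + M3) ^+ 2) (dec x z ^+ 2) ((1 + u) ^+ 2) (u ^+ 2) => v1 v2 v3 v4; lra.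
Qed.

End VelocityEnergy.
End FiniteEnergy.

Section PressurePotential.
Context {R : realType} {m : nat}.
Local Open Scope ring_scope.
Hypothesis m0 : (0 < m)%N.
Implicit Types (x y xi : 'rV[R]_m) (t s z M : R) (f g : 'rV[R]_m -> R).
Local Notation qK := (@qK R m).
Local Notation qK_half := (@qK_half R m).
Local Notation qK_ge0 := (@qK_ge0 R m).
Local Notation mu := (@lebesgue_measure R).
Local Notation Intg D f := (mu.-integrable (D : set R) (EFin \o (f : R -> R))).
Local Notation Rint := (@Rintegral _ _ R mu).
Local Notation kappa := (@kappa R m).

Lemma ln_norm_le (r0 r : R) : 0 < r0 -> r0 <= r -> `|ln r| <= `|ln r0| + r.
Proof.
move=> r00 rr0; have r_0 : 0 < r by exact: lt_le_trans rr0.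
have h1 : ln r <= r.
  have := @ln_sublinear R r r_0; exact: ltW.
have h2 : ln r0 <= ln r by rewrite ler_ln// posrE.
rewrite ler_norml; have := ler_norm (ln r0); have := ler_norm (- ln r0); rewrite normrN.
by move=> h3 h4; apply/andP; split; lra.
Qed.

Lemma Eprof_bound (r0 : R) : 0 < r0 -> exists2 K, 0 < K & forall r, r0 <= r -> `|@Eprof R m r| <= K * (1 + r).
Proof.
move=> r00; rewrite /Eprof; case m3 : (3 <= m.+1)%N.
  set c := _^-1; exists (`|c| * r0 `^ ((2 - m.+1%:R) / 2) + 1) => [|r rr0].
    by rewrite ltr_wpDl// mulr_ge0// powR_ge0.
  have r_0 : 0 <= r by rewrite (le_trans (ltW r00)).
  rewrite normrM (ger0_norm (powR_ge0 _ _)).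
  have p0 : (2 - m.+1%:R) / 2 <= 0 :> R.
    have : 3 <= m.+1%:R :> R by rewrite ler_nat.
    by move=> ?; lra.
  have h1 := ler_wpM2l (normr_ge0 c) (powR_anti r00 rr0 p0).
  have h2 := mulr_ge0 (normr_ge0 c) (powR_ge0 r0 ((2 - m.+1%:R) / 2)).
  apply: le_trans h1 _; move: h2; move: (_ * _) => u u0; nra.
set c := - _^-1; exists (`|c| * (`|ln r0| + 1) + 1) => [|r rr0].
  by rewrite ltr_wpDl// mulr_ge0// addr_ge0.
have r_0 : 0 < r by exact: lt_le_trans rr0.
rewrite normrM normf_div (ger0_norm (ler0n R 2)).
have h1 := ln_norm_le r00 rr0; have c0 := normr_ge0 c; have l0 := normr_ge0 (ln r0).
have h2 : `|ln r| / 2 <= (`|ln r0| + 1) * (1 + r) by nra.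
have h3 := ler_wpM2l c0 h2; apply: le_trans h3 _; rewrite mulrA mulrDl; lra.
Qed.

Lemma rr_shift_le x xi z : 1 + rr (x - xi) z <= 2 * (1 + rr x z) * (1 + sq xi).
Proof.
have h : sq (x - xi) <= 2 * sq x + 2 * sq xi.
  rewrite /sq !mulr_sumr -big_split /=; apply: ler_sum => j _; rewrite !mxE.
  by have := sqr_ge0 (x 0 j + xi 0 j); nra.
rewrite /rr; have := sq_ge0 x; have := sq_ge0 xi; have := sqr_ge0 z.
by move: h; move: (sq x) (sq xi) (sq _) (z ^+ 2) => u v w s; nra.
Qed.

Definition Pot f x z : R := iintR (fun xi => Efund (emb (x - xi) z) * f xi).

Section Potential.
Context (f : 'rV[R]_m -> R) (A : R).
Hypotheses (cf : continuous f) (df : dom qK A (fun xi => (1 + sq xi) * f xi)).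

Lemma moment_dom : dom qK A f.
Proof.
split=> // y; apply: le_trans (df.2 y); rewrite normrM ger0_norm ?addr_ge0 ?sq_ge0//.
by rewrite ler_peMl// lerDl sq_ge0.
Qed.

Lemma Efund_continuous x s : 0 < s -> continuous (fun xi => Efund (emb (x - xi) s) * f xi).
Proof.
move=> s0; apply: continuous_mul => //.
have -> : (fun xi => Efund (emb (x - xi) s)) = (fun xi => @Eprof R m (rr (x - xi) s)).
  by apply/funext => xi; rewrite EfundE.
move=> xi; apply: (@continuous_comp _ _ _ (fun xi => rr (x - xi) s) (@Eprof R m)).
  exact: (@continuous_reflect R m (@rr R m ^~ s) x (@rr_continuous R m s)).
by apply: is_derive_continuous; apply: Eprof_is_derive => //; exact: rr_gt0.
Qed.

Lemma Pot_dom x d z : 0 < d -> exists2 K, 0 < K & forall s, d <= s -> s <= z -> dom qK (K * A) (fun xi => Efund (emb (x - xi) s) * f xi).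
Proof.
move=> d0; have [K K0 hK] := Eprof_bound (exprn_gt0 2 d0).
have A0 := dom_ge0 df.
exists (K * (2 * (1 + rr x z))) => [|s' ds sz].
  by rewrite mulr_gt0// mulr_gt0// br_gt0.
have s0 : 0 < s' by exact: lt_le_trans ds.
split; first exact: Efund_continuous.
move=> xi; rewrite EfundE// normrM.
have h1 : d ^+ 2 <= rr (x - xi) s'.
  rewrite /rr; have : d ^+ 2 <= s' ^+ 2 by rewrite lerXn2r// nnegrE ltW.
  by have := sq_ge0 (x - xi); lra.
have h2 := hK _ h1; have h3 := rr_shift_le x xi s'.
have h4 : rr x s' <= rr x z by rewrite lerD2l lerXn2r// nnegrE ltW// (lt_le_trans s0).
have q0 := sq_ge0 xi; have h5 : 0 <= 1 + sq xi by lra.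
have := df.2 xi; rewrite normrM (ger0_norm h5) => h6.
have h7 : `|@Eprof R m (rr (x - xi) s')| <= K * (2 * (1 + rr x z)) * (1 + sq xi).
  apply: le_trans h2 _; rewrite -mulrA ler_wpM2l ?(ltW K0)//; apply: le_trans h3 _.
  by rewrite ler_wpM2r// ler_wpM2l// lerD2l.
apply: le_trans (ler_wpM2r (normr_ge0 _) h7) _.
rewrite -!mulrA; rewrite !mulrA -[leLHS]mulrA -[leRHS]mulrA ler_wpM2l// mulr_ge0// ?mulr_ge0 ?(ltW K0)//.
exact: ltW (br_gt0 _ _).
Qed.

Lemma Pot_is_derive x z : 0 < z -> is_derive z 1 (Pot f x) (kappa * G None f x z).
Proof.
move=> z0; have z2 : 0 < z / 2 by rewrite divr_gt0.
have [K K0 hK] := @Pot_dom x (z / 2) (2 * z) z2.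
have dm := moment_dom; have A0 := dom_ge0 df.
have kd s d : 0 < d -> d <= s -> dom qK (@kb R m d * A) (fun xi => kk None (x - xi) s * f xi).
  move=> d0 ds; have s0 : 0 < s by exact: lt_le_trans ds.
  apply: dom_mul => //; last by move=> xi; exact: kk_kb.
  exact: (@continuous_reflect R m (fun y => kk None y s) x (kk_continuous s0)).
rewrite (G_reflect None x z0 dm) -(@iintR_scale _ qK qK_half _ (@kb R m z * A)); last exact: kd.
apply: (@iintR_is_derive R qK qK_half m (K * A) (`|kappa| * (@kb R m (z / 2) * A)) z (z / 2)
  (fun s xi => Efund (emb (x - xi) s) * f xi) (fun s xi => kappa * (kk None (x - xi) s * f xi))) => //.
- by move=> s; rewrite ltr_norml => hs; apply: hK; lra.
- by move=> s; rewrite ltr_norml => hs; apply: dom_scale; apply: kd => //; lra.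
move=> s xi; rewrite ltr_norml => hs; have s0 : 0 < s by lra.
have r0 := rr_gt0 (x - xi) s0.
have d1 := is_derive_fadd (is_derive_fcst (sq (x - xi)) s) (is_derive_fsqr (is_derive_fid s)).
have d2 := is_derive_fcomp (Eprof_is_derive m0 r0) d1.
have d3 : is_derive s 1 (fun s => Efund (emb (x - xi) s)) (kappa * kk None (x - xi) s).
  rewrite [X in is_derive _ _ _ X](_ : _ = kappa / 2 * rr (x - xi) s `^ (- @pp R m) * (0 + 2 * s * 1)); last first.
    by rewrite /kk /=; move: kappa (_ `^ _) => u v; field.
  by apply: is_derive_ext d2; near=> r; rewrite EfundE//; near: r; exact: lt_nbhsr.
have := is_derive_fmul d3 (is_derive_fcst (f xi) s).
by rewrite mulr0 addr0 -mulrA.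
Unshelve. all: by end_near. Qed.

End Potential.
Lemma gk_moment_dom t : 0 < t -> exists A, dom qK A (fun xi => (1 + sq xi) * gk t xi).
Proof.
move=> t0; have [K K0 hK] := @gk_local_bound R m t t0; exists K; split=> [|y].
  apply: continuous_mul; last exact: gk_continuous.
  by apply: continuous_add; [exact: cst_continuous|exact: sq_continuous].
rewrite ger0_norm; last by rewrite mulr_ge0 ?gk_ge0// addr_ge0 ?sq_ge0.
by apply: hK; lra.
Qed.

Lemma dnA_neg x z t : t <= 0 -> dnA (emb x z) t = 0.
Proof.
move=> t0; apply: (partial_normal _).1; rewrite /Afun.
have -> : (fun s => iintR (fun z' : 'rV[R]_m => Gam (emb z' 0) t * Efund (emb x s - emb z' 0))) =
   (fun s => iintR (fun z' : 'rV[R]_m => 0)).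
  by apply/funext => s; congr iintR; apply/funext => z'; rewrite /Gam ltNge t0 mul0r.
exact: is_derive_fcst.
Qed.

Lemma dnAE x z t : 0 < t -> 0 < z -> dnA (emb x z) t = hk t 0 * (kappa * G None (gk t) x z).
Proof.
move=> t0 z0; apply: (partial_normal _).1.
have [A hA] := gk_moment_dom t0; have cg := @gk_continuous R m t.
have d := is_derive_fscale (hk t 0) (Pot_is_derive cg hA x z0).
apply: is_derive_ext d; near=> s.
have s0 : 0 < s by near: s; exact: lt_nbhsr.
have [K K0 hK] := Pot_dom cg hA x s s0.
rewrite /Pot -(@iintR_scale _ qK qK_half _ (K * A)); last exact: hK.
by rewrite /Afun; congr iintR; apply/funext => z'; rewrite GamE// emb_sub subr0 -mulrA [gk t z' * _]mulrC.
Unshelve. all: by end_near. Qed.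

Definition Jk f s x z : R := if 0 < s then hk s 0 * (kappa * G None (U f s) x z) else 0.

Lemma dnA_conv f C x z s (c : R) : 0 < z -> dom qK C f ->
  iintR (fun xi => dnA (emb x z - emb xi 0) s * (f xi * c)) = c * Jk f s x z.
Proof.
move=> z0 df; rewrite /Jk; case: ifPn => [s0|]; last first.
  rewrite -leNgt => s0; rewrite mulr0.
  have -> : (fun xi => dnA (emb x z - emb xi 0) s * (f xi * c)) = (fun xi => 0 * f xi).
    by apply/funext => xi; rewrite emb_sub subr0 dnA_neg// !mul0r.
  by rewrite (iintR_scale qK_half 0 df) mul0r.
have [K hK] := @gk_Cd R m m0 s s0.
have -> : (fun xi => dnA (emb x z - emb xi 0) s * (f xi * c)) =
    (fun xi => c * (hk s 0 * kappa) * (G None (@gk R m s) (x - xi) z * f xi)).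
  by apply/funext => xi; rewrite emb_sub subr0 dnAE//; ring.
have bd xi : `|G None (@gk R m s) (x - xi) z| <= @gA R m * K.
  by apply: G_bounded => //; exact: Cd_pred hK.
have gc : continuous (fun xi => G None (@gk R m s) (x - xi) z).
  exact: G_slice_continuous z0 (Cd_dom hK).
rewrite (iintR_scale qK_half _ (dom_prod_bounded gc bd df)) (G_conv m0 None x z0 (Cd_dom hK) df).
have -> : conv (@gk R m s) f = U f s by apply/funext => y; rewrite (conv_gk s0 df).
by ring.
Qed.

Lemma U_H f C s : 0 < s -> dom qK C f -> U f s = H f s.
Proof. by move=> s0 df; apply/funext => x; rewrite (H_U x s0 df). Qed.

Lemma GU_bound f C : dom qK C f -> exists2 M, 0 < M & forall s x z, 0 < s -> 0 < z ->
  `|G None (U f s) x z| <= M * dec x z.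
Proof.
move=> df; have C0 := dom_ge0 df.
have hS y : (1 + sq y) `^ (m%:R / 2) * `|f y| <= C.
  have m2 : 0 <= m%:R / 2 :> R by rewrite divr_ge0.
  apply: le_trans (ler_wpM2l (powR_ge0 _ _) (df.2 y)) _; rewrite mulrCA ler_piMr//.
  apply: le_trans (sq_wt_le _ y m2) _; rewrite Wt_le1// /qK -natr1; lra.
have [M M0 hM] := G_heat_dec m0 df hS; exists M => // s x z s0 z0.
by rewrite (U_H s0 df) hM.
Qed.


Lemma GU_local f C x z T : 0 <= T -> 0 < z -> dom qK C f ->
  exists B, forall s, 0 <= s <= T -> dom qK B (fun y => kk None y z * U f s (x - y)).
Proof.
move=> T0 z0 df; have [A A0 hA] := @U_Cd R m T T0.
exists (@kb R m z * (A * C * Px x)) => s hs.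
by apply: G_dom (lexx z) _ => //; have := hA 0%N C f s hs (conj df I); case.
Qed.

Lemma GU_continuous f C s x z : 0 < s -> 0 < z -> dom qK C f -> {for s, continuous (fun s => G None (U f s) x z)}.
Proof.
move=> s0 z0 df; have T0 : 0 <= s + 1 by lra.
have [B hB] := GU_local x T0 z0 df.
apply: (@continuous_of_seq _ _ 0 (s + 1)) => [|u hu cu]; first lra.
have hu' n : 0 <= u n <= s + 1 by have := hu n; lra.
have dB n : dom qK B (fun y => kk None y z * U f (u n) (x - y)) by apply: hB.
have dB' : dom qK B (fun y => kk None y z * U f s (x - y)) by apply: hB; lra.
apply: (iintR_dct qK_half dB dB').
move=> y; apply: cvgM; first exact: cvg_cst.
by apply: (@U_cvg R m C f u (fun=> x - y) s (x - y) (s + 1)) => //; exact: cvg_cst.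
Qed.

Lemma GU_is_derive f C s x z : 0 < s -> 0 < z -> Cd 2 C f ->
  is_derive s 1 (fun s => G None (U f s) x z) (G None (U (lap f) s) x z).
Proof.
move=> s0 z0 cf; have T0 : 0 <= 2 * s by lra.
have df := Cd_dom cf; have dl := lap_dom cf.
have [B hB] := GU_local x T0 z0 df; have [B' hB'] := GU_local x T0 z0 dl.
apply: (@iintR_is_derive R qK qK_half m B B' s s (fun s y => kk None y z * U f s (x - y))
  (fun s y => kk None y z * U (lap f) s (x - y))) => //.
- by move=> r; rewrite ltr_norml => hr; apply: hB; lra.
- by move=> r; rewrite ltr_norml => hr; apply: hB'; lra.
move=> r y; rewrite ltr_norml => hr; have r0 : 0 < r by lra.
apply: is_derive_fscale; rewrite (U_H r0 dl).
apply: is_derive_ext (H_is_derive (x - y) r0 cf); near=> q.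
by rewrite (U_H (f := f) (C := C))//; near: q; exact: lt_nbhsr.
Unshelve. all: by end_near. Qed.

Lemma GU_line f C s x z j (r : R) : 0 < s -> 0 < z -> Cd 1 C f ->
  is_derive r 1 (fun r => G None (U f s) (x + r *: unitv R j) z) (G None (U (partial j f) s) (x + r *: unitv R j) z).
Proof.
move=> s0 z0 cf; have [A A0 hA] := @U_Cd R m s (ltW s0).
have ss : 0 <= s <= s by rewrite (ltW s0) lexx.
have := G_line j None x r z0 (hA 1%N C f s ss cf).
by rewrite (U_partial j (ltW s0) cf).1.
Qed.

Lemma GU_lap f C s x z : 0 < s -> 0 < z -> Cd 2 C f ->
  G None (U (lap f) s) x z = \sum_(j < m) G None (U (partial j (partial j f)) s) x z.
Proof.
move=> s0 z0 cf; have [A A0 hA] := @U_bound R m s (ltW s0).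
have dp j : dom qK C (partial j (partial j f)) := Cd_dom (Cd_partial j (Cd_partial j cf)).
have [A2 A20 hA2] := @U_dom R m s (ltW s0); have ss : 0 <= s <= s by rewrite (ltW s0) lexx.
have E y : U (lap f) s y = \sum_(j < m) U (partial j (partial j f)) s y.
  rewrite /U -(iintR_sum qK_half (index_enum _) (fun j => hA2 C _ s y ss (dp j))).
  by congr iintR; apply/funext => w; rewrite /lap mulr_sumr.
have [B hB] := choice (fun j => GU_local x (ltW s0) z0 (dp j)).
rewrite /G -(iintR_sum qK_half (index_enum _) (fun j => hB j s ss)).
by congr iintR; apply/funext => y; rewrite E mulr_sumr.
Qed.

Lemma hk0E s : 0 < s -> hk s 0 = (4 * pi) `^ (- (1 / 2)) * s `^ (- (1 / 2)) :> R.
Proof.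
move=> s0; rewrite /hk expr0n /= mul0r oppr0 expR0 mulr1 powRM ?(ltW s0)//.
by rewrite mulr_ge0 ?pi_ge0.
Qed.

Lemma hk0_le s : 0 < s -> hk s 0 <= s `^ (- (1 / 2)) :> R.
Proof.
move=> s0; rewrite hk0E// ler_piMl ?powR_ge0//.
rewrite -[leRHS](powR_one (- (1 / 2))); apply: powR_anti; [by []| |lra].
by have := @pi_ge2 R; lra.
Qed.

End PressurePotential.

Section TimePotential.
Context {R : realType} {m : nat}.
Local Open Scope ring_scope.
Hypothesis m0 : (0 < m)%N.
Implicit Types (x y xi : 'rV[R]_m) (t s z M : R) (f g : 'rV[R]_m -> R).
Local Notation qK := (@qK R m).
Local Notation mu := (@lebesgue_measure R).
Local Notation Intg D f := (mu.-integrable (D : set R) (EFin \o (f : R -> R))).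
Local Notation Rint := (@Rintegral _ _ R mu).
Local Notation kappa := (@kappa R m).

Lemma Rint_sum (D : set R) (I : Type) (r : seq I) (F : I -> R -> R) : measurable D ->
  (forall i, Intg D (F i)) ->
  Intg D (fun t => \sum_(i <- r) F i t) /\ Rint D (fun t => \sum_(i <- r) F i t) = \sum_(i <- r) Rint D (F i).
Proof.
move=> mD IF; elim: r => [|i r [IH1 IH2]].
  have E : (fun t : R => \sum_(i <- [::]) F i t) = (fun=> 0) by apply/funext => t; rewrite big_nil.
  rewrite E big_nil; split; last by rewrite /Rintegral integral0.
  exact: (integrable0 mu D).
have E : (fun t : R => \sum_(j <- i :: r) F j t) = (fun t => F i t + \sum_(j <- r) F j t).
  by apply/funext => t; rewrite big_cons.
rewrite E big_cons; split; first exact: integrable_add.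
by rewrite (RintD mD (IF i) IH1) IH2.
Qed.

Lemma Jk_bound f C : dom qK C f -> exists2 M, 0 < M & forall s x z, 0 < s -> 0 < z ->
  `|Jk f s x z| <= M * s `^ (- (1 / 2)) * dec x z.
Proof.
move=> df; have [M M0 hM] := GU_bound m0 df.
exists (`|kappa| * M + 1) => [|s x z s0 z0]; first by rewrite ltr_wpDl// mulr_ge0// ltW.
rewrite /Jk s0 normrM (ger0_norm (hk_ge0 _ _)) normrM.
have h1 := ler_wpM2l (normr_ge0 kappa) (hM s x z s0 z0).
have h2 := ler_pM (hk_ge0 s 0) (mulr_ge0 (normr_ge0 _) (normr_ge0 _)) (hk0_le s0) h1.
apply: le_trans h2 _; have d0 := ltW (dec_gt0 x z); have p0 := powR_ge0 s (- (1 / 2)).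
by have := mulr_ge0 p0 d0; move: (s `^ _) (dec x z) => u v uv; lra.
Qed.

Lemma Jk_continuous f C s x z : 0 < s -> 0 < z -> dom qK C f -> {for s, continuous (fun s => Jk f s x z)}.
Proof.
move=> s0 z0 df.
have E : \forall r \near s, hk r 0 * (kappa * G None (U f r) x z) = Jk f r x z.
  by near=> r; rewrite /Jk ifT//; near: r; exact: lt_nbhsr.
have c : {for s, continuous (fun r => hk r 0 * (kappa * G None (U f r) x z))}.
  apply: continuousM; first exact: hk_continuous_t.
  by apply: continuousM; [exact: cst_continuous|exact: GU_continuous df].
rewrite /prop_for /continuous_at -(nbhs_singleton E).
by apply: cvg_trans c; apply: near_eq_cvg; near=> r; near: r.
Unshelve. all: by end_near. Qed.

Section Source.
Context (h : R -> R) (Hb : R).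
Hypotheses (ch : continuous h) (hb : forall s, `|h s| <= Hb) (h0 : forall s, s <= 0 -> h s = 0).

Let Hb0 : 0 <= Hb := le_trans (normr_ge0 _) (hb 0).

Definition Ig f t x z : R := Rint [set: R] (fun tau => h tau * Jk f (t - tau) x z).

Lemma Ig_rep f C t x z (T : R) : 0 < z -> dom qK C f -> 0 < T -> t <= T ->
  Intg `]0, T[%classic (fun s => h (t - s) * Jk f s x z) /\
  Ig f t x z = Rint `]0, T[%classic (fun s => h (t - s) * Jk f s x z).
Proof.
move=> z0 df T0 tT; have [M M0 hM] := Jk_bound df.
have I0 : Intg `]0, T[%classic (fun s => Hb * M * dec x z * s `^ (- (1 / 2))).
  by apply: integrable_scale => //; apply: integrable_pow => //; lra.
have I : Intg `]0, T[%classic (fun s => h (t - s) * Jk f s x z).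
  apply: integrable_dom I0 => //.
    apply: measurable_open_itv => s /andP[s0 _]; apply: continuousM; last exact: Jk_continuous df.
    exact: shift_continuous.
  move=> s; rewrite /= in_itv /= => /andP[s0 _]; rewrite normrM.
  apply: le_trans (ler_pM (normr_ge0 _) (normr_ge0 _) (hb (t - s)) (hM s x z s0 z0)) _.
  by rewrite le_eqVlt; apply/orP; left; apply/eqP; ring.
split; first exact: I.
pose Phi s := h (t - s) * Jk f s x z.
have E : Phi = (Phi \_ `]0, T[%classic).
  apply/funext => s; rewrite /patch; case: ifPn => // /negP hs.
  rewrite /Phi /Jk; case: ifPn => s0; last by rewrite mulr0.
  rewrite h0 ?mul0r// subr_le0; rewrite leNgt; apply/negP => sT; apply: hs.
  by rewrite inE /= in_itv /= s0 (lt_le_trans sT).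
have IT : Intg [set: R] Phi.
  rewrite E; have := (@integrable_mkcond _ _ R mu _ (EFin \o (fun s => h (t - s) * Jk f s x z)) (measurable_itv `]0, T[)).1 I.
  by rewrite restrict_EFin.
have n1 : (-1 : R) != 0 by rewrite oppr_eq0 oner_eq0.
have [_ A] := Rint_affine t n1 IT.
rewrite normrN normr1 invr1 mul1r in A.
rewrite (Rint_mkcond _ (measurable_itv _)) -/Phi -E -A /Ig; apply: Rint_eq => tau _.
have -> : -1 * tau + t = t - tau by ring.
by rewrite /Phi opprB addrCA subrr addr0.
Qed.

Lemma Ig_bound f C : dom qK C f -> exists2 M, 0 < M & forall t x z, t <= 2 -> 0 < z ->
  `|Ig f t x z| <= M * dec x z.
Proof.
move=> df; have [M M0 hM] := Jk_bound df.
have I0 : Intg `]0, 2[%classic (fun s : R => s `^ (- (1 / 2))) by apply: integrable_pow => //; lra.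
pose I := Rint `]0, 2[%classic (fun s : R => s `^ (- (1 / 2))).
have I00 : 0 <= I by apply: Rintegral_ge0 => s _; exact: powR_ge0.
exists (Hb * M * I + 1) => [|t x z t2 z0].
  by rewrite ltr_wpDl// mulr_ge0// mulr_ge0// ltW.
have [I1 ->] := Ig_rep x z0 df (ltr0n R 2) t2.
have d0 := ltW (dec_gt0 x z).
apply: (@le_trans _ _ (Hb * M * dec x z * I)).
  rewrite -(RintZ _ (measurable_itv _) I0); apply: le_norm_Rint => //; first exact: integrable_scale.
  move=> s; rewrite /= in_itv /= => /andP[s0 _]; rewrite normrM.
  apply: le_trans (ler_pM (normr_ge0 _) (normr_ge0 _) (hb (t - s)) (hM s x z s0 z0)) _.
  by rewrite le_eqVlt; apply/orP; left; apply/eqP; ring.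
by rewrite mulrDl mul1r mulrAC lerDl.
Qed.

Lemma Ig_line f C t x z j (r : R) : 0 < z -> Cd 1 C f ->
  is_derive r 1 (fun r => Ig f t (x + r *: unitv R j) z) (Ig (partial j f) t (x + r *: unitv R j) z).
Proof.
move=> z0 cf; have df := Cd_dom cf; have dp := Cd_dom (Cd_partial j cf).
pose T := `|t| + 1; have T0 : 0 < T by rewrite ltr_wpDl.
have tT : t <= T by have := ler_norm t; rewrite /T; lra.
clearbody T.
have E : (fun r => Ig f t (x + r *: unitv R j) z) =
    (fun r => Rint `]0, T[%classic (fun s => h (t - s) * Jk f s (x + r *: unitv R j) z)).
  by apply/funext => q; rewrite (Ig_rep _ z0 df T0 tT).2.
rewrite E (Ig_rep _ z0 dp T0 tT).2.
have [M M0 hM] := Jk_bound dp.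
have p1 : -1 < - (1 / 2) :> R by lra.
have I0 := integrable_scale (Hb * M) (measurable_itv _) (integrable_pow p1 T0).
pose F (q s : R) := h (t - s) * Jk f s (x + q *: unitv R j) z.
pose dF (q s : R) := h (t - s) * Jk (partial j f) s (x + q *: unitv R j) z.
have h1 (q : R) : `|q - r| < 1 -> Intg `]0, T[%classic (F q).
  by move=> _; exact: (Ig_rep _ z0 df T0 tT).1.
have h2 (q s : R) : `|q - r| < 1 -> `]0, T[%classic s -> is_derive q 1 (F ^~ s) (dF q s).
  move=> _; rewrite /= in_itv /= => /andP[s0 _]; apply: is_derive_fscale.
  by rewrite /Jk s0; apply: is_derive_fscale; apply: is_derive_fscale; exact: GU_line cf.
have h3 (q s : R) : `|q - r| < 1 -> `]0, T[%classic s -> `|dF q s| <= Hb * M * s `^ (- (1 / 2)).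
  move=> _; rewrite /= in_itv /= => /andP[s0 _]; rewrite normrM -mulrA.
  have Ms := mulr_ge0 (ltW M0) (powR_ge0 s (- (1 / 2))).
  have h3 := le_trans (hM _ (x + q *: unitv R j) _ s0 z0) (ler_piMr Ms (dec_le1 (x + q *: unitv R j) z)).
  exact: (ler_pM (normr_ge0 _) (normr_ge0 _) (hb (t - s)) h3).
exact: (@Rint_is_derive R `]0, T[%classic F dF _ r 1 (measurable_itv _) ltr01 h1 h2 I0 h3).2.
Qed.

Section Early.
Context (a D : R).
Hypotheses (ha : 0 < a <= 1 / 2) (dh : forall s, s < 1 -> is_derive s 1 h (derive1 h s))
  (bh : forall s, s < 1 -> `|derive1 h s| <= D * (1 - s) `^ (a - 1)).

Let D0 : 0 <= D.
Proof. by have := bh (ltr01 : (0 : R) < 1); rewrite subr0 powR_one mulr1; apply: le_trans. Qed.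

Let am : a - 1 <= 0. Proof. by case/andP: ha => _; lra. Qed.

Lemma Ig_early f C : dom qK C f -> exists2 M, 0 < M & forall t x z, t < 1 -> 0 < z ->
  `|derive1 (fun t => Ig f t x z) t| <= M * (1 - t) `^ (a - 1) * dec x z.
Proof.
move=> df; have [M M0 hM] := Jk_bound df.
have p1 : -1 < - (1 / 2) :> R by lra.
have I0 := integrable_pow p1 (ltr0n R 2).
pose I := Rint `]0, 2[%classic (fun s : R => s `^ (- (1 / 2))).
have I00 : 0 <= I by apply: Rintegral_ge0 => s _; exact: powR_ge0.
exists (D * M * I + 1) => [|t x z t1 z0].
  by rewrite ltr_wpDl// mulr_ge0// mulr_ge0// ltW.
have d0 := ltW (dec_gt0 x z).
pose F (q s : R) := h (q - s) * Jk f s x z.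
pose dF (q s : R) := derive1 h (q - s) * Jk f s x z.
pose e := (1 - t) / 2; have e0 : 0 < e by rewrite divr_gt0// subr_gt0.
have q2 (q : R) : `|q - t| < e -> q <= 2 by rewrite ltr_norml /e; lra.
have h1 (q : R) : `|q - t| < e -> Intg `]0, 2[%classic (F q).
  by move=> /q2 hq; exact: (Ig_rep x z0 df (ltr0n R 2) hq).1.
have q1 (q s : R) : `|q - t| < e -> 0 < s -> q - s < 1 /\ e <= 1 - (q - s).
  by rewrite ltr_norml /e => hq s0; split; lra.
have h2 (q s : R) : `|q - t| < e -> `]0, 2[%classic s -> is_derive q 1 (F ^~ s) (dF q s).
  move=> hq; rewrite /= in_itv /= => /andP[s0 _]; have [qs _] := q1 q s hq s0.
  have d1 := is_derive_fsub (is_derive_fid q) (is_derive_fcst s q).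
  have d2 := @is_derive_fcomp R h (fun q => q - s) q _ _ (dh qs) d1; rewrite subr0 mulr1 in d2.
  have := is_derive_fmul d2 (is_derive_fcst (Jk f s x z) q).
  by rewrite mulr0 addr0.
have h3 (q s : R) : `|q - t| < e -> `]0, 2[%classic s -> `|dF q s| <= D * e `^ (a - 1) * M * s `^ (- (1 / 2)).
  move=> hq; rewrite /= in_itv /= => /andP[s0 _]; have [qs ge] := q1 q s hq s0.
  have b1 : `|derive1 h (q - s)| <= D * e `^ (a - 1).
    by apply: le_trans (bh qs) _; rewrite ler_wpM2l//; exact: powR_anti.
  have Ms : 0 <= M * s `^ (- (1 / 2)) by rewrite mulr_ge0 ?powR_ge0// ltW.
  have b2 := le_trans (hM _ x _ s0 z0) (ler_piMr Ms (dec_le1 x z)).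
  by rewrite /dF normrM -mulrA; exact: (ler_pM (normr_ge0 _) (normr_ge0 _) b1 b2).
have I1 := integrable_scale (D * e `^ (a - 1) * M) (measurable_itv _) I0.
have [I2 d] := @Rint_is_derive R `]0, 2[%classic F dF _ t e (measurable_itv _) e0 h1 h2 I1 h3.
have E : \forall q \near t, Rint `]0, 2[%classic (F q) = Ig f q x z.
  near=> q; have hq : q < 2 by near: q; apply: lt_nbhsl; lra.
  by rewrite (Ig_rep x z0 df (ltr0n R 2) (ltW hq)).2.
have [_ d2] := is_derive_ext E d.
rewrite derive1E d2; apply: (@le_trans _ _ (D * (1 - t) `^ (a - 1) * M * dec x z * I)).
  rewrite -(RintZ _ (measurable_itv _) I0); apply: (@le_norm_Rint _ _ _ _ (measurable_itv _) I2).
    exact: integrable_scale.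
  move=> s; rewrite /= in_itv /= => /andP[s0 _]; rewrite /dF normrM.
  have ts : t - s < 1 by lra.
  have b1 : `|derive1 h (t - s)| <= D * (1 - t) `^ (a - 1).
    by apply: le_trans (bh ts) _; rewrite ler_wpM2l//; apply: powR_anti => //; lra.
  apply: le_trans (ler_pM (normr_ge0 _) (normr_ge0 _) b1 (hM s x z s0 z0)) _.
  by rewrite le_eqVlt; apply/orP; left; apply/eqP; ring.
have -> : D * (1 - t) `^ (a - 1) * M * dec x z * I = D * M * I * ((1 - t) `^ (a - 1) * dec x z) by ring.
by rewrite -[leRHS]mulrA mulrDl mul1r lerDl mulr_ge0 ?powR_ge0.
Unshelve. all: by end_near. Qed.

End Early.

Section Late.
Context (a K : R).
Hypotheses (ha : 0 < a <= 1 / 2) (h1 : forall s, 1 <= s -> h s = 0)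
  (kh : forall s, 0 < s < 1 -> `|h s| <= K * (1 - s) `^ a).

Let K0 : 0 <= K.
Proof.
have h2 : 0 < (1 / 2 : R) < 1 by lra.
have := le_trans (normr_ge0 _) (kh h2); rewrite pmulr_lge0// powR_gt0; lra.
Qed.

Lemma Ig_late_rep f t x z : Ig f t x z = Rint `]0, 1[%classic (fun tau => h tau * Jk f (t - tau) x z).
Proof.
rewrite (Rint_mkcond _ (measurable_itv _)); apply: Rint_eq => tau _; rewrite /patch; case: ifPn => // /negP ht.
case: (leP tau 0) => t0; first by rewrite h0// mul0r.
case: (leP 1 tau) => t1; first by rewrite h1// mul0r.
by exfalso; apply: ht; rewrite inE /= in_itv /= t0 t1.
Qed.

Lemma Ig_late_integrable f C t x z : 1 < t -> 0 < z -> dom qK C f ->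
  Intg `]0, 1[%classic (fun tau => h tau * Jk f (t - tau) x z).
Proof.
move=> t1 z0 df; have [M M0 hM] := Jk_bound df.
apply: (@integrable_bounded_itv _ _ 0 1 (Hb * (M * (t - 1) `^ (- (1 / 2))))).
  move=> tau htau; apply: continuousM; first exact: ch.
  apply: (@continuous_comp _ _ _ (fun tau : R => t - tau) (fun s => Jk f s x z)).
    by apply: cvgB; [exact: cvg_cst|exact: cvg_id].
  by apply: (@Jk_continuous f C) => //; lra.
move=> tau htau; rewrite normrM.
have s0 : 0 < t - tau by lra.
have ts : (t - tau) `^ (- (1 / 2)) <= (t - 1) `^ (- (1 / 2)) by apply: powR_anti; lra.
have b := le_trans (hM _ x _ s0 z0) (ler_piMr (mulr_ge0 (ltW M0) (powR_ge0 _ _)) (dec_le1 x z)).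
have b2 := le_trans b (ler_wpM2l (ltW M0) ts).
exact: (ler_pM (normr_ge0 _) (normr_ge0 _) (hb tau) b2).
Qed.

Lemma hk20E s : hk2 s 0 = - (2 * s)^-1 * hk s 0 :> R.
Proof. by rewrite /hk2 mul0r expr0n addr0. Qed.

(* The heat operator annihilates the tangential factor of the kernel, so only the normal factor is differentiated. *)
Lemma Ig_late f C : Cd 2 C f -> exists2 M, 0 < M & forall t x z, 1 < t -> 0 < z ->
  `|derive1 (fun t => Ig f t x z) t - \sum_j Ig (partial j (partial j f)) t x z| <= M * (t - 1) `^ (a - 1) * dec x z.
Proof.
move=> cf; have df := Cd_dom cf; have dl := lap_dom cf.
have dp j : dom qK C (partial j (partial j f)) := Cd_dom (Cd_partial j (Cd_partial j cf)).
have [M M0 hM] := GU_bound m0 df; have [M' M'0 hM'] := GU_bound m0 dl.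
have a0 : 0 < a by case/andP: ha.
have p1 : -1 < - (1 / 2) :> R by lra.
have [I0 _] := @integrable_singularity R (- (1 / 2)) p1.
pose I := Rint `]0, 1[%classic (fun s : R => `|1 - s| `^ (- (1 / 2))).
have I00 : 0 <= I by apply: Rintegral_ge0 => s _; exact: powR_ge0.
exists (K * `|kappa| * M * I + 1) => [|t x z t1 z0].
  by rewrite ltr_wpDl// mulr_ge0// mulr_ge0 ?(ltW M0)// mulr_ge0.
have d0 := ltW (dec_gt0 x z).
pose F (q s : R) := h s * Jk f (q - s) x z.
pose V q := hk2 q 0 * (kappa * G None (U f q) x z).
pose W q := hk q 0 * (kappa * G None (U (lap f) q) x z).
pose dF (q s : R) := h s * (V (q - s) + W (q - s)).
pose e := (t - 1) / 2; have e0 : 0 < e by rewrite divr_gt0// subr_gt0.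
have q1 (q s : R) : `|q - t| < e -> 0 < s < 1 -> e <= q - s by rewrite ltr_norml /e => hq hs; lra.
have b1 (q : R) : `|q - t| < e -> Intg `]0, 1[%classic (F q).
  by rewrite ltr_norml => hq; apply: (Ig_late_integrable x _ z0 df); move: hq; rewrite /e; lra.
clearbody e.
have b2 (q s : R) : `|q - t| < e -> `]0, 1[%classic s -> is_derive q 1 (F ^~ s) (dF q s).
  move=> hq; rewrite /= in_itv /= => hs; have s0 := lt_le_trans e0 (q1 q s hq hs).
  have d1 := is_derive_fsub (is_derive_fid q) (is_derive_fcst s q).
  have d2 := is_derive_fmul (hk_is_derive_t 0 s0) (is_derive_fscale kappa (GU_is_derive x s0 z0 cf)).
  have d3 : is_derive (q - s) 1 (fun q => Jk f q x z) (V (q - s) + W (q - s)).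
    by apply: is_derive_ext d2; near=> r; rewrite /Jk ifT//; near: r; exact: lt_nbhsr.
  have d4 := @is_derive_fcomp R (fun q => Jk f q x z) (fun q => q - s) q _ _ d3 d1; rewrite subr0 mulr1 in d4.
  exact: is_derive_fscale d4.
have kap0 := normr_ge0 kappa.
have bV s : 0 < s -> `|V s| <= `|kappa| * M * ((2 * s)^-1 * s `^ (- (1 / 2))) * dec x z.
  move=> s0; have i0 : 0 <= (2 * s)^-1 by rewrite invr_ge0 mulr_ge0// ltW.
  rewrite /V hk20E (normrM (- (2 * s)^-1 * hk s 0)) (normrM (- (2 * s)^-1)) (normrM kappa) normrN (ger0_norm i0) (ger0_norm (hk_ge0 s 0)).
  have c1 := ler_wpM2l i0 (hk0_le s0); have c2 := ler_wpM2l kap0 (hM s x z s0 z0).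
  apply: le_trans (ler_pM (mulr_ge0 i0 (hk_ge0 s 0)) (mulr_ge0 kap0 (normr_ge0 _)) c1 c2) _.
  by rewrite le_eqVlt; apply/orP; left; apply/eqP; ring.
have bW s : 0 < s -> `|W s| <= `|kappa| * M' * s `^ (- (1 / 2)).
  move=> s0; rewrite /W (normrM (hk s 0)) (normrM kappa) (ger0_norm (hk_ge0 s 0)).
  have c1 := le_trans (hM' s x z s0 z0) (ler_piMr (ltW M'0) (dec_le1 x z)).
  apply: le_trans (ler_pM (hk_ge0 s 0) (mulr_ge0 kap0 (normr_ge0 _)) (hk0_le s0) (ler_wpM2l kap0 c1)) _.
  by rewrite mulrC.
pose B := Hb * (`|kappa| * M * ((2 * e)^-1 * e `^ (- (1 / 2))) + `|kappa| * M' * e `^ (- (1 / 2))).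
have b3 (q s : R) : `|q - t| < e -> `]0, 1[%classic s -> `|dF q s| <= B.
  move=> hq; rewrite /= in_itv /= => hs; have es := q1 q s hq hs; have s0 := lt_le_trans e0 es.
  have c1 : (q - s) `^ (- (1 / 2)) <= e `^ (- (1 / 2)) by apply: powR_anti => //; lra.
  have c2 : (2 * (q - s))^-1 <= (2 * e)^-1 by rewrite lef_pV2 ?posrE ?mulr_gt0// ler_pM2l.
  have i0 : 0 <= (2 * (q - s))^-1 by rewrite invr_ge0 mulr_ge0// ltW.
  have c3 := ler_pM i0 (powR_ge0 _ _) c2 c1.
  have kM : 0 <= `|kappa| * M by rewrite mulr_ge0// ltW.
  have kM' : 0 <= `|kappa| * M' by rewrite mulr_ge0// ltW.
  have c4 := le_trans (bV _ s0) (ler_piMr (mulr_ge0 kM (mulr_ge0 i0 (powR_ge0 _ _))) (dec_le1 x z)).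
  have c5 := le_trans c4 (ler_wpM2l kM c3).
  have c6 := le_trans (bW _ s0) (ler_wpM2l kM' c1).
  have c7 := le_trans (ler_normD (V (q - s)) (W (q - s))) (lerD c5 c6).
  by rewrite /dF normrM; exact: (ler_pM (normr_ge0 _) (normr_ge0 _) (hb s) c7).
have IB : Intg `]0, 1[%classic (fun=> B) by apply: integrable_cst_itv; exact: itv_mu_fin.
have [I2 d] := @Rint_is_derive R `]0, 1[%classic F dF _ t e (measurable_itv _) e0 b1 b2 IB b3.
have E : (fun t => Ig f t x z) = (fun q => Rint `]0, 1[%classic (F q)).
  by apply/funext => q; rewrite Ig_late_rep.
have IW j : Intg `]0, 1[%classic (fun tau => h tau * Jk (partial j (partial j f)) (t - tau) x z).
  exact: (Ig_late_integrable x t1 z0 (dp j)).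
have [I3 S] := Rint_sum (index_enum _) (measurable_itv `]0%R, 1%R[) IW.
rewrite derive1E E; have [_ ->] := d.
have -> : \sum_j Ig (partial j (partial j f)) t x z = Rint `]0, 1[%classic (fun tau => h tau * W (t - tau)).
  rewrite (eq_bigr (fun j => Rint `]0, 1[%classic (fun tau => h tau * Jk (partial j (partial j f)) (t - tau) x z))); last first.
    by move=> j _; rewrite Ig_late_rep.
  rewrite -S; apply: Rint_eq => s; rewrite /= in_itv /= => hs; have s0 : 0 < t - s by rewrite subr_gt0; case/andP: hs => _ /lt_trans; exact.
  rewrite /W (GU_lap x s0 z0 cf) !mulr_sumr; apply: eq_bigr => j _.
  by rewrite /Jk s0.
have I4 : Intg `]0, 1[%classic (fun tau => h tau * W (t - tau)).
  apply: integrable_eq I3 => // s; rewrite /= in_itv /= => hs; have s0 : 0 < t - s by rewrite subr_gt0; case/andP: hs => _ /lt_trans; exact.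
  rewrite /W (GU_lap x s0 z0 cf) !mulr_sumr; apply: eq_bigr => j _.
  by rewrite /Jk s0.
rewrite -(RintB (measurable_itv _) I2 I4).
apply: (@le_trans _ _ (K * `|kappa| * M * (t - 1) `^ (a - 1) * dec x z * I)).
  rewrite -(RintZ _ (measurable_itv _) I0); apply: (@le_norm_Rint _ _ _ _ (measurable_itv _)).
  - exact: integrable_sub.
  - exact: integrable_scale.
  move=> s; rewrite /= in_itv /= => hs; have s0 : 0 < t - s by rewrite subr_gt0; case/andP: hs => _ /lt_trans; exact.
  have -> : dF t s - h s * W (t - s) = h s * V (t - s) by rewrite /dF; ring.
  rewrite normrM; have u0 : 0 < 1 - s by rewrite subr_gt0; case/andP: hs.
  rewrite (gtr0_norm u0).
  apply: le_trans (ler_pM (normr_ge0 _) (normr_ge0 _) (kh hs) (bV _ s0)) _.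
  have c1 : (1 - s) `^ a * ((2 * (t - s))^-1 * (t - s) `^ (- (1 / 2))) <= (t - 1) `^ (a - 1) * (1 - s) `^ (- (1 / 2)).
    have -> : (2 * (t - s))^-1 * (t - s) `^ (- (1 / 2)) = 2^-1 * ((t - s) `^ (a - 1) * (t - s) `^ (- (a + 1 / 2))).
      have pw : (t - s)^-1 = (t - s) `^ (- 1) by rewrite powR_inv1// ltW.
      by rewrite -powR_split// invfM -mulrA pw -powR_split//; congr (_ * _ `^ _); field.
    have -> : (1 - s) `^ (- (1 / 2)) = (1 - s) `^ a * (1 - s) `^ (- (a + 1 / 2)).
      by rewrite -powR_split//; congr (_ `^ _); field.
    have e1 : (t - s) `^ (a - 1) <= (t - 1) `^ (a - 1).
      by case/andP: hs => _ s1; apply: powR_anti; [rewrite subr_gt0|exact: lerB (lexx t) (ltW s1)|case/andP: ha => _; lra].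
    have e2 : (t - s) `^ (- (a + 1 / 2)) <= (1 - s) `^ (- (a + 1 / 2)) by apply: powR_anti; [|rewrite lerD2r ltW|lra].
    have e3 := ler_pM (powR_ge0 _ _) (powR_ge0 _ _) e1 e2.
    have P0 := powR_ge0 (1 - s) a.
    have e4 := ler_wpM2l P0 e3.
    have e5 := mulr_ge0 P0 (mulr_ge0 (powR_ge0 (t - s) (a - 1)) (powR_ge0 (t - s) (- (a + 1 / 2)))).
    move: e4 e5; move: (_ `^ a) (_ `^ (a - 1)) (_ `^ (- (a + 1 / 2))) => u1 u2 u3 e4 e5; lra.
  have Z : 0 <= K * (`|kappa| * M) * dec x z by rewrite mulr_ge0// mulr_ge0// mulr_ge0// ltW.
  have c2 := ler_wpM2l Z c1; apply: le_trans (le_trans _ c2) _.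
    by rewrite le_eqVlt; apply/orP; left; apply/eqP; ring.
  by rewrite le_eqVlt; apply/orP; left; apply/eqP; ring.
have -> : K * `|kappa| * M * (t - 1) `^ (a - 1) * dec x z * I = K * `|kappa| * M * I * ((t - 1) `^ (a - 1) * dec x z) by ring.
by rewrite -[leRHS]mulrA mulrDl mul1r lerDl mulr_ge0 ?powR_ge0.
Unshelve. all: by end_near. Qed.

End Late.

End Source.
End TimePotential.

Section PressureBound.
Context {R : realType} {m : nat}.
Local Open Scope ring_scope.
Hypothesis m0 : (0 < m)%N.
Implicit Types (x y xi : 'rV[R]_m) (t s z M : R) (f : 'rV[R]_m -> R).
Local Notation qK := (@qK R m).
Local Notation qK_half := (@qK_half R m).
Local Notation mu := (@lebesgue_measure R).
Local Notation Intg D f := (mu.-integrable (D : set R) (EFin \o (f : R -> R))).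
Local Notation Rint := (@Rintegral _ _ R mu).
Local Notation kappa := (@kappa R m).

Lemma jbr_emb x z : jbr (emb x z) = (1 + rr x z) `^ (1 / 2).
Proof. by rewrite /jbr enorm_emb -powR12_sqrt ?(ltW (br_gt0 _ _))// mul1r. Qed.

Lemma jbr_pow k x z : (jbr (emb x z) ^+ k)^-1 = (1 + rr x z) `^ (- (k%:R / 2)).
Proof. by rewrite jbr_emb -powR_mulrn ?powR_ge0// -powRrM powRN; congr (_ `^ _)^-1; field. Qed.

Lemma dec_jbr x z : dec x z = (jbr (emb x z) ^+ m)^-1.
Proof. by rewrite jbr_pow. Qed.

(* Decay rate of the single-layer potential: logarithmic growth in the plane. *)
Definition Eweight (y : 'rV[R]_m.+1) : R :=
  if (3 <= m.+1)%N then (jbr y ^+ (m.+1 - 2))^-1 else ln (enorm y + 2).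

Lemma ln2_gt0 : 0 < ln 2 :> R. Proof. by rewrite ln_gt0// ltr1n. Qed.

Lemma ln2_le (e : R) : 0 <= e -> ln 2 <= ln (e + 2).
Proof. by move=> e0; rewrite ler_ln ?posrE//; lra. Qed.

Lemma Eweight_gt0 x z : 0 < Eweight (emb x z).
Proof.
rewrite /Eweight; case: ifP => _; first by rewrite jbr_pow powR_gt0 ?br_gt0.
by apply: lt_le_trans ln2_gt0 (ln2_le _); exact: sqrtr_ge0.
Qed.

Lemma enorm_emb_sqr x z : enorm (emb x z) ^+ 2 = rr x z /\ 0 <= enorm (emb x z).
Proof. by split; [exact: enorm_emb|exact: sqrtr_ge0]. Qed.

Lemma dec_Eweight : exists2 K, 0 < K & forall x z, dec x z <= K * Eweight (emb x z).
Proof.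
rewrite /Eweight; case m3 : (3 <= m.+1)%N.
  exists 1 => // x z; rewrite mul1r jbr_pow /dec; apply: ler_powR; first by rewrite lerDl rr_ge0.
  by rewrite lerN2 ler_pM2r ?invr_gt0// ler_nat subSS leq_subr.
exists (ln 2)^-1 => [|x z]; first by rewrite invr_gt0 ln2_gt0.
apply: le_trans (dec_le1 x z) _; rewrite mulrC ler_pdivlMr ?ln2_gt0// mul1r.
by apply: ln2_le; exact: sqrtr_ge0.
Qed.

Lemma Eweight_height : exists2 K, 0 < K & forall x z, 0 < z < 1 -> Eweight (emb x 1) <= K * Eweight (emb x z).
Proof.
rewrite /Eweight; case m3 : (3 <= m.+1)%N.
  exists 1 => // x z hz; rewrite mul1r !jbr_pow; apply: powR_mono_neg; [exact: br_gt0| |by rewrite divr_ge0].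
  rewrite lerD2l /rr lerD2l; have : z ^+ 2 <= 1 ^+ 2 by rewrite lerXn2r// ?nnegrE; lra.
  by rewrite expr1n.
exists 2 => // x z hz; have [e1 e0] := enorm_emb_sqr x z; have [f1 f0] := enorm_emb_sqr x 1.
move: e1 e0 f1 f0; move: (enorm (emb x z)) (enorm (emb x 1)) => e f e1 e0 f1 f0.
have fe : f <= e + 1.
  rewrite -(ler_sqr (x := f)) ?nnegrE//; last lra.
  have : rr x 1 <= rr x z + 1 by rewrite /rr; have := sqr_ge0 z; lra.
  by rewrite -f1 -e1; nra.
have h : f + 2 <= (e + 2) ^+ 2 by nra.
have e2 : 0 < e + 2 by lra.
rewrite mulr_natl -lnXn// ler_ln ?posrE ?exprn_gt0//; lra.
Qed.

Lemma rr_shift_ge x xi z : 1 <= z -> 1 + rr x z <= 4 * (1 + sq xi) * rr (x - xi) z.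
Proof.
move=> z1; have := rr_shift_le (x - xi) (- xi) z; rewrite opprK subrK.
have -> : sq (- xi) = sq xi by rewrite /sq; apply: eq_bigr => j _; rewrite mxE sqrrN.
have h1 : 1 <= rr (x - xi) z by rewrite /rr; have := sq_ge0 (x - xi); nra.
have := sq_ge0 xi; move: (sq xi) (rr (x - xi) z) h1 => u v h1 u0; nra.
Qed.

Lemma Eprof_far : exists2 K, 0 < K & forall x xi z, 1 <= z ->
  `|@Eprof R m (rr (x - xi) z)| <= K * Eweight (emb x z) * (1 + sq xi) ^+ m.
Proof.
rewrite /Eprof /Eweight; case m3 : (3 <= m.+1)%N.
  set c := _^-1; exists (`|c| * 4 ^+ m + 1) => [|x xi z z1].
    by rewrite ltr_wpDl// mulr_ge0// exprn_ge0.
  rewrite normrM (ger0_norm (powR_ge0 _ _)) jbr_pow.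
  set p : R := (m.+1 - 2)%:R / 2.
  have p0 : 0 <= p by rewrite divr_ge0.
  have pE : (2 - m.+1%:R) / 2 = - p by rewrite /p natrB//; lra.
  have q0 := sq_ge0 xi; have X0 : 0 < 1 + rr x z := br_gt0 x z.
  set W := 4 * (1 + sq xi); have W1 : 1 <= W by rewrite /W; lra.
  have W0 : 0 < W by lra.
  have h := rr_shift_ge x xi z1; rewrite -/W in h.
  have r0 : 0 < rr (x - xi) z by apply: rr_gt0; lra.
  have h1 : (1 + rr x z) / W <= rr (x - xi) z by rewrite ler_pdivrMr// mulrC.
  have h2 : rr (x - xi) z `^ (- p) <= W `^ p * (1 + rr x z) `^ (- p).
    apply: le_trans (powR_mono_neg _ h1 p0) _; first by rewrite divr_gt0.
    rewrite powRM ?(ltW X0) ?invr_ge0 ?(ltW W0)// mulrC ler_wpM2r ?powR_ge0//.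
    by rewrite -powR_inv1 ?(ltW W0)// -powRrM mulN1r opprK.
  have h3 : W `^ p <= 4 ^+ m * (1 + sq xi) ^+ m.
    rewrite -exprMn -/W -powR_mulrn ?(ltW W0)//; apply: ler_powR => //.
    rewrite /p; have : (m.+1 - 2)%:R <= m%:R :> R by rewrite ler_nat subSS leq_subr.
    by have : 0 <= (m.+1 - 2)%:R :> R by []; lra.
  rewrite pE; have P0 := powR_ge0 (1 + rr x z) (- p).
  have h4 := le_trans h2 (ler_wpM2r P0 h3).
  have h5 := ler_wpM2l (normr_ge0 c) h4; apply: le_trans h5 _.
  have : 0 <= (1 + sq xi) ^+ m * (1 + rr x z) `^ (- p) by rewrite mulr_ge0// exprn_ge0//; lra.
  by move: (_ `^ (- p)) ((1 + sq xi) ^+ m) (4 ^+ m) => u1 u2 u3; lra.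
have m1 : m = 1%N by apply/eqP; rewrite eqn_leq m0 -ltnS leqNgt m3.
set c := - _^-1; have l0 := ln2_gt0.
exists (`|c| * (3 + (ln 2)^-1) + 1) => [|x xi z z1].
  by rewrite ltr_wpDl// mulr_ge0// addr_ge0// invr_ge0 ltW.
have -> : (1 + sq xi) ^+ m = 1 + sq xi by move: (sq xi) => u; rewrite m1 expr1.
rewrite normrM; set L := ln (enorm _ + 2).
have [e1 e0] := enorm_emb_sqr x z; have L2 : ln 2 <= L by exact: ln2_le.
have q0 := sq_ge0 xi.
have r1 : 1 <= rr (x - xi) z by rewrite /rr; have := sq_ge0 (x - xi); nra.
have e2 : 0 < enorm (emb x z) + 2 by lra.
have b1 : rr (x - xi) z <= 2 * (enorm (emb x z) + 2) ^+ 2 * (1 + sq xi).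
  apply: (@le_trans _ _ (1 + rr (x - xi) z)); first by rewrite lerDr.
  apply: le_trans (rr_shift_le x xi z) _; rewrite ler_wpM2r ?addr_ge0// -e1; nra.
have b2 : ln (rr (x - xi) z) <= ln 2 + 2 * L + ln (1 + sq xi).
  have p1 : 0 < 2 * (enorm (emb x z) + 2) ^+ 2 by rewrite mulr_gt0// exprn_gt0.
  have p2 : 0 < 1 + sq xi by lra.
  have : ln (rr (x - xi) z) <= ln (2 * (enorm (emb x z) + 2) ^+ 2 * (1 + sq xi)).
    by rewrite ler_ln// posrE ?mulr_gt0//; lra.
  by rewrite lnM ?posrE// lnM ?posrE ?exprn_gt0// lnXn// mulr_natl.
clearbody L.
have b3 : ln (1 + sq xi) <= sq xi by apply: le_ln1Dx; lra.
have b0 : 0 <= ln (rr (x - xi) z) by exact: ln_ge0.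
rewrite normf_div (ger0_norm b0) (ger0_norm (ler0n R 2)).
have i0 : 0 < (ln 2)^-1 :> R by rewrite invr_gt0.
have L0 : 0 < L by lra.
have b4 : sq xi <= (ln 2)^-1 * L * sq xi.
  by rewrite ler_peMl// mulrC ler_pdivlMr// mul1r.
have b5 : ln (rr (x - xi) z) / 2 <= (3 + (ln 2)^-1) * (L * (1 + sq xi)).
  have := mulr_ge0 (ltW L0) q0; have := mulr_ge0 (ltW i0) (ltW L0).
  by move: b4 b2 b3 b0; move: L2 q0; move: ((ln (2 : R))^-1) (ln (2 : R)) (ln (rr _ _)) (ln (1 + _)) (sq xi) => u1 u2 u3 u4 u5 *; lra.
have b6 := ler_wpM2l (normr_ge0 c) b5; apply: le_trans b6 _.
have : 0 <= L * (1 + sq xi) by rewrite mulr_ge0 ?addr_ge0// ltW.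
by move: ((ln (2 : R))^-1) (sq xi) => u1 u2; lra.
Qed.

Section PotentialBound.
Context (g : 'rV[R]_m -> R) (C r : R).
Hypotheses (cg : Cd 1 C g) (sg : forall xi, r < enorm xi -> g xi = 0).

Let cgc : continuous g. Proof. by case: cg => -[]. Qed.

Lemma moment_bound : exists A, dom qK A (fun xi => (1 + sq xi) * g xi).
Proof.
apply: (@supported_dom R m _ r) => [|xi h]; last by rewrite sg ?mulr0.
apply: continuous_mul => //; apply: continuous_add; [exact: cst_continuous|exact: sq_continuous].
Qed.

Lemma Pot_bound : exists2 K, 0 < K & forall x z, 0 < z -> `|Pot g x z| <= K * Eweight (emb x z).
Proof.
have [A hA] := moment_bound; have [K1 K10 hK1] := Eprof_far.
have [B hB] : exists B, dom qK B (fun xi => (1 + sq xi) ^+ m * `|g xi|).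
  apply: (@supported_dom R m _ r) => [|xi h]; last by rewrite sg ?normr0 ?mulr0.
  apply: continuous_mul; last first.
    by move=> x; apply: continuous_comp; [exact: cgc|exact: norm_continuous].
  move=> x; apply: (@continuous_comp _ _ _ (fun x => 1 + sq x) (fun u : R => u ^+ m)); last exact: exprn_continuous.
  by apply: continuous_add; [exact: cst_continuous|exact: sq_continuous].
pose S := iintR (fun xi => (1 + sq xi) ^+ m * `|g xi|).
have S0 : 0 <= S.
  apply: (iintR_ge0 hB) => y; rewrite mulr_ge0// exprn_ge0// addr_ge0//; exact: sq_ge0.
have far x z : 1 <= z -> `|Pot g x z| <= K1 * Eweight (emb x z) * S.
  move=> z1; have z0 : 0 < z by lra.
  have [K' K'0 hK'] := Pot_dom m0 cgc hA x z z0.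
  rewrite /S -(iintR_scale qK_half _ hB).
  apply: (iintR_norm_le qK_half (hK' z (lexx z) (lexx z)) (dom_scale _ hB)) => xi.
  by rewrite normrM EfundE// mulrA ler_wpM2r// hK1.
have [K2 K20 hK2] := dec_Eweight; have [K3 K30 hK3] := Eweight_height.
pose Q := `|kappa| * (@nA R m * C).
have Q0 : 0 <= Q by rewrite mulr_ge0// mulr_ge0 ?nA_ge0// (Cd_ge0 cg).
pose T : R := 2 `^ (m%:R / 2) * 2 `^ (m%:R / 2).
have T0 : 0 <= T by rewrite mulr_ge0 ?powR_ge0.
have n1 := mulr_ge0 (ltW K10) S0; have n2 := mulr_ge0 (mulr_ge0 (ltW K10) (ltW K30)) S0.
have n3 := mulr_ge0 (mulr_ge0 Q0 T0) (ltW K20).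
exists (K1 * S + K1 * K3 * S + Q * T * K2 + 1) => [|x z z0]; first lra.
have E0 := ltW (Eweight_gt0 x z).
case: (leP 1 z) => z1.
  by apply: le_trans (far x z z1) _; rewrite mulrAC ler_wpM2r//; lra.
have d1 (s : R) : z <= s <= 1 -> is_derive s 1 (Pot g x) (kappa * G None g x s).
  by move=> hs; apply: (Pot_is_derive m0 cgc hA); lra.
have d2 (s : R) : z <= s <= 1 -> `|kappa * G None g x s| <= Q * dec x 0.
  move=> hs; have s0 : 0 < s by lra.
  rewrite normrM /Q -mulrA ler_wpM2l//; apply: le_trans (G_normal_dec m0 x s0 (Cd_dom cg)) _.
  rewrite ler_wpM2l//; first by rewrite mulr_ge0 ?nA_ge0// (Cd_ge0 cg).
  by apply: dec_mono => //; exact: ltW.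
have d3 := mvt_le (ltW z1) d1 d2.
have d4 : dec x 0 <= T * dec x z.
  have := dec_peetre x z 0; rewrite subr0 => h; apply: le_trans h _.
  rewrite /T mulrA ler_wpM2r ?(ltW (dec_gt0 _ _))// ler_wpM2l ?powR_ge0//.
  apply: powR_mono; [by rewrite addr_ge0// sqr_ge0| |by rewrite divr_ge0].
  have : z ^+ 2 <= 1 ^+ 2 by rewrite lerXn2r ?nnegrE// ltW.
  by rewrite expr1n; lra.
have d5 : `|Pot g x 1 - Pot g x z| <= Q * T * K2 * Eweight (emb x z).
  apply: le_trans d3 _; apply: (@le_trans _ _ (Q * dec x 0)).
    have q1 := mulr_ge0 Q0 (ltW (dec_gt0 x 0)); have q2 : 1 - z <= 1 by lra.
    exact: ler_piMr q1 q2.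
  have e1 := ler_wpM2l Q0 (le_trans d4 (ler_wpM2l T0 (hK2 x z))).
  by apply: le_trans e1 _; rewrite le_eqVlt; apply/orP; left; apply/eqP; ring.
have hz : 0 < z < 1 by lra.
have d6 : `|Pot g x 1| <= K1 * K3 * S * Eweight (emb x z).
  apply: le_trans (far x 1 (lexx 1)) _.
  have := ler_wpM2l n1 (hK3 x z hz); move: (Eweight _) (Eweight _) => u1 u2; lra.
have -> : Pot g x z = Pot g x 1 - (Pot g x 1 - Pot g x z) by ring.
apply: le_trans (ler_normB _ _) _; apply: le_trans (lerD d6 d5) _.
by rewrite -mulrDl ler_wpM2r//; lra.
Qed.

End PotentialBound.
Section Pressure.
Context (a r C : R) (g : 'rV[R]_m -> R) (h : R -> R).
Hypotheses (cg : Cd 3 C g) (sg : forall xi, r < enorm xi -> g xi = 0).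
Hypotheses (ha : 0 < a <= 1 / 2) (hh0 : forall s, 0 <= h s) (hhcont : continuous h)
  (hhsupp : forall s, s < 1 / 4 \/ 1 < s -> h s = 0)
  (hhC1 : forall s, 0 < s < 1 -> derivable h s 1 /\ {for s, continuous (derive1 h)})
  (hhform : forall s, 1 / 2 <= s <= 1 -> h s = (1 - s) `^ a).

Let cg2 : Cd 2 C g := Cd_pred cg.
Let cg1 : Cd 1 C g := Cd_pred cg2.
Let C0 : 0 <= C := Cd_ge0 cg.
Let cgc : continuous g. Proof. by case: cg => -[]. Qed.

Lemma phat_normal x z t : 0 < z ->
  partial ord_max (partial ord_max (fun y : 'rV[R]_m.+1 => iintR (fun xi : 'rV[R]_m => Efund (y - emb xi 0) * phin g h xi t))) (emb x z) =
  h t * (kappa * Dz None g x z).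
Proof.
move=> z0; have [A hA] := moment_bound cg1 sg.
set P := (fun y : 'rV[R]_m.+1 => iintR _).
have P1 s : 0 < s -> partial ord_max P (emb x s) = h t * (kappa * G None g x s).
  move=> s0; apply: (partial_normal _).1.
  apply: is_derive_ext (is_derive_fscale (h t) (Pot_is_derive m0 cgc hA x s0)); near=> q.
  have q0 : 0 < q by near: q; exact: lt_nbhsr.
  have [K K0 hK] := Pot_dom m0 cgc hA x q q0.
  rewrite /Pot -(iintR_scale qK_half _ (hK q (lexx q) (lexx q))) /P; congr iintR.
  by apply/funext => xi; rewrite emb_sub subr0 /phin; ring.
apply: (partial_normal _).1.
have d := is_derive_fscale (h t) (is_derive_fscale kappa (G_is_derive None x z0 cg1)).
by apply: is_derive_ext d; near=> q; rewrite P1//; near: q; exact: lt_nbhsr.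
Unshelve. all: by end_near. Qed.

Lemma phat_potential x z (c : R) : 0 < z ->
  iintR (fun xi : 'rV[R]_m => Efund (emb x z - emb xi 0) * (g xi * c)) = c * Pot g x z.
Proof.
move=> z0; have [A hA] := moment_bound cg1 sg.
have [K K0 hK] := Pot_dom m0 cgc hA x z z0.
rewrite /Pot -(iintR_scale qK_half _ (hK z (lexx z) (lexx z))); congr iintR.
by apply/funext => xi; rewrite emb_sub subr0; ring.
Qed.

Lemma phat_time x z s : 0 < z ->
  Rint [set: R] (fun tau => iintR (fun xi : 'rV[R]_m => dnA (emb x z - emb xi 0) (s - tau) * phin g h xi tau)) =
  Ig h g s x z.
Proof.
move=> z0; apply: Rint_eq => tau _.
by rewrite -(dnA_conv m0 x _ _ z0 (Cd_dom cg)).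
Qed.

Let h0 s : s <= 0 -> h s = 0.
Proof. by move=> s0; apply: hhsupp; left; lra. Qed.

Lemma sum_not_last (F : 'I_m.+1 -> R) : \sum_(j < m.+1 | j != ord_max) F j = \sum_(j < m) F (lift ord_max j).
Proof.
rewrite big_mkcond big_ord_recr /= eqxx addr0; apply: eq_bigr => j _.
by rewrite widen_lift eq_sym neq_lift.
Qed.

Lemma phat_laplace x z t : 0 < z ->
  lapx' (fun y : 'rV[R]_m.+1 => Rint [set: R] (fun tau => iintR (fun xi : 'rV[R]_m => dnA (y - emb xi 0) (t - tau) * phin g h xi tau))) (emb x z) =
  \sum_j Ig h (partial j (partial j g)) t x z.
Proof.
have [Hb Hb0 hb] := profile_bounded hh0 hhcont hhsupp.
move=> z0; rewrite /lapx' sum_not_last; apply: eq_bigr => j _.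
set F := (fun y : 'rV[R]_m.+1 => Rint _ _).
have FE x' : F (emb x' z) = Ig h g t x' z by rewrite /F phat_time.
have F1 x' : partial (lift ord_max j) F (emb x' z) = Ig h (partial j g) t x' z.
  apply: (partial_tangential _).1.
  have -> : (fun s : R => F (emb (x' + s *: unitv R j) z)) = (fun s : R => Ig h g t (x' + s *: unitv R j) z).
    by apply/funext => s.
  by have := Ig_line m0 hhcont hb h0 t x' j 0 z0 cg1; rewrite scale0r addr0.
apply: (partial_tangential _).1.
have -> : (fun s : R => partial (lift ord_max j) F (emb (x + s *: unitv R j) z)) =
   (fun s : R => Ig h (partial j g) t (x + s *: unitv R j) z) by apply/funext => s.
have cp : Cd 1 C (partial j g) := Cd_partial j cg2.
by have := Ig_line m0 hhcont hb h0 t x j 0 z0 cp; rewrite scale0r addr0.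
Qed.

Lemma phatE x z t : 0 < z -> phat g h (emb x z) t =
  2 * (h t * (kappa * Dz None g x z)) + 2 * (derive1 h t * Pot g x z) -
  4 * (derive1 (fun s => Ig h g s x z) t - \sum_j Ig h (partial j (partial j g)) t x z).
Proof.
move=> z0; rewrite /phat (phat_normal x t z0) (phat_potential x _ z0) (phat_laplace x t z0).
have -> : (fun s => Ig h g s x z) = (fun s => Rint [set: R] (fun tau =>
    iintR (fun xi : 'rV[R]_m => dnA (emb x z - emb xi 0) (s - tau) * phin g h xi tau))).
  by apply/funext => s; rewrite (phat_time x s z0).
by [].
Qed.

Lemma Ig_small f t x z : t < 1 / 4 -> Ig h f t x z = 0.
Proof.
move=> t4; rewrite /Ig (@Rint_eq _ _ _ (fun=> 0)) => [|tau _]; first by rewrite /Rintegral integral0.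
case: (ltP tau (1 / 4)) => t5; first by rewrite hhsupp ?mul0r//; left.
by rewrite /Jk ifF ?mulr0//; apply/negbTE; rewrite -leNgt; lra.
Qed.

Lemma derive1_near0 (f : R -> R) t : (\forall s \near t, f s = 0) -> derive1 f t = 0.
Proof.
move=> E; have E' : \forall s \near t, 0 = f s by apply: filterS E => s ->.
by rewrite derive1E; have [_ ->] := is_derive_ext E' (is_derive_fcst (0 : R) t).
Qed.

Lemma pressure_bound : exists2 K, 0 < K & forall (y : 'rV[R]_m.+1) (t : R), 0 < xlast y -> t != 1 ->
  `|phat g h y t| <=
   K * (if (1 / 4 <= t) && (t <= 1) then ((1 - t) `^ (1 - a))^-1 * Eweight y else 0)
 + K * (if 1 < t then (`|t - 1| `^ (1 - a) * jbr y ^+ (m.+1 - 1))^-1 else 0).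
Proof.
have [Hb Hb0 hb] := profile_bounded hh0 hhcont hhsupp.
have [D D0 hD] := profile_derive_bound ha hhsupp hhC1 hhform.
have aa : 0 < a <= a by case/andP: ha => -> _; rewrite lexx.
have [Hc Hc0 hc] := profile_holder ha hh0 hhcont hhsupp hhC1 hhform aa.
have h1 : forall s, 1 <= s -> h s = 0 := profile_ge1 ha hhsupp hhform.
have kh s : 0 < s < 1 -> `|h s| <= Hc * (1 - s) `^ a.
  move=> hs; have u0 : 0 < 1 - s by lra.
  have e := hc s 1; rewrite (h1 1 (lexx 1)) subr0 [`|s - 1|]distrC (gtr0_norm u0) in e; exact: e.
have dh : forall s, s < 1 -> is_derive s 1 h (derive1 h s) := profile_is_derive hhsupp hhC1.
have [K1 K10 hK1] := Pot_bound cg1 sg.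
have [K2 K20 hK2] := dec_Eweight.
have [K3 K30 hK3] := Ig_early m0 hhcont hb h0 ha dh hD (Cd_dom cg).
have [K4 K40 hK4] := Ig_late m0 hhcont hb h0 ha h1 kh cg2.
have [K5 K50 hK5] := @uniform_bound R _ (fun (j : 'I_m) M => forall t x z, t <= 2 -> 0 < z -> `|Ig h (partial j (partial j g)) t x z| <= M * dec x z)
  (fun i M M' H (le : M <= M') t x z (t2 : t <= 2) (z0 : 0 < z) => le_trans (H t x z t2 z0) (ler_wpM2r (ltW (dec_gt0 x z)) le))
  (fun j => Ig_bound m0 hhcont hb h0 (Cd_dom (Cd_partial j (Cd_partial j cg2)))).
pose Q := `|kappa| * (m%:R * @gA R m * C).
have gA0 : 0 <= @gA R m by rewrite addr_ge0 ?tA_ge0 ?nA_ge0.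
have Q0 : 0 <= Q by rewrite mulr_ge0// mulr_ge0// mulr_ge0.
pose K := 2 * (Hb * Q * K2) + 2 * (D * K1) + 4 * (K3 * K2 + m%:R * K5 * K2) + 4 * K4.
have n1 : 0 <= Hb * Q * K2 by rewrite mulr_ge0 ?(ltW K20)// mulr_ge0// ltW.
have n2 : 0 <= D * K1 by rewrite mulr_ge0// ltW.
have n3 : 0 <= K3 * K2 by rewrite mulr_ge0// ltW.
have n4 : 0 <= m%:R * K5 * K2 by rewrite mulr_ge0 ?(ltW K20)// mulr_ge0// ltW.
exists K => [|y t]; first by rewrite /K ltr_wpDl ?mulr_gt0// !addr_ge0// mulr_ge0// addr_ge0.
rewrite (vec_decomp y) xlast_emb; move: (xprime y) (xlast y) => x z z0 t1; rewrite phatE//.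
have E0 := Eweight_gt0 x z; have d0 := dec_gt0 x z.
case: (ltP t (1 / 4)) => t4.
  rewrite /= ifF; last by apply/negbTE; rewrite -leNgt; lra.
  have n : \forall s \near t, s < 1 / 4 by exact: lt_nbhsl.
  rewrite hhsupp; last by left.
  rewrite (derive1_near0 (f := h)); last by apply: filterS n => s hs; apply: hhsupp; left.
  rewrite (derive1_near0 (f := fun s => Ig h g s x z)); last by apply: filterS n => s hs; exact: Ig_small.
  have S0 : \sum_j Ig h (partial j (partial j g)) t x z = 0 by apply: big1 => j _; exact: Ig_small.
  rewrite S0.
  by rewrite !mul0r !mulr0 subrr mulr0 subr0 addr0 normr0.
case: (ltP t 1) => tt.
  rewrite ifT; last by rewrite /= ltW.
  rewrite [X in _ + _ * X]ifF ?mulr0 ?addr0; last by apply/negbTE; rewrite -leNgt ltW.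
  have u0 : 0 < 1 - t by rewrite subr_gt0.
  rewrite -powRN opprB; set p := (1 - t) `^ (a - 1).
  have p1 : 1 <= p.
    rewrite /p -[leLHS](powR_one (a - 1)); apply: powR_anti => //; first by lra.
    by case/andP: ha => _; lra.
  have dE := hK2 x z; have p0 := le_trans ler01 p1.
  have c1 : `|h t * (kappa * Dz None g x z)| <= Hb * Q * K2 * (p * Eweight (emb x z)).
    have e1 := Dz_dec m0 None x z0 cg2.
    have e2 := ler_wpM2l (normr_ge0 kappa) e1.
    rewrite (normrM (h t)) (normrM kappa).
    apply: le_trans (ler_pM (normr_ge0 _) (mulr_ge0 (normr_ge0 _) (normr_ge0 _)) (hb t) e2) _.
    have e3 : dec x z <= K2 * (p * Eweight (emb x z)).
      by apply: le_trans dE _; rewrite ler_wpM2l ?(ltW K20)// ler_peMl// ltW.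
    by have := ler_wpM2l (mulr_ge0 (ltW Hb0) Q0) e3; rewrite /Q; move: (p * _) => w; lra.
  have c2 : `|derive1 h t * Pot g x z| <= D * K1 * (p * Eweight (emb x z)).
    rewrite normrM; apply: le_trans (ler_pM (normr_ge0 _) (normr_ge0 _) (hD t tt) (hK1 x z z0)) _.
    by rewrite -/p le_eqVlt; apply/orP; left; apply/eqP; ring.
  have c3 : `|derive1 (fun s => Ig h g s x z) t| <= K3 * K2 * (p * Eweight (emb x z)).
    apply: le_trans (hK3 t x z tt z0) _; rewrite -/p.
    have := ler_wpM2l (mulr_ge0 (ltW K30) p0) dE; lra.
  have c4 : `|\sum_j Ig h (partial j (partial j g)) t x z| <= m%:R * K5 * K2 * (p * Eweight (emb x z)).
    apply: le_trans (ler_norm_sum _ _ _) _.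
    apply: (@le_trans _ _ (\sum_(j < m) K5 * (K2 * (p * Eweight (emb x z))))).
      apply: ler_sum => j _; have t2 : t <= 2 by rewrite (le_trans (ltW tt))// ler1n.
      apply: le_trans (hK5 j t x z t2 z0) _; rewrite ler_wpM2l ?(ltW K50)//.
      by apply: le_trans dE _; rewrite ler_wpM2l ?(ltW K20)// ler_peMl// ltW.
    by rewrite sumr_const card_ord -[leLHS]mulr_natl !mulrA.
  have w0 : 0 <= p * Eweight (emb x z) by rewrite mulr_ge0// ltW.
  have gen (v1 v2 v3 v4 w k1 k2 k3 k4 k5 : R) : `|v1| <= k1 * w -> `|v2| <= k2 * w -> `|v3| <= k3 * w ->
      `|v4| <= k4 * w -> 0 <= w -> 0 <= k5 ->
      `|2 * v1 + 2 * v2 - 4 * (v3 - v4)| <= (2 * k1 + 2 * k2 + 4 * (k3 + k4) + 4 * k5) * w.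
    by move=> a1 a2 a3 a4 a5 a6; have a7 := mulr_ge0 a6 a5; move: a1 a2 a3 a4; rewrite !ler_norml => *; lra.
  exact: gen c1 c2 c3 c4 w0 (ltW K40).
have t2 : 1 < t by rewrite lt_neqAle eq_sym t1.
rewrite /= ifF; last by apply/negbTE; rewrite -ltNge.
rewrite ifT// mulr0 add0r h1//.
rewrite (derive1_near0 (f := h)); last first.
  have n : \forall s \near t, 1 < s by exact: lt_nbhsr.
  by apply: filterS n => s hs; apply: h1; exact: ltW.
rewrite !mul0r !mulr0 addr0 add0r normrN normrM (ger0_norm (ler0n R 4)).
have u0 : 0 < t - 1 by rewrite subr_gt0.
rewrite subSS subn0 invfM -dec_jbr (gtr0_norm u0) -powRN opprB.
have := hK4 t x z t2 z0; have := mulr_ge0 (powR_ge0 (t - 1) (a - 1)) (ltW d0).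
move: (`|_|) ((t - 1) `^ (a - 1)) (dec x z) => v p d pd hv.
have N : 0 <= (2 * (Hb * Q * K2) + 2 * (D * K1) + 4 * (K3 * K2 + m%:R * K5 * K2)) * (p * d).
  by rewrite mulr_ge0// !addr_ge0// mulr_ge0// addr_ge0.
by move: N hv; rewrite /K; move: (Hb * Q * K2) (D * K1) (K3 * K2) (m%:R * K5 * K2) => k1 k2 k3 k4; lra.
Qed.

End Pressure.
End PressureBound.

Section LowerBound.
Context {R : realType}.
Local Open Scope ring_scope.
Local Notation mu := (@lebesgue_measure R).
Local Notation Intg D f := (mu.-integrable (D : set R) (EFin \o (f : R -> R))).
Local Notation Rint := (@Rintegral _ _ R mu).
Local Notation D2 := (`]0%R, 2%R[%classic : set R).

Lemma iintE_box_ge k (d : R) (f : 'rV[R]_k -> \bar R) : 0 < d -> (forall y, (0 <= f y)%E) ->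
  (forall y : 'rV[R]_k, (forall j, `|y 0 j| <= d) -> (1 <= f y)%E) -> (((2 * d) ^+ k)%:E <= iintE f)%E.
Proof.
move=> d0; elim: k f => [|k IH] f f0 f1; first by rewrite expr0; apply: f1; case.
have c0 : 0 <= (2 * d) ^+ k by rewrite exprn_ge0// mulr_ge0// ltW.
pose c : R := (2 * d) ^+ k; pose F := ((fun=> c%:E) : R -> \bar R) \_ `[- d, d]%classic.
have S (s : R) : (0 <= F s <= iintE (fun y : 'rV[R]_k => f (vcons s y)))%E.
  rewrite /F /patch; case: ifPn => [|_].
    rewrite inE /= in_itv /= -ler_norml => sd; rewrite lee_fin c0 /=.
    apply: IH => [y|y hy]; first exact: f0.
    apply: f1 => j; case: (unliftP ord0 j) => [j'|] ->; first by rewrite vconsS.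
    by rewrite vcons0.
  by rewrite lexx iintE_ge0.
apply: le_trans (ge0_integral_mono (fun s _ => S s)).
rewrite /F -integral_mkcond integral_cst//= lebesgue_measure_itv /= lte_fin ifT; last lra.
by rewrite -EFinB -EFinM lee_fin exprSr opprK -mulr2n -[d *+ 2]mulr_natl.
Qed.

Lemma volB1_gt0 m : 0 < volB1 R m.
Proof.
pose f (x : 'rV[R]_m.+1) : \bar R := (if enorm x < 1 then 1 else 0)%:E.
have f0 y : (0 <= f y)%E by rewrite /f lee_fin; case: ifP.
have n0 : 0 < m.+1%:R :> R by rewrite ltr0n.
have q1 : 1 / 2 < 1 :> R by lra.
have /andP[_ up] : (0 <= iintE f <= (2 `^ (m.+1%:R) * wt_mass 1 ^+ m.+1)%:E)%E.
  apply: (iintE_bound q1 (powR_ge0 _ _)) => y; rewrite f0 /f lee_fin; case: ifPn => y1; last by rewrite mulr_ge0 ?powR_ge0// Wt_ge0.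
  have e0 : 0 <= enorm y by exact: sqrtr_ge0.
  have h : 2 `^ (- m.+1%:R) <= Wt 1 y.
    apply: le_trans (radial_Wt y ler01); rewrite mul1r; apply: powR_mono_neg; rewrite ?ler0n//.
      by rewrite ltr_pwDl// sqr_ge0.
    have : enorm y ^+ 2 <= 1 ^+ 2 by rewrite lerXn2r ?nnegrE// ltW.
    by rewrite expr1n; lra.
  have := ler_wpM2l (powR_ge0 2 m.+1%:R) h.
  by rewrite -powR_split// subrr powRr0.
pose d : R := (2 * m.+1%:R)^-1; have d0 : 0 < d by rewrite invr_gt0 mulr_gt0.
have lo : (((2 * d) ^+ m.+1)%:E <= iintE f)%E.
  apply: iintE_box_ge => // y hy; rewrite /f ifT//.
  have s1 : sq y < 1.
    apply: (@le_lt_trans _ _ (\sum_(j < m.+1) d ^+ 2)).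
      apply: ler_sum => j _; rewrite -[y 0 j ^+ 2]real_normK ?num_real// lerXn2r ?nnegrE//; exact: ltW.
    rewrite sumr_const card_ord -[ltLHS]mulr_natl /d exprVn exprMn invfM mulrCA.
    have n1 : 1 <= m.+1%:R :> R by rewrite ler1n.
    have : m.+1%:R / m.+1%:R ^+ 2 <= 1 :> R by rewrite ler_pdivrMr ?exprn_gt0// mul1r expr2 ler_peMl// ltW.
    by move: (_ / _) => u; lra.
  by rewrite enorm_sq -sqrtr1 ltr_sqrt.
rewrite /volB1 -/f fine_gt0//; apply/andP; split.
  by apply: lt_le_trans lo; rewrite lte_fin exprn_gt0// mulr_gt0.
by apply: le_lt_trans up _; rewrite ltry.
Qed.

Lemma kappa_neq0 m : (3 <= m.+1)%N -> @kappa R m != 0.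
Proof.
move=> m3; have n3 : 3 <= m.+1%:R :> R by rewrite ler_nat.
rewrite /kappa m3 mulf_neq0//; last by rewrite subr_eq0 lt_eqF//; lra.
have v0 := volB1_gt0 m; have p0 : 0 < m.+1%:R * (m.+1%:R - 2) :> R by rewrite mulr_gt0//; lra.
by rewrite invr_eq0 gt_eqF// mulr_gt0.
Qed.

Lemma hk_lower : exists2 c, 0 < c & forall s z, 0 < s -> z ^+ 2 <= 4 * s -> c * s `^ (- (1 / 2)) <= @hk R s z.
Proof.
exists ((4 * pi) `^ (- (1 / 2)) * expR (- 1)) => [|s z s0 zs].
  by rewrite mulr_gt0 ?expR_gt0// powR_gt0// mulr_gt0// pi_gt0.
have e1 : (4 * pi * s) `^ (- (1 / 2)) = (4 * pi) `^ (- (1 / 2)) * s `^ (- (1 / 2)) :> R.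
  by rewrite powRM ?(ltW s0)// mulr_ge0// pi_ge0.
rewrite /hk e1 -!mulrA ler_wpM2l ?powR_ge0// mulrC ler_wpM2l ?powR_ge0// ler_expR lerN2.
by rewrite mulrA -expr2 ler_pdivrMr ?mul1r// mulr_gt0.
Qed.

Section MainTerm.
Context (a : R).
Hypothesis ha : 0 < a <= 1 / 2.

Let a0 : 0 < a. Proof. by case/andP: ha. Qed.
Let a12 : a <= 1 / 2. Proof. by case/andP: ha. Qed.

Definition heat_rate (z : R) : R := if a == 1 / 2 then ln (2 / z) else (z `^ (1 - 2 * a))^-1.

Lemma hk_Ek : exists2 K, 0 < K & forall t z, 0 < t <= 2 -> @hk R t z <= K * (t * Ek t z).
Proof.
have [K K0 hK] := @hk_weight R 0 (lexx 0); exists K => // t z ht.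
apply: le_trans (hK t z ht); rewrite powRr0 mul1r ler_peMl ?hk_ge0// lerDl.
by rewrite divr_ge0 ?sqr_ge0//; lra.
Qed.

Lemma integrable_powhk z : 0 < z -> Intg `]0, 1 / 2[%classic (fun s => s `^ (a - 1) * hk s z).
Proof.
move=> z0; have [K K0 hK] := hk_Ek.
have I0 : Intg `]0, 1 / 2[%classic (fun s => K * Ek s z).
  apply: integrable_scale => //.
  apply: (@integrableS _ _ R mu _ _ _ _ _ _ (integrable_Ek0 z0)) => //.
  by apply: subset_itvl; rewrite bnd_simp; lra.
apply: integrable_dom I0 => //.
  apply: measurable_open_itv => s /andP[s0 _]; apply: continuousM; last exact: hk_continuous_t.
  by apply: continuous_powR => //; exact: cvg_id.
move=> s; rewrite /= in_itv /= => /andP[s0 s1].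
rewrite ger0_norm ?mulr_ge0 ?powR_ge0 ?hk_ge0//.
have s2 : 0 < s <= 2 by lra.
apply: le_trans (ler_wpM2l (powR_ge0 _ _) (hK s z s2)) _.
have -> : s `^ (a - 1) * (K * (s * Ek s z)) = s `^ a * (K * Ek s z).
  rewrite powR_pred// ; field; lra.
rewrite (ler_piMl (mulr_ge0 (ltW K0) (Ek_ge0 s z)))//.
by rewrite -[leRHS](powRr0 s); apply: ger_powR; [lra|exact: ltW].
Qed.

Lemma powhk_lower : exists c C : R, 0 < c /\ 0 <= C /\ forall z, 0 < z <= 1 ->
  c * heat_rate z - C <= Rint `]0, 1 / 2[%classic (fun s => s `^ (a - 1) * hk s z).
Proof.
have [c c0 hc] := hk_lower.
have base (F : R -> R) (z : R) : 0 < z <= 1 -> (forall s : R, 0 < s -> is_derive s 1 F (s `^ (a - 3 / 2))) ->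
    c * (F (1 / 2) - F (z ^+ 2 / 4)) <= Rint `]0, 1 / 2[%classic (fun s => s `^ (a - 1) * hk s z).
  move=> hz dF; have z0 : 0 < z by lra.
  have z20 : 0 < z ^+ 2 by rewrite exprn_gt0.
  have z2 : z ^+ 2 <= 1 by have : z ^+ 2 <= 1 ^+ 2 by [rewrite lerXn2r ?nnegrE//; lra]; rewrite expr1n.
  set u := z ^+ 2 / 4; have u0 : 0 < u by rewrite divr_gt0.
  have u1 : u <= 1 / 2 by rewrite /u; lra.
  have I := integrable_powhk z0.
  rewrite (Rint_itv_split (ltW u0) u1 I).
  have P0 : 0 <= Rint `]0, u[%classic (fun s => s `^ (a - 1) * hk s z).
    by apply: Rintegral_ge0 => s _; rewrite mulr_ge0 ?powR_ge0 ?hk_ge0.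
  have dF' (s : R) : u <= s <= 1 / 2 -> is_derive s 1 F (s `^ (a - 3 / 2)).
    by move=> hs; apply: dF; lra.
  have cF (s : R) : u <= s <= 1 / 2 -> {for s, continuous (fun s => s `^ (a - 3 / 2))}.
    by move=> hs; apply: continuous_powR; [lra|exact: cvg_id].
  have [I2 E] := Rint_FTC u1 dF' cF.
  have mF : measurable_fun `]u, 1 / 2[%classic (fun s : R => s `^ (a - 3 / 2)).
    by apply: measurable_open_itv => s hs; apply: cF; lra.
  rewrite (Rint_itv_cc mF) in E.
  have I3 : Intg `]u, 1 / 2[%classic (fun s : R => s `^ (a - 3 / 2)).
    by apply: (@integrableS _ _ R mu _ _ _ _ _ _ I2) => //; exact: subset_itv_oo_cc.
  have I4 : Intg `]u, 1 / 2[%classic (fun s => s `^ (a - 1) * hk s z).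
    apply: (@integrableS _ _ R mu _ _ _ _ _ _ I) => //.
    by apply: subset_itvr; rewrite bnd_simp ltW.
  apply: (@le_trans _ _ (Rint `]u, 1 / 2[%classic (fun s => s `^ (a - 1) * hk s z))); last by rewrite lerDr.
  rewrite -E -(RintZ _ (measurable_itv _) I3); apply: Rint_le => //; first exact: integrable_scale.
  move=> s; rewrite /= in_itv /= => hs; have s0 : 0 < s by lra.
  have -> : c * s `^ (a - 3 / 2) = s `^ (a - 1) * (c * s `^ (- (1 / 2))).
    by rewrite mulrCA -powR_split//; congr (_ * _ `^ _); field.
  by rewrite ler_wpM2l ?powR_ge0//; apply: hc => //; move: hs; rewrite /u; lra.
rewrite /heat_rate; case: eqP => [aE|/eqP aN].
  exists (2 * c), (c * ln 2); split; first by rewrite mulr_gt0.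
  split; first by rewrite mulr_ge0 ?(ltW c0)// ltW// ln_gt0// ltr1n.
  move=> z hz; have z0 : 0 < z by lra.
  apply: le_trans (base (@ln R) z hz _); last first.
    move=> s s0; rewrite aE (_ : 1 / 2 - 3 / 2 = -1); last by field.
    by rewrite powR_inv1 ?(ltW s0)//; exact: is_derive1_ln.
  have e1 : ln (2 / z) = ln 2 - ln z by rewrite ln_div ?posrE.
  have e2 : ln (1 / 2) = - ln 2 :> R by rewrite ln_div ?posrE// ln1 sub0r.
  have e3 : ln (z ^+ 2 / 4) = 2 * (ln z - ln 2).
    rewrite (_ : z ^+ 2 / 4 = (z / 2) ^+ 2); last by field.
    by rewrite lnXn ?divr_gt0// ln_div ?posrE// -[LHS]mulr_natl.
  rewrite e1 e2 e3; lra.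
have a1 : a < 1 / 2 by rewrite lt_neqAle aN a12.
pose p := 1 / 2 - a; have p0 : 0 < p by rewrite /p; lra.
have i0 : 0 < p^-1 by rewrite invr_gt0.
exists (c * p^-1 * 4^-1 `^ (- p)), (c * p^-1 * (1 / 2) `^ (- p)).
split; first by rewrite !mulr_gt0// powR_gt0.
split; first by rewrite !mulr_ge0 ?powR_ge0// ltW.
move=> z hz; have z0 : 0 < z by lra.
apply: le_trans (base (fun s => - (p^-1 * s `^ (- p))) z hz _); last first.
  move=> s s0; have d := is_derive_fopp (is_derive_fscale p^-1 (@is_derive_fpowR R id (- p) s _ s0 (is_derive_fid s))).
  rewrite [X in is_derive _ _ _ X](_ : _ = - (p^-1 * (- p * s `^ (- p - 1) * 1)))//.
  rewrite mulr1 mulNr mulrN opprK mulrA mulVf ?gt_eqF// mul1r /p; congr (_ `^ _); by field.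
have -> : (z ^+ 2 / 4) `^ (- p) = (z `^ (1 - 2 * a))^-1 * 4^-1 `^ (- p).
  rewrite powRM ?sqr_ge0 ?invr_ge0// -powR_mulrn ?(ltW z0)// -powRrM -powRN; congr (_ `^ _ * _).
  by rewrite /p; field.
by move: ((z `^ _)^-1) (4^-1 `^ (- p)) ((1 / 2) `^ (- p)) (p^-1) => u1 u2 u3 u4; lra.
Qed.

Lemma main_lower (h : R -> R) (Hb : R) : continuous h -> (forall s, `|h s| <= Hb) ->
  (forall s, 1 / 2 <= s <= 1 -> h s = (1 - s) `^ a) -> exists c C : R, 0 < c /\ 0 <= C /\
  forall z, 0 < z <= 1 -> c * heat_rate z - C <= `|main_t h 1 z|.
Proof.
move=> ch hb hform; have Hb0 : 0 <= Hb := le_trans (normr_ge0 _) (hb 0).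
have [c [C [c0 [C0 low]]]] := powhk_lower; have [K K0 hK] := @hk2_Ek R.
pose B := Hb * (K * (1 / 2) `^ (- (3 / 2))).
have B0 : 0 <= B by rewrite mulr_ge0// mulr_ge0 ?powR_ge0// ltW.
exists (a * c), (a * C + 1 + B * (2 - 1 / 2)); split; first by rewrite mulr_gt0.
split; first by rewrite !addr_ge0// mulr_ge0//; [exact: ltW|lra].
move=> z hz; have z0 : 0 < z by lra.
have I : Intg D2 (fun s => h (1 - s) * hk2 s z).
  by apply: (integrable_hk2 z0 Hb0) => s _; [exact: shift_continuous|exact: hb].
have l1 : 0 <= 1 / 2 :> R by lra.
have l2 : 1 / 2 <= 2 :> R by lra.
have IS (u v : R) : 0 <= u -> v <= 2 -> Intg `]u, v[%classic (fun s => h (1 - s) * hk2 s z).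
  move=> u0 v2; apply: (@integrableS _ _ R mu _ _ _ _ _ _ I) => //.
  by move=> s; rewrite /= !in_itv /=; lra.
rewrite /main_t (Rint_itv_split l1 l2 I).
have E : forall s, 0 < s < 1 / 2 -> h (1 - s) = s `^ a.
  move=> s hs; have h2 : 1 / 2 <= 1 - s <= 1 by lra.
  by rewrite (hform _ h2); congr (_ `^ _); ring.
have -> : Rint `]0, 1 / 2[%classic (fun s => h (1 - s) * hk2 s z) = Rint `]0, 1 / 2[%classic (fun s => s `^ a * hk2 s z).
  by apply: Rint_eq => s; rewrite /= in_itv /= => hs; rewrite E.
have Ia : Intg `]0, 1 / 2[%classic (fun s => s `^ a * hk2 s z).
  by apply: integrable_eq (IS _ _ (lexx 0) l2) => // s; rewrite /= in_itv /= => hs; rewrite E.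
have Ip := integrable_scale a (measurable_itv _) (integrable_powhk z0).
have l0 : 0 < 1 / 2 :> R by lra.
have FTC : Rint `]0, 1 / 2[%classic (fun s => a * (s `^ (a - 1) * hk s z) + s `^ a * hk2 s z) = (1 / 2) `^ a * hk (1 / 2) z - 0.
  apply: (@Rint_FTC_open R (fun s => s `^ a * hk s z)) => //.
  - move=> s /andP[s0 _].
    have d := is_derive_fmul (@is_derive_fpowR R id a s _ s0 (is_derive_fid s)) (hk_is_derive_t z s0).
    by rewrite mulr1 -mulrA in d.
  - move=> s /andP[s0 _].
    have cp (p : R) : {for s, continuous (fun s => s `^ p)} by apply: continuous_powR => //; exact: cvg_id.
    apply: continuousD; last by apply: continuousM; [exact: cp|exact: hk2_continuous_t].
    by apply: continuousM; [exact: cst_continuous|apply: continuousM; [exact: cp|exact: hk_continuous_t]].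
  - exact: integrable_add.
  - exact: hk_cvg0 (ltW a0) z0.
  have cF : {for (1 / 2), continuous (fun s => s `^ a * hk s z)}.
    apply: continuousM; last exact: hk_continuous_t.
    by apply: continuous_powR => //; exact: cvg_id.
  exact: cvg_at_left_filter cF.
rewrite (RintD (measurable_itv _) Ip Ia) (RintZ _ (measurable_itv _) (integrable_powhk z0)) subr0 in FTC.
have b1 : `|(1 / 2) `^ a * hk (1 / 2) z| <= 1.
  rewrite ger0_norm ?mulr_ge0 ?powR_ge0 ?hk_ge0//.
  have h1 : (1 / 2) `^ a <= 1 :> R.
    by rewrite -[leRHS](powRr0 (1 / 2)); apply: ger_powR; [lra|exact: ltW].
  have h2 : hk (1 / 2) z <= 1.
    rewrite /hk; have e1 : expR (- (z ^+ 2 / (4 * (1 / 2)))) <= 1.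
      by rewrite -expR0 ler_expR oppr_le0 divr_ge0 ?sqr_ge0//; lra.
    have e2 : (4 * pi * (1 / 2)) `^ (- (1 / 2)) <= 1 :> R.
      by rewrite -[leRHS](powR_one (- (1 / 2))); apply: powR_anti; [lra| |lra]; have := @pi_ge2 R; lra.
    by have := ler_pM (powR_ge0 _ _) (expR_ge0 _) e2 e1; rewrite mulr1.
  by have := ler_pM (powR_ge0 _ _) (hk_ge0 _ _) h1 h2; rewrite mulr1.
have b2 : `|Rint `]1 / 2, 2[%classic (fun s => h (1 - s) * hk2 s z)| <= B * (2 - 1 / 2).
  rewrite -(Rint_cst_itv B l2); apply: le_norm_Rint => //; first exact: IS.
    by apply: integrable_cst_itv; exact: itv_mu_fin.
  move=> s; rewrite /= in_itv /= => hs; have s0 : 0 < s <= 2 by lra.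
  have h1 := le_trans (hK s z s0) (ler_wpM2l (ltW K0) (Ek_le z (proj1 (andP s0)))).
  have h2 : s `^ (- (3 / 2)) <= (1 / 2) `^ (- (3 / 2)) by apply: powR_anti; lra.
  by rewrite normrM; exact: (ler_pM (normr_ge0 _) (normr_ge0 _) (hb _) (le_trans h1 (ler_wpM2l (ltW K0) h2))).
have b3 := ler_wpM2l (ltW a0) (low z hz).
move: FTC b1 b2 b3.
move: (Rint `]0, 1 / 2[%classic (fun s => s `^ (a - 1) * hk s z)) (Rint `]0, 1 / 2[%classic (fun s => s `^ a * hk2 s z)).
move: (Rint `]1 / 2, 2[%classic _) ((1 / 2) `^ a * _) (heat_rate z) => S T w P Q FTC.
have -> : Q = T - a * P by lra.
rewrite !ler_norml => b1 b2 b3; have := ler_norm (- (T - a * P + S)); rewrite normrN; lra.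
Qed.

End MainTerm.

Section KernelTrace.
Context {m : nat} (g : 'rV[R]_m -> R) (C d : R).
Implicit Types (x xi : 'rV[R]_m) (z : R).
Hypotheses (m0 : (0 < m)%N) (cg : Cd 2 C g) (g0 : forall xi, 0 <= g xi).
Hypotheses (sg : forall xi k, d < `|xi 0 k| -> g xi = 0) (d45 : d * Num.sqrt m%:R <= 4 / 5).
Let w : R := Num.sqrt m%:R.
Let w0 : 0 < w. Proof. by rewrite sqrtr_gt0 ltr0n. Qed.
Let ww : w ^+ 2 = m%:R. Proof. by rewrite sqr_sqrtr. Qed.
Let c0 : R := (2 * w)^-1 * 3 `^ (- @pp R m).

(* On the support of g the numerator x_j - xi_j keeps the sign of x_j. *)
Lemma tangential_kernel_lower x xi j z (sgn : R) : sgn ^+ 2 = 1 -> sgn * x 0 j = `|x 0 j| ->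
  3 <= enorm x -> (forall k, `|x 0 k| <= `|x 0 j|) -> 0 < z <= 1 -> (forall k, `|xi 0 k| <= d) ->
  c0 * (enorm x ^+ m)^-1 <= sgn * kk (Some j) (x - xi) z.
Proof.
move=> s2 sx x3 xj hz xid; set e := enorm x in x3 *.
have e2 : e ^+ 2 = sq x by rewrite /e enorm_sq sqr_sqrtr ?sq_ge0.
have d0 : 0 <= d by exact: le_trans (normr_ge0 _) (xid j).
have b1 : e <= w * `|x 0 j|.
  rewrite -ler_sqr ?nnegrE ?mulr_ge0 ?(ltW w0)//; last lra.
  rewrite e2 exprMn ww /sq; apply: (@le_trans _ _ (\sum_(k < m) `|x 0 j| ^+ 2)).
    by apply: ler_sum => k _; rewrite -[x 0 k ^+ 2]real_normK ?num_real// lerXn2r ?nnegrE.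
  by rewrite sumr_const card_ord -[leLHS]mulr_natl.
have b2 : w * `|xi 0 j| <= 4 / 5.
  by apply: le_trans d45; rewrite mulrC ler_wpM2r ?(ltW w0).
have s1 : `|sgn| = 1 by have := s2; rewrite -[sgn ^+ 2]real_normK ?num_real// => /eqP; rewrite sqrp_eq1 ?normr_ge0// => /eqP.
have b3 : e / 2 <= w * (sgn * (x - xi) 0 j).
  rewrite !mxE mulrBr sx; have h : sgn * xi 0 j <= `|xi 0 j|.
    by apply: le_trans (ler_norm _) _; rewrite normrM s1 mul1r.
  by have := ler_wpM2l (ltW w0) h; rewrite mulrBr; lra.
have b4 : sq xi <= 1.
  apply: (@le_trans _ _ (\sum_(k < m) d ^+ 2)).
    by apply: ler_sum => k _; rewrite -[xi 0 k ^+ 2]real_normK ?num_real// lerXn2r ?nnegrE.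
  rewrite sumr_const card_ord -[leLHS]mulr_natl -ww -exprMn mulrC.
  have : (d * w) ^+ 2 <= (4 / 5) ^+ 2 by rewrite lerXn2r ?nnegrE// ?mulr_ge0 ?(ltW w0)//; lra.
  by rewrite /w; lra.
have r0 : 0 < rr (x - xi) z by apply: rr_gt0; lra.
have b5 : rr (x - xi) z <= 3 * e ^+ 2.
  have := rr_shift_le x xi z; rewrite /rr.
  have h : sq (x - xi) <= 2 * sq x + 2 * sq xi.
    rewrite /sq !mulr_sumr -big_split /=; apply: ler_sum => k _; rewrite !mxE.
    by have := sqr_ge0 (x 0 k + xi 0 k); nra.
  by move: h; rewrite -e2 => h _; nra.
have p0 : 0 <= @pp R m := ltW pp_gt0.
have b6 := powR_mono_neg r0 b5 p0.
have e0 : 0 < e by lra.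
have e3 : (3 * e ^+ 2) `^ (- @pp R m) = 3 `^ (- @pp R m) * (e ^+ m.+1)^-1.
  rewrite powRM ?sqr_ge0// -[e ^+ 2]powR_mulrn ?(ltW e0)// -powRrM -[e ^+ m.+1]powR_mulrn ?(ltW e0)// -powRN.
  by congr (_ * _ `^ _); rewrite /pp; field.
rewrite e3 in b6; rewrite /kk /= mulrA.
have b7 : e / 2 / w <= sgn * (x - xi) 0 j by rewrite ler_pdivrMr// [leRHS]mulrC.
have n1 : 0 <= e / 2 / w by rewrite !divr_ge0 ?(ltW w0)// ltW.
have n2 : 0 <= 3 `^ (- @pp R m) * (e ^+ m.+1)^-1 by rewrite mulr_ge0 ?powR_ge0// invr_ge0 exprn_ge0// ltW.
apply: le_trans (ler_pM n1 n2 b7 b6); rewrite /c0 le_eqVlt; apply/orP; left; apply/eqP.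
have em : e ^+ m != 0 by rewrite expf_neq0// gt_eqF.
rewrite exprS; move: (3 `^ _) (e ^+ m) em => u v v0; field.
by rewrite v0 !gt_eqF.
Qed.

Lemma kT_lower x j : 3 <= enorm x -> (forall k, `|x 0 k| <= `|x 0 j|) ->
  c0 * iintR g * (enorm x ^+ m)^-1 <= `|kT (Some j) g x|.
Proof.
move=> x3 xj; have dg := Cd_dom cg.
pose sgn : R := if 0 <= x 0 j then 1 else -1.
have s2 : sgn ^+ 2 = 1 by rewrite /sgn; case: ifP; rewrite ?sqrrN expr1n.
have sx : sgn * x 0 j = `|x 0 j|.
  by rewrite /sgn; case: (leP 0 (x 0 j)) => h; rewrite ?mul1r ?mulN1r ?(ger0_norm h) ?(ltr0_norm h).
have s1 : `|sgn| = 1 by rewrite /sgn; case: ifP; rewrite ?normrN normr1.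
have Gl z : 0 < z <= 1 -> c0 * iintR g * (enorm x ^+ m)^-1 <= `|G (Some j) g x z|.
  move=> hz; have z0 : 0 < z by lra.
  have A0 := dom_ge0 dg; have kd : dom (@qK R m) (@kb R m z * C) (fun xi => kk (Some j) (x - xi) z * g xi).
    apply: dom_mul => //; last by move=> xi; exact: kk_kb.
    exact: (@continuous_reflect R m (fun y => kk (Some j) y z) x (kk_continuous z0)).
  apply: (@le_trans _ _ (sgn * G (Some j) g x z)); last first.
    by apply: le_trans (ler_norm _) _; rewrite normrM s1 mul1r.
  rewrite mulrAC (G_reflect (Some j) x z0 dg) -(iintR_scale (@qK_half R m) _ dg) -(iintR_scale (@qK_half R m) _ kd).
  apply: (iintR_le (@qK_half R m) (dom_scale _ dg) (dom_scale _ kd)) => xi.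
  case: (pselect (forall k, `|xi 0 k| <= d)) => [h|/existsNP [k /negP]].
    rewrite mulrA ler_wpM2r//; exact: tangential_kernel_lower.
  by rewrite -ltNge => /sg ->; rewrite !mulr0.
pose DM : R := m%:R * @gA R m * C.
have DM0 : 0 <= DM by rewrite mulr_ge0 ?(Cd_ge0 cg)// mulr_ge0// addr_ge0 ?tA_ge0 ?nA_ge0.
apply/ler_addgt0Pr => e e0.
pose z := Num.min 1 (e / (DM + 1)); have n1 : 0 < DM + 1 by lra.
have hz : 0 < z <= 1 by rewrite lt_min ltr01 divr_gt0// ge_min lexx.
have kd := kT_diff m0 cg (Some j) x hz.
have ze : DM * z <= e.
  have : z <= e / (DM + 1) by rewrite ge_min lexx orbT.
  by rewrite ler_pdivlMr// => h; have := hz; nra.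
have h1 := le_trans kd ze; apply: le_trans (Gl z hz) _.
by have := ler_distD (kT (Some j) g x) (G (Some j) g x z) 0; rewrite !subr0; lra.
Qed.

End KernelTrace.
Section FactorSign.
Variables (G : R -> R) (c : R).
Hypotheses (dG : forall z, derivable G z 1) (eG : forall z, G (- z) = G z)
  (sG : forall z, c < `|z| -> G z = 0) (G1 : G 0 = 1) (mG : forall z, 0 < z -> derive1 G z <= 0).

Lemma factor_ge0 z : 0 <= G z.
Proof.
have W y : 0 < y -> 0 <= G y.
  move=> y0; pose b := y + `|c| + 1.
  have yb : y <= b by rewrite /b -addrA lerDl addr_ge0.
  have Gb : G b = 0.
    apply: sG; rewrite gtr0_norm /b; last by have := normr_ge0 c; lra.
    by have := ler_norm c; lra.
  have d (x : R) : is_derive x 1 G (derive1 G x) by rewrite derive1E; exact: derivableP.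
  have [|u] := @MVT_segment R G (derive1 G) y b yb (fun u _ => d u).
  - by apply: continuous_subspaceT => x; exact: is_derive_continuous (d x).
  rewrite in_itv /= Gb sub0r => /andP[yu _] E; rewrite -oppr_le0 E.
  by rewrite mulr_le0_ge0 ?subr_ge0// mG// (lt_le_trans y0).
case: (ltgtP z 0) => [z0|z0|->]; last by rewrite G1.
  by rewrite -eG W// oppr_gt0.
exact: W.
Qed.

End FactorSign.

Section NormalDerivativeLower.
Context {m : nat} (a C d : R) (g : 'rV[R]_m -> R) (h : R -> R).
Hypotheses (m2 : (1 < m)%N) (cg : Cd 3 C g) (g0 : forall xi, 0 <= g xi) (g00 : 0 < g 0).
Hypotheses (sg : forall (xi : 'rV[R]_m) k, d < `|xi 0 k| -> g xi = 0) (d45 : d * Num.sqrt m%:R <= 4 / 5).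
Hypotheses (ha : 0 < a <= 1 / 2) (hh0 : forall s, 0 <= h s) (hhcont : continuous h)
  (hhsupp : forall s, s < 1 / 4 \/ 1 < s -> h s = 0)
  (hhC1 : forall s, 0 < s < 1 -> derivable h s 1 /\ {for s, continuous (derive1 h)})
  (hhform : forall s, 1 / 2 <= s <= 1 -> h s = (1 - s) `^ a).

Lemma vel_n_lower : exists C1 C2 : R, 0 < C1 /\ 0 < C2 /\
  forall j (x : 'rV[R]_m) z, 0 < z <= 1 -> 3 <= enorm x -> (forall k, `|x 0 k| <= `|x 0 j|) ->
  C1 / enorm x ^+ m * heat_rate a z - C2 / enorm x ^+ m.-1 <= `|vel_n (@kappa R m) (Some j) g h x z 1|.
Proof.
have m0 : (0 < m)%N := ltnW m2; have cg2 := Cd_pred cg.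
have [Hb Hb0 hb] := profile_bounded hh0 hhcont hhsupp.
have [c [B [c0 [B0 low]]]] := main_lower ha hhcont hb hhform.
have [M M0 hM] := @uniform_bound R 'I_m (fun j M => forall x z t, 0 < z ->
    `|vel_n (@kappa R m) (Some j) g h x z t - @cN R m * An (Some j) (@kappa R m) g x * main_t h t z| <= M * dec x z)
  (fun i M M' H (le : M <= M') x z t (z0 : 0 < z) => le_trans (H x z t z0) (ler_wpM2r (ltW (dec_gt0 x z)) le))
  (fun j => vel_n_decomp m0 (@kappa R m) (Some j) cg hhcont hb).
set k0 : R := (2 * Num.sqrt m%:R)^-1 * 3 `^ (- @pp R m).
have k00 : 0 < k0 by rewrite mulr_gt0 ?powR_gt0// invr_gt0 mulr_gt0// sqrtr_gt0 ltr0n.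
have I0 : 0 < iintR g := iintR_gt0 (@qK_half R m) (Cd_dom cg) g0 g00.
pose A := `|@cN R m| * (4 * `|@kappa R m|) * (k0 * iintR g).
have A0 : 0 < A.
  have c1 : 0 < `|@cN R m| by rewrite normr_gt0 gt_eqF//; exact: cN_gt0.
  have c2 : 0 < `|@kappa R m| by rewrite normr_gt0 kappa_neq0.
  by rewrite /A (mulr_gt0 (mulr_gt0 c1 (mulr_gt0 _ c2)))// mulr_gt0.
exists (A * c), (A * B + M); split; first by rewrite mulr_gt0.
split; first by rewrite ltr_wpDl// mulr_ge0// ltW.
move=> j x z hz x3 xj; have z0 : 0 < z by lra.
set e := enorm x in x3 *; have e0 : 0 < e by lra.
have em : 0 < e ^+ m by rewrite exprn_gt0.
have T := kT_lower m0 cg2 g0 sg d45 x3 xj; rewrite -/k0 -/e in T.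
have d1 : dec x z <= (e ^+ m)^-1.
  have e2 : e ^+ 2 <= 1 + rr x z.
    by rewrite /e enorm_sq sqr_sqrtr ?sq_ge0// /rr; have := sqr_ge0 z; lra.
  have e20 : 0 < e ^+ 2 by rewrite exprn_gt0.
  have m20 : 0 <= m%:R / 2 :> R by rewrite divr_ge0.
  apply: le_trans (powR_mono_neg e20 e2 m20) _.
  rewrite -[e ^+ 2]powR_mulrn ?(ltW e0)// -powRrM -[e ^+ m]powR_mulrn ?(ltW e0)// -powRN.
  by rewrite (_ : 2%:R * - (m%:R / 2) = - m%:R) //; field.
have L := low z hz; have D := hM j x z 1 z0.
have E : `|@cN R m * An (Some j) (@kappa R m) g x * main_t h 1 z| = `|@cN R m| * (4 * `|@kappa R m|) * (`|kT (Some j) g x| * `|main_t h 1 z|).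
  rewrite /An /= mulr0 mul0r sub0r !normrM normrN !normrM (ger0_norm (ler0n R 4)); ring.
have T0 : 0 <= k0 * iintR g * (e ^+ m)^-1 by rewrite mulr_ge0 ?mulr_ge0 ?invr_ge0 ?(ltW k00) ?(ltW I0) ?(ltW em).
have P1 : A * (e ^+ m)^-1 * (c * heat_rate a z - B) <= `|@cN R m * An (Some j) (@kappa R m) g x * main_t h 1 z|.
  rewrite E /A -!mulrA ler_wpM2l// ler_wpM2l// ler_wpM2l// !mulrA.
  apply: le_trans (ler_wpM2l T0 L) _; exact: ler_wpM2r.
have P2 := le_trans D (ler_wpM2l (ltW M0) d1).
have P3 : (e ^+ m)^-1 <= (e ^+ m.-1)^-1.
  by rewrite lef_pV2 ?posrE ?exprn_gt0// ler_weXn2l ?leq_pred//; lra.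
have N0 : 0 <= A * B + M by rewrite addr_ge0 ?mulr_ge0// ltW.
have P4 := ler_wpM2l N0 P3.
have P5 := lerB_dist (@cN R m * An (Some j) (@kappa R m) g x * main_t h 1 z)
  (@cN R m * An (Some j) (@kappa R m) g x * main_t h 1 z - vel_n (@kappa R m) (Some j) g h x z 1).
rewrite subKr [X in _ - X]distrC in P5.
move: P1 P2 P4 P5; move: (`|_ * main_t _ _ _|) (`|_ - _|) (`|vel_n _ _ _ _ _ _ _|) ((e ^+ m)^-1) ((e ^+ m.-1)^-1) (heat_rate a z).
by move=> u1 u2 u3 u4 u5 u6; clearbody A; lra.
Qed.

End NormalDerivativeLower.
End LowerBound.

(* n = m.+1 >= 2 *)
Theorem theorem1p1 (R : realType) (m : nat) (hm : (1 <= m)%N) (a : R)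
  (ha : 0 < a <= 1 / 2)
  (g : 'rV[R]_m -> R) (hgC3 : Ck 3 g)
  (hgsupp : exists r : R, r < 1 /\ forall xi, r < enorm xi -> g xi = 0)
  (h : R -> R) (hh0 : forall s, 0 <= h s) (hhcont : continuous h)
  (hhsupp : forall s, s < 1 / 4 \/ 1 < s -> h s = 0)
  (hhC1 : forall s, 0 < s < 1 -> derivable h s 1 /\ {for s, continuous (derive1 h)})
  (hhform : forall s, 1 / 2 <= s <= 1 -> h s = (1 - s) `^ a) :
  (* (i) Hoelder continuity on the closed half space times [0,2] *)
  (forall b : R, (a < 1 / 2 /\ b = a) \/ (a = 1 / 2 /\ 0 < b < 1 / 2) ->
     exists M : R, forall (i : 'I_m.+1) (x y : 'rV[R]_m.+1) (t s : R),
       0 < xlast x -> 0 < xlast y -> 0 <= t <= 2 -> 0 <= s <= 2 ->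
       `|vhat g h i x t| <= M /\
       `|vhat g h i x t - vhat g h i y s| <= M * (enorm (x - y) `^ (2 * b) + `|t - s| `^ b))
  /\
  (* (ii) finite energy *)
  ((3 <= m.+1)%N ->
     exists M : R,
       {ae (@lebesgue_measure R), forall t : R, 0 < t < 2 ->
          (iintE (fun x : 'rV[R]_m.+1 =>
             if (0 < xlast x)%R then (\sum_(i < m.+1) vhat g h i x t ^+ 2)%:E else 0%E)
           <= M%:E)%E}
       /\
       (\int[@lebesgue_measure R]_(t in `]0%R, 2%R[)
          iintE (fun x : 'rV[R]_m.+1 =>
             if (0 < xlast x)%R then
               (\sum_(i < m.+1) \sum_(j < m.+1)
                   partial j (fun y => vhat g h i y t) x ^+ 2)%:E
             else 0%E) < +oo)%E)
  /\
  (* (iii) pressure bound (the bound is +oo at t = 1) *)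
  (exists C : R, 0 < C /\
     forall (x : 'rV[R]_m.+1) (t : R), 0 < xlast x -> t != 1 ->
       `|phat g h x t| <=
         C * (if (1 / 4 <= t) && (t <= 1) then
                ((1 - t) `^ (1 - a))^-1 *
                (if (3 <= m.+1)%N then (jbr x ^+ (m.+1 - 2))^-1 else ln (enorm x + 2))
              else 0)
       + C * (if 1 < t then (`|t - 1| `^ (1 - a) * jbr x ^+ (m.+1 - 1))^-1 else 0))
  /\
  (* (iv) lower bound for d_{x_n} vhat_i at t = 1 *)
  ((3 <= m.+1)%N ->
     forall G : R -> R,
       (forall (k : nat) (z : R), derivable (derive1n k G) z 1) ->
       (forall z, G (- z) = G z) ->
       (exists c : R, c < 4 / (5 * Num.sqrt (m%:R)) /\ forall z, c < `|z| -> G z = 0) ->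
       (forall z, `|z| < (2 * Num.sqrt (m%:R))^-1 -> G z = 1) ->
       (forall z, 0 < z -> derive1 G z <= 0) ->
       (forall xi : 'rV[R]_m, g xi = \prod_(j < m) G (xi 0 j)) ->
       exists C1 C2 : R, 0 < C1 /\ 0 < C2 /\
         forall (x : 'rV[R]_m.+1) (i : 'I_m.+1),
           0 < xlast x -> 3 <= enorm (xprime x) -> xlast x <= 1 ->
           i != ord_max ->
           (forall j : 'I_m.+1, j != ord_max -> `|x 0 j| <= `|x 0 i|) ->
           (if a == 1 / 2 then
              C1 / enorm (xprime x) ^+ (m.+1 - 1) * ln (2 / xlast x)
              - C2 / enorm (xprime x) ^+ (m.+1 - 2)
            else
              C1 / (enorm (xprime x) ^+ (m.+1 - 1) * xlast x `^ (1 - 2 * a))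
              - C2 / enorm (xprime x) ^+ (m.+1 - 2))
           <= `|partial ord_max (fun y => vhat g h i y 1) x|).
Proof.
have [r [_ sg]] := hgsupp; have [C cg] := supported_Cd hgC3 sg.
have [Hb Hb0 hb] := profile_bounded hh0 hhcont hhsupp.
have h00 s : s <= 0 -> h s = 0 by move=> s0; apply: hhsupp; left; lra.
have split_point (x : 'rV[R]_m.+1) : exists x' z, x = emb x' z.
  by exists (xprime x), (xlast x); exact: vec_decomp.
split; [|split; [|split]].
- move=> b hb'; have [b1 b2] : 0 < b <= a /\ 0 < b < 1 / 2.
    by move: hb' ha => [[h1 ->]|[-> h1]] /andP[h2 h3]; split; lra.
  have [Hc Hc0 hc] := profile_holder ha hh0 hhcont hhsupp hhC1 hhform b1.
  have [M M0 hM] := @uniform_bound R 'I_m.+1 (fun i M => forall (x y : 'rV[R]_m) (z w t s : R), 0 < z -> 0 < w ->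
    `|vel (@kappa R m) (unlift ord_max i) g h x z t| <= M /\
    `|vel (@kappa R m) (unlift ord_max i) g h x z t - vel (@kappa R m) (unlift ord_max i) g h y w s| <=
       M * (enorm (emb x z - emb y w) `^ (2 * b) + `|t - s| `^ b))
    (fun i M M' H (le : M <= M') x y z w t s (z0 : 0 < z) (w0 : 0 < w) =>
       conj (le_trans (H x y z w t s z0 w0).1 le)
            (le_trans (H x y z w t s z0 w0).2 (ler_wpM2r (addr_ge0 (powR_ge0 _ _) (powR_ge0 _ _)) le)))
    (fun i => vel_holder hm cg hhcont hb (@kappa R m) (unlift ord_max i) b2 hc).
  exists M => i x y t s; have [x' [z ->]] := split_point x; have [y' [w ->]] := split_point y.
  rewrite !xlast_emb => z0 w0 ht hs.
  rewrite (vhatE hm i x' cg hhcont hb h00 z0 ht) (vhatE hm i y' cg hhcont hb h00 w0 hs); exact: hM.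
- by move=> m3; apply: (finite_energy m3 cg ha hh0 hhcont hhsupp hhC1 hhform).
- have [K K0 hK] := pressure_bound hm cg sg ha hh0 hhcont hhsupp hhC1 hhform.
  by exists K; split => // x t x0 t1; exact: hK.
move=> m3 G dG eG [c [c4 sG]] G1 mG gG.
have w0 : 0 < Num.sqrt m%:R :> R by rewrite sqrtr_gt0 ltr0n.
have G01 : G 0 = 1 by apply: G1; rewrite normr0 invr_gt0 mulr_gt0.
have G0 z : 0 <= G z := factor_ge0 (dG 0%N) eG sG G01 mG z.
have g0 xi : 0 <= g xi by rewrite gG prodr_ge0.
have g00 : 0 < g 0 by rewrite gG prodr_gt0// => j _; rewrite mxE G01.
have sgk (xi : 'rV[R]_m) k : c < `|xi 0 k| -> g xi = 0.
  by move=> /sG E; rewrite gG (bigD1 k)//= E mul0r.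
have d45 : c * Num.sqrt m%:R <= 4 / 5.
  by move: c4; rewrite invfM mulrA ltr_pdivlMr// => /ltW.
have [C1 [C2 [C10 [C20 low]]]] := vel_n_lower m3 cg g0 g00 sgk d45 ha hh0 hhcont hhsupp hhform.
exists C1, C2; split=> //; split=> // x i.
have [x' [z ->]] := split_point x; rewrite xlast_emb xprime_emb => z0 x3 z1.
case: (unliftP ord_max i) => [j|] ->; last by rewrite eqxx.
move=> _ xmax; have t2 : 0 <= (1 : R) <= 2 by rewrite ler01 ler1n.
have hz : 0 < z <= 1 by rewrite z0.
have xe k : (emb x' z) 0 (lift ord_max k) = x' 0 k by rewrite mxE liftK.
have hx k : `|x' 0 k| <= `|x' 0 j|.
  by rewrite -!xe; apply: xmax; rewrite eq_sym neq_lift.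
have [-> _] := vhat_partial m3 cg hh0 hhcont hhsupp (lift ord_max j) x' z0 t2.
have := low j x' z hz x3 hx; rewrite liftK /heat_rate subSS subn0 subn2.
by case: ifP => // _; rewrite invfM mulrA.
Qed.
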